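(* Consider the fractional optimal control problem (P): find a control $u$ and a corresponding state trajectory $x$ such that $$J[x(\cdot),u(\cdot)]=\int_a^bL(t,x(t),u(t))\,dt\longrightarrow\max,$$ $${}^{A}_{C}D^{\alpha,\beta,\gamma}_{a,b}x(t)=f(t,x(t),u(t)),\quad t\in[a,b],\qquad x(a)=x_a,$$ $$x(\cdot)\in AC^{\alpha,\beta}([a,b],\mathbb{R}),\qquad u(\cdot)\in\Omega(t)\subseteq L^2([a,b],\mathbb{R})\ \text{ for a.e. } t\in[a,b],$$ where $|\alpha+\beta|\ge1$, $\gamma\in[0,1]$, $\Omega(t)$ is a closed convex subset of $L^2([a,b],\mathbb{R})$, $L$ and $f$ are continuously differentiable in all their three arguments, and $f$ is locally Lipschitz with Lipschitz constant $K$. Let $u^*$ be an optimal control with optimal state trajectory $x^*$, and let $u^{\epsilon}$ be a control perturbation around $u^*$, that is, $u^{\epsilon}(t)=u^*(t)+\epsilon h(t)$ for all $t\in[a,b]$, where $h\in L^2([a,b],\mathbb{R})$ is a variation and $\epsilon\in\mathbb{R}$. Denote by $x^{\epsilon}$ its corresponding state trajectory, solution of $${}^{A}_{C}D^{\alpha,\beta,\gamma}_{a,b}x^{\epsilon}(t)=f(t,x^{\epsilon}(t),u^{\epsilon}(t)),\qquad x^{\epsilon}(a)=x_a.$$ If $K<\dfrac{1}{(b-a)^{\alpha-1}M}$, where $M=\sup_{|x|<(b-a)^{\alpha}}A(x)$, then $x^{\epsilon}$ converges to the optimal state trajectory $x^*$ when $\epsilon$ tends to zero, i.e. $x^{\epsilon}(t)\to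 x^*(t)$ for every $t\in[a,b]$; that is, $x^*$ is continuous (with respect to the control perturbation).
   Context: Let $[a,b]$ be a real interval, $\alpha\in[0,1]$ real, $\beta\in\mathbb{C}$ with $\mathrm{Re}(\beta)\ge0$, $R>(b-a)^{\mathrm{Re}(\beta)}$, and $A(x)=\sum_{n\ge0}a_nx^n$ a complex function analytic on the disc $D(0,R)$; the supremum defining $M$ is understood to be real. For an analytic kernel $B$, an order $\nu$ and $x\in L^1([a,b],\mathbb{R})$, $${}^{B}I^{\nu,\beta}_{a^+}x(t)=\int_a^t(t-s)^{\nu-1}B\left((t-s)^{\beta}\right)x(s)\,ds,\qquad {}^{B}I^{\nu,\beta}_{b^-}x(t)=\int_t^b(s-t)^{\nu-1}B\left((s-t)^{\beta}\right)x(s)\,ds.$$ Put $A_\Gamma(x)=\sum_{n\ge0}a_n\Gamma(\beta n+\alpha)x^n$. The function $\bar A(x)=\sum_{n\ge0}\bar a_nx^n$ is the analytic function with $A_\Gamma\cdot\bar A_\Gamma=1$, where $\bar A_\Gamma(x)=\sum_{n\ge0}\bar a_n\Gamma(\beta n+1-\alpha)x^n$ ($\bar A$ being the kernel used with order $1-\alpha$). $L^{\alpha,\beta}([a,b],\mathbb{R})$ is the set of $x\in L^1([a,b],\mathbb{R})$ such that ${}^{\bar A}I^{1-\alpha,\beta}_{a^+}x$ and ${}^{\bar A}I^{1-\alpha,\beta}_{b^-}x$ are absolutely continuous on $[a,b]$. $AC^{\alpha,\beta}([a,b],\mathbb{R})$ is the set of absolutely continuous functions $x$ that can be represented as $x(t)=x(a)+{}^{\bar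 A}I^{\alpha,\beta}_{a^+}\varphi(t)$ and $x(t)=x(b)+{}^{\bar A}I^{\alpha,\beta}_{b^-}\varphi(t)$ for some $\varphi\in L^{\alpha,\beta}([a,b],\mathbb{R})$. Caputo derivatives, for $x\in AC^{\alpha,\beta}$: ${}^{A}_{C}D^{\alpha,\beta}_{a^+}x(t)=\frac{d}{dt}\left[{}^{\bar A}I^{1-\alpha,\beta}_{a^+}(x(t)-x(a))\right]$ and ${}^{A}_{C}D^{\alpha,\beta}_{b^-}x(t)=-\frac{d}{dt}\left[{}^{\bar A}I^{1-\alpha,\beta}_{b^-}(x(t)-x(b))\right]$. Combined operator, for $\gamma\in[0,1]$: ${}^{A}_{C}D^{\alpha,\beta,\gamma}_{a,b}=\gamma\,{}^{A}_{C}D^{\alpha,\beta}_{a^+}+(1-\gamma)\,{}^{A}_{C}D^{\alpha,\beta}_{b^-}$. ''Locally Lipschitz with constant $K$'' refers to the variables $(x,u)$: for each $t$ and locally in $(x,u)$, $|f(t,x,u)-f(t,y,v)|\le K(|x-y|+|u-v|)$. An optimal control and its optimal state trajectory form a pair satisfying all constraints of (P) and maximizing $J$ among such pairs. *)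

(* Defs.v *)
From HB Require Import structures.
From mathcomp Require Import all_boot all_order all_algebra.
From mathcomp Require Import all_classical all_reals all_analysis.
From mathcomp Require Import complex.

Set Implicit Arguments.
Unset Strict Implicit.
Unset Printing Implicit Defensive.
Import Order.TTheory GRing.Theory Num.Theory.
Import numFieldNormedType.Exports.
Import Normc.

Local Open Scope classical_set_scope.
Local Open Scope ring_scope.
Local Open Scope complex_scope.

(* MathComp / MathComp-Analysis; complex numbers are R[i] over a realType R. *)

Definition leb (R : realType) := @lebesgue_measure R.
Arguments leb R : clear implicits.

(* The principal value r^z; it is meant for r > 0 only. *)
Definition cpow (R : realType) (r : R) (z : R[i]) : R[i] :=
  (r `^ complex.Re z)%:C *
  (cos (complex.Im z * ln r) +i* sin (complex.Im z * ln r)).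

Definition Cintegral (R : realType) (D : set R) (g : R -> R[i]) : R[i] :=
  (\int[leb R]_(s in D) complex.Re (g s)) +i*
  (\int[leb R]_(s in D) complex.Im (g s)).

Definition Cderivable (R : realType) (g : R -> R[i]) (t : R) : Prop :=
  derivable (fun s => complex.Re (g s)) t 1 /\
  derivable (fun s => complex.Im (g s)) t 1.

Definition Cderive (R : realType) (g : R -> R[i]) (t : R) : R[i] :=
  ('D_1 (fun s => complex.Re (g s)) t) +i*
  ('D_1 (fun s => complex.Im (g s)) t).

Definition Euler_integral (R : realType) (z : R[i]) : R[i] :=
  Cintegral `]0, +oo[ (fun r => cpow r (z - 1) * (expR (- r))%:C).

(* The Gamma function on the half-plane -1 < Re z, with its pole at 0: Euler's
   integral where it converges, and Gamma(z) = Gamma(z + 1) / z elsewhere.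
   At the pole the value is 0, by the convention 0^-1 = 0. *)
Definition Gamma (R : realType) (z : R[i]) : R[i] :=
  if 0 < complex.Re z then Euler_integral z else Euler_integral (z + 1) / z.

(* An analytic function on a disc centred at 0 is given by the sequence of its
   Taylor coefficients. *)
Definition power_series (R : realType) (c : nat -> R[i]) (z : R[i]) :
    nat -> R[i]^o :=
  fun n => \sum_(0 <= k < n) c k * z ^+ k.

Definition analytic_on_disc (R : realType) (c : nat -> R[i]) (rho : R) : Prop :=
  forall z : R[i], normc z < rho -> cvgn (power_series c z).

Definition power_sum (R : realType) (c : nat -> R[i]) (z : R[i]) : R[i] :=
  limn (power_series c z).

Definition Gamma_coef (R : realType) (c : nat -> R[i]) (nu : R) (beta : R[i])
    (n : nat) : R[i] :=
  c n * Gamma (beta * n%:R + nu%:C).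

(* A_Gamma * Abar_Gamma = 1 as a product of power series: the Gamma factors may
   make these series converge at 0 only. *)
Definition conjugate_kernel (R : realType) (a abar : nat -> R[i]) (alpha : R)
    (beta : R[i]) : Prop :=
  forall n : nat,
    \sum_(k < n.+1) Gamma_coef a alpha beta k *
                    Gamma_coef abar (1 - alpha) beta (n - k)
    = (n == 0%N)%:R.

Definition frac_int_left (R : realType) (B : nat -> R[i]) (nu : R)
    (beta : R[i]) (a : R) (x : R -> R) (t : R) : R[i] :=
  Cintegral `[a, t] (fun s =>
    ((t - s) `^ (nu - 1))%:C * power_sum B (cpow (t - s) beta) * (x s)%:C).

Definition frac_int_right (R : realType) (B : nat -> R[i]) (nu : R)
    (beta : R[i]) (b : R) (x : R -> R) (t : R) : R[i] :=
  Cintegral `[t, b] (fun s =>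
    ((s - t) `^ (nu - 1))%:C * power_sum B (cpow (s - t) beta) * (x s)%:C).

Definition L1 (R : realType) (a b : R) (x : R -> R) : Prop :=
  (leb R).-integrable `[a, b] (EFin \o x).

Definition L2 (R : realType) (a b : R) (x : R -> R) : Prop :=
  (x \_ `[a, b] : R -> R) \in Lfun (leb R) 2%:E.

Definition abs_continuous (R : realType) (a b : R) (g : R -> R) : Prop :=
  forall e : R, 0 < e -> exists2 d : R, 0 < d &
    forall (n : nat) (l r : 'I_n -> R),
      (forall i, [/\ a <= l i, l i < r i & r i <= b]) ->
      (forall i j, i != j -> r i <= l j \/ r j <= l i) ->
      \sum_(i < n) (r i - l i) < d ->
      \sum_(i < n) `|g (r i) - g (l i)| < e.

(* A fractional integral of an L^1 function is defined almost everywhere only;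
   it is absolutely continuous if it has an absolutely continuous
   representative. *)
Definition ae_abs_continuous (R : realType) (a b : R) (g : R -> R[i]) : Prop :=
  exists G : R -> R[i],
    [/\ abs_continuous a b (fun t => complex.Re (G t)),
        abs_continuous a b (fun t => complex.Im (G t)) &
        {ae leb R, forall t, t \in `[a, b] -> g t = G t}].

Definition L_space (R : realType) (abar : nat -> R[i]) (alpha : R)
    (beta : R[i]) (a b : R) (x : R -> R) : Prop :=
  [/\ L1 a b x,
      ae_abs_continuous a b (frac_int_left abar (1 - alpha) beta a x) &
      ae_abs_continuous a b (frac_int_right abar (1 - alpha) beta b x)].

(* One and the same phi serves in both representations. *)
Definition AC_space (R : realType) (abar : nat -> R[i]) (alpha : R)
    (beta : R[i]) (a b : R) (x : R -> R) : Prop :=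
  abs_continuous a b x /\
  exists phi : R -> R,
    [/\ L_space abar alpha beta a b phi,
        {ae leb R, forall t, t \in `[a, b] ->
           (x t)%:C = (x a)%:C + frac_int_left abar alpha beta a phi t} &
        {ae leb R, forall t, t \in `[a, b] ->
           (x t)%:C = (x b)%:C + frac_int_right abar alpha beta b phi t}].

Definition pre_caputo_left (R : realType) (abar : nat -> R[i]) (alpha : R)
    (beta : R[i]) (a : R) (x : R -> R) : R -> R[i] :=
  frac_int_left abar (1 - alpha) beta a (fun s => x s - x a).

Definition pre_caputo_right (R : realType) (abar : nat -> R[i]) (alpha : R)
    (beta : R[i]) (b : R) (x : R -> R) : R -> R[i] :=
  frac_int_right abar (1 - alpha) beta b (fun s => x s - x b).

Definition caputo_left (R : realType) (abar : nat -> R[i]) (alpha : R)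
    (beta : R[i]) (a : R) (x : R -> R) (t : R) : R[i] :=
  Cderive (pre_caputo_left abar alpha beta a x) t.

Definition caputo_right (R : realType) (abar : nat -> R[i]) (alpha : R)
    (beta : R[i]) (b : R) (x : R -> R) (t : R) : R[i] :=
  - Cderive (pre_caputo_right abar alpha beta b x) t.

Definition combined_caputo (R : realType) (abar : nat -> R[i]) (alpha : R)
    (beta : R[i]) (gamma a b : R) (x : R -> R) (t : R) : R[i] :=
  gamma%:C * caputo_left abar alpha beta a x t +
  (1 - gamma)%:C * caputo_right abar alpha beta b x t.

(* The derivatives of absolutely continuous functions exist, and the controls
   are defined, almost everywhere: so is the state equation understood. *)
Definition state_equation (R : realType) (abar : nat -> R[i]) (alpha : R)
    (beta : R[i]) (gamma a b : R) (f : R -> R -> R -> R) (x u : R -> R) : Prop :=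
  {ae leb R, forall t, t \in `[a, b] ->
    [/\ Cderivable (pre_caputo_left abar alpha beta a x) t,
        Cderivable (pre_caputo_right abar alpha beta b x) t &
        combined_caputo abar alpha beta gamma a b x t = (f t (x t) (u t))%:C]}.

Definition state_trajectory (R : realType) (abar : nat -> R[i]) (alpha : R)
    (beta : R[i]) (gamma a b : R) (f : R -> R -> R -> R) (xa : R)
    (u x : R -> R) : Prop :=
  [/\ AC_space abar alpha beta a b x,
      state_equation abar alpha beta gamma a b f x u & x a = xa].

Definition admissible (R : realType) (abar : nat -> R[i]) (alpha : R)
    (beta : R[i]) (gamma a b : R) (f : R -> R -> R -> R) (xa : R)
    (Omega : R -> set (R -> R)) (u x : R -> R) : Prop :=
  state_trajectory abar alpha beta gamma a b f xa u x /\
  {ae leb R, forall t, t \in `[a, b] -> Omega t u}.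

Definition J_defined (R : realType) (a b : R) (L : R -> R -> R -> R)
    (x u : R -> R) : Prop :=
  L1 a b (fun t => L t (x t) (u t)).

Definition J (R : realType) (a b : R) (L : R -> R -> R -> R)
    (x u : R -> R) : R :=
  \int[leb R]_(t in `[a, b]) L t (x t) (u t).

(* L and the controls carry no growth condition, so that J need not be defined
   at every admissible pair. *)
Definition optimal (R : realType) (abar : nat -> R[i]) (alpha : R)
    (beta : R[i]) (gamma a b : R) (L f : R -> R -> R -> R) (xa : R)
    (Omega : R -> set (R -> R)) (u x : R -> R) : Prop :=
  [/\ admissible abar alpha beta gamma a b f xa Omega u x,
      J_defined a b L x u &
      forall v y : R -> R,
        admissible abar alpha beta gamma a b f xa Omega v y ->
        J_defined a b L y v -> J a b L y v <= J a b L x u].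

(* Closedness is that of the normed space L^2([a,b]); in particular a closed set
   of functions is invariant under modification on null sets. *)
Definition closed_convex_L2 (R : realType) (a b : R) (W : set (R -> R)) : Prop :=
  [/\ W `<=` L2 a b,
      forall (u v : R -> R) (c : R), W u -> W v -> 0 <= c <= 1 ->
        W (fun s => c * u s + (1 - c) * v s) &
      forall (v : nat -> R -> R) (u : R -> R),
        (forall n, W (v n)) -> L2 a b u ->
        ('N[leb R]_2%:E[EFin \o ((v n \- u)%R \_ `[a, b])])%E
           @[n --> \oo] --> 0%E ->
        W u].

(* The derivative in t is one-sided at the ends of [a,b]. *)
Definition C1_on_slab (R : realType) (a b : R) (g : R -> R -> R -> R) : Prop :=
  exists g1 g2 g3 : R -> R -> R -> R,
    (forall t x u : R, t \in `[a, b] ->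
      [/\ (g s x u - g t x u) / (s - t) @[s --> within `[a, b] t^'] --> g1 t x u,
          is_derive x 1 (fun y => g t y u) (g2 t x u) &
          is_derive u 1 (fun v => g t x v) (g3 t x u)]) /\
    [/\ {within [set p : R * R * R | p.1.1 \in `[a, b]],
          continuous (fun p : R * R * R => g1 p.1.1 p.1.2 p.2)},
        {within [set p : R * R * R | p.1.1 \in `[a, b]],
          continuous (fun p : R * R * R => g2 p.1.1 p.1.2 p.2)} &
        {within [set p : R * R * R | p.1.1 \in `[a, b]],
          continuous (fun p : R * R * R => g3 p.1.1 p.1.2 p.2)}].

Definition locally_Lipschitz (R : realType) (a b : R) (g : R -> R -> R -> R)
    (K : R) : Prop :=
  forall t x0 u0 : R, t \in `[a, b] ->
    exists2 U : set (R * R), nbhs (x0, u0) U &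
      forall x u y v : R, U (x, u) -> U (y, v) ->
        `|g t x u - g t y v| <= K * (`|x - y| + `|u - v|).

(* The values A(x) for |x| < r and x in the disc D(0,rho) of definition of A;
   the supremum of a complex function is understood through real parts. *)
Definition kernel_values (R : realType) (c : nat -> R[i]) (rho r : R) : set R :=
  [set complex.Re (power_sum c z) | z in [set z : R[i] | normc z < r /\
                                                         normc z < rho]].

(* Main.v *)
(** Only the constant term of the reciprocity [A_Gamma * Abar_Gamma = 1] and the
global Lipschitz bound that follows from the local one are used: whatever the size
of [K], [|x^eps(t) - x^*(t)| <= N_t |eps|]. Let [phi] be the difference of the two
densities representing [x^eps] and [x^*]. If the kernel [k] is not real near [0],
Titchmarsh's theorem applied to its imaginary part gives [phi = 0]. Otherwise [k] is
a real fractional power series and, writing [cv] and [rcv] for left and right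
convolution, [cv k phi - rcv k phi] is constant (E1) and
[|g0 phi + gamma cv q phi + (1 - gamma) rcv q phi| <= K (|cv k phi| + |eps h|)] (E2),
where [g0 + int q] is the absolutely continuous convolution of the kernels of orders
[1 - alpha] and [alpha]. The bound [||phi||_1 <= C |eps|] is proved by contradiction:
a weak limit of normalized solutions solves (E1) and (E2) with [eps = 0]; (E1),
averaged against [x^(-alpha-1)], shows that [phi] equals a weakly singular integral of
itself inside the interval, so the limit is not zero; but it is flat at [0] by (E1) and
(E2), hence zero near [0] by a Carleman type estimate, and so zero everywhere. *)

Require Import Defs.
From HB Require Import structures.
From mathcomp Require Import all_boot all_order all_algebra.
From mathcomp Require Import all_classical all_reals all_analysis.
From mathcomp Require Import measurable_realfun ring lra.
From mathcomp Require Import complex.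
Import Order.TTheory GRing.Theory Num.Theory.
Import numFieldNormedType.Exports.
Import Normc.
Set Implicit Arguments. Unset Strict Implicit. Unset Printing Implicit Defensive.
Local Open Scope classical_set_scope.
Local Open Scope ring_scope.

Local Notation mfs := (measurable_fun setT).
Local Notation mfsM := measurable_funM.
Local Notation mfsB := measurable_funB.
Local Notation mfsD := measurable_funD.
Local Notation mfsT := measurableT_comp.
Local Notation mfs_if := measurable_fun_ifT.

(** For [0 < gamma < 1] the state equation carries memory from both sides, so no Gronwall argument
    started at [a] is available. What excludes a nonzero solution with [eps = 0] happens at the left
    end: left convolution turns [t^i] into a nonzero multiple of the noninteger power [t^(alpha+i)],
    up to smaller terms, while right convolution of a function small at 0 adds only a polynomial up
    to the order considered; (E1) cannot balance the two, so every Taylor coefficient dies. In (E2)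
    the factor [g0] is the square of the leading coefficient times a Beta value, hence nonzero, and
    the other terms are convolutions with integrable kernels, which converge uniformly along weak
    limits of bounded functions; so normalized solutions cannot lose their mass. A bound on
    [||phi||_1] is not yet one on the state, since [k] may be unbounded: at [b] the constant of (E1)
    is the state difference itself, and in the interior the averaged form of (E1) bounds [phi]
    locally. The exponent [-alpha-1] makes the average of the primitive [|y|^alpha / alpha]
    homogeneous of degree 0, that is a sign function, whose derivative returns [phi]. *)

Lemma powR_expR (R : realType) (m s : R) : expR m `^ s = expR (s * m).
Proof. by rewrite /powR gt_eqF ?expR_gt0// expRK. Qed.

(** * Lebesgue measure under affine maps of the line *)

Section affine.
Variable R : realType.
Notation mu := (@lebesgue_measure R).

Lemma mfs_affine (c d : R) : mfs (fun x : R => c * x + d).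
Proof. by apply: mfsD => //; exact: mfsM. Qed.

(** Uniqueness of Lebesgue measure: the pushforward scaled by [|c|] has the right value on half-open
    intervals. A negative [c] moves the closed end of the preimage from the right to the left, hence
    the two cases. *)
Lemma lebesgue_measure_affine (c d : R) (A : set R) : c != 0 -> measurable A ->
 mu A = (`|c|%:E * mu ((fun x => c * x + d)%R @^-1` A))%E.
move=> c0.
pose phi := fun x : measurableTypeR R => (c * x + d : measurableTypeR R).
have mphi : mfs phi by exact: mfs_affine.
pose nu : {measure set (measurableTypeR R) -> \bar R} :=
 mscale (NngNum (normr_ge0 c)) (measure_function.measure_function_pushforward__canonical__measure_function_Measure mu mphi).
move=> mA; transitivity (nu A); last by [].
apply: (@lebesgue_measure_unique R nu) => // _ /= [[a b] _ <-] /=.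
rewrite /nu /mscale /pushforward /= lebesgue_measure_itv/= lte_fin.
have [c1|c1] : c < 0 \/ 0 < c by apply/orP; rewrite -neq_lt.
- rewrite [X in (_ * mu X)%E](_ : _ = `[(b - d) / c, (a - d) / c[%classic); last first.
  apply/seteqP; split=> x /=; rewrite !in_itv/= => /andP[h1 h2];
  apply/andP; split; rewrite /phi.
  + by rewrite ler_ndivrMr// mulrC lerBrDr.
  + by rewrite ltr_ndivlMr// mulrC ltrBlDr.
  + by move: h2; rewrite ltr_ndivlMr// mulrC ltrBlDr.
  + by move: h1; rewrite ler_ndivrMr// mulrC lerBrDr.
 rewrite lebesgue_measure_itv/= lte_fin ltr_nM2r ?invr_lt0// ltrD2r.
 case: ifPn => ab; last by rewrite mule0.
 by rewrite -!EFinB -EFinM ltr0_norm//; congr EFin; field.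
- rewrite [X in (_ * mu X)%E](_ : _ = `](a - d) / c, (b - d) / c]%classic); last first.
  apply/seteqP; split=> x /=; rewrite !in_itv/= => /andP[h1 h2];
  apply/andP; split; rewrite /phi.
  + by rewrite ltr_pdivrMr// mulrC ltrBlDr.
  + by rewrite ler_pdivlMr// mulrC lerBrDr.
  + by move: h1; rewrite ltr_pdivrMr// mulrC ltrBlDr.
  + by move: h2; rewrite ler_pdivlMr// mulrC lerBrDr.
 rewrite lebesgue_measure_itv/= lte_fin ltr_pM2r ?invr_gt0// ltrD2r.
 case: ifPn => ab; last by rewrite mule0.
 by rewrite -!EFinB -EFinM gtr0_norm//; congr EFin; field.
Qed.

Lemma ge0_integral_affine (c d : R) (f : R -> \bar R) : c != 0 ->
 mfs f -> (forall x, 0 <= f x)%E ->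
 (\int[mu]_x f x = `|c|%:E * \int[mu]_x f (c * x + d)%R)%E.
move=> c0 mf f0.
pose phi := fun x : measurableTypeR R => (c * x + d : measurableTypeR R).
have mphi : mfs phi by exact: mfs_affine.
pose nu : {measure set (measurableTypeR R) -> \bar R} :=
 mscale (NngNum (normr_ge0 c)) (measure_function.measure_function_pushforward__canonical__measure_function_Measure mu mphi).
rewrite (eq_measure_integral nu); last first.
 by move=> A mA _; exact: lebesgue_measure_affine.
rewrite ge0_integral_mscale//; congr (_ * _)%E.
by rewrite ge0_integral_pushforward//= preimage_setT.
Qed.

End affine.

(** * Elementary limits of real sequences *)

Section limits.
Variable R : realType.

Lemma cvg_dist_dom (u e : nat -> R) (l : R) : (forall n, `|u n - l| <= e n) ->
 e n @[n --> \oo] --> 0 -> u n @[n --> \oo] --> l.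
move=> ue e0; apply/cvgrPdist_le => d d0.
move/cvgrPdist_le : e0 => /(_ d d0); apply: filterS => n.
by rewrite sub0r normrN distrC => h; rewrite (le_trans (ue n))// (le_trans (ler_norm _)).
Qed.

Lemma cvg_inv1Dn (C a : R) : 0 < a -> C / (1 + n%:R * a) @[n --> \oo] --> 0.
move=> a0; have m0 : 0 < Num.min 1 a by rewrite lt_min ltr01.
apply: (@cvg_dist_dom _ (fun n => `|C| / Num.min 1 a * harmonic n)).
 move=> n; rewrite subr0 normrM -mulrA ler_wpM2l//.
 have h1 : 0 < 1 + n%:R * a by rewrite ltr_pwDl// mulr_ge0// ltW.
 rewrite normfV gtr0_norm// /harmonic /= -invfM lef_pV2 ?posrE ?mulr_gt0//.
 rewrite -natr1 mulrDr mulr1 addrC lerD//; first by rewrite ge_min lexx.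
 by rewrite mulrC ler_wpM2l// ge_min lexx orbT.
rewrite -[X in _ --> X](mulr0 (`|C| / Num.min 1 a)).
by apply: cvgM; [exact: cvg_cst|exact: cvg_harmonic].
Qed.

Lemma expR_sub1_le (y : R) : 0 <= y -> y <= 1 -> expR y - 1 <= expR 1 * y.
move=> y0 y1; have h := expR_ge1Dx (- y); have e1 := expR_ge0 y.
have : expR y * (1 - y) <= 1.
 by apply: (le_trans (ler_wpM2l e1 h)); rewrite expRxMexpNx_1.
have : expR y <= expR 1 by rewrite ler_expR.
nra.
Qed.

End limits.

(** * Real-valued integration over the line *)

Section integration.
Variable R : realType.
Notation mu := (@lebesgue_measure R).
Implicit Types f g h : R -> R.

Lemma aeS (P Q : R -> Prop) : {ae mu, forall x, P x} -> (forall x, P x -> Q x) ->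
 {ae mu, forall x, Q x}.
Proof. by move=> h PQ; apply: (@filterS _ _ (ae_filter_ringOfSetsType mu) _ _ PQ h). Qed.

Lemma aeS2 (P Q S : R -> Prop) : {ae mu, forall x, P x} -> {ae mu, forall x, Q x} ->
 (forall x, P x -> Q x -> S x) -> {ae mu, forall x, S x}.
move=> hP hQ PQS.
by apply: (@filterS2 _ _ (ae_filter_ringOfSetsType mu) _ _ _ PQS hP hQ).
Qed.

Lemma aeW (P : R -> Prop) : (forall x, P x) -> {ae mu, forall x, P x}.
Proof. by move=> h; exists set0; split => //= x /(_ (h x)). Qed.

Lemma eqint (f g : R -> \bar R) : f =1 g -> (\int[mu]_x f x = \int[mu]_x g x)%E.
Proof. by move=> /funext ->. Qed.

Lemma eqRint (f g : R -> R) : f =1 g -> \int[mu]_x f x = \int[mu]_x g x.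
Proof. by move=> /funext ->. Qed.

Lemma aeN (P : nat -> R -> Prop) : (forall n, {ae mu, forall x, P n x}) ->
 {ae mu, forall x, forall n, P n x}.
move=> h; have /(negligibleS _) := negligible_bigcup h; apply.
by move=> x /= /existsNP [n hn]; exists n.
Qed.

(** Integration is over the whole line; a function on an interval is extended by 0, so that the
    algebra of convolutions needs no endpoints. *)
Definition itg f := mu.-integrable setT (EFin \o f).

Definition norm1 f : R := \int[mu]_x `|f x|.

Lemma imeas f : itg f -> mfs f.
Proof. by move=> /(measurable_int mu)/measurable_EFinP. Qed.

Lemma itg_dom f g : mfs f ->
 (forall x, `|f x| <= g x) -> itg g -> itg f.
move=> mf fg ig; apply: (le_integrable _ _ _ ig) => //; first exact/measurable_EFinP.
by move=> x _ /=; rewrite lee_fin (le_trans (fg x))// ler_norm.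
Qed.

Lemma itgN f : itg f -> itg (fun x => - f x).
Proof. by move=> h; exact: (integrableN h). Qed.

Lemma itgD f g : itg f -> itg g -> itg (fun x => f x + g x).
Proof. by move=> hf hg; exact: (integrableD measurableT hf hg). Qed.

Lemma itgB f g : itg f -> itg g -> itg (fun x => f x - g x).
Proof. by move=> hf hg; apply: itgD => //; exact: itgN. Qed.

Lemma itgZ (k : R) f : itg f -> itg (fun x => k * f x).
Proof. by move=> hf; exact: (integrableZl measurableT k hf). Qed.

Lemma itg0 : itg (fun=> 0).
Proof. exact: integrable0. Qed.

Lemma itg_norm f : itg f -> itg (fun x => `|f x|).
Proof. by move=> hf; apply: (integrable_norm hf). Qed.

Lemma itg_sum (n : nat) (F : 'I_n -> R -> R) : (forall i, itg (F i)) ->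
 itg (fun x => \sum_(i < n) F i x).
move=> h; have := @integrable_sum _ _ _ mu setT measurableT _ (index_enum 'I_n) xpredT
 (fun i => EFin \o F i) (fun i _ => h i).
by rewrite /itg; congr integrable; apply/funext => x /=; rewrite sumEFin.
Qed.

Lemma mfs_patch0 (D : set R) f : measurable D -> mfs f ->
 mfs (f \_ D).
move=> mD mf; apply: (measurable_restrictT f mD).1.
exact: (measurable_funS measurableT (@subsetT _ D) mf).
Qed.

Lemma itg_restrict (D : set R) f : measurable D -> itg (f \_ D) <->
 mu.-integrable D (EFin \o f).
move=> mD; rewrite /itg -restrict_EFin; split.
 by move=> h; have := (integrable_restrict mu mD measurableT (EFin \o f)).2 h; rewrite setTI.
by move=> h; apply/integrable_restrict => //; rewrite setTI.
Qed.

Lemma intE f : itg f -> (\int[mu]_x (f x)%:E = (\int[mu]_x f x)%:E)%E.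
Proof. by move=> h; rewrite /Rintegral fineK//; exact: integrable_fin_num. Qed.

Lemma int_ge0 f : (forall x, 0 <= f x) -> 0 <= \int[mu]_x f x.
Proof. by move=> h; apply: Rintegral_ge0. Qed.

Lemma intD f g : itg f -> itg g ->
 \int[mu]_x (f x + g x) = \int[mu]_x f x + \int[mu]_x g x.
Proof. by move=> *; apply: RintegralD. Qed.

Lemma intB f g : itg f -> itg g ->
 \int[mu]_x (f x - g x) = \int[mu]_x f x - \int[mu]_x g x.
Proof. by move=> *; apply: RintegralB. Qed.

Lemma intZ (k : R) f : itg f -> \int[mu]_x (k * f x) = k * \int[mu]_x f x.
Proof. by move=> *; apply: RintegralZl. Qed.

Lemma intZr (k : R) f : itg f -> \int[mu]_x (f x * k) = (\int[mu]_x f x) * k.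
Proof. by move=> *; apply: RintegralZr. Qed.

Lemma intN f : itg f -> \int[mu]_x (- f x) = - \int[mu]_x f x.
move=> h; transitivity (\int[mu]_x (-1 * f x)).
 by apply: eq_Rintegral => x _; rewrite mulN1r.
by rewrite intZ// mulN1r.
Qed.

Lemma int_le f g : itg f -> itg g -> (forall x, f x <= g x) ->
 \int[mu]_x f x <= \int[mu]_x g x.
Proof. by move=> *; apply: le_Rintegral. Qed.

Lemma int_norm f : itg f -> `|\int[mu]_x f x| <= \int[mu]_x `|f x|.
Proof. by move=> *; apply: le_normr_Rintegral. Qed.

Lemma norm1_ge0 f : 0 <= norm1 f.
Proof. exact: int_ge0. Qed.

Lemma int_ae_eq f g : mfs f -> mfs g ->
 {ae mu, forall x, f x = g x} -> \int[mu]_x f x = \int[mu]_x g x.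
move=> mf mg fg; rewrite /Rintegral; congr fine.
apply: ae_eq_integral => //; [exact/measurable_EFinP|exact/measurable_EFinP|].
by apply: (aeS fg) => x -> _.
Qed.

Lemma itg_ae_dom f g : mfs f -> itg g ->
 {ae mu, forall x, `|f x| <= g x} -> itg f.
move=> mf ig fg; apply/integrableP; split; first exact/measurable_EFinP.
have [mg gfin] := (integrableP _ _ _ (itg_norm ig)).
apply: le_lt_trans gfin; apply: ae_ge0_le_integral => //.
- by apply/measurable_EFinP; apply: mfsT.
- by apply: mfsT => //.
apply: (aeS fg) => x h _ /=; rewrite lee_fin normr_id.
by rewrite (le_trans h)// ler_norm.
Qed.

Lemma int_ae_le f g : itg f -> itg g ->
 {ae mu, forall x, f x <= g x} -> \int[mu]_x f x <= \int[mu]_x g x.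
move=> hf hg fg; have mf := imeas hf; have mg := imeas hg.
have mm : mfs (fun x => Num.min (f x) (g x)).
 exact: measurable_minr.
have im : itg (fun x => Num.min (f x) (g x)).
 apply: (itg_dom mm _ (itgD (itg_norm hf) (itg_norm hg))) => x.
 by rewrite minEle; case: ifPn => _; rewrite ?lerDl ?lerDr.
rewrite (@int_ae_eq f (fun x => Num.min (f x) (g x)))//.
 by apply: int_le => // x; rewrite ge_min lexx orbT.
by apply: (aeS fg) => x h; rewrite min_l.
Qed.

Lemma itg_affine (c d : R) f : c != 0 -> itg f ->
 itg (fun x => f (c * x + d)).
move=> c0 hf; have mf := imeas hf; apply/integrableP; split.
 by apply/measurable_EFinP; apply: mfsT => //; exact: mfs_affine.
move/integrableP : hf => [_]; rewrite (ge0_integral_affine d c0)//; last first.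
 by apply: mfsT => //; exact/measurable_EFinP.
move=> h; rewrite ltNge; apply/negP => h1; move: h; apply/negP; rewrite -leNgt.
move: h1; rewrite leye_eq => /eqP; rewrite /= => ->.
by rewrite gt0_muley// lte_fin normr_gt0.
Qed.

Lemma int_affine (c d : R) f : c != 0 -> itg f ->
 \int[mu]_x f x = `|c| * \int[mu]_x f (c * x + d).
move=> c0 hf; have hf' := itg_affine d c0 hf.
have [hp hn] : itg f^\+ /\ itg f^\- by split;
 [exact: integrable_funrpos|exact: integrable_funrneg].
have E g : itg g -> (forall x, 0 <= g x) ->
  \int[mu]_x g x = `|c| * \int[mu]_x g (c * x + d).
 move=> hg g0; apply: EFin_inj; rewrite EFinM -!intE//; last exact: itg_affine.
 by rewrite (ge0_integral_affine d c0)//; exact: (measurable_int mu).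
have fE x : f x = f^\+ x - f^\- x by rewrite -[in LHS](funrposBneg f).
transitivity (\int[mu]_x (f^\+ x - f^\- x)).
 by apply: eq_Rintegral => x _; rewrite -fE.
rewrite intB// (E _ hp); last by move=> x; rewrite funrpos_ge0.
rewrite (E _ hn); last by move=> x; rewrite funrneg_ge0.
rewrite -mulrBr -intB; [|exact: (itg_affine d c0 hp)|exact: (itg_affine d c0 hn)].
by congr (_ * _); apply: eq_Rintegral => x _; rewrite -fE.
Qed.

Lemma ae_affine (c d : R) (P : R -> Prop) : c != 0 -> {ae mu, forall x, P x} ->
 {ae mu, forall x, P (c * x + d)}.
move=> c0 [A [mA A0 PA]]; exists ((fun x => c * x + d) @^-1` A); split.
- by rewrite -[X in measurable X]setTI; apply: (mfs_affine c d) => //.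
- have := lebesgue_measure_affine d c0 mA; rewrite A0 => /esym /eqP.
 by rewrite mule_eq0 eqe normr_eq0 (negbTE c0) /= => /eqP.
- by move=> x /= h; apply: PA.
Qed.

Lemma ae_refl (u : R) (P : R -> Prop) : {ae mu, forall x, P x} ->
 {ae mu, forall x, P (u - x)}.
move=> h; have c0 : (-1 : R) != 0 by rewrite oppr_eq0 oner_neq0.
by apply: (aeS (ae_affine u c0 h)) => x; rewrite mulN1r addrC.
Qed.

Lemma Rdct (F : nat -> R -> R) (f g : R -> R) :
 (forall n, mfs (F n)) -> mfs f -> itg g ->
 {ae mu, forall x, F n x @[n --> \oo] --> f x} ->
 (forall n, {ae mu, forall x, `|F n x| <= g x}) ->
 \int[mu]_x F n x @[n --> \oo] --> \int[mu]_x f x.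
move=> mF mf ig cF dF.
have [|||||if_ _] := @dominated_convergence _ _ R mu setT measurableT
 (fun n => EFin \o F n) (EFin \o f) (EFin \o g).
- by move=> n; apply/measurable_EFinP; exact: mF.
- by apply/measurable_EFinP; exact: mf.
- by apply: (aeS cF) => x h _; apply: cvg_EFin => //; exact: nearW.
- exact: ig.
- by apply: (aeS (aeN dF)) => x h n _ /=; rewrite lee_fin.
move=> h; apply: fine_cvg.
rewrite fineK//; exact: integrable_fin_num.
Qed.

Lemma derive_const_near (F : R -> R) (x : R) : (\forall y \near x, F y = 0) ->
 derive1 F x = 0.
move=> h; rewrite derive1E (@near_eq_derive _ _ _ F (cst 0))//.
by rewrite derive_cst.
Qed.

Lemma int_eq0_ae f : itg f -> (forall x, 0 <= f x) -> \int[mu]_x f x = 0 ->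
 {ae mu, forall x, f x = 0}.
move=> hf f0 h; have [H _] := ae_eq_integral_abs mu measurableT (measurable_int mu hf).
have {}H : ae_eq mu setT (EFin \o f) (cst 0).
 apply: H; transitivity (\int[mu]_x (f x)%:E)%E; last by rewrite intE// h.
 by apply: eqint => x /=; rewrite ger0_norm.
by apply: (aeS H) => x /(_ I) [].
Qed.

Lemma ae_neq (x : R) : {ae mu, forall t, t != x}.
exists [set x]; split => //; first exact: lebesgue_measure_set1.
by move=> t /= /negP; rewrite negbK => /eqP.
Qed.

Lemma int_sum (n : nat) (F : 'I_n -> R -> R) : (forall i, itg (F i)) ->
 \int[mu]_x (\sum_(i < n) F i x) = \sum_(i < n) \int[mu]_x F i x.
elim: n F => [|n ih] F hF.
 rewrite big_ord0; transitivity (\int[mu]_(s in [set: R]) (0 : R)).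
  by apply: eqRint => s; rewrite big_ord0.
 by rewrite Rintegral_cst// mul0r.
rewrite big_ord_recr /= -ih// -intD//; last exact: itg_sum.
by apply: eqRint => x; rewrite big_ord_recr.
Qed.

(** The primitive from [c] is 0 near each point of []c, d[], and at almost every point its
    derivative is [f] by Lebesgue differentiation. *)
Lemma ae_zero_itv f (c d : R) : itg f ->
 (forall x, c < x -> x < d -> \int[mu]_(y in `]c, x]) f y = 0) ->
 {ae mu, forall x, c < x -> x < d -> f x = 0}.
move=> hf h0.
have hl : locally_integrable setT f by apply: open_integrable_locally => //; exact: openT.
have hi y : mu.-integrable [set` Interval (BRight c) (BRight y)] (EFin \o f).
 by apply: integrableS hf.
apply: (aeS (FTC1 hi hl)) => x H cx xd.
have [|_ <-] := H; first by rewrite ?bnd_simp.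
apply: derive_const_near.
near=> y; apply: h0.
- by near: y; exact: lt_nbhsr.
- by near: y; exact: lt_nbhsl.
Unshelve. all: by end_near. Qed.

End integration.

(** * Fubini and convolution on the line *)

Section convolution.
Variable R : realType.
Notation mu := (@lebesgue_measure R).
Notation mu2 := (mu \x mu)%E.
Implicit Types f g h : R -> R.

Lemma int2_swap (F : R * R -> R) : mu2.-integrable setT (EFin \o F) ->
 mu2.-integrable setT (EFin \o (fun p => F (p.2, p.1))).
move=> iF; have mF : mfs F.
 by apply/measurable_EFinP; exact: (measurable_int _ iF).
have mF' : mfs (EFin \o (fun p : R * R => F (p.2, p.1))).
 by apply/measurable_EFinP; apply: mfsT => //; exact: measurable_swap.
apply: (integrable21ltyP mu mu mF').2.
by apply: (integrable12ltyP mu mu _).1 iF; exact/measurable_EFinP.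
Qed.

(** The real integral sends an infinite value to 0, so the inner real integrals match the extended
    ones for almost every section only; that suffices. *)
Lemma Rfubini (F : R * R -> R) : mu2.-integrable setT (EFin \o F) ->
 \int[mu]_x \int[mu]_y F (x, y) = \int[mu]_y \int[mu]_x F (x, y).
move=> iF.
have h1 := integrable_fubini_F iF; have h2 := integrable_fubini_F (int2_swap iF).
have f1 := integrable_ae measurableT h1; have f2 := integrable_ae measurableT h2.
have m1 := measurable_int mu h1; have m2 := measurable_int mu h2.
rewrite /Rintegral; congr fine.
transitivity (\int[mu]_x \int[mu]_y (EFin \o F) (x, y))%E.
 apply: ae_eq_integral => //.
  apply/measurable_EFinP; apply: mfsT => //.
 by apply: (aeS f1) => x hx _; rewrite fineK//; exact: hx.
rewrite (Fubini iF); apply: ae_eq_integral => //.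
 apply/measurable_EFinP; apply: mfsT => //.
by apply: (aeS f2) => x hx _; rewrite fineK//; exact: hx.
Qed.

Lemma Rfubini_ae1 (F : R * R -> R) : mu2.-integrable setT (EFin \o F) ->
 {ae mu, forall x, itg (fun y => F (x, y))}.
Proof. by move=> iF; exact: (ae_integrable1 iF). Qed.

Lemma Rfubini_ae2 (F : R * R -> R) : mu2.-integrable setT (EFin \o F) ->
 {ae mu, forall y, itg (fun x => F (x, y))}.
Proof. by move=> iF; exact: (ae_integrable2 iF). Qed.

Lemma Rfubini_itg1 (F : R * R -> R) : mu2.-integrable setT (EFin \o F) ->
 itg (fun x => \int[mu]_y F (x, y)).
move=> iF; have h1 := integrable_fubini_F iF.
have f1 := integrable_ae measurableT h1; have m1 := measurable_int mu h1.
apply/integrableP; split.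
 by apply/measurable_EFinP; apply: mfsT.
have [_] := integrableP _ _ _ h1; apply: le_lt_trans.
apply: ae_ge0_le_integral => //.
- apply: mfsT => //.
 by apply/measurable_EFinP; apply: mfsT.
- by apply: mfsT.
by apply: (aeS f1) => x hx _; rewrite /= -abse_EFin fineK//; exact: hx.
Qed.

Definition cv f g t := \int[mu]_s (f (t - s) * g s).

(** Where this fails, [cv f g t] is only a default value of the integral; identities at a point
    carry it as a hypothesis, and [cvok_ae] supplies it almost everywhere. *)
Definition cvok f g t := itg (fun s => f (t - s) * g s).

Lemma mfs_subl f (t : R) : mfs f ->
 mfs (fun s : R => f (t - s)).
Proof. by move=> mf; apply: mfsT => //; exact: mfsB. Qed.

Lemma mfs_cv2 f g : mfs f -> mfs g ->
 mfs (fun p : R * R => f (p.1 - p.2) * g p.2).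
move=> mf mg; apply: mfsM.
 by apply: mfsT => //; exact: mfsB.
by apply: mfsT.
Qed.

Lemma itg_shift f (u : R) : itg f -> itg (fun s => f (s - u)).
move=> hf; have := itg_affine (- u) (oner_neq0 _) hf.
by under eq_fun do rewrite mul1r.
Qed.

Lemma int_shift f (u : R) : itg f -> \int[mu]_s f (s - u) = \int[mu]_s f s.
move=> hf; rewrite [RHS](int_affine (- u) (oner_neq0 _) hf) normr1 mul1r.
by apply: eq_Rintegral => x _; rewrite mul1r.
Qed.

Lemma itg_refl f (u : R) : itg f -> itg (fun s => f (u - s)).
move=> hf; have c0 : (-1 : R) != 0 by rewrite oppr_eq0 oner_neq0.
have := itg_affine u c0 hf; congr itg; apply/funext => x.
by rewrite mulN1r addrC.
Qed.

Lemma int_refl f (u : R) : itg f -> \int[mu]_s f (u - s) = \int[mu]_s f s.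
move=> hf; have c0 : (-1 : R) != 0 by rewrite oppr_eq0 oner_neq0.
rewrite [RHS](int_affine u c0 hf) normrN1 mul1r.
by apply: eq_Rintegral => x _; rewrite mulN1r addrC.
Qed.

Lemma cv_itg2 f g : itg f -> itg g ->
 mu2.-integrable setT (EFin \o (fun p : R * R => f (p.1 - p.2) * g p.2)).
move=> hf hg; have mf := imeas hf; have mg := imeas hg.
have mfg : mfs (EFin \o (fun p : R * R => f (p.1 - p.2) * g p.2)).
 by apply/measurable_EFinP; exact: mfs_cv2.
apply: (integrable21ltyP mu mu mfg).2.
rewrite (@eqint _ _ (fun y => (norm1 f * `|g y|)%:E)); last first.
 move=> y /=; rewrite (@eqint _ _ (fun x : R => (`|g y| * `|f (x - y)|)%:E)).
  rewrite intE; last by apply: itgZ; apply: itg_norm; exact: itg_shift.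
  rewrite intZ; last by apply: itg_norm; exact: itg_shift.
  by rewrite (int_shift y (itg_norm hf)) mulrC.
 by move=> x; rewrite normrM mulrC.
rewrite intE ?ltry//; apply: itgZ; exact: itg_norm.
Qed.

Lemma cvok_ae f g : itg f -> itg g -> {ae mu, forall t, cvok f g t}.
Proof. by move=> hf hg; exact: (Rfubini_ae1 (cv_itg2 hf hg)). Qed.

Lemma cv_itg f g : itg f -> itg g -> itg (cv f g).
Proof. by move=> hf hg; exact: (Rfubini_itg1 (cv_itg2 hf hg)). Qed.

Lemma int_cv f g : itg f -> itg g ->
 \int[mu]_t cv f g t = \int[mu]_t f t * \int[mu]_t g t.
move=> hf hg; rewrite /cv (Rfubini (cv_itg2 hf hg)) /=.
transitivity (\int[mu]_y (\int[mu]_t f t * g y)).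
 apply: eq_Rintegral => y _.
 by rewrite intZr ?int_shift//; exact: itg_shift.
by rewrite intZ.
Qed.

Lemma cv_le_norm f g t : cvok f g t ->
 `|cv f g t| <= cv (fun x => `|f x|) (fun x => `|g x|) t.
move=> h; apply: (le_trans (int_norm h)).
by rewrite /cv le_eqVlt; apply/orP; left; apply/eqP; apply: eq_Rintegral => x _; rewrite normrM.
Qed.

Lemma norm1_cv f g : itg f -> itg g -> norm1 (cv f g) <= norm1 f * norm1 g.
move=> hf hg; rewrite /norm1 -int_cv; [|exact: itg_norm..].
apply: int_ae_le; [exact/itg_norm/cv_itg|apply: cv_itg; exact: itg_norm|].
by apply: (aeS (cvok_ae hf hg)) => t; exact: cv_le_norm.
Qed.

Lemma cvC f g t : cvok f g t -> cv f g t = cv g f t.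
move=> h; rewrite /cv -(int_refl t h); apply: eq_Rintegral => s _.
by rewrite opprB addrCA subrr addr0 mulrC.
Qed.

(** Finiteness at [t] of the convolution of absolute values makes the triple integrand integrable,
    so Fubini applies. The form at a point serves where a convolution is evaluated at a prescribed
    [t], as in [Wt_const]. *)
Lemma cvA_at f g h t : itg f -> itg g -> itg h ->
 cvok (fun x => `|f x|) (cv (fun x => `|g x|) (fun x => `|h x|)) t ->
 cv f (cv g h) t = cv (cv f g) h t.
move=> hf hg hh hok; have mf := imeas hf.
have mg := imeas hg; have mh := imeas hh.
pose F (p : R * R) := f (t - p.1) * (g (p.1 - p.2) * h p.2).
have mF : mfs F.
 apply: mfsM; last exact: mfs_cv2.
 by apply: mfsT => //; exact: mfsB.
have iF : mu2.-integrable setT (EFin \o F).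
 apply/integrable12ltyP; first exact/measurable_EFinP.
 move/integrableP : (hok) => [mok]; apply: le_lt_trans.
 apply: ae_ge0_le_integral => //.
 - by move=> x _; exact: integral_ge0.
 - have := @measurable_fun_fubini_tonelli_F _ _ _ _ R mu (abse \o (EFin \o F)).
  apply; last by move=> x; exact: abse_ge0.
  by apply: mfsT => //; exact/measurable_EFinP.
 - exact: mfsT.
 apply: (aeS (cvok_ae hg hh)) => s hs _ /=.
 rewrite (@eqint _ _ (fun y : R => (`|f (t - s)| * `|g (s - y) * h y|)%:E)); last first.
  by move=> y; rewrite /F /= normrM.
 rewrite intE; last by apply: itgZ; exact: (itg_norm hs).
 rewrite intZ; last exact: (itg_norm hs).
 rewrite lee_fin normrM normr_id ler_wpM2l//.
 rewrite (le_trans _ (ler_norm _))// le_eqVlt; apply/orP; left; apply/eqP.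
 by apply: eq_Rintegral => y _; rewrite normrM.
have mcv : mfs (cv g h) := imeas (cv_itg hg hh).
transitivity (\int[mu]_s \int[mu]_u F (s, u)).
 apply: int_ae_eq.
 - by apply: mfsM => //; exact: mfs_subl.
 - exact: (imeas (Rfubini_itg1 iF)).
 by apply: (aeS (cvok_ae hg hh)) => s hs; rewrite /F /= intZ.
rewrite Rfubini//.
apply: int_ae_eq.
- exact: (imeas (Rfubini_itg1 (int2_swap iF))).
- apply: mfsM => //.
 by apply: mfs_subl; exact: (imeas (cv_itg hf hg)).
apply: (aeS (Rfubini_ae2 iF)) => u hu /=; rewrite /F /=.
(* Where [h u] is not 0 the integrable section can be divided by it, which gives integrability of
   the inner product; where it is 0 both sides vanish. *)
have [h0|h0] := eqVneq (h u) 0.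
 rewrite h0 mulr0; transitivity (\int[mu]_(s in [set: R]) (0 : R)).
  by apply: eq_Rintegral => s _; rewrite !mulr0.
 by rewrite Rintegral_cst// mul0r.
have hi : itg (fun s => f (t - s) * g (s - u)).
 have := itgZ (h u)^-1 hu; congr itg; apply/funext => s.
 by rewrite /F /=; field.
transitivity (\int[mu]_s (f (t - s) * g (s - u) * h u)).
 by apply: eq_Rintegral => s _; rewrite mulrA.
rewrite intZr//; congr (_ * _); rewrite -(int_shift (- u) hi).
by apply: eq_Rintegral => s _; rewrite opprK addrK opprD addrA addrAC.
Qed.

End convolution.

(** * Titchmarsh's convolution theorem *)

Section titchmarsh.
Variable R : realType.
Notation mu := (@lebesgue_measure R).
Implicit Types f g h u v w : R -> R.

Definition van f (c : R) := {ae mu, forall x, x < c -> f x = 0}.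

Definition supp0 f (B : R) := forall x, x < 0 \/ B < x -> f x = 0.

Lemma vanS f (c d : R) : d <= c -> van f c -> van f d.
Proof. by move=> dc h; apply: (aeS h) => x fx xd; apply: fx; exact: lt_le_trans dc. Qed.

Lemma itg_mulbd h f (B C : R) : mfs h -> itg f -> supp0 f B ->
 (forall x, 0 <= x -> x <= B -> `|h x| <= C) -> itg (fun x => h x * f x).
move=> mh hf sf hC.
apply: (itg_dom _ _ (itgZ `|C| (itg_norm hf))).
 by apply: mfsM => //; exact: imeas.
move=> x; rewrite normrM.
have [x0|x0] := ltP x 0; first by rewrite (sf x (or_introl x0)) normr0 !mulr0.
have [xB|xB] := ltP B x; first by rewrite (sf x (or_intror xB)) normr0 !mulr0.
by rewrite ler_wpM2r// (le_trans (hC _ x0 xB))// ler_norm.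
Qed.

Lemma mfs_expRM (p : R) : mfs (fun x : R => expR (p * x)).
Proof. by apply: mfsT => //; exact: mulrl_measurable. Qed.

Lemma itg_exp f (B p : R) : itg f -> supp0 f B -> itg (fun x => expR (p * x) * f x).
move=> hf sf; apply: (@itg_mulbd _ _ B (expR (`|p| * B))) => //.
 exact: mfs_expRM.
move=> x x0 xB; rewrite ger0_norm ?expR_ge0// ler_expR.
by rewrite (le_trans (ler_wpM2r x0 (ler_norm p)))// ler_wpM2l.
Qed.

Lemma supp0M h f (B : R) : supp0 f B -> supp0 (fun x => h x * f x) B.
Proof. by move=> sf x /sf ->; rewrite mulr0. Qed.

Lemma cv_supp0 f g (B C : R) : supp0 f B -> supp0 g C -> supp0 (cv f g) (B + C).
move=> sf sg x hx; rewrite /cv; transitivity (\int[mu]_(s in [set: R]) (0 : R)).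
 apply: eqRint => s.
 have [s0|s0] := ltP s 0; first by rewrite (sg s (or_introl s0)) mulr0.
 have [sC|sC] := ltP C s; first by rewrite (sg s (or_intror sC)) mulr0.
 by rewrite sf ?mul0r//; case: hx => hx; [left|right]; lra.
by rewrite Rintegral_cst// mul0r.
Qed.

Lemma cv_exp f g (p t : R) : cvok f g t ->
 cv (fun x => expR (p * x) * f x) (fun x => expR (p * x) * g x) t =
 expR (p * t) * cv f g t.
move=> h; rewrite /cv -intZ//; apply: eqRint => s.
have -> : expR (p * t) = expR (p * (t - s)) * expR (p * s).
 by rewrite -expRD -mulrDr subrK.
ring.
Qed.

(* [1 - exp (- expR (p (s - t)))] tends to the indicator of [t < s] as p grows,
  while its integral against [f] is a power series in the given moments. *)
Lemma exp_moments_vanish f (c M : R) : itg f -> supp0 f c ->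
 (forall p : nat, `|\int[mu]_t (expR (p%:R * (c - t)) * f t)| <= M) -> van f c.
move=> hf sf hM.
have [c0|c0] := leP c 0.
 by apply: aeW => x xc; apply: sf; left; exact: lt_le_trans c0.
have mf := imeas hf.
have M0 : 0 <= M by apply: le_trans (hM 0%N).
have iE (p : nat) (k : nat) (s : R) : itg (fun t => expR (p%:R * (s - t)) ^+ k * f t).
 have := itgZ (expR ((k%:R * p%:R) * s)) (itg_exp (- (k%:R * p%:R)) hf sf).
 congr itg; apply/funext => t; rewrite mulrA -expRD -expRM_natl.
 by congr (expR _ * _); ring.
pose g (p : nat) (s t : R) := 1 - expR (- expR (p%:R * (s - t))).
have gb p s t : `|g p s t| <= 1.
 rewrite ger0_norm; last by rewrite subr_ge0 -expR0 ler_expR oppr_le0 expR_ge0.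
 by rewrite gerBl expR_ge0.
have mg p s : mfs (g p s).
 apply: mfsB => //; apply: mfsT => //.
 apply: mfsT => //; apply: mfsT => //.
 by apply: mfsM => //; exact: mfsB.
(* After expanding the exponential, the [k]-th term is [y0^k / k!] times the moment of index [p k]
   centred at [c], which is at most [M]; the terms with [k > 0] sum to at most [M (e^y0 - 1)], and
   [y0] tends to 0 as [p] grows because [s < c]. *)
have key (p : nat) (s : R) : 0 < s -> s < c -> `|\int[mu]_t (g p s t * f t)| <=
  M * (expR (expR (p%:R * (s - c))) - 1).
 move=> s0 sc; pose y t := expR (p%:R * (s - t)); pose y0 := expR (p%:R * (s - c)).
 pose F n t := (1 - series (exp_coeff (- y t)) n) * f t.
 have my : mfs y.
  by apply: mfsT => //; apply: mfsM => //; exact: mfsB.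
 have mF n : mfs (F n).
  apply: mfsM => //; apply: mfsB => //.
  rewrite /series /= /exp_coeff /=; apply: measurable_sum => k.
  apply: mfsM => //; apply: measurable_funX; exact: measurable_funN.
 have Flim : \int[mu]_t F n t @[n --> \oo] --> \int[mu]_t (g p s t * f t).
  apply: (@Rdct _ _ _ (fun t => (1 + expR (expR (p%:R * s))) * `|f t|)) => //.
  - by apply: mfsM.
  - by apply: itgZ; exact: itg_norm.
  - apply: aeW => t; apply: cvgM; last exact: cvg_cst.
   apply: cvgB; first exact: cvg_cst.
   exact: is_cvg_series_exp_coeff.
  - move=> n; apply: aeW => t; rewrite /F normrM.
   have [t0|t0] := ltP t 0; first by rewrite (sf t (or_introl t0)) normr0 !mulr0.
   rewrite ler_wpM2r// (le_trans (ler_normB _ _))// normr1 lerD2l.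
   apply: (@le_trans _ _ (series (exp_coeff (y t)) n)).
    rewrite /series /= (le_trans (ler_norm_sum _ _ _))// ler_sum// => k _.
    by rewrite /exp_coeff /= normrM normrX normrN normfV normr_nat ger0_norm ?expR_ge0.
   apply: (@le_trans _ _ (expR (y t))).
    apply: nondecreasing_cvgn_le; last exact: is_cvg_series_exp_coeff.
    apply: nondecreasing_series => k _ _.
    by rewrite /exp_coeff /= mulr_ge0// exprn_ge0// expR_ge0.
   by rewrite ler_expR ler_expR ler_wpM2l// gerBl.
 have Fb n : (0 < n)%N -> `|\int[mu]_t F n t| <= M * (series (exp_coeff y0) n - 1).
  case: n => // n _.
  have -> : \int[mu]_t F n.+1 t =
    - \sum_(k < n) (-1) ^+ k.+1 / k.+1`!%:R * \int[mu]_t (y t ^+ k.+1 * f t).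
   transitivity (\int[mu]_t (- \sum_(k < n) ((-1) ^+ k.+1 / k.+1`!%:R * (y t ^+ k.+1 * f t)))).
    apply: eqRint => t; rewrite /F /series /= big_nat_recl//= big_mkord.
    rewrite /exp_coeff /= expr0 fact0 divr1 opprD addrA subrr sub0r mulNr mulr_suml.
    congr (- _); apply: eq_bigr => k _; rewrite [(- y t) ^+ _]exprNn.
    by move: (_ ^+ k.+1) (y t ^+ k.+1) => A B; ring.
   rewrite intN; last by apply: itg_sum => k; apply: itgZ; exact: iE.
   congr (- _); rewrite int_sum; last by move=> k; apply: itgZ; exact: iE.
   by apply: eq_bigr => k _; rewrite intZ//; exact: iE.
  rewrite normrN (le_trans (ler_norm_sum _ _ _))//.
  rewrite /series /= big_nat_recl//= big_mkord /exp_coeff /= expr0 fact0 divr1.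
  rewrite addrAC subrr add0r mulr_sumr ler_sum// => k _.
  rewrite !normrM normrX normrN1 expr1n mul1r normfV normr_nat mulrC.
  rewrite [leLHS]mulrC [leRHS]mulrCA [leLHS]mulrC [leRHS]mulrA ler_wpM2r ?invr_ge0//.
  have -> : \int[mu]_t (y t ^+ k.+1 * f t) = y0 ^+ k.+1 *
    \int[mu]_t (expR ((p * k.+1)%:R * (c - t)) * f t).
   rewrite -intZ.
    apply: eqRint => t; rewrite mulrA /y /y0 -!expRM_natl -expRD natrM.
    by congr (expR _ * _); ring.
   have := iE p k.+1 c; congr itg; apply/funext => t.
   by rewrite -expRM_natl natrM mulrCA mulrA.
  by rewrite normrM normrX (ger0_norm (expR_ge0 _)) ler_wpM2l ?exprn_ge0 ?expR_ge0.
 have := cvg_norm Flim => hl.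
 have hr : M * (series (exp_coeff y0) n - 1) @[n --> \oo] --> M * (expR y0 - 1).
  apply: cvgM; first exact: cvg_cst.
  apply: cvgB; last exact: cvg_cst.
  exact: is_cvg_series_exp_coeff.
 apply: (ler_cvg_to (hl _) hr).
 by near=> n; apply: Fb; near: n; exists 1%N.
have lim (s : R) : 0 < s -> s < c -> \int[mu]_t ((if t < s then 1 else 0) * f t) = 0.
 move=> s0 sc.
 have h1 : \int[mu]_t (g p s t * f t) @[p --> \oo] -->
   \int[mu]_t ((if t < s then 1 else 0) * f t).
  apply: (@Rdct _ _ _ (fun t => `|f t|)).
  - by move=> p; apply: mfsM.
  - apply: mfsM => //; apply: mfs_if => //.
   exact: measurable_fun_ltr.
  - exact: itg_norm.
  - apply: (aeS (ae_neq s)) => t ts; apply: cvgM; last exact: cvg_cst.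
   have [lts|lst|e] := ltgtP t s; last by rewrite e eqxx in ts.
   + have a0 : 0 < s - t by rewrite subr_gt0.
    apply: cvg_dist_dom (cvg_inv1Dn 1 a0) => p.
    have pos : 0 < 1 + p%:R * (s - t) by rewrite ltr_pwDl// mulr_ge0// ltW.
    rewrite /g addrAC subrr sub0r normrN ger0_norm ?expR_ge0// mul1r expRN.
    rewrite lef_pV2 ?posrE ?expR_gt0//.
    by apply: (le_trans _ (expR_ge1Dx _)); apply: (le_trans (expR_ge1Dx _)); rewrite lerDr.
   + have a0 : 0 < t - s by rewrite subr_gt0.
    apply: cvg_dist_dom (cvg_inv1Dn 1 a0) => p.
    have pos : 0 < 1 + p%:R * (t - s) by rewrite ltr_pwDl// mulr_ge0// ltW.
    rewrite subr0 /g ger0_norm; last first.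
     by rewrite subr_ge0 -expR0 ler_expR oppr_le0 expR_ge0.
    apply: (@le_trans _ _ (expR (p%:R * (s - t)))).
     by have := expR_ge1Dx (- expR (p%:R * (s - t))); lra.
    rewrite mul1r -opprB mulrN expRN.
    rewrite lef_pV2 ?posrE ?expR_gt0//.
    exact: expR_ge1Dx.
  - move=> p; apply: aeW => t; rewrite normrM -[leRHS]mul1r ler_wpM2r//.
 have a0 : 0 < c - s by rewrite subr_gt0.
 have h2 : \int[mu]_t (g p s t * f t) @[p --> \oo] --> 0.
  apply: cvg_dist_dom (cvg_inv1Dn (M * expR 1) a0) => p; rewrite subr0.
  have pos : 0 < 1 + p%:R * (c - s) by rewrite ltr_pwDl// mulr_ge0// ltW.
  apply: (le_trans (key p s s0 sc)); rewrite -mulrA ler_wpM2l//.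
  set y0 := expR (p%:R * (s - c)); have y00 : 0 <= y0 := expR_ge0 _.
  have y01 : y0 <= (1 + p%:R * (c - s))^-1.
   rewrite /y0 -opprB mulrN expRN.
   rewrite lef_pV2 ?posrE ?expR_gt0//.
   exact: expR_ge1Dx.
  have y02 : y0 <= 1.
   by rewrite (le_trans y01)// invf_le1// lerDl mulr_ge0// ltW.
  by rewrite (le_trans (expR_sub1_le y00 y02))// ler_wpM2l.
 exact: (cvg_unique (@Rhausdorff R) h1 h2).
(* [ae_zero_itv] takes a finite left end; -1 will do, since [f] is 0 on the negative half-line. *)
have ae0 : {ae mu, forall x, - 1 < x -> x < c -> f x = 0}.
 apply: ae_zero_itv => // x x1 xc.
 rewrite Rintegral_mkcond.
 have [x0|x0] := leP x 0.
  transitivity (\int[mu]_(s in [set: R]) (0 : R)); last by rewrite Rintegral_cst// mul0r.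
  apply: int_ae_eq => //.
   exact: mfs_patch0.
  apply: (aeS (ae_neq 0)) => t t0; rewrite patchE; case: ifPn => //.
  rewrite inE/= in_itv/= => /andP[_ tx]; apply: sf; left.
  by rewrite lt_neqAle t0 (le_trans tx).
 rewrite -(lim _ x0 xc); apply: int_ae_eq.
 - exact: mfs_patch0.
 - apply: mfsM => //; apply: mfs_if => //.
  exact: measurable_fun_ltr.
 apply: (aeS (ae_neq x)) => t tx; rewrite patchE.
 have [t1|t1] := ltP t 0.
  by rewrite (sf t (or_introl t1)) mulr0; case: ifP.
 case: ifPn; rewrite ?inE ?notin_setE /= in_itv/=.
  by move=> /andP[_ tx']; rewrite lt_neqAle tx tx' mul1r.
 case: ifPn => [tx' []|]; last by rewrite mul0r.
 by apply/andP; split; [lra|exact: ltW].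
apply: (aeS ae0) => x h xc; have [x1|x1] := ltP (-1) x; first exact: h.
by apply: sf; left; lra.
Unshelve. all: by end_near. Qed.

Lemma cv_van f g (c d t : R) : mfs f -> mfs g ->
 van f c -> van g d -> t < c + d -> cv f g t = 0.
move=> mf mg vf vg tcd; transitivity (\int[mu]_(s in [set: R]) (0 : R)); last first.
 by rewrite Rintegral_cst// mul0r.
apply: int_ae_eq => //; first by apply: mfsM => //; exact: mfs_subl.
apply: (aeS2 (ae_refl t vf) vg) => s h1 h2.
have [sd|sd] := ltP s d; first by rewrite h2// mulr0.
by rewrite h1 ?mul0r//; lra.
Qed.

Lemma cv_ae_r f g g' (t : R) : mfs f -> mfs g ->
 mfs g' -> {ae mu, forall x, g x = g' x} -> cv f g t = cv f g' t.
move=> mf mg mg' gg'; apply: int_ae_eq.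
- by apply: mfsM => //; exact: mfs_subl.
- by apply: mfsM => //; exact: mfs_subl.
by apply: (aeS gg') => s ->.
Qed.

Lemma cvA_ae f g h : itg f -> itg g -> itg h ->
 {ae mu, forall t, cv f (cv g h) t = cv (cv f g) h t}.
move=> hf hg hh; have hc := cv_itg (itg_norm hg) (itg_norm hh).
by apply: (aeS (cvok_ae (itg_norm hf) hc)) => t ht; exact: cvA_at.
Qed.

Lemma cvC_ae f g : itg f -> itg g -> {ae mu, forall t, cv f g t = cv g f t}.
Proof. by move=> hf hg; apply: (aeS (cvok_ae hf hg)) => t; exact: cvC. Qed.

Lemma cv_swap4 (a b c d : R -> R) : itg a -> itg b -> itg c -> itg d ->
 {ae mu, forall t, cv (cv a b) (cv c d) t = cv (cv a d) (cv b c) t}.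
move=> ha hb hc hd.
have hbc := cv_itg hb hc; have hcd := cv_itg hc hd.
have e1 := cvA_ae ha hb hcd.
have e2 := cvA_ae hb hc hd; have e3 := cvC_ae hbc hd; have e4 := cvA_ae ha hd hbc.
apply: (aeS2 e1 e4) => t <- <-; apply: cv_ae_r.
- exact: imeas.
- by apply: imeas; exact: cv_itg.
- by apply: imeas; exact: cv_itg.
by apply: (aeS2 e2 e3) => s -> <-.
Qed.

Lemma supp0_van f (B : R) : supp0 f B -> van f 0.
Proof. by move=> sf; apply: aeW => x x0; apply: sf; left. Qed.

(** The Laplace transform of [w] at [p] squares to that of [cv w w], hence is at most
    [S e^(-p c / 2)]. Removing from [w] its part beyond [c / 2], whose contribution stays bounded
    after rescaling by [e^(p c / 2)], leaves a function with bounded exponential moments, to which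
    [exp_moments_vanish] applies. *)
Lemma cv_sqr_van w (B c : R) : itg w -> supp0 w B -> van (cv w w) c -> van w (c / 2).
move=> hw sw vw.
have [c0|c0] := leP c 0.
 by apply: (vanS _ (supp0_van sw)); rewrite pmulr_lle0// invr_gt0.
pose S := Num.sqrt (norm1 (cv w w)).
have hL (p : nat) : `|\int[mu]_t (expR (- p%:R * t) * w t)| <= expR (- (p%:R * (c / 2))) * S.
 have ie := itg_exp (- p%:R) hw sw.
 have iw := cv_itg hw hw.
 have ee := itg_exp (- p%:R) iw (cv_supp0 sw sw).
 have L2 : (\int[mu]_t (expR (- p%:R * t) * w t)) ^+ 2 =
   \int[mu]_t (expR (- p%:R * t) * cv w w t).
  rewrite expr2 -int_cv//; apply: int_ae_eq.
  - by apply: imeas; exact: cv_itg.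
  - exact: imeas.
  by apply: (aeS (cvok_ae hw hw)) => t; exact: cv_exp.
 rewrite -ler_sqr ?nnegrE ?mulr_ge0 ?expR_ge0 ?sqrtr_ge0//.
 rewrite -normrX L2 exprMn sqr_sqrtr ?norm1_ge0// -expRM_natl.
 rewrite (le_trans (int_norm ee))// -[X in _ <= X * _]/(expR _) /norm1 -intZ; last exact: itg_norm.
 apply: int_ae_le; [exact: itg_norm|by apply: itgZ; exact: itg_norm|].
 apply: (aeS vw) => t ht; have [tc|tc] := ltP t c; first by rewrite ht// mulr0 normr0 mulr0.
 rewrite normrM ler_wpM2r// ger0_norm ?expR_ge0// ler_expR mulNr mulrN lerN2.
 by rewrite mulrCA ler_wpM2l// mulrC divfK.
pose f t := if t < c / 2 then w t else 0.
have mind : mfs (fun t : R => t < c / 2) by exact: measurable_fun_ltr.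
have mw := imeas hw.
have hf : itg f.
 apply: (itg_dom _ _ (itg_norm hw)); first exact: mfs_if.
 by move=> t; rewrite /f; case: ifP => // _; rewrite normr0.
have sf : supp0 f (c / 2).
 move=> x [x0|xc]; rewrite /f; case: ifPn => // h; first by apply: sw; left.
 by move: (lt_trans xc h); rewrite ltxx.
have vf : van f (c / 2).
 apply: (@exp_moments_vanish _ _ (S + norm1 w)) => // p.
 pose r t := if t < c / 2 then 0 else expR (p%:R * (c / 2 - t)) * w t.
 have ie := itg_exp (- p%:R) hw sw.
 have ie' : itg (fun t => expR (p%:R * (c / 2 - t)) * w t).
  have := itgZ (expR (p%:R * (c / 2))) ie; congr itg; apply/funext => t.
  by rewrite mulrA -expRD; congr (expR _ * _); ring.
 have hr : itg r.
  apply: (itg_dom _ _ (itg_norm ie')).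
   by apply: mfs_if => //; exact: imeas.
  by move=> t; rewrite /r; case: ifP => // _; rewrite normr0.
 have -> : \int[mu]_t (expR (p%:R * (c / 2 - t)) * f t) =
   expR (p%:R * (c / 2)) * \int[mu]_t (expR (- p%:R * t) * w t) - \int[mu]_t r t.
  rewrite -intZ// -intB//; last exact: itgZ.
  apply: eqRint => t; rewrite mulrA -expRD /f /r.
  have -> : p%:R * (c / 2) + - p%:R * t = p%:R * (c / 2 - t) by ring.
  by case: ifP => _; rewrite ?subr0// mulr0 subrr.
 rewrite (le_trans (ler_normB _ _))// lerD//.
  rewrite normrM ger0_norm ?expR_ge0//.
  by have := ler_wpM2l (expR_ge0 (p%:R * (c / 2))) (hL p); rewrite [leRHS]mulrA expRxMexpNx_1 mul1r.
 rewrite (le_trans (int_norm hr))//; apply: int_le; [exact: itg_norm..|] => t.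
 rewrite /r; case: ifPn => h; first by rewrite normr0.
 rewrite normrM -[leRHS]mul1r ler_wpM2r// ger0_norm ?expR_ge0// -[leRHS]expR0 ler_expR.
 by rewrite mulr_ge0_le0// subr_le0 leNgt.
by apply: (aeS vf) => x fx xc; have := fx xc; rewrite /f xc.
Qed.

Definition mx (i : nat) f := fun x : R => x ^+ i * f x.

Lemma mx_itg i f (B : R) : itg f -> supp0 f B -> itg (mx i f).
move=> hf sf; apply: (@itg_mulbd _ _ B (B ^+ i)) => //.
by move=> x x0 xB; rewrite normrX ger0_norm// lerXn2r ?nnegrE// (le_trans x0).
Qed.

Lemma supp0_mx i f (B : R) : supp0 f B -> supp0 (mx i f) B.
Proof. exact: supp0M. Qed.

(** Multiplication by the variable is a derivation for convolution, since [t = (t - s) + s]. *)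
Lemma cv_mulx u v (B : R) : itg u -> supp0 u B -> itg v -> supp0 v B ->
 {ae mu, forall t, t * cv u v t = cv (mx 1 u) v t + cv u (mx 1 v) t}.
move=> hu su hv sv; have hu1 := mx_itg 1 hu su; have hv1 := mx_itg 1 hv sv.
have h3 := cvok_ae hu hv; have h1 := cvok_ae hu1 hv; have h2 := cvok_ae hu hv1.
apply: (aeS2 h3 (aeS2 h1 h2 (fun t a b => conj a b))) => t h [h' h''].
rewrite /cv -intZ// -intD//; apply: eqRint => s; rewrite /mx !expr1; ring.
Qed.

(** Put [W = cv u (mx 1 v)]. By the derivation rule [W] is also [mx 1 (cv u v)] minus
    [cv (mx 1 u) v]. Convolve this with [W]: the first product vanishes up to [x + y]; the second
    regroups by [cv_swap4] into [cv u v] convolved with [cv (mx 1 v) (mx 1 u)] and vanishes up to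
    [x + w]. Then [cv_sqr_van] takes the square root, which halves the threshold. *)
Lemma van_step u v (B x y w : R) : itg u -> supp0 u B -> itg v -> supp0 v B ->
 van (cv u v) x -> van (cv u (mx 1 v)) y -> van (cv (mx 1 u) (mx 1 v)) w ->
 van (cv u (mx 1 v)) ((x + Num.min y w) / 2).
move=> hu su hv sv vx vy vw.
have hu1 := mx_itg 1 hu su; have hv1 := mx_itg 1 hv sv.
have su1 := supp0_mx 1 su; have sv1 := supp0_mx 1 sv.
pose W := cv u (mx 1 v); have hW : itg W by exact: cv_itg.
have huv := cv_itg hu hv; have hu1v := cv_itg hu1 hv.
have suv := cv_supp0 su sv.
have hxuv : itg (mx 1 (cv u v)) := mx_itg 1 huv suv.
have eW : {ae mu, forall t, W t = mx 1 (cv u v) t - cv (mx 1 u) v t}.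
 by apply: (aeS (cv_mulx hu su hv sv)) => t h; rewrite /mx expr1 h addrC addKr.
have e4 := cv_swap4 hu hv1 hu1 hv.
have e5 := cvC_ae hv1 hu1.
have o1 := cvok_ae hW hxuv; have o2 := cvok_ae hW hu1v.
apply: (@cv_sqr_van _ (B + B)) => //; first exact: cv_supp0.
apply: (aeS2 e4 (aeS2 o1 o2 (fun t a b => conj a b))) => t h4 [h1 h2] tlt.
have mW := imeas hW.
rewrite (cv_ae_r t mW mW (imeas (itgB hxuv hu1v)) eW).
have -> : cv W (fun x => mx 1 (cv u v) x - cv (mx 1 u) v x) t =
  cv W (mx 1 (cv u v)) t - cv W (cv (mx 1 u) v) t.
 by rewrite /cv -intB//; apply: eqRint => s; rewrite mulrBr.
have [y1 w1] : t < x + y /\ t < x + w.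
 by split; apply: (lt_le_trans tlt); rewrite lerD2l ge_min lexx ?orbT.
have vx' : van (mx 1 (cv u v)) x by apply: (aeS vx) => s h sx; rewrite /mx h// mulr0.
have huv1 := cv_itg hu1 hv1; have hvu1 := cv_itg hv1 hu1.
rewrite addrC in y1; rewrite (cv_van mW (imeas hxuv) vy vx' y1) h4 sub0r.
rewrite (cv_ae_r t (imeas huv) (imeas hvu1) (imeas huv1) e5).
by rewrite (cv_van (imeas huv) (imeas huv1) vx vw w1) oppr0.
Qed.

(** [b n] is the supremum of the [c <= T] up to which all convolutions of [x^i f] and [x^j g] with
    [i + j = n] vanish. The averaging in [van_step] makes [b] concave past a drop: once [b] drops,
    each later drop is at least as large, which contradicts [b >= 0]. Hence [b] stays at its initial
    value [T]. *)
Lemma titchmarsh_van (f g : R -> R) (T : R) : 0 < T -> itg f -> supp0 f T ->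
 itg g -> supp0 g T -> van (cv f g) T -> forall n c, c < T -> van (cv f (mx n g)) c.
move=> T0 hf sf hg sg vfg.
pose V n c := forall i j, (i + j = n)%N -> van (cv (mx i f) (mx j g)) c.
have hmf i := mx_itg i hf sf; have hmg j := mx_itg j hg sg.
have smf i := supp0_mx i sf; have smg j := supp0_mx j sg.
have VS n c d : d <= c -> V n c -> V n d by move=> dc h i j ij; exact: vanS (h i j ij).
have V0 n : V n 0.
 move=> i j _; apply: (@supp0_van _ (T + T)); exact: cv_supp0.
pose S n := [set c | 0 <= c <= T /\ V n c].
have S0 n : S n 0 by split; [rewrite lexx ltW|exact: V0].
have supS n : has_sup (S n).
 by split; [exists 0; exact: S0|exists T => c [/andP[_ cT] _]].
pose b n := sup (S n).
have b0 n : 0 <= b n by apply: ub_le_sup; [exact: (supS n).2|exact: S0].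
have bT n : b n <= T by apply: ge_sup; [exact: (supS n).1|move=> c [/andP[_ cT] _]].
have Vb n c : c < b n -> V n c.
 by move=> /(sup_gt (supS n).1)[d [_ Vd]] /ltW dc; exact: VS Vd.
have bV n c : c <= T -> V n c -> c <= b n.
 move=> cT Vc; have [c0|c0] := leP 0 c; last by rewrite ltW// (lt_le_trans c0).
 by apply: ub_le_sup; [exact: (supS n).2|split => //; rewrite c0 cT].
have mx0 h : mx 0 h = h by apply/funext => x; rewrite /mx expr0 mul1r.
have mx1 i h : mx 1 (mx i h) = mx i.+1 h.
 by apply/funext => x; rewrite /mx expr1 exprS mulrA.
have b0T : b 0%N = T.
 apply/le_anti; rewrite bT bV// => -[|i] [|j] //= _; by rewrite !mx0.
have step n x y z : V n x -> V n.+1 y -> V n.+2 z -> (x + Num.min y z) / 2 <= x ->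
  V n.+1 ((x + Num.min y z) / 2).
 move=> Vx Vy Vz cx.
 have st i j : (i + j = n)%N -> van (cv (mx i f) (mx j.+1 g)) ((x + Num.min y z) / 2).
  move=> ij; rewrite -mx1; apply: (@van_step _ _ T) => //.
  - exact: Vx.
  - by rewrite mx1; apply: Vy; rewrite addnS ij.
  - by rewrite !mx1; apply: Vz; rewrite addnS addSn ij.
 (* For [j = 0] the right factor carries no power of [x] and [van_step] does not apply; the
    derivation rule recovers this convolution from its neighbour, at a threshold not beyond [x]. *)
 move=> i [|j]; last by rewrite addnS => -[]; exact: st.
 rewrite addn0 => ->; have h1 := st n 0%N (addn0 n); have h2 := Vx n 0%N (addn0 n).
 have h3 := cv_mulx (hmf n) (smf n) (hmg 0%N) (smg 0%N).
 rewrite !mx1 in h3.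
 apply: (aeS2 h3 (aeS2 h1 h2 (fun t a b => conj a b))) => t h [h' h''] tc.
 by move: h; rewrite h'// h'' ?(lt_le_trans tc)// mulr0 addr0.
have conc n : b n.+1 < b n -> b n - b n.+1 <= b n.+1 - b n.+2.
 move=> lt; rewrite leNgt; apply/negP => lt2.
 (* The three thresholds are suprema that may not be attained, so each is lowered by [e]; quarters
    keep the resulting average above [b n.+1]. *)
 pose e := Num.min ((b n - b n.+1) / 4) ((b n + b n.+2 - b n.+1 - b n.+1) / 4).
 have [e1 e2] : e <= (b n - b n.+1) / 4 /\ e <= (b n + b n.+2 - b n.+1 - b n.+1) / 4.
  by split; rewrite ge_min lexx ?orbT.
 have e0 : 0 < e by rewrite lt_min; apply/andP; split; lra.
 have bn := bT n; have bn1 := bT n.+1.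
 have m1 : Num.min (b n.+1 - e) (b n.+2 - e) <= b n.+1 - e by rewrite ge_min lexx.
 have : V n.+1 (((b n - e) + Num.min (b n.+1 - e) (b n.+2 - e)) / 2).
  apply: step; [apply: Vb; lra|apply: Vb; lra|apply: Vb; lra|lra].
 move=> /bV; have [m|m] := leP (b n.+1 - e) (b n.+2 - e).
  move=> h; have : (b n - e + (b n.+1 - e)) / 2 <= b n.+1 by apply: h; lra.
  lra.
 move=> h; have : (b n - e + (b n.+2 - e)) / 2 <= b n.+1 by apply: h; lra.
 lra.
have ball n : b n = T.
 elim: n => // n ih; apply/le_anti; rewrite bT /= leNgt; apply/negP => lt.
 have lt' : b n.+1 < b n by rewrite ih.
 pose d := b n - b n.+1; have d0 : 0 < d by rewrite subr_gt0.
 have dec k : b (n + k).+1 < b (n + k)%N /\ d <= b (n + k)%N - b (n + k).+1.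
  elim: k => [|k [h1 h2]]; first by rewrite addn0.
  rewrite addnS; have h3 := conc _ h1; split; last exact: le_trans h3.
  by rewrite -subr_gt0 (lt_le_trans d0)// (le_trans h2).
 have dec2 k : b (n + k)%N <= T - k%:R * d.
  elim: k => [|k h]; first by rewrite addn0 mul0r subr0 bT.
  have [_ h2] := dec k; rewrite addnS -natr1 mulrDl mul1r; lra.
 have [k hk] : exists k : nat, T < k%:R * d.
  exists (Num.bound (T / d)); rewrite -ltr_pdivrMr//.
  by apply: archi_boundP; rewrite divr_ge0// ltW.
 have := dec2 k; have := b0 (n + k)%N; lra.
move=> n c cT; have := Vb n c; rewrite ball => /(_ cT 0%N n (add0n n)).
by rewrite mx0.
Qed.

(** For almost every [t < T] all moments in [s] of [f (t - s) * g s] vanish, so this product is 0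
    for almost every [s]. After exchanging the variables, for each [c > 0] some [s < c] with
    [g s != 0] makes [f] vanish up to [T - c]. *)
Theorem titchmarsh (f g : R -> R) (T : R) : 0 < T -> itg f -> supp0 f T ->
 itg g -> supp0 g T -> van (cv f g) T -> (forall c, 0 < c -> ~ van g c) ->
 van f T.
move=> T0 hf sf hg sg vfg ng.
have h1 := titchmarsh_van T0 hf sf hg sg vfg.
have mf := imeas hf; have mg := imeas hg.
have key t : t < T -> cvok f g t -> (forall n, cv f (mx n g) t = 0) ->
  {ae mu, forall s, f (t - s) * g s = 0}.
 move=> tT ok hn; pose F s := f (t - s) * g s.
 have sF : supp0 F T.
  by move=> s hs; rewrite /F (sg s hs) mulr0.
 have vF : van F T.
  apply: (@exp_moments_vanish _ _ 0) => // p.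
  rewrite (_ : \int[mu]_s _ = 0) ?normr0//.
  have E : \int[mu]_s (expR (p%:R * (T - s)) * F s) =
    expR (p%:R * T) * \int[mu]_s (expR (- p%:R * s) * F s).
   rewrite -intZ; last exact: (itg_exp _ ok sF).
   by apply: eqRint => s; rewrite mulrA -expRD; congr (expR _ * _); ring.
  rewrite E; apply/eqP; rewrite mulf_eq0 expR_eq0 /=; apply/eqP.
  pose G n s := series (exp_coeff (- p%:R * s)) n * F s.
  have mG n : mfs (G n).
   apply: mfsM; last exact: imeas.
   rewrite /series /= /exp_coeff /=; apply: measurable_sum => k.
   by apply: mfsM => //; apply: measurable_funX; exact: mulrl_measurable.
  have lim : \int[mu]_s G n s @[n --> \oo] --> \int[mu]_s (expR (- p%:R * s) * F s).
   apply: (@Rdct _ _ _ (fun s => expR (p%:R * T) * `|F s|)) => //.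
   - by apply: mfsM; [exact: mfs_expRM|exact: imeas].
   - by apply: itgZ; exact: itg_norm.
   - apply: aeW => s; apply: cvgM; last exact: cvg_cst.
    exact: is_cvg_series_exp_coeff.
   - move=> n; apply: aeW => s; rewrite /G normrM.
    have [s0|s0] := ltP s 0; first by rewrite (sF s (or_introl s0)) normr0 !mulr0.
    have [sT|sT] := ltP T s; first by rewrite (sF s (or_intror sT)) normr0 !mulr0.
    rewrite ler_wpM2r//.
    apply: (@le_trans _ _ (series (exp_coeff (p%:R * s)) n)).
     rewrite /series /= (le_trans (ler_norm_sum _ _ _))// ler_sum// => k _.
     rewrite /exp_coeff /= normrM normrX mulNr normrN normfV normr_nat.
     by rewrite ger0_norm ?mulr_ge0.
    apply: (@le_trans _ _ (expR (p%:R * s))); last by rewrite ler_expR ler_wpM2l.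
    apply: nondecreasing_cvgn_le; last exact: is_cvg_series_exp_coeff.
    apply: nondecreasing_series => k _ _.
    by rewrite /exp_coeff /= mulr_ge0// exprn_ge0// mulr_ge0.
  have z n : \int[mu]_s G n s = 0.
   have ik k : itg (fun s => s ^+ k * F s) := mx_itg k ok sF.
   transitivity (\int[mu]_s (\sum_(k < n) ((- p%:R) ^+ k / k`!%:R * (s ^+ k * F s)))).
    apply: eqRint => s; rewrite /G /series /= big_mkord mulr_suml.
    apply: eq_bigr => k _; rewrite /exp_coeff /= exprMn.
    by move: (_ ^+ k) (s ^+ k) => A B; ring.
   rewrite int_sum; last by move=> k; exact: itgZ.
   apply: big1 => k _; rewrite intZ//.
   rewrite (_ : \int[mu]_s _ = 0) ?mulr0// -(hn k).
   by apply: eqRint => s; rewrite /mx /F mulrCA.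
  have lim0 : \int[mu]_s G n s @[n --> \oo] --> (0 : R).
   by under eq_fun do rewrite z; exact: cvg_cst.
  exact: (cvg_unique (@Rhausdorff R) lim lim0).
 apply: (aeS (aeS2 vF (ae_neq T) (fun s a b => conj a b))) => s [h sT].
 have [ss|ss] := ltP s T; first exact: h.
 by apply: sF; right; rewrite lt_neqAle eq_sym sT.
have key2 : {ae mu, forall t, t < T -> {ae mu, forall s, f (t - s) * g s = 0}}.
 have hn : {ae mu, forall t, forall n, t < T -> cv f (mx n g) t = 0}.
  (* Vanishing is known up to each [c < T]; countably many such [c] exhaust the half-line, so the
     exceptional sets stay null. *)
  apply: aeN => n; have [c hc] : exists c : nat -> R, forall k, c k < T /\ T - harmonic k <= c k.
   exists (fun k => T - harmonic k) => k; split => //.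
   by rewrite gtrBl /harmonic /= invr_gt0.
  apply: (aeS (aeN (fun k => h1 n _ (hc k).1))) => t h tT.
  have e0 : 0 < T - t by rewrite subr_gt0.
  have /cvgrPdist_lt /(_ _ e0) [N _ /(_ N (leqnn N))] := @cvg_harmonic R.
  rewrite sub0r normrN /= => hN; apply: (h N).
  apply: (lt_le_trans _ (hc N).2).
  by rewrite ltrBrDl -ltrBrDr; exact: le_lt_trans (ler_norm _) hN.
 apply: (aeS2 hn (cvok_ae hf hg)) => t h ok tT; apply: key => // n; exact: h.
have key3 : {ae mu, forall s, {ae mu, forall t, t < T -> f (t - s) * g s = 0}}.
 pose H (p : R * R) := (if p.1 < T then 1 else 0) * `|f (p.1 - p.2) * g p.2|.
 have ifg := cv_itg2 hf hg.
 have iH : (mu \x mu)%E.-integrable setT (EFin \o H).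
  apply: (le_integrable _ _ _ ifg) => //.
   apply/measurable_EFinP; apply: mfsM.
    apply: mfs_if => //; apply: measurable_fun_ltr => //.
   by apply: mfsT => //; exact: mfs_cv2.
  move=> [t s] _ /=; rewrite lee_fin /H /= normrM normr_id -[leRHS]mul1r ler_wpM2r//.
  by case: ifP; rewrite ?normr1 ?normr0.
 have H0 p : 0 <= H p by rewrite /H mulr_ge0//; case: ifP.
 have iz : \int[mu]_s \int[mu]_t H (t, s) = 0.
  rewrite -(Rfubini iH); transitivity (\int[mu]_(s in [set: R]) (0 : R)); last first.
   by rewrite Rintegral_cst// mul0r.
  apply: int_ae_eq => //; first exact: (imeas (Rfubini_itg1 iH)).
  apply: (aeS key2) => t h; rewrite /H /=; case: ifPn => tT; last first.
   transitivity (\int[mu]_(s in [set: R]) (0 : R)); last by rewrite Rintegral_cst// mul0r.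
   by apply: eqRint => s; rewrite mul0r.
  transitivity (\int[mu]_(s in [set: R]) (0 : R)); last by rewrite Rintegral_cst// mul0r.
  apply: int_ae_eq => //.
   apply: mfsM => //; apply: mfsT => //; apply: mfsM => //.
   exact: mfs_subl.
  by apply: (aeS (h tT)) => s ->; rewrite normr0 mulr0.
 have iH' := int2_swap iH.
 have hz := int_eq0_ae (Rfubini_itg1 iH') (fun s => int_ge0 (fun t => H0 (t, s))) iz.
 apply: (aeS2 hz (Rfubini_ae1 iH')) => s h1' h2'.
 apply: (aeS (int_eq0_ae h2' (fun t => H0 (t, s)) h1')) => t; rewrite /H /= => + tT.
 by rewrite tT mul1r => /normr0_eq0.
have fin c : 0 < c -> van f (T - c).
 move=> c0; apply: contrapT => nf; apply: (ng c c0).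
 apply: (aeS key3) => s hs sc; apply: contrapT => /eqP gs.
 apply: nf; apply: (aeS (ae_affine s (oner_neq0 _) hs)) => x /= h xT.
 move: h; rewrite mul1r addrK => /(_ _)/eqP; rewrite mulf_eq0 (negbTE gs) orbF.
 by move=> h; apply/eqP; apply: h; lra.
apply: (aeS (aeN (fun n => fin (harmonic n) (harmonic_gt0 n)))) => x h xT.
have e0 : 0 < T - x by rewrite subr_gt0.
have /cvgrPdist_lt /(_ _ e0) [N _ /(_ N (leqnn N))] := @cvg_harmonic R.
rewrite sub0r normrN /= => hN; apply: (h N).
by rewrite ltrBrDl -ltrBrDr; exact: le_lt_trans (ler_norm _) hN.
Qed.

End titchmarsh.

(** * Truncated power functions *)

Section powers.
Variable R : realType.
Notation mu := (@lebesgue_measure R).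

(** The kernel of the fractional integral of order [m] without its Gamma factor, cut to []0, b[]; a
    bound by [s^x] is therefore written with [pp (x + 1)]. *)
Definition pp (m b x : R) := if (0 < x) && (x < b) then x `^ (m - 1) else 0.

Lemma pp_ge0 m b x : 0 <= pp m b x.
Proof. by rewrite /pp; case: ifP => // _; exact: powR_ge0. Qed.

Lemma mfs_pp m b : mfs (pp m b).
apply: mfs_if => //.
by apply: measurable_and; exact: measurable_fun_ltr.
Qed.

Lemma mfs_EFin_patch (D : set R) (f : R -> R) : measurable D ->
 mfs f -> mfs ((fun x => (f x)%:E) \_ D).
move=> mD mf; have -> : (fun x => (f x)%:E) \_ D = EFin \o (f \_ D).
 by rewrite -restrict_EFin.
by apply/measurable_EFinP; exact: mfs_patch0.
Qed.

Lemma powR_prim (m x : R) : m != 0 -> 0 < x ->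
 is_derive x (1 : R) (fun x => x `^ m / m) (x `^ (m - 1)) /\ {for x, continuous (fun x => x `^ (m - 1))}.
move=> m0 x0; split; last first.
 by apply: differentiable_continuous; apply/derivable1_diffP; have [] := is_derive1_powR (m - 1) x0.
have h := is_derive1_powR m x0.
have -> : (fun x => x `^ m / m) = m^-1 *: (fun x => x `^ m) by apply/funext => y; rewrite /= mulrC.
have -> : x `^ (m - 1) = m^-1 *: (m * x `^ (m - 1)) by rewrite /GRing.scale /= mulKf.
exact: is_deriveZ.
Qed.

Lemma powR_prim_cont (m x : R) : m != 0 -> 0 < x -> {for x, continuous (fun x => x `^ m / m)}.
move=> m0 x0; apply: differentiable_continuous; apply/derivable1_diffP.
by have [[]] := powR_prim m0 x0.
Qed.

Lemma powR_antideriv (m c d : R) : m != 0 -> 0 < c -> c < d ->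
 (\int[mu]_(x in `[c, d]) (x `^ (m - 1))%:E = (d `^ m / m - c `^ m / m)%:E)%E.
move=> m0 c0 cd; have P x : c < x -> 0 < x := lt_trans c0.
rewrite (@continuous_FTC2 _ _ (fun x => x `^ m / m))// ?EFinB//.
- apply: continuous_in_subspaceT => x; rewrite inE/= in_itv/= => /andP[cx _].
 exact: (powR_prim m0 (lt_le_trans c0 cx)).2.
- split; [|by apply: cvg_at_right_filter; exact: powR_prim_cont|by apply: cvg_at_left_filter; apply: powR_prim_cont; auto].
 by move=> x; rewrite in_itv/= => /andP[/P x0 _]; have [[]] := powR_prim m0 x0.
- move=> x; rewrite in_itv/= => /andP[/P x0 _].
 by rewrite derive1E; have [[_ ->]] := powR_prim m0 x0.
Qed.
(** Monotone convergence along [[b / (i + 2), b]]: for [m < 1] the integrand is unbounded at 0, so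
    the fundamental theorem is applied away from it. *)
Lemma pp_int (m b : R) : 0 < m -> 0 < b ->
 itg (pp m b) /\ \int[mu]_x pp m b x = b `^ m / m.
move=> m0 b0; have m0' : m != 0 by rewrite gt_eqF.
pose F (i : nat) := `[b / i.+2%:R, b]%classic.
have h : (\int[mu]_x (pp m b x)%:E = (b `^ m / m)%:E)%E.
 transitivity (\int[mu]_(x in `]0%R, b]) (x `^ (m - 1))%:E)%E.
  rewrite [RHS]integral_mkcond; apply: ae_eq_integral => //.
  - by apply/measurable_EFinP; exact: mfs_pp.
  - by apply: mfs_EFin_patch => //; exact: measurable_powR.
  apply: (aeS (ae_neq b)) => x xb _; rewrite patchE /pp.
  case: ifPn => h; case: ifPn => //; rewrite ?inE ?notin_setE/= in_itv/=.
   by move: h => /andP[-> /ltW ->].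
  by move: h; rewrite (lt_neqAle x) xb /= => /negbTE ->.
 have -> : `]0, b]%classic = \bigcup_i F i.
  apply/seteqP; split => x /=; rewrite ?in_itv/=.
   move=> /andP[x0 xb]; have := archi_boundP (ltW (divr_gt0 b0 x0)).
   set n := Num.bound _ => hn; exists n => //; rewrite /F /= in_itv/= xb andbT.
   rewrite ler_pdivrMr// mulrC -ler_pdivrMr// (le_trans (ltW hn))// ler_nat.
   by rewrite ltnW// ltnS leqnSn.
  move=> [i _]; rewrite /F /= in_itv/= => /andP[h ->]; rewrite andbT.
  by rewrite (lt_le_trans _ h)// divr_gt0.
 have c1 : (\int[mu]_(x in F i) (x `^ (m - 1))%:E)%E @[i --> \oo] -->
   (\int[mu]_(x in \bigcup_i F i) (x `^ (m - 1))%:E)%E.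
  apply: ge0_nondecreasing_set_cvg_integral.
  - move=> i j ij; apply/subsetPset => x; rewrite /F /= !in_itv/= => /andP[h ->].
   by rewrite andbT (le_trans _ h)// ler_pM2l// lef_pV2 ?posrE// ler_nat ltnS.
  - by move=> i; rewrite /F; exact: measurable_itv.
  - by move=> i; apply/measurable_EFinP; apply: (measurable_funS measurableT).
  - by move=> i x _; rewrite lee_fin powR_ge0.
 have E i : (\int[mu]_(x in F i) (x `^ (m - 1))%:E =
   (b `^ m / m - (b / i.+2%:R) `^ m / m)%:E)%E.
  rewrite powR_antideriv ?divr_gt0// ltr_pdivrMr// ltr_pMr// ltr1n//.
 apply: (cvg_unique (@ereal_hausdorff R) c1).
 rewrite /=; under eq_fun do rewrite E.
 apply: cvg_EFin; first exact: nearW.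
 rewrite -[X in _ --> X]subr0; apply: cvgB; first exact: cvg_cst.
 rewrite -[X in _ --> X](mul0r m^-1); apply: cvgM; last exact: cvg_cst.
 have h0 := powR_cvg0 m0.
 apply: (cvg_comp _ _ _ h0) => /= A [e e0 hA].
 have be : 0 < e / b by rewrite divr_gt0.
 have [N _ hN] := near_infty_natSinv_lt (PosNum be).
 exists N => // n Nn /=; apply: hA.
  rewrite /= sub0r normrN gtr0_norm ?divr_gt0// mulrC -ltr_pdivlMr//.
  rewrite (le_lt_trans _ (hN n Nn))//= lef_pV2 ?posrE// ler_nat.
  exact: leqnSn.
 by rewrite divr_gt0.
have ib : itg (pp m b).
 apply/integrableP; split; first by apply/measurable_EFinP; exact: mfs_pp.
 rewrite (@eqint _ _ (fun x => (pp m b x)%:E)) ?h ?ltry//.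
 by move=> x /=; rewrite ger0_norm// pp_ge0.
by split => //; apply: EFin_inj; rewrite -intE.
Qed.

Definition pt (m c x : R) := if c < x then x `^ (- m - 1) else 0.

Lemma pt_ge0 m b x : 0 <= pt m b x.
Proof. by rewrite /pt; case: ifP => // _; exact: powR_ge0. Qed.

Lemma mfs_pt m b : mfs (pt m b).
Proof. by apply: mfs_if => //; exact: measurable_fun_ltr. Qed.

Lemma pt_int (m c : R) : 0 < m -> 0 < c ->
 itg (pt m c) /\ \int[mu]_x pt m c x = c `^ (- m) / m.
move=> m0 c0; have n0 : - m != 0 by rewrite oppr_eq0 gt_eqF.
have P x : c < x -> 0 < x := lt_trans c0.
have h : (\int[mu]_x (pt m c x)%:E = (c `^ (- m) / m)%:E)%E.
 transitivity (\int[mu]_(x in `[c, +oo[) (x `^ (- m - 1))%:E)%E.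
  rewrite [RHS]integral_mkcond; apply: ae_eq_integral => //.
  - by apply/measurable_EFinP; exact: mfs_pt.
  - by apply: mfs_EFin_patch => //; exact: measurable_powR.
  apply: (aeS (ae_neq c)) => x xb _; rewrite patchE /pt.
  case: ifPn => h; case: ifPn => //; rewrite ?inE ?notin_setE/= in_itv/= andbT.
   by rewrite ltW.
  by move: h; rewrite (lt_neqAle c) eq_sym xb /= => /negbTE ->.
 rewrite (@ge0_continuous_FTC2y _ _ (fun x => x `^ (- m) / (- m)) _ 0).
 - by rewrite sub0e -EFinN invrN mulrN opprK.
 - by move=> x _; exact: powR_ge0.
 - apply: continuous_in_subspaceT => x; rewrite inE/= in_itv/= andbT => cx.
  exact: (powR_prim n0 (lt_le_trans c0 cx)).2.
 - rewrite -[X in _ --> X](mul0r (- m)^-1); apply: cvgM; last exact: cvg_cst.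
  apply/cvgrPdist_lt => e e0; near=> x.
  have y0 : 0 < e^-1 `^ m^-1 by rewrite powR_gt0// invr_gt0.
  have yx : e^-1 `^ m^-1 < x by near: x; apply: nbhs_pinfty_gt; rewrite num_real.
  rewrite sub0r normrN ger0_norm ?powR_ge0// powRN -[ltRHS]invrK ltf_pV2 ?posrE ?invr_gt0 ?powR_gt0// ?(lt_trans y0 yx)//.
  have -> : e^-1 = (e^-1 `^ m^-1) `^ m by rewrite -powRrM mulVf ?gt_eqF// powRr1// invr_ge0 ltW.
  by apply: gt0_ltr_powR; rewrite // nnegrE ltW// (lt_trans y0).
 - by move=> x /P x0; have [[]] := powR_prim n0 x0.
 - by apply: cvg_at_right_filter; exact: powR_prim_cont.
 - move=> x; rewrite in_itv/= andbT => /P x0.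
  by rewrite derive1E; have [[_ ->]] := powR_prim n0 x0.
have ib : itg (pt m c).
 apply/integrableP; split; first by apply/measurable_EFinP; exact: mfs_pt.
 rewrite (@eqint _ _ (fun x => (pt m c x)%:E)) ?h ?ltry//.
 by move=> x /=; rewrite ger0_norm// pt_ge0.
by split => //; apply: EFin_inj; rewrite -intE.
Unshelve. all: by end_near. Qed.

Definition pe (m b x : R) := pp m b x + pp m b (- x).

Lemma pe_ge0 m b x : 0 <= pe m b x.
Proof. by rewrite addr_ge0// pp_ge0. Qed.

Lemma pe_int (m b : R) : 0 < m -> 0 < b ->
 itg (pe m b) /\ \int[mu]_x pe m b x = 2 * (b `^ m / m).
move=> m0 b0; have [i1 e1] := pp_int m0 b0.
have i2 : itg (fun x => pp m b (- x)).
 by have := itg_refl 0 i1; congr itg; apply/funext => x; rewrite sub0r.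
split; first exact: itgD.
rewrite intD// e1 -[X in _ + X](_ : \int[mu]_x pp m b (0 - x) = _); last first.
 by apply: eqRint => x; rewrite sub0r.
by rewrite int_refl// e1; ring.
Qed.

Lemma peE (m b x : R) : x != 0 -> `|x| < b -> pe m b x = `|x| `^ (m - 1).
rewrite /pe /pp oppr_gt0; have [x0|x0|->] := ltgtP x 0 => //.
 by move=> _; rewrite ltr0_norm//= add0r => ->.
by move=> _; rewrite gtr0_norm//= => ->; rewrite addr0.
Qed.

End powers.

(** * Geometrically dominated series *)

Section geometric.
Variable R : realType.
Implicit Types x z : nat -> R.

Definition ssum x : R := limn (series x).

(** Power series are used strictly inside their disc, where this one condition yields convergence,
    shifts and products; [C >= 0] follows at [n = 0]. *)
Definition geo x := exists C y : R, [/\ 0 <= y, y < 1 & forall n, `|x n| <= C * y ^+ n].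

Lemma geo_cvg x : geo x -> series x @ \oo --> ssum x.
move=> [C [y [y0 y1 h]]]; apply: normed_cvg.
apply: (@series_le_cvg _ _ (geometric C y)) => //.
- by move=> n; rewrite /=.
- by move=> n; rewrite /=; exact: le_trans (h n).
- by apply: is_cvg_geometric_series; rewrite ger0_norm.
Qed.

Lemma series_geo_le x (C y : R) n : 0 <= y -> y < 1 -> (forall n, `|x n| <= C * y ^+ n) ->
 `|series x n| <= C / (1 - y).
move=> y0 y1 h; have C0 : 0 <= C by have := h 0%N; rewrite expr0 mulr1; exact: le_trans.
have y1' : 0 < 1 - y by rewrite subr_gt0.
rewrite ler_pdivlMr//.
have H : `|series x n| * (1 - y) <= C * (1 - y ^+ n).
 elim: n => [|n ih]; first by rewrite /series /= big_nil normr0 mul0r expr0 subrr mulr0.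
 rewrite seriesSr.
 have := ler_normD (series x n) (x n); have := h n; rewrite exprS.
 have : 0 <= y ^+ n by exact: exprn_ge0.
 move: (y ^+ n) (series x n) (x n) ih => q S u ih q0 hu hs.
 nra.
rewrite (le_trans H)// -[leRHS]mulr1 ler_wpM2l// gerBl exprn_ge0//.
Qed.

Lemma ssum_bound x (C y : R) : 0 <= y -> y < 1 -> (forall n, `|x n| <= C * y ^+ n) ->
 `|ssum x| <= C / (1 - y).
move=> y0 y1 h; have hg : geo x by exists C, y.
have hl : (fun n => `|series x n|) @ \oo --> `|ssum x| by apply: cvg_norm; exact: geo_cvg.
apply: (ler_cvg_to hl (cvg_cst _)).
by apply: nearW => n; exact: series_geo_le.
Qed.

Lemma ssum_lim x (l : R) : series x @ \oo --> l -> ssum x = l.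
Proof. by move=> h; apply/cvg_lim. Qed.

Lemma geoZ (k : R) x : geo x -> geo (fun n => k * x n).
move=> [C [y [y0 y1 h]]]; exists (`|k| * C), y; split => // n.
by rewrite normrM -mulrA ler_wpM2l.
Qed.

Lemma geoD x z : geo x -> geo z -> geo (fun n => x n + z n).
move=> [C [y [y0 y1 h]]] [C' [y' [y'0 y'1 h']]]; exists (C + C'), (Num.max y y').
have C0 : 0 <= C by have := h 0%N; rewrite expr0 mulr1; exact: le_trans.
have C'0 : 0 <= C' by have := h' 0%N; rewrite expr0 mulr1; exact: le_trans.
split; first by rewrite le_max y0.
 by rewrite gt_max y1.
move=> n; rewrite (le_trans (ler_normD _ _))// mulrDl lerD//.
 by rewrite (le_trans (h n))// ler_wpM2l// lerXn2r ?nnegrE ?le_max ?y0 ?lexx.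
by rewrite (le_trans (h' n))// ler_wpM2l// lerXn2r ?nnegrE ?le_max ?y'0 ?lexx ?orbT.
Qed.

Lemma ssumZ (k : R) x : geo x -> ssum (fun n => k * x n) = k * ssum x.
move=> hx; apply: ssum_lim; have -> : series (fun n => k * x n) = fun n => k * series x n.
 by apply/funext => n; rewrite /series /= mulr_sumr.
by apply: cvgM; [exact: cvg_cst|exact: geo_cvg].
Qed.

Lemma ssumD x z : geo x -> geo z -> ssum (fun n => x n + z n) = ssum x + ssum z.
move=> hx hz; apply: ssum_lim.
have -> : series (fun n => x n + z n) = fun n => series x n + series z n.
 by apply/funext => n; rewrite /series /= big_split.
by apply: cvgD; exact: geo_cvg.
Qed.

Lemma ssumB x z : geo x -> geo z -> ssum (fun n => x n - z n) = ssum x - ssum z.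
move=> hx hz; have -> : (fun n => x n - z n) = (fun n => x n + (-1) * z n).
 by apply/funext => n; rewrite mulN1r.
by rewrite ssumD ?ssumZ ?mulN1r//; exact: geoZ.
Qed.

Lemma ssum_sum (N : nat) (x : nat -> nat -> R) : (forall j, geo (x j)) ->
 geo (fun n => \sum_(j < N) x j n) /\
 ssum (fun n => \sum_(j < N) x j n) = \sum_(j < N) ssum (x j).
move=> h; elim: N => [|N [ih1 ih2]].
 rewrite big_ord0 (_ : (fun n => \sum_(j < 0) x j n) = fun=> 0); last first.
  by apply/funext => n; rewrite big_ord0.
 split; first by exists 0, 0; split => // n; rewrite mul0r normr0.
 apply: ssum_lim; rewrite (_ : series _ = fun=> 0); first exact: cvg_cst.
 by apply/funext => n; rewrite /series /= big1.
have -> : (fun n => \sum_(j < N.+1) x j n) = fun n => \sum_(j < N) x j n + x N n.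
 by apply/funext => n; rewrite big_ord_recr.
by rewrite big_ord_recr /= -ih2 -ssumD//; split => //; exact: geoD.
Qed.

Lemma ssum_recl x : geo x -> ssum x = x 0%N + ssum (fun n => x n.+1).
move=> hx; have hx' : geo (fun n => x n.+1).
 move: hx => [C [y [y0 y1 h]]]; exists (C * y), y; split => // n.
 by rewrite (le_trans (h n.+1))// exprS mulrA.
apply: ssum_lim; rewrite -(cvg_shiftS (series x)) /=.
have -> : (fun n => series x n.+1) = fun n => x 0%N + series (fun n => x n.+1) n.
 by apply/funext => n; rewrite /series /= big_nat_recl.
by apply: cvgD; [exact: cvg_cst|exact: geo_cvg].
Qed.

End geometric.

(** * Bounds for the Taylor coefficients of powers of 1 - v *)

Section binomial_series.
Variable R : realType.
Implicit Types nu v th : R.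

(* Taylor coefficients at 0 of [(1 - v) `^ (nu - 1)]. *)
Definition bc nu (j : nat) : R := \prod_(l < j) (1 - nu / l.+1%:R).

Lemma bc0 nu : bc nu 0 = 1. Proof. by rewrite /bc big_ord0. Qed.

Lemma bcS nu j : bc nu j.+1 = bc nu j * (1 - nu / j.+1%:R).
Proof. by rewrite /bc big_ord_recr. Qed.

Lemma bc_shift nu j : bc (nu + 1) j.+1 = - (nu / j.+1%:R) * bc nu j.
elim: j => [|j ih]; first by rewrite bcS !bc0 mul1r !divr1; ring.
rewrite bcS ih (bcS nu j).
have h1 : (j.+1%:R : R) != 0 by rewrite pnatr_eq0.
have h2 : (j.+2%:R : R) != 0 by rewrite pnatr_eq0.
have h3 : j.+2%:R = j.+1%:R + 1 :> R by rewrite natr1.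
rewrite h3 in h2 *; move: (j.+1%:R : R) h1 h2 => x h1 h2.
by field; rewrite h1 h2.
Qed.

(** Coefficients in [(1 - v)^nu = (1 - v) (1 - v)^(nu-1)]. Bounds climb along this relation from a
    small order [nu0] to [nu0 + m]. *)
Lemma bc_rec nu j : bc (nu + 1) j.+1 = bc nu j.+1 - bc nu j.
Proof. by rewrite bc_shift bcS; ring. Qed.

Lemma bc_bound0 nu j : 0 < nu -> nu <= 2 -> `|bc nu j| <= 1.
move=> n0 n2; rewrite /bc normr_prod; apply: prodr_ile1 => l _; rewrite normr_ge0 /=.
have l0 : 0 < (l.+1%:R : R) by rewrite ltr0n.
have l1 : 1 <= (l.+1%:R : R) by rewrite ler1n.
have h2 : nu / l.+1%:R <= 2 by rewrite ler_pdivrMr//; lra.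
have h0 : 0 <= nu / l.+1%:R by rewrite divr_ge0 ?ltW.
move: (nu / _) h2 h0 => q h2 h0.
by rewrite ler_norml; apply/andP; split; lra.
Qed.

(** Cauchy's estimate on the circle of radius [v1]: each further factor [1 - v] costs [1 + v1]. The
    dependence on the order must be at most geometric, because the orders [m + n bt] met in a kernel
    are unbounded. *)
Lemma bc_bound (v1 nu0 : R) m j : 0 < v1 -> v1 <= 1 -> 0 < nu0 -> nu0 <= 2 ->
 `|bc (nu0 + m%:R) j| <= (1 + v1) ^+ m * v1^-1 ^+ j.
move=> v0 v1_1 n0 n2; have iv : 1 <= v1^-1 by rewrite invf_ge1.
elim: m j => [|m ih] j.
 by rewrite addr0 expr0 mul1r (le_trans (bc_bound0 _ n0 n2))// exprn_ege1.
rewrite -natr1 addrA; case: j => [|j].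
 by rewrite bc0 expr0 mulr1 normr1 exprn_ege1// lerDl ltW.
rewrite bc_rec (le_trans (ler_normB _ _))//.
have := ih j.+1; have := ih j; rewrite exprS => h1 h2.
have -> : (1 + v1) ^+ m.+1 * (v1^-1 * v1^-1 ^+ j) =
 (1 + v1) ^+ m * (v1^-1 * v1^-1 ^+ j) + (1 + v1) ^+ m * v1^-1 ^+ j.
 by rewrite exprS; field; rewrite gt_eqF.
exact: lerD.
Qed.

Lemma bc_ge0 th j : 0 < th -> th <= 1 -> 0 <= bc th j.
move=> t0 t1; apply: prodr_ge0 => l _; rewrite subr_ge0 ler_pdivrMr ?ltr0n// mul1r.
by rewrite (le_trans t1)// ler1n.
Qed.

Lemma bc_nonincr th j : 0 < th -> th <= 1 -> bc th j.+1 <= bc th j.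
move=> t0 t1; rewrite bcS -[leRHS]mulr1 ler_wpM2l ?bc_ge0// gerBl divr_ge0// ltW//.
Qed.

Lemma bc_le th i j : 0 < th -> th <= 1 -> (i <= j)%N -> bc th j <= bc th i.
move=> t0 t1; elim: j => [|j ih]; first by rewrite leqn0 => /eqP ->.
rewrite leq_eqVlt => /orP[/eqP -> //|]; rewrite ltnS => /ih.
by apply: le_trans; exact: bc_nonincr.
Qed.

Lemma bc_half th j : 0 < th -> th <= 2^-1 -> bc th j <= 2 * bc th j.+1.
move=> t0 t1; rewrite bcS mulrCA -[leLHS]mulr1 ler_wpM2l ?bc_ge0//; first by lra.
have : th / j.+1%:R <= 2^-1.
 by rewrite ler_pdivrMr ?ltr0n// (le_trans t1)// ler_pMr// ler1n.
by move: (th / _) => q hq; lra.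
Qed.

(** The coarse bound grows like [v1^(-j)]; comparison with [bc th] keeps the bound nonincreasing in
    [j]. The factor 3 per unit of order is [1 + 2], the 2 coming from [bc_half]. *)
Lemma bc_sharp (th nu0 : R) m j : 0 < th -> th <= 2^-1 -> th <= nu0 -> nu0 <= 2 - th ->
 `|bc (nu0 + m%:R) j| <= 3 ^+ m * bc th j.
move=> t0 t1 n0 n2; have t1' : th <= 1 by lra.
elim: m j => [|m ih] j.
 rewrite addr0 expr0 mul1r /bc normr_prod; apply: ler_prod => l _.
 rewrite normr_ge0 /=; have l0 : 0 < (l.+1%:R : R) by rewrite ltr0n.
 have l1 : 1 <= (l.+1%:R : R) by rewrite ler1n.
 have h1 : th / l.+1%:R <= nu0 / l.+1%:R by rewrite ler_pM2r// invr_gt0.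
 have h2 : nu0 / l.+1%:R + th / l.+1%:R <= 2.
  by rewrite -mulrDl ler_pdivrMr//; lra.
 move: (nu0 / _) (th / _) h1 h2 => p q h1 h2.
 by rewrite ler_norml; apply/andP; split; lra.
rewrite -natr1 addrA; case: j => [|j].
 by rewrite !bc0 mulr1 normr1 exprn_ege1// ler1n.
rewrite bc_rec (le_trans (ler_normB _ _))//.
have h1 := ih j.+1; have h2 := ih j; have h3 := bc_half j t0 t1.
have p0 : 0 <= 3 ^+ m :> R by rewrite exprn_ge0.
rewrite exprS; move: (3 ^+ m) (bc th j) (bc th j.+1) p0 h1 h2 h3 => p a b p0 h1 h2 h3.
nra.
Qed.

(** The sum telescopes: [th] times a summand is [bc th j - bc th j.+1]. *)
Lemma bc_sum (th : R) N : 0 < th -> th <= 1 ->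
 \sum_(j < N) bc th j / j.+1%:R <= th^-1.
move=> t0 t1; have -> : \sum_(j < N) bc th j / j.+1%:R = th^-1 * (1 - bc th N).
 elim: N => [|N ih]; first by rewrite big_ord0 bc0 subrr mulr0.
 rewrite big_ord_recr /= ih bcS; have : (N.+1%:R : R) != 0 by rewrite pnatr_eq0.
 move: (N.+1%:R : R) => x x0; field.
 by rewrite x0 gt_eqF.
have b0 := bc_ge0 N t0 t1; have i0 : 0 < th^-1 by rewrite invr_gt0.
by move: (bc th N) (th^-1) b0 i0 => u w u0 w0; nra.
Qed.

(** Uniform in [N], which the Carleman estimate relies on. As [bc th] is nonincreasing, each summand
    is at most its analogue with denominator [j.+1], taken either at [j] or at the reflected index;
    hence twice [bc_sum]. *)
Lemma bc_sum_refl (th : R) N : 0 < th -> th <= 1 ->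
 \sum_(j < N) bc th j / (N - j)%:R <= 2 * th^-1.
move=> t0 t1; rewrite mulr_natl mulr2n.
apply: (@le_trans _ _ (\sum_(j < N) (bc th j / j.+1%:R +
  bc th (rev_ord j) / (rev_ord j).+1%:R))).
 apply: ler_sum => j _; have jN : (0 < N - j)%N by rewrite subn_gt0.
 have b0 i : 0 <= bc th i / i.+1%:R :> R by rewrite divr_ge0// bc_ge0.
 have e : (rev_ord j).+1 = (N - j)%N by rewrite /= -subSn// subSS.
 have [h|h] := leqP j.+1 (N - j).
  apply: (@le_trans _ _ (bc th j / j.+1%:R)); last by rewrite lerDl.
  by rewrite ler_wpM2l ?bc_ge0// lef_pV2 ?posrE ?ltr0n// ler_nat.
 apply: (@le_trans _ _ (bc th (rev_ord j) / (rev_ord j).+1%:R)); last by rewrite lerDr.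
 rewrite e ler_wpM2r ?invr_ge0//; apply: bc_le => //=.
 by rewrite -ltnS -subSn// subSS; rewrite ltnW.
rewrite big_split /= lerD ?bc_sum//.
rewrite (reindex_inj rev_ord_inj) (eq_bigr (fun j : 'I_N => bc th j / j.+1%:R)).
 exact: bc_sum.
by move=> j _; have /(congr1 val) /= -> := rev_ordK j.
Qed.

End binomial_series.

(** * The binomial series and its remainders *)

Section binomial.
Variable R : realType.
Implicit Types nu v th : R.

Lemma powRD_pos (X a b : R) : 0 < X -> X `^ (a + b) = X `^ a * X `^ b.
Proof. by move=> X0; rewrite powRD// (gt_eqF X0) implybT. Qed.

(** Splits off an integer so that the recursion in the order starts in [[th, 3/2]], where the
    coefficients are bounded factor by factor. *)
Lemma nu_dec th nu : th <= 2^-1 -> th <= nu ->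
 exists nu0 m, [/\ nu = nu0 + m%:R, th <= nu0, nu0 <= 3 / 2 & m%:R <= Num.max nu 0].
move=> th2 thnu; have [h|h] := leP nu (3 / 2).
 by exists nu, 0%N; split; rewrite ?addr0// le_max lexx orbT.
have h0 : 0 <= nu - 2^-1 by lra.
have /andP[h1 h2] := truncn_itv h0; set m := Num.trunc _ in h1 h2.
exists (nu - m%:R), m; rewrite -[m.+1]addn1 natrD in h2; split.
- by rewrite subrK.
- by lra.
- by lra.
- by rewrite le_max; apply/orP; left; lra.
Qed.

Lemma bc_coarse (v1 nu : R) j : 0 < v1 -> v1 <= 1 -> 0 < nu ->
 `|bc nu j| <= (1 + v1) `^ nu * v1^-1 ^+ j.
move=> v0 v11 n0; have [nu0 [m [e h1 h2 h3]]] : exists nu0 m, [/\ nu = nu0 + m%:R,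
  Num.min nu 2^-1 <= nu0, nu0 <= 3 / 2 & m%:R <= Num.max nu 0].
 by apply: nu_dec; rewrite ge_min lexx ?orbT.
have n00 : 0 < nu0 by apply: lt_le_trans h1; rewrite lt_min n0 invr_gt0 ltr0n.
rewrite e (le_trans (bc_bound _ _ v0 v11 n00 _))//; first by lra.
rewrite ler_wpM2r ?exprn_ge0 ?invr_ge0 ?(ltW v0)// -powR_mulrn; last by rewrite addr_ge0// ltW.
by rewrite ler_powR ?lerDl ?lerDr // ltW.
Qed.

Lemma bc_sharp' (th nu : R) j : 0 < th -> th <= 2^-1 -> th <= nu ->
 `|bc nu j| <= 3 `^ nu * bc th j.
move=> t0 t1 n0; have [nu0 [m [e h1 h2 h3]]] := nu_dec t1 n0.
rewrite e (le_trans (bc_sharp _ _ t0 t1 h1 _))//; first by lra.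
rewrite ler_wpM2r ?bc_ge0//; first by lra.
rewrite -powR_mulrn// ler_powR ?ler1n// lerDr.
by rewrite (le_trans _ h1)// ltW.
Qed.

(** [y^N] is below each of the first [N] terms of the geometric series. *)
Lemma natmul_expr_le (y : R) N : 0 <= y -> y < 1 -> N%:R * y ^+ N <= (1 - y)^-1.
move=> y0 y1; have y1' : 0 < 1 - y by rewrite subr_gt0.
apply: (@le_trans _ _ (\sum_(k < N) y ^+ k)).
 rewrite mulr_natl -[N in _ *+ N]card_ord -sumr_const; apply: ler_sum => k _.
 by apply: ler_wiXn2l => //; rewrite ?ltW// ltnW.
rewrite -[leRHS]mul1r ler_pdivlMr// mulrC.
have -> : (1 - y) * (\sum_(k < N) y ^+ k) = 1 - y ^+ N.
 by rewrite -[in RHS](expr1n _ N) subrXX; congr *%R; apply: eq_bigr => i _; rewrite expr1n mul1r.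
by rewrite gerBl exprn_ge0.
Qed.

Definition bsum nu (N : nat) v : R := \sum_(j < N) bc nu j * v ^+ j.

Lemma bsum_deriv nu N v : is_derive v 1 (bsum nu N) (\sum_(j < N) bc nu j * (v ^+ j.-1 *+ j)).
rewrite /bsum; elim: N => [|N ih].
 rewrite (_ : (fun v => _) = cst 0); last by apply/funext => x; rewrite big_ord0.
 by rewrite big_ord0; exact: is_derive_cst.
rewrite (_ : (fun v => _) = (fun v => \sum_(j < N) bc nu j * v ^+ j) \+ (bc nu N \*: (fun v => v ^+ N))); last first.
 by apply/funext => x; rewrite big_ord_recr.
rewrite big_ord_recr /=; apply: is_deriveD.
apply: is_deriveZ.
have h := @is_deriveX R _ id N v 1 1 (is_derive_id _ _).
have -> : (fun v : R => v ^+ N) = id ^+ N by apply/funext => x; rewrite fctE.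
by apply: (is_derive_eq h); rewrite /GRing.scale /= mulr1 mulr_natl.
Qed.

(** [(1 - v)^(nu-1)] solves [(1 - v) y' = (1 - nu) y]; a partial sum of its series solves it up to a
    single term. *)
Lemma bsum_ode nu N v : (1 - v) * (\sum_(j < N) bc nu j * (v ^+ j.-1 *+ j)) -
 (1 - nu) * bsum nu N v = - (N%:R * bc nu N * v ^+ N.-1).
rewrite /bsum; elim: N => [|N ih]; first by rewrite !big_ord0; ring.
rewrite !big_ord_recr /= !mulrDr opprD addrACA ih bcS -natr1.
have : (N.+1%:R : R) != 0 by rewrite pnatr_eq0.
case: N {ih} => [|N] h /=.
 by rewrite !bc0 !mulr0n !expr0 !add0r ?divr1; ring.
rewrite -(mulr_natr (v ^+ N)) exprS; move: h; rewrite -[N.+2]addn1 natrD.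
by move: (N.+1%:R : R) => x h; field.
Qed.

Lemma oneB_deriv (a v : R) : v < 1 ->
 is_derive v 1 (fun v => (1 - v) `^ a) (- (a * (1 - v) `^ (a - 1))).
move=> v1; have h : 0 < 1 - v by rewrite subr_gt0.
have h1 := is_derive1_powR a h.
have h2 : is_derive v 1 (fun v => 1 - v) (-1).
 have := is_deriveB (is_derive_cst (1 : R^o) (v : R^o) 1) (is_derive_id (v : R^o) 1).
 by rewrite sub0r.
have := @is_derive1_comp R (fun x => x `^ a) (fun v => 1 - v) v _ _ h1 h2.
by rewrite mulrN1.
Qed.

(** Multiplied by [(1 - x)^(1-nu)], the partial sum has value 1 at 0 and, by [bsum_ode], a
    derivative consisting of one term; the mean value theorem on [[0, v]] bounds its distance from
    1. *)
Lemma binom_rem_le (v1 nu v : R) N : 0 < v1 -> v1 < 1 -> 0 <= v -> v < v1 -> 0 < nu ->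
 `|(1 - v) `^ (nu - 1) - bsum nu N.+1 v| <=
  ((1 - v) `^ (nu - 1) * (1 - v) `^ (- nu) * (1 + v1) `^ nu) * (N.+1%:R * (v / v1) ^+ N.+1).
move=> v10 v11 v0 vv1 n0; have vlt1 : v < 1 := lt_trans vv1 v11.
have iv0 : 0 < v1^-1 by rewrite invr_gt0.
have rhs0 : 0 <= ((1 - v) `^ (nu - 1) * (1 - v) `^ (- nu) * (1 + v1) `^ nu) * (N.+1%:R * (v / v1) ^+ N.+1).
 by rewrite !mulr_ge0 ?powR_ge0// exprn_ge0// divr_ge0// ltW.
move: v0; rewrite le_eqVlt => /predU1P[v0|v0].
 have -> : (1 - v) `^ (nu - 1) - bsum nu N.+1 v = 0; last by rewrite normr0.
 apply/eqP; rewrite subr_eq0 eq_sym -v0 subr0 powR1; apply/eqP.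
 rewrite /bsum big_ord_recl bc0 expr0 mulr1 big1 ?addr0// => i _.
 by rewrite expr0n mulr0.
pose F x := (1 - x) `^ (1 - nu) * bsum nu N.+1 x.
have dF (x : R) : x < 1 -> is_derive x 1 F (- (N.+1%:R * bc nu N.+1 * x ^+ N) * (1 - x) `^ (- nu)).
 move=> x1; have h0 : 0 < 1 - x by rewrite subr_gt0.
 have := is_deriveM (oneB_deriv (1 - nu) x1) (bsum_deriv nu N.+1 x).
 move=> h; apply: (is_derive_eq h); rewrite -bsum_ode /GRing.scale /=.
 have -> : (1 - x) `^ (1 - nu) = (1 - x) * (1 - x) `^ (- nu).
  by rewrite powRD_pos// powRr1// ltW.
 have -> : 1 - nu - 1 = - nu by ring.
 by ring.
have [xi] : exists2 xi, xi \in `]0, v[%R & F v - F 0 =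
  (- (N.+1%:R * bc nu N.+1 * xi ^+ N) * (1 - xi) `^ (- nu)) * (v - 0).
 apply: MVT => //.
  by move=> x; rewrite in_itv/= => /andP[_ xv]; apply: dF; exact: lt_trans vlt1.
 apply: derivable_within_continuous => x; rewrite in_itv/= => /andP[_ xv].
 by have [] := dF x (le_lt_trans xv vlt1).
rewrite in_itv/= => /andP[xi0 xiv] E.
have F0 : F 0 = 1.
 rewrite /F subr0 powR1 mul1r /bsum big_ord_recl bc0 expr0 mulr1 big1 ?addr0// => i _.
 by rewrite expr0n mulr0.
have w0 : 0 < 1 - v by rewrite subr_gt0.
have Fv : bsum nu N.+1 v = (1 - v) `^ (nu - 1) * F v.
 by rewrite /F mulrA -powRD_pos// (_ : nu - 1 + (1 - nu) = 0) ?powRr0 ?mul1r//; ring.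
have -> : (1 - v) `^ (nu - 1) - bsum nu N.+1 v = (1 - v) `^ (nu - 1) *
  (N.+1%:R * bc nu N.+1 * xi ^+ N * (1 - xi) `^ (- nu) * v).
 rewrite Fv; move: E; rewrite F0 subr0 => E.
 have -> : F v = 1 - N.+1%:R * bc nu N.+1 * xi ^+ N * (1 - xi) `^ (- nu) * v.
  by move: E; rewrite -!mulNr; move: (_ * v) => q <-; ring.
 by ring.
rewrite normrM ger0_norm ?powR_ge0// -!mulrA ler_wpM2l ?powR_ge0//.
rewrite !normrM (ger0_norm (powR_ge0 _ _)) (ger0_norm (ler0n _ _)) (gtr0_norm v0).
rewrite (ger0_norm (exprn_ge0 _ (ltW xi0))).
have h1 := bc_coarse N.+1 v10 (ltW v11) n0.
have h2 : (1 - xi) `^ (- nu) <= (1 - v) `^ (- nu).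
 rewrite !powRN lef_pV2 ?posrE ?powR_gt0//; last by rewrite subr_gt0 (lt_trans xiv).
 rewrite ge0_ler_powR ?nnegrE ?(ltW n0) ?(ltW w0)// ?lerD2l ?lerN2 ?(ltW xiv)//.
 by rewrite subr_ge0 (le_trans (ltW xiv))// ltW.
have h3 : xi ^+ N * v <= v ^+ N.+1.
 rewrite exprSr ler_wpM2r ?(ltW v0)// lerXn2r ?nnegrE ?(ltW xi0) ?(ltW v0) ?(ltW xiv)//.
have -> : N.+1%:R * (`|bc nu N.+1| * (xi ^+ N * ((1 - xi) `^ (- nu) * v))) =
  N.+1%:R * ((1 - xi) `^ (- nu) * (`|bc nu N.+1| * (xi ^+ N * v))) by ring.
have -> : (1 - v) `^ (- nu) * ((1 + v1) `^ nu * (N.+1%:R * (v / v1) ^+ N.+1)) =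
  N.+1%:R * ((1 - v) `^ (- nu) * ((1 + v1) `^ nu * v1^-1 ^+ N.+1 * v ^+ N.+1)).
 by rewrite expr_div_n exprVn; ring.
rewrite ler_wpM2l// ler_pM ?powR_ge0 ?mulr_ge0 ?exprn_ge0 ?(ltW xi0) ?(ltW v0)//.
by rewrite ler_pM// ?mulr_ge0 ?exprn_ge0 ?(ltW xi0) ?(ltW v0).
Qed.

Lemma geo_bc nu v : 0 < nu -> 0 <= v -> v < 1 -> geo (fun j => bc nu j * v ^+ j).
move=> n0 v0 v1; set w := (1 + v) / 2; have w0 : 0 < w by rewrite /w; lra.
have w1 : w < 1 by rewrite /w; lra.
have vw : v < w by rewrite /w; lra.
exists ((1 + w) `^ nu), (v / w); split; first by rewrite divr_ge0 ?(ltW w0).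
 by rewrite ltr_pdivrMr// mul1r.
move=> j; rewrite normrM (ger0_norm (exprn_ge0 _ v0)) expr_div_n -exprVn mulrCA mulrC.
by rewrite ler_wpM2l ?exprn_ge0//; apply: bc_coarse => //; exact: ltW.
Qed.

Lemma binom_series nu v : 0 < nu -> 0 <= v -> v < 1 ->
 ssum (fun j => bc nu j * v ^+ j) = (1 - v) `^ (nu - 1).
move=> n0 v0 v1; apply: ssum_lim.
set w := (1 + v) / 2; have w0 : 0 < w by rewrite /w; lra.
have w1 : w < 1 by rewrite /w; lra.
have vw : v < w by rewrite /w; lra.
(* The ratio [v / u < 1] is reserved to absorb the factor [N + 1], and [u / w < 1] to give
   convergence. *)
set u := (w + v) / 2; have u0 : 0 < u by rewrite /u; lra.
have uw : u < w by rewrite /u; lra.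
have vu : v < u by rewrite /u; lra.
set D := ((1 - v) `^ (nu - 1) * (1 - v) `^ (- nu) * (1 + w) `^ nu).
have D0 : 0 <= D by rewrite /D !mulr_ge0// powR_ge0.
rewrite -(cvg_shiftS (series _)) /=.
apply: (@cvg_dist_dom _ _ (fun N => (D * (1 - v / u)^-1) * (u / w) ^+ N.+1)).
 move=> N; rewrite distrC.
 have -> : series (fun j => bc nu j * v ^+ j) N.+1 = bsum nu N.+1 v.
  by rewrite /series /= /bsum big_mkord.
 rewrite (le_trans (binom_rem_le _ w0 w1 v0 vw n0))// -/D -mulrA ler_wpM2l//.
 have -> : v / w = (v / u) * (u / w) by field; rewrite !gt_eqF.
 have h0 : 0 <= u / w by apply: divr_ge0; exact: ltW.
 rewrite (exprMn _ (v / u)) mulrA; apply: ler_wpM2r; first exact: exprn_ge0.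
 apply: natmul_expr_le; first by rewrite divr_ge0 // ltW.
 by rewrite ltr_pdivrMr// mul1r.
rewrite -(mulr0 (D * (1 - v / u)^-1)); apply: cvgM; first exact: cvg_cst.
rewrite (cvg_shiftS (fun n => (u / w) ^+ n)).
apply: cvg_expr; rewrite ger0_norm; last by rewrite divr_ge0 // ltW.
by rewrite ltr_pdivrMr// mul1r.
Qed.

Definition rem nu N v := (1 - v) `^ (nu - 1) - bsum nu N v.

Lemma ssum_tail (x : nat -> R) N : geo x ->
 ssum x - \sum_(j < N) x j = ssum (fun n => x (n + N)%N) /\ geo (fun n => x (n + N)%N).
move=> hx; elim: N => [|N [ih1 ih2]].
 by rewrite big_ord0 subr0; have -> : (fun n => x (n + 0)%N) = x by apply/funext => n; rewrite addn0.
have E n : x (n + N.+1)%N = x (n.+1 + N)%N by rewrite addnS addSn.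
split; last first.
 move: ih2 => [C [y [y0 y1 h]]]; exists (C * y), y; split => // n.
 by rewrite E (le_trans (h n.+1))// exprS mulrA.
rewrite big_ord_recr /= opprD addrA ih1 (ssum_recl ih2) add0n addrC addKr.
by congr ssum; apply/funext => n; rewrite E.
Qed.

Lemma rem_tail nu N v : 0 < nu -> 0 <= v -> v < 1 ->
 rem nu N v = ssum (fun j => bc nu (j + N) * v ^+ (j + N)).
move=> n0 v0 v1; have [h _] := ssum_tail N (geo_bc n0 v0 v1).
by rewrite -h binom_series.
Qed.

Lemma rem_coarse (v1 nu v : R) N : 0 < v1 -> v1 <= 1 -> 0 <= v -> v <= v1 / 2 -> 0 < nu ->
 `|rem nu N v| <= 2 * (1 + v1) `^ nu * (v / v1) ^+ N.
move=> v10 v11 v0 vv n0; have vl : v < 1 by lra.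
have q0 : 0 <= v / v1 by rewrite divr_ge0 // ltW.
have q1 : v / v1 <= 2^-1 by rewrite ler_pdivrMr// mulrC.
rewrite rem_tail//.
apply: (le_trans (@ssum_bound _ _ ((1 + v1) `^ nu * (v / v1) ^+ N) (v / v1) q0 _ _)).
- by lra.
- move=> n; rewrite -mulrA -exprD normrM (ger0_norm (exprn_ge0 _ v0)) expr_div_n -exprVn.
 rewrite addnC mulrA [leRHS]mulrAC ler_wpM2r ?exprn_ge0//; exact: bc_coarse.
rewrite -[leRHS]mulrA [leRHS]mulrC ler_wpM2l ?mulr_ge0 ?powR_ge0 ?exprn_ge0//.
by rewrite -[leRHS]invrK lef_pV2 ?posrE//; lra.
Qed.

Lemma ssum_le (x z : nat -> R) : geo x -> geo z -> (forall n, x n <= z n) -> ssum x <= ssum z.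
move=> hx hz h; apply: (ler_cvg_to (geo_cvg hx) (geo_cvg hz)).
by apply: nearW => n; apply: ler_sum.
Qed.

Lemma ssum_norm_le (x z : nat -> R) : geo x -> geo z -> (forall n, `|x n| <= z n) -> `|ssum x| <= ssum z.
move=> hx hz h; rewrite ler_norml; apply/andP; split.
 rewrite -mulN1r -ssumZ//; apply: ssum_le => //; first exact: geoZ.
 by move=> n; rewrite mulN1r; have := h n; rewrite ler_norml => /andP[].
by apply: ssum_le => // n; exact: le_trans (ler_norm _) (h n).
Qed.

(** Since [bc th (n + N) <= bc th n], the tail is dominated by [v^N] times the full comparison
    series, whose sum is [(1 - v)^(th-1)]. *)
Lemma rem_sharp (th nu v : R) N : 0 < th -> th <= 2^-1 -> th <= nu -> 0 <= v -> v < 1 ->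
 `|rem nu N v| <= 3 `^ nu * v ^+ N * (1 - v) `^ (th - 1).
move=> t0 t1 tn v0 v1; have n0 : 0 < nu by exact: lt_le_trans tn.
have t1' : th <= 1 by lra.
rewrite rem_tail// -binom_series// -ssumZ//; last exact: geo_bc.
have [_ g] := ssum_tail N (geo_bc n0 v0 v1).
apply: ssum_norm_le => //; first by apply: geoZ; exact: geo_bc.
move=> n; rewrite normrM (ger0_norm (exprn_ge0 _ v0)) exprD.
have h := bc_sharp' (n + N) t0 t1 tn.
have h2 := bc_le t0 t1' (leq_addr N n).
rewrite [v ^+ n * _]mulrC !mulrA ler_wpM2r ?exprn_ge0// [leRHS]mulrAC ler_wpM2r ?exprn_ge0//.
by rewrite (le_trans h)// ler_wpM2l ?powR_ge0.
Qed.

End binomial.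

(** * Fractional power series kernels and their expansion in t / s *)

Section kernels.
Variable R : realType.
Notation mu := (@lebesgue_measure R).
Implicit Types (e : nat -> R) (m bt T L C : R).

(** Cauchy's inequalities in the variable [s^bt]: the series with terms [e_n s^(n bt)] is
    geometrically dominated for [s < L]. *)
Definition coefbd e L bt C := forall n, `|e n| * L `^ (n%:R * bt) <= C.

(* [e_n x_n s^(m-1+n bt)] is dominated by a geometric series as soon as [x_n]
  grows at most like [X ^ (m + n bt)] with [X s < L]. *)
Lemma ker_term_le e L bt C m (X s r D x : R) n : coefbd e L bt C -> 0 < L -> 0 < bt ->
 0 < X -> 0 < s -> s <= r -> `|x| <= X `^ (m + n%:R * bt) * D ->
 `|e n * s `^ (m + n%:R * bt - 1) * x| <=
   (C * X `^ m * D * s `^ (m - 1)) * ((X * r / L) `^ bt) ^+ n.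
move=> he L0 b0 X0 s0 sr hx; have r0 : 0 < r by exact: lt_le_trans sr.
have nb0 : 0 <= n%:R * bt by rewrite mulr_ge0// ltW.
have D0 : 0 <= D.
 have := le_trans (normr_ge0 _) hx; rewrite pmulr_rge0//; exact: powR_gt0.
rewrite !normrM (ger0_norm (powR_ge0 _ _)).
apply: (@le_trans _ _ (`|e n| * s `^ (m + n%:R * bt - 1) * (X `^ (m + n%:R * bt) * D))).
 by rewrite ler_wpM2l// mulr_ge0// powR_ge0.
have -> : m + n%:R * bt - 1 = (m - 1) + n%:R * bt by ring.
rewrite (powRD_pos (m - 1))// (powRD_pos m (n%:R * bt))// -powR_mulrn ?powR_ge0// -powRrM [bt * _]mulrC.
rewrite powRM ?mulr_ge0 ?invr_ge0 ?(ltW L0) ?(ltW X0) ?(ltW r0)//.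
rewrite powRM ?(ltW X0) ?(ltW r0)//.
have -> : L^-1 `^ (n%:R * bt) = (L `^ (n%:R * bt))^-1.
 by rewrite -powR_inv1 ?(ltW L0)// -powRrM mulN1r powRN.
have h1 := he n; have L1 : 0 < L `^ (n%:R * bt) by exact: powR_gt0.
have h2 : s `^ (n%:R * bt) <= r `^ (n%:R * bt).
 by rewrite ge0_ler_powR ?nnegrE ?(ltW s0) ?(ltW r0).
have E0 : 0 <= `|e n| by [].
rewrite -ler_pdivlMr in h1; last by [].
have p1 := powR_ge0 s (m - 1); have p2 := powR_ge0 X m.
have p3 := powR_ge0 X (n%:R * bt); have p4 := powR_ge0 s (n%:R * bt).
move: (`|e n|) (s `^ (n%:R * bt)) (r `^ (n%:R * bt)) (L `^ (n%:R * bt)) (X `^ m) (X `^ (n%:R * bt)) (s `^ (m - 1)) h1 L1 h2 E0 p1 p2 p3 p4.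
move=> E S Rn l Xm Xn sm h1 L1 h2 E0 p1 p2 p3 p4.
have -> : E * (sm * S) * (Xm * Xn * D) = (E * S) * (sm * Xm * Xn * D) by ring.
have -> : C * Xm * D * sm * (Xn * Rn * l^-1) = (C / l * Rn) * (sm * Xm * Xn * D) by ring.
by rewrite ler_wpM2r ?mulr_ge0// ler_pM.
Qed.

Lemma ratio_lt1 (X r L bt : R) : 0 < L -> 0 < bt -> 0 < X -> 0 < r -> X * r < L ->
 0 <= (X * r / L) `^ bt /\ (X * r / L) `^ bt < 1.
move=> L0 b0 X0 r0 h; split; first exact: powR_ge0.
have e1 : (1 : R) `^ bt = 1 by rewrite powR1.
rewrite -[X in _ < X]e1 gt0_ltr_powR// ?nnegrE ?divr_ge0 ?mulr_ge0// ?(ltW L0) ?(ltW X0) ?(ltW r0)//.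
by rewrite ltr_pdivrMr// mul1r.
Qed.

Definition kt e m bt T (n : nat) (s : R) : R := e n * pp (m + n%:R * bt) T s.

Lemma mfs_kt e m bt T n : mfs (kt e m bt T n).
Proof. by apply: mfsM => //; exact: mfs_pp. Qed.

Lemma mfs_ssum (x : nat -> R -> R) : (forall n, mfs (x n)) ->
 (forall s, geo (x ^~ s)) -> mfs (fun s => ssum (x ^~ s)).
move=> mx hx; apply: (@measurable_fun_cvg _ _ _ setT (fun n s => series (x ^~ s) n)) => //.
- by move=> n; apply: measurable_sum => i; exact: mx.
- by move=> s _; exact: geo_cvg.
Qed.

Section fixed_kernel.
Variables (e : nat -> R) (L bt C m T : R).
Hypotheses (he : coefbd e L bt C) (L0 : 0 < L) (b0 : 0 < bt) (T0 : 0 < T) (m0 : 0 < m).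

(** The multiplier sequence [x] lets one estimate cover the kernel itself ([x = 1]), its expansion
    coefficients and its remainders. *)
Definition kx (x : nat -> R) s : R := ssum (fun n => kt e m bt T n s * x n).

Lemma kx_term (X r D : R) (x : nat -> R) s n : 0 < X -> r <= T -> s <= r ->
 `|x n| <= X `^ (m + n%:R * bt) * D ->
 `|kt e m bt T n s * x n| <= (C * X `^ m * D * pp m T s) * ((X * r / L) `^ bt) ^+ n.
move=> X0 rT sr hx; rewrite /kt /pp.
case: ifPn => [/andP[s0 sT]|_]; first exact: ker_term_le.
by rewrite !(mulr0, mul0r) normr0.
Qed.

Lemma kx_geo (X D : R) (x : nat -> R) s : 0 < X -> X * T < L ->
 (forall n, `|x n| <= X `^ (m + n%:R * bt) * D) -> geo (fun n => kt e m bt T n s * x n).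
move=> X0 XT hx; have [h1 h2] := ratio_lt1 L0 b0 X0 T0 XT.
exists (C * X `^ m * D * pp m T s), ((X * T / L) `^ bt); split => // n.
have [sT|sT] := leP s T; first exact: kx_term.
rewrite /kt /pp; case: ifPn => [/andP[_ h]|_]; first by have := lt_trans h sT; rewrite ltxx.
by rewrite !(mulr0, mul0r) normr0.
Qed.

Lemma kx_bound (X r D : R) (x : nat -> R) s : 0 < X -> 0 < r -> X * r < L -> r <= T -> s <= r ->
 (forall n, `|x n| <= X `^ (m + n%:R * bt) * D) ->
 `|kx x s| <= (C * X `^ m / (1 - (X * r / L) `^ bt)) * D * pp m T s.
move=> X0 r0 Xr rT sr hx; have [h1 h2] := ratio_lt1 L0 b0 X0 r0 Xr.
apply: (le_trans (ssum_bound h1 h2 _)); first by move=> n; exact: kx_term.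
by rewrite le_eqVlt; apply/orP; left; apply/eqP; ring.
Qed.

Lemma mfs_kx (X D : R) (x : nat -> R) : 0 < X -> X * T < L ->
 (forall n, `|x n| <= X `^ (m + n%:R * bt) * D) -> mfs (kx x).
move=> X0 XT hx; apply: (@mfs_ssum (fun n s => kt e m bt T n s * x n)).
 by move=> n; apply: mfsM => //; exact: mfs_kt.
by move=> s; exact: kx_geo hx.
Qed.

Definition ker s := kx (fun=> 1) s.

Lemma one_bd n : `|1 : R| <= 1 `^ (m + n%:R * bt) * 1.
Proof. by rewrite powR1 mulr1 normr1. Qed.

Hypothesis TL : T < L.

Let TL1 : 1 * T < L. Proof. by rewrite mul1r. Qed.

Definition kC : R := C / (1 - (T / L) `^ bt).

Lemma ker_bound s : `|ker s| <= kC * pp m T s.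
have [sT|sT] := leP s T.
 apply: (le_trans (kx_bound ltr01 T0 TL1 (lexx _) sT one_bd)).
 by rewrite powR1 !mulr1 mul1r.
have p0 : pp m T s = 0 by rewrite /pp; case: ifPn => // /andP[_ h]; have := lt_trans h sT; rewrite ltxx.
rewrite p0 mulr0 /ker /kx (_ : (fun n => _) = fun=> 0); last first.
 apply/funext => n; rewrite /kt /pp; case: ifPn; rewrite ?mulr0 ?mul0r// => /andP[_ h].
 by have := lt_trans h sT; rewrite ltxx.
by rewrite (@ssum_lim _ _ 0) ?normr0//; rewrite (_ : series _ = fun=> 0); [exact: cvg_cst|
 apply/funext => n; rewrite /series /= big1].
Qed.

Lemma mfs_ker : mfs ker.
Proof. exact: mfs_kx one_bd. Qed.

Lemma kC_ge0 : 0 <= kC.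
have [h1 h2] := ratio_lt1 L0 b0 ltr01 T0 TL1; rewrite mul1r in h1 h2.
rewrite divr_ge0 ?subr_ge0 ?(ltW h2)//.
by have := he 0; apply: le_trans; rewrite mulr_ge0// powR_ge0.
Qed.

Lemma itg_ker : itg ker.
apply: (itg_dom mfs_ker ker_bound); apply: itgZ.
by have [] := pp_int m0 T0.
Qed.

(** Coefficient of [(t / s)^j] in [ker (s - t)]: each power [(s - t)^(nu-1)] is written as
    [s^(nu-1) (1 - t / s)^(nu-1)], expanded, and regrouped over [n]; [rm] collects the remainders in
    the same way. *)
Definition cs (j : nat) s := kx (fun n => bc (m + n%:R * bt) j) s.
Definition rm (N : nat) v s := kx (fun n => rem (m + n%:R * bt) N v) s.

Let nu0 n : 0 < m + n%:R * bt.
Proof. by rewrite ltr_wpDr// mulr_ge0// ltW. Qed.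

Section coarse.
Variable v1 : R.
Hypotheses (v0 : 0 < v1) (v11 : v1 <= 1) (v1L : (1 + v1) * T < L).

(** The factor 2 comes from summing the remainder at a ratio at most 1/2; one constant then serves
    coefficients and remainders. *)
Definition kC1 : R := 2 * (C * (1 + v1) `^ m / (1 - ((1 + v1) * T / L) `^ bt)).

Lemma kC1_ge0 : 0 <= kC1.
have X0 : 0 < 1 + v1 by rewrite addr_gt0.
have [h1 h2] := ratio_lt1 L0 b0 X0 T0 v1L.
rewrite mulr_ge0// divr_ge0 ?subr_ge0 ?(ltW h2)// mulr_ge0 ?powR_ge0//.
by have := he 0; apply: le_trans; rewrite mulr_ge0// powR_ge0.
Qed.

Lemma cs_coarse j s : s <= T -> `|cs j s| <= kC1 * v1^-1 ^+ j * pp m T s.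
move=> sT; have X0 : 0 < 1 + v1 by rewrite addr_gt0.
apply: (le_trans (@kx_bound (1 + v1) T (v1^-1 ^+ j) _ s X0 T0 v1L (lexx _) sT _)).
 by move=> n; exact: bc_coarse.
rewrite ler_wpM2r ?pp_ge0// ler_wpM2r ?exprn_ge0 ?invr_ge0 ?(ltW v0)//.
have := kC1_ge0; rewrite /kC1; lra.
Qed.

Lemma mfs_cs j : mfs (cs j).
have X0 : 0 < 1 + v1 by rewrite addr_gt0.
apply: (@mfs_kx (1 + v1) (v1^-1 ^+ j)) => // n; exact: bc_coarse.
Qed.

Lemma rm_coarse N v s : s <= T -> 0 <= v -> v <= v1 / 2 ->
 `|rm N v s| <= kC1 * (v / v1) ^+ N * pp m T s.
move=> sT v00 vv; have X0 : 0 < 1 + v1 by rewrite addr_gt0.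
apply: (le_trans (@kx_bound (1 + v1) T (2 * (v / v1) ^+ N) _ s X0 T0 v1L (lexx _) sT _)).
 move=> n; apply: (le_trans (rem_coarse _ v0 v11 v00 vv (nu0 _))).
 by rewrite le_eqVlt; apply/orP; left; apply/eqP; ring.
by rewrite /kC1 le_eqVlt; apply/orP; left; apply/eqP; ring.
Qed.

Lemma ker_taylor N (t s : R) : 0 <= t -> t < s -> s < T ->
 ker (s - t) = \sum_(j < N) cs j s * (t / s) ^+ j + rm N (t / s) s.
move=> t0 ts sT; have s0 : 0 < s by exact: le_lt_trans ts.
have X0 : 0 < 1 + v1 by rewrite addr_gt0.
have v0' : 0 <= t / s by rewrite divr_ge0// ltW.
have v1' : t / s < 1 by rewrite ltr_pdivrMr// mul1r.
have gj j : geo (fun n => kt e m bt T n s * bc (m + n%:R * bt) j).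
 by apply: (@kx_geo (1 + v1) (v1^-1 ^+ j)) => // n; exact: bc_coarse.
have gj' (j : nat) : geo (fun n => (t / s) ^+ j * (kt e m bt T n s * bc (m + n%:R * bt) j)).
 exact: geoZ.
have gk : geo (fun n => kt e m bt T n (s - t) * 1) by apply: (@kx_geo 1 1) => //; exact: one_bd.
have [h1 h2] := ssum_sum N gj'.
have E n : kt e m bt T n s * rem (m + n%:R * bt) N (t / s) = kt e m bt T n (s - t) * 1 -
  \sum_(j < N) (t / s) ^+ j * (kt e m bt T n s * bc (m + n%:R * bt) j).
 rewrite /rem mulrBr; congr (_ - _); last first.
  by rewrite /bsum mulr_sumr; apply: eq_bigr => j _; ring.
 rewrite mulr1 /kt /pp s0 sT subr_gt0 ts (le_lt_trans _ sT) /=; last by rewrite gerBl.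
 rewrite -mulrA; congr (_ * _); have -> : 1 - t / s = (s - t) / s by field; rewrite gt_eqF.
 rewrite powRM ?invr_ge0 ?subr_ge0 ?(ltW ts) ?(ltW s0)//.
 rewrite mulrCA -powRM ?invr_ge0 ?(ltW s0)// divff ?gt_eqF// powR1 mulr1//.
rewrite /rm /kx (funext E) ssumB// h2 /ker /kx [RHS]addrC.
rewrite [X in _ - X + _](_ : _ = \sum_(j < N) cs j s * (t / s) ^+ j) ?subrK//.
by apply: eq_bigr => j _; rewrite ssumZ// mulrC.
Qed.

End coarse.

Section sharp.
Variables th r : R.
Hypotheses (t0 : 0 < th) (t1 : th <= 2^-1) (tm : th <= m) (r0 : 0 < r) (rL : 3 * r < L) (rT : r <= T).

(** The base 3 of [bc_sharp'] asks for [3 r < L], so the sharp bounds hold near 0 only; this makes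
    the Carleman estimate a local one. *)
Definition kC2 : R := C * 3 `^ m / (1 - (3 * r / L) `^ bt).

Lemma kC2_ge0 : 0 <= kC2.
have X0 : 0 < 3 :> R by lra.
have [h1 h2] := ratio_lt1 L0 b0 X0 r0 rL.
rewrite divr_ge0 ?subr_ge0 ?(ltW h2)// mulr_ge0 ?powR_ge0//.
by have := he 0; apply: le_trans; rewrite mulr_ge0// powR_ge0.
Qed.

Let thnu n : th <= m + n%:R * bt.
Proof. by rewrite (le_trans tm)// lerDl mulr_ge0// ltW. Qed.

Lemma cs_sharp j s : s <= r -> `|cs j s| <= kC2 * bc th j * pp m T s.
move=> sr; have X0 : 0 < 3 :> R by lra.
by apply: (@kx_bound 3 r) => // n; exact: bc_sharp'.
Qed.

Lemma rm_sharp N v s : s <= r -> 0 <= v -> v < 1 ->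
 `|rm N v s| <= kC2 * (v ^+ N * (1 - v) `^ (th - 1)) * pp m T s.
move=> sr v00 v1; have X0 : 0 < 3 :> R by lra.
apply: (@kx_bound 3 r) => // n; rewrite mulrA; exact: rem_sharp.
Qed.

End sharp.
End fixed_kernel.
End kernels.

(** * Cauchy products of series *)

Section cauchy_product.
Variable R : realType.
Implicit Types x z : nat -> R.

Lemma eqle (x y : R) : x = y -> x <= y. Proof. by move=> ->. Qed.

Definition cprod x z n : R := \sum_(i < n.+1) x i * z (n - i)%N.

Lemma cprod_partial x z N :
 series (cprod x z) N = \sum_(i < N) x i * \sum_(j < N - i) z j.
elim: N => [|N ih]; first by rewrite /series /= big_nil big_ord0.
rewrite seriesSr ih big_ord_recr /= subSnn big_ord_recl big_ord0 addr0.
rewrite /cprod big_ord_recr /= subnn addrA; congr (_ + _).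
rewrite -big_split /=; apply: eq_bigr => i _.
by rewrite subSn ?(ltnW (ltn_ord i))// big_ord_recr /= mulrDr.
Qed.

Lemma geo_common x z : geo x -> geo z -> exists C w, [/\ 0 < w, w < 1, 0 <= C,
 forall n, `|x n| <= C * w ^+ n & forall n, `|z n| <= C * w ^+ n].
move=> [C [y [y0 y1 h]]] [C' [y' [y'0 y'1 h']]].
have C0 : 0 <= C by have := h 0%N; rewrite expr0 mulr1; exact: le_trans.
have C'0 : 0 <= C' by have := h' 0%N; rewrite expr0 mulr1; exact: le_trans.
exists (C + C'), (Num.max 2^-1 (Num.max y y')); split.
- by rewrite lt_max invr_gt0 ltr0n.
- by rewrite !gt_max y1 y'1 !andbT; lra.
- by rewrite addr_ge0.
- move=> n; rewrite (le_trans (h n))// ler_pM ?exprn_ge0// ?lerDl//.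
 by rewrite lerXn2r ?nnegrE ?le_max ?y0 ?lexx ?orbT.
- move=> n; rewrite (le_trans (h' n))// ler_pM ?exprn_ge0// ?lerDr//.
 by rewrite lerXn2r ?nnegrE ?le_max ?y'0 ?lexx ?orbT.
Qed.

Lemma natS_expr_le (w : R) : 0 < w -> w < 1 ->
 exists D w', [/\ w < w', w' < 1, 0 <= D & forall n, n.+1%:R * w ^+ n <= D * w' ^+ n].
move=> w0 w1; set w' := (1 + w) / 2; have ww : w < w' by rewrite /w'; lra.
have w'0 : 0 < w' by exact: lt_trans ww.
have y0 : 0 <= w / w' by rewrite divr_ge0 // ltW.
have y1 : w / w' < 1 by rewrite ltr_pdivrMr// mul1r.
exists (1 + (1 - w / w')^-1), w'; split => //; first by rewrite /w'; lra.
 by rewrite addr_ge0// invr_ge0 subr_ge0 ltW.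
move=> n; have -> : w ^+ n = (w / w') ^+ n * w' ^+ n by rewrite -exprMn divfK// gt_eqF.
rewrite mulrA ler_wpM2r ?exprn_ge0 ?(ltW w'0)// -natr1 mulrDl mul1r addrC lerD//.
 by rewrite exprn_ile1// ltW.
exact: natmul_expr_le.
Qed.

Lemma cprod_le x z C w n : 0 <= w -> 0 <= C -> (forall n, `|x n| <= C * w ^+ n) ->
 (forall n, `|z n| <= C * w ^+ n) -> `|cprod x z n| <= C * C * (n.+1%:R * w ^+ n).
move=> w0 C0 hx hz; rewrite (le_trans (ler_norm_sum _ _ _))//.
apply: (@le_trans _ _ (\sum_(i < n.+1) C * C * w ^+ n)); last first.
 by rewrite sumr_const card_ord -mulr_natl; apply: eqle; ring.
apply: ler_sum => i _; rewrite normrM.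
have -> : C * C * w ^+ n = (C * w ^+ i) * (C * w ^+ (n - i)).
 have -> : w ^+ n = w ^+ i * w ^+ (n - i) by rewrite -exprD subnKC// -ltnS.
 by ring.
exact: ler_pM.
Qed.

Lemma geo_cprod x z : geo x -> geo z -> geo (cprod x z).
move=> hx hz; have [C [w [w0 w1 C0 h1 h2]]] := geo_common hx hz.
have [D [w' [ww w'1 D0 h]]] := natS_expr_le w0 w1.
exists (C * C * D), w'; split => //; first by rewrite ltW// (lt_trans w0).
move=> n; rewrite (le_trans (cprod_le n (ltW w0) C0 h1 h2))// -[leRHS]mulrA.
by rewrite ler_wpM2l ?mulr_ge0.
Qed.

(** The partial sum of the product differs from [series x N * ssum z] by tails of [z] weighted by
    [x], altogether at most a multiple of [N w^N]. *)
Lemma ssum_cprod x z : geo x -> geo z -> ssum (cprod x z) = ssum x * ssum z.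
move=> hx hz; have [C [w [w0 w1 C0 h1 h2]]] := geo_common hx hz.
have [D [w' [ww w'1 D0 h]]] := natS_expr_le w0 w1.
have w1' : 0 < 1 - w by rewrite subr_gt0.
have w'0 : 0 < w' := lt_trans w0 ww.
apply: ssum_lim.
have hX : (fun N => series x N * ssum z) @ \oo --> ssum x * ssum z.
 by apply: cvgM; [exact: geo_cvg|exact: cvg_cst].
have hE : (fun N => series (cprod x z) N - series x N * ssum z) @ \oo --> (0 : R).
 apply: (@cvg_dist_dom _ _ (fun N => (C * (C / (1 - w)) * D) * w' ^+ N)); last first.
  rewrite -(mulr0 (C * (C / (1 - w)) * D)); apply: cvgM; first exact: cvg_cst.
  by apply: cvg_expr; rewrite gtr0_norm.
 move=> N; rewrite subr0 cprod_partial /series /= big_mkord mulr_suml -sumrB.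
 rewrite (le_trans (ler_norm_sum _ _ _))//.
 apply: (@le_trans _ _ (\sum_(i < N) C * (C / (1 - w)) * w ^+ N)).
  apply: ler_sum => i _; rewrite -mulrBr normrM distrC.
  have [-> hg] := ssum_tail (N - i) hz.
  have -> : C * (C / (1 - w)) * w ^+ N = (C * w ^+ i) * (C * w ^+ (N - i) / (1 - w)).
   have -> : w ^+ N = w ^+ i * w ^+ (N - i) by rewrite -exprD subnKC// ltnW.
   by ring.
  rewrite ler_pM//; apply: ssum_bound => //; first exact: ltW.
  by move=> n; rewrite (le_trans (h2 _))// exprD; apply: eqle; ring.
 rewrite sumr_const card_ord -mulr_natr -!mulrA !ler_wpM2l ?invr_ge0 ?(ltW w1')//.
 rewrite mulrC (le_trans _ (h N))// ler_wpM2r ?exprn_ge0 ?(ltW w0)//.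
 by rewrite ler_nat.
have -> : series (cprod x z) = (fun N => series (cprod x z) N - series x N * ssum z) \+
  (fun N => series x N * ssum z) by apply/funext => N /=; rewrite subrK.
by rewrite -[X in _ --> X]add0r; exact: cvgD.
Qed.

(** Supplies the dominating function when the product of two kernels is integrated term by term. *)
Lemma series_cprod_norm x z N : `|series (cprod x z) N| <=
 series (fun n => `|x n|) N * series (fun n => `|z n|) N.
rewrite cprod_partial (le_trans (ler_norm_sum _ _ _))// /series /= !big_mkord mulr_suml.
apply: ler_sum => i _; rewrite normrM ler_wpM2l// (le_trans (ler_norm_sum _ _ _))//.
rewrite -(big_mkord xpredT (fun j => `|z j|)) -(big_mkord xpredT (fun j => `|z j|)).
by rewrite [leRHS](@big_cat_nat _ _ _ (N - i))//= ?leq_subr// lerDl sumr_ge0.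
Qed.

End cauchy_product.

(** * The Beta integral and the convolution of powers *)

Section beta.
Variable R : realType.
Notation mu := (@lebesgue_measure R).
Implicit Types a b t T s : R.

Definition bf a b s := pp a 1 (1 - s) * pp b 1 s.
Definition Bt a b : R := \int[mu]_s bf a b s.

Lemma half_powR_le a s : 0 < a -> 2^-1 <= s -> s <= 1 -> s `^ (a - 1) <= 2.
move=> a0 s2 s1; have s0 : 0 < s by apply: lt_le_trans s2; rewrite invr_gt0.
have -> : s `^ (a - 1) = s^-1 * s `^ a.
 by rewrite powRD_pos// mulrC powRN powRr1// ltW.
have h1 : s^-1 <= 2 by rewrite -[leRHS]invrK lef_pV2 ?posrE.
have h2 : s `^ a <= 1.
 have <- : (1 : R) `^ a = 1 by rewrite powR1.
 by rewrite ge0_ler_powR ?nnegrE ?(ltW a0) ?(ltW s0).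
rewrite -[leRHS]mulr1 ler_pM ?powR_ge0 ?invr_ge0 ?(ltW s0)//.
Qed.

Lemma bf_ge0 a b s : 0 <= bf a b s.
Proof. by rewrite mulr_ge0// pp_ge0. Qed.

(** On each half of the interval one of the two factors is away from its singularity and at most
    2. *)
Lemma bf_le a b s : 0 < a -> 0 < b -> bf a b s <= 2 * (pp a 1 (1 - s) + pp b 1 s).
move=> a0 b0; have h1 := pp_ge0 a 1 (1 - s); have h2 := pp_ge0 b 1 s; rewrite /bf.
have [s2|s2] := leP s 2^-1.
 have : pp a 1 (1 - s) <= 2.
  rewrite /pp; case: ifPn => // /andP[s1 s0]; apply: half_powR_le => //; lra.
 by move: (pp a _ _) (pp b _ _) h1 h2 => p q; nra.
have : pp b 1 s <= 2.
 rewrite /pp; case: ifPn => // /andP[s1 s0]; apply: half_powR_le => //; lra.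
by move: (pp a _ _) (pp b _ _) h1 h2 => p q; nra.
Qed.

Lemma mfs_bf a b : mfs (bf a b).
apply: mfsM; last exact: mfs_pp.
by apply: mfs_subl; exact: mfs_pp.
Qed.

Lemma bf_int a b : 0 < a -> 0 < b -> itg (bf a b) /\ Bt a b <= 2 * (a^-1 + b^-1).
move=> a0 b0; have [i1 e1] := pp_int a0 ltr01; have [i2 e2] := pp_int b0 ltr01.
have i3 : itg (fun s => 2 * (pp a 1 (1 - s) + pp b 1 s)).
 by apply: itgZ; apply: itgD => //; exact: itg_refl.
have i4 : itg (bf a b).
 apply: (itg_dom (mfs_bf a b) _ i3) => s.
 by rewrite ger0_norm ?bf_ge0// bf_le.
split => //; rewrite /Bt (le_trans (int_le i4 i3 _))//; first by move=> s; exact: bf_le.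
rewrite intZ; last by apply: itgD => //; exact: itg_refl.
rewrite intD//; last exact: itg_refl.
rewrite int_refl// e1 e2.
have h c : (1 : R) `^ c = 1 by rewrite powR1.
by rewrite !h !div1r.
Qed.

Lemma Bt_gt0 a b : 0 < a -> 0 < b -> 0 < Bt a b.
move=> a0 b0; have [i1 _] := bf_int a0 b0.
rewrite lt_neqAle; apply/andP; split; last by apply: int_ge0 => s; exact: bf_ge0.
apply/negP => /eqP /esym e; have [A [mA A0 h]] := int_eq0_ae i1 (bf_ge0 a b) e.
have sub : `]0, 1[%classic `<=` A.
 move=> s; rewrite /= in_itv/= => /andP[s0 s1]; apply: h => /=.
 apply/eqP; rewrite /bf /pp s0 s1 subr_gt0 s1 ltrBlDr ltrDl s0 /=.
 by rewrite mulf_neq0// gt_eqF// powR_gt0// subr_gt0.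
have M1 : (1%:E <= mu `]0%R, 1%R[)%E by rewrite lebesgue_measure_itv /= lte01 oppr0 adde0.
have M2 : (mu `]0%R, 1%R[ <= mu A)%E by apply: le_measure; rewrite ?inE//; exact: measurable_itv.
have M3 : (mu A <= 0)%E by rewrite le_eqVlt; apply/orP; left; apply/eqP; exact: A0.
have := le_trans M1 (le_trans M2 M3).
by rewrite leNgt lte01.
Qed.

Lemma Bt1r c : 0 < c -> Bt 1 c = c^-1.
move=> c0; have [i e] := pp_int c0 ltr01.
rewrite powR1 div1r in e; rewrite /Bt -e; apply: eqRint => s; rewrite /bf /pp.
case: (ifPn ((0 < s) && (s < 1))) => [/andP[s0 s1]|_]; last by rewrite mulr0.
by rewrite subr_gt0 s1 ltrBlDr ltrDl s0 /= subrr powRr0 mul1r.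
Qed.

Lemma pp_conv_scale a b t T s : 0 < t -> t < T ->
 pp a T (t - s) * pp b T s = t `^ (a - 1) * t `^ (b - 1) * bf a b (t^-1 * s + 0).
move=> t0 tT; rewrite addr0 /bf /pp.
have -> : 1 - t^-1 * s = (t - s) / t by field; rewrite gt_eqF.
have -> : t^-1 * s = s / t by rewrite mulrC.
have ti : 0 < t^-1 by rewrite invr_gt0.
have [h|h] := boolP ((0 < s) && (s < t)).
 move: (h) => /andP[s0 st]; have sT := lt_trans st tT.
 rewrite s0 sT subr_gt0 st (lt_trans _ tT) ?gtrBl//= divr_gt0 ?subr_gt0//=.
 rewrite ltr_pdivrMr// mul1r gtrBl s0 /= divr_gt0//= ltr_pdivrMr// mul1r st /=.
 rewrite !powRM ?subr_ge0 ?(ltW s0) ?(ltW st) ?(ltW ti)//.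
 have e c : t `^ c * t^-1 `^ c = 1.
  by rewrite -powRM ?(ltW t0) ?(ltW ti)// divff ?gt_eqF// powR1.
 have -> : t `^ (a - 1) * t `^ (b - 1) *
  ((t - s) `^ (a - 1) * t^-1 `^ (a - 1) * (s `^ (b - 1) * t^-1 `^ (b - 1))) =
  (t `^ (a - 1) * t^-1 `^ (a - 1)) * (t `^ (b - 1) * t^-1 `^ (b - 1)) *
   ((t - s) `^ (a - 1) * s `^ (b - 1)) by ring.
 by rewrite !e !mul1r.
rewrite !pmulr_lgt0// subr_gt0; move: h; rewrite negb_and => /orP[|] /negbTE ->.
 by rewrite !(mulr0, mul0r).
by rewrite /= !(mulr0, mul0r).
Qed.

Lemma pp_conv a b t T : 0 < a -> 0 < b -> 0 < t -> t < T ->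
 cvok (pp a T) (pp b T) t /\ cv (pp a T) (pp b T) t = Bt a b * t `^ (a + b - 1).
move=> a0 b0 t0 tT; have [i1 _] := bf_int a0 b0.
have tn : t^-1 != 0 by rewrite invr_eq0 gt_eqF.
have i2 := itg_affine 0 tn i1.
have E : (fun s => pp a T (t - s) * pp b T s) =
  fun s => t `^ (a - 1) * t `^ (b - 1) * bf a b (t^-1 * s + 0).
 by apply/funext => s; exact: pp_conv_scale.
split; first by rewrite /cvok E; exact: itgZ.
rewrite /cv E intZ// /Bt (int_affine 0 tn i1) ger0_norm ?invr_ge0 ?(ltW t0)//.
have -> : a + b - 1 = (a - 1) + (b - 1) + 1 by ring.
by rewrite !powRD_pos// powRr1 ?(ltW t0)//; field; rewrite gt_eqF.
Qed.

End beta.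

(** * Convolution of two kernels *)

Section kernel_conv.
Variable R : realType.
Notation mu := (@lebesgue_measure R).
Implicit Types (e : nat -> R).

Definition gcoef e e' m m' bt n : R := \sum_(i < n.+1)
 e i * e' (n - i)%N * Bt (m + i%:R * bt) (m' + (n - i)%:R * bt).

Variables (L bt T : R).
Hypotheses (L0 : 0 < L) (b0 : 0 < bt) (T0 : 0 < T) (TL : T < L).

Let nu0 (m : R) n : 0 < m -> 0 < m + n%:R * bt.
Proof. by move=> m0; rewrite ltr_wpDr// mulr_ge0// ltW. Qed.

(** The Beta factors are bounded uniformly; the [n + 1] summands cost an arbitrarily small part of
    the radius, whence [L1 < L]. *)
Lemma gcoef_bd e e' (m m' C L1 : R) : 0 < m -> 0 < m' -> coefbd e L bt C -> coefbd e' L bt C ->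
 0 < L1 -> L1 < L -> exists C', coefbd (gcoef e e' m m' bt) L1 bt C'.
move=> m0 m'0 he he' L10 L1L.
have C0 : 0 <= C by have := he 0%N; apply: le_trans; rewrite mulr_ge0// powR_ge0.
have h1L : 1 * L1 < L by rewrite mul1r.
have [w0 w1] := ratio_lt1 L0 b0 ltr01 L10 h1L; rewrite mul1r in w0 w1.
have wp : 0 < (L1 / L) `^ bt by rewrite powR_gt0// divr_gt0.
have [D [w' [ww w'1 D0 h]]] := natS_expr_le wp w1.
set B := 2 * (m^-1 + m'^-1); have B0 : 0 <= B by rewrite mulr_ge0// addr_ge0// invr_ge0 ltW.
exists (C * C * B * D) => n; rewrite -ler_pdivlMr; last by rewrite powR_gt0.
have LL : L1 `^ (n%:R * bt) = L `^ (n%:R * bt) * ((L1 / L) `^ bt) ^+ n.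
 rewrite -powR_mulrn// -powRrM [bt * _]mulrC -powRM ?divr_ge0 ?(ltW L0) ?(ltW L10)//.
 by rewrite (mulrC L) divfK// gt_eqF.
rewrite /gcoef (le_trans (ler_norm_sum _ _ _))//.
apply: (@le_trans _ _ (\sum_(i < n.+1) C * C * B / L `^ (n%:R * bt))).
 apply: ler_sum => i _; rewrite !normrM.
 have Lp c : 0 < L `^ c by exact: powR_gt0.
 have -> : C * C * B / L `^ (n%:R * bt) = (C / L `^ (i%:R * bt)) * (C / L `^ ((n - i)%:R * bt)) * B.
  have -> : n%:R * bt = i%:R * bt + (n - i)%:R * bt.
   by rewrite -mulrDl -natrD subnKC// -ltnS.
  by rewrite powRD_pos//; field; rewrite !gt_eqF.
 rewrite ler_pM// ?mulr_ge0//; last first.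
  rewrite ger0_norm ?(ltW (Bt_gt0 _ _))// ?nu0//.
  have [_ hB] := bf_int (nu0 i m0) (nu0 (n - i) m'0).
  rewrite (le_trans hB)// ler_wpM2l// lerD// lef_pV2 ?posrE ?nu0// lerDl mulr_ge0// ltW//.
 by rewrite ler_pM// ler_pdivlMr.
rewrite sumr_const card_ord -[_ *+ _]mulr_natr LL.
have Lp : 0 < L `^ (n%:R * bt) by exact: powR_gt0.
have qp : 0 < ((L1 / L) `^ bt) ^+ n by rewrite exprn_gt0.
rewrite ler_pdivlMr ?mulr_gt0//.
have hn := h n; have w'n : w' ^+ n <= 1 by rewrite exprn_ile1 ?ltW// (lt_trans wp).
have -> : C * C * B / L `^ (n%:R * bt) * n.+1%:R * (L `^ (n%:R * bt) * ((L1 / L) `^ bt) ^+ n) =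
 C * C * B * (n.+1%:R * ((L1 / L) `^ bt) ^+ n) by field; rewrite gt_eqF.
apply: ler_wpM2l; first by apply: mulr_ge0 => //; exact: mulr_ge0.
by rewrite (le_trans hn)// ler_piMr.
Qed.

Lemma kt_conv e e' (m m' : R) n i (t : R) : 0 < m -> 0 < m' -> 0 < t -> t < T -> (i <= n)%N ->
 cvok (kt e m bt T i) (kt e' m' bt T (n - i)) t /\
 cv (kt e m bt T i) (kt e' m' bt T (n - i)) t =
  e i * e' (n - i)%N * Bt (m + i%:R * bt) (m' + (n - i)%:R * bt) * t `^ (m + m' + n%:R * bt - 1).
move=> m0 m'0 t0 tT ni.
have [h1 h2] := pp_conv (nu0 i m0) (nu0 (n - i) m'0) t0 tT.
have E : (fun s => kt e m bt T i (t - s) * kt e' m' bt T (n - i) s) = (fun s =>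
 e i * e' (n - i)%N * (pp (m + i%:R * bt) T (t - s) * pp (m' + (n - i)%:R * bt) T s)).
 by apply/funext => s; rewrite /kt; ring.
split; first by rewrite /cvok E; exact: itgZ.
rewrite /cv E intZ// -/(cv _ _ t) h2 mulrA; congr (_ * _ `^ _).
have -> : n%:R = i%:R + (n - i)%:R :> R by rewrite -natrD subnKC.
by ring.
Qed.

(** Termwise integration of the Cauchy product, by dominated convergence. For [t < T] the cut of the
    kernels at [T] is not felt, so the identity holds at every such point. *)
Lemma ker_conv e e' (m m' C t : R) : 0 < m -> 0 < m' -> coefbd e L bt C -> coefbd e' L bt C ->
 0 < t -> t < T ->
 cv (ker e bt m T) (ker e' bt m' T) t = ker (gcoef e e' m m' bt) bt (m + m') T t.
move=> m0 m'0 he he' t0 tT.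
have TL1 : 1 * T < L by rewrite mul1r.
have g1 s : geo (fun n => kt e m bt T n s).
 have := kx_geo he L0 b0 T0 s ltr01 TL1 (one_bd bt m).
 by under eq_fun do rewrite mulr1.
have g2 s : geo (fun n => kt e' m' bt T n s).
 have := kx_geo he' L0 b0 T0 s ltr01 TL1 (one_bd bt m').
 by under eq_fun do rewrite mulr1.
pose F N s := series (cprod (fun n => kt e m bt T n (t - s)) (fun n => kt e' m' bt T n s)) N.
have kerE (e1 : nat -> R) m1 s : ker e1 bt m1 T s = ssum (fun n => kt e1 m1 bt T n s).
 by rewrite /ker /kx; congr ssum; apply/funext => n; rewrite mulr1.
have hF s : F ^~ s @ \oo --> ker e bt m T (t - s) * ker e' bt m' T s.
 by rewrite !kerE -ssum_cprod//; apply: geo_cvg; exact: geo_cprod.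
have [ok _] := pp_conv m0 m'0 t0 tT.
have nb (e1 : nat -> R) m1 s N : 0 < m1 -> coefbd e1 L bt C ->
  series (fun n => `|kt e1 m1 bt T n s|) N <= kC L bt C T * pp m1 T s.
 move=> m10 he1.
 have he1' : coefbd (fun n => `|e1 n|) L bt C by move=> n; rewrite normr_id.
 have E : (fun n => `|kt e1 m1 bt T n s|) = (fun n => kt (fun n => `|e1 n|) m1 bt T n s).
  by apply/funext => n; rewrite /kt normrM (ger0_norm (pp_ge0 _ _ _)).
 apply: (le_trans _ (le_trans (ler_norm _) (ker_bound m1 he1' L0 b0 T0 TL s))).
 rewrite E kerE; apply: nondecreasing_cvgn_le.
  by apply/nondecreasing_seqP => n; rewrite seriesSr lerDl mulr_ge0// pp_ge0.
 have := kx_geo he1' L0 b0 T0 s ltr01 TL1 (one_bd bt m1).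
 under eq_fun do rewrite mulr1.
 by move=> /geo_cvg h; apply/cvg_ex; eexists; exact: h.
have mF N : mfs (F N).
 apply: measurable_sum => n; apply: measurable_sum => i; apply: mfsM; last exact: mfs_kt.
 by apply: mfs_subl; exact: mfs_kt.
have mk : mfs (fun s : R => ker e bt m T (t - s) * ker e' bt m' T s).
 apply: mfsM; last exact: (mfs_ker m' he' L0 b0 T0 TL).
 by apply: mfs_subl; exact: (mfs_ker m he L0 b0 T0 TL).
have hlim := @Rdct _ F _ (fun s => kC L bt C T * kC L bt C T * (pp m T (t - s) * pp m' T s))
 mF mk (itgZ _ ok) (aeW hF).
have {}hlim : \int[mu]_s F N s @[N --> \oo] --> cv (ker e bt m T) (ker e' bt m' T) t.
 apply: hlim => N.
 apply: aeW => s; rewrite (le_trans (series_cprod_norm _ _ _))//.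
 have -> : kC L bt C T * kC L bt C T * (pp m T (t - s) * pp m' T s) =
  (kC L bt C T * pp m T (t - s)) * (kC L bt C T * pp m' T s) by ring.
 rewrite ler_pM ?nb//; by rewrite /series /= sumr_ge0.
rewrite kerE; apply/esym/ssum_lim; apply: cvg_trans hlim.
apply: near_eq_cvg; apply: nearW => N /=.
have -> : F N = fun s => \sum_(n < N) \sum_(i < n.+1) kt e m bt T i (t - s) * kt e' m' bt T (n - i) s.
 by apply/funext => s; rewrite /F /series /= big_mkord.
rewrite /series /= big_mkord int_sum; last first.
 move=> n; apply: itg_sum => i; have ni : (i <= n)%N by rewrite -ltnS.
 by have [] := kt_conv e e' m0 m'0 t0 tT ni.
apply: eq_bigr => n _; rewrite int_sum; last first.
 move=> i; have ni : (i <= n)%N by rewrite -ltnS.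
 by have [] := kt_conv e e' m0 m'0 t0 tT ni.
rewrite /kt /gcoef /pp t0 tT /= mulr_suml; apply: eq_bigr => i _.
have ni : (i <= n)%N by rewrite -ltnS.
by have [_ <-] := kt_conv e e' m0 m'0 t0 tT ni.
Qed.

End kernel_conv.

Ltac pos := match goal with
 | H : is_true (0 <= ?x) |- is_true (0 <= ?x) => exact H
 | H : is_true (0 < ?x) |- is_true (0 <= ?x) => exact (ltW H)
 | |- is_true (0 <= 1) => exact ler01
 | |- is_true (0 <= _%:R) => exact: ler0n
 | |- is_true (0 <= `|_|) => exact: normr_ge0
 | |- is_true (0 <= powR _ _) => exact: powR_ge0
 | |- is_true (0 <= pp _ _ _) => exact: pp_ge0
 | |- is_true (0 <= pt _ _ _) => exact: pt_ge0
 | |- is_true (0 <= _ * _) => apply: mulr_ge0; pos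
 | |- is_true (0 <= _ ^+ _) => apply: exprn_ge0; pos
 | |- is_true (0 <= _^-1) => rewrite invr_ge0; pos
 | H : is_true (?y < ?x) |- is_true (0 <= ?x - ?y) => rewrite subr_ge0; exact (ltW H)
 | H : is_true (?y <= ?x) |- is_true (0 <= ?x - ?y) => rewrite subr_ge0; exact H
 | |- is_true (0 <= _ + _) => apply: addr_ge0; pos
 | _ => idtac
 end.
#[local] Opaque powR ker kC kC1 kC2 cs rm Bt.

(** * Expansions at 0 of left and right convolutions *)

Section local_bounds.
Variable R : realType.
Notation mu := (@lebesgue_measure R).
Implicit Types (f g : R -> R) (x y C r t s T b c : R) (p : {poly R}).

Definition bigO f x := exists C r, [/\ 0 <= C, 0 < r &
 {ae mu, forall t, 0 < t -> t < r -> `|f t| <= C * t `^ x}].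

(** Right convolution produces a polynomial at 0 out of the values of the function far from 0;
    orders of smallness are therefore counted modulo polynomials of arbitrary degree. *)
Definition polyO f x := exists p, bigO (fun t => f t - p.[t]) x.

Lemma powR_le_exp t x y : 0 < t -> t <= 1 -> x <= y -> t `^ y <= t `^ x.
move=> t0 t1 xy; have -> : y = x + (y - x) by ring.
rewrite powRD_pos// ler_piMr ?powR_ge0//.
have h : (1 : R) `^ (y - x) = 1 by rewrite powR1.
by rewrite -[leRHS]h ge0_ler_powR ?nnegrE ?subr_ge0 ?(ltW t0).
Qed.

Lemma bigO_le f x y : x <= y -> bigO f y -> bigO f x.
move=> xy [C [r [C0 r0 h]]]; exists C, (Num.min r 1); split => //.
 by rewrite lt_min r0 ltr01.
apply: (aeS h) => t ht t0; rewrite lt_min => /andP[tr t1].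
rewrite (le_trans (ht t0 tr))// ler_wpM2l// powR_le_exp// ltW//.
Qed.

Lemma bigO_D f g x : bigO f x -> bigO g x -> bigO (fun t => f t + g t) x.
move=> [C [r [C0 r0 h]]] [C' [r' [C'0 r'0 h']]]; exists (C + C'), (Num.min r r').
split; [exact: addr_ge0|by rewrite lt_min r0|].
apply: (aeS2 h h') => t ht ht' t0; rewrite lt_min => /andP[tr tr'].
by rewrite (le_trans (ler_normD _ _))// mulrDl lerD ?ht ?ht'.
Qed.

Lemma bigO_Z f x c : bigO f x -> bigO (fun t => c * f t) x.
move=> [C [r [C0 r0 h]]]; exists (`|c| * C), r; split => //; first exact: mulr_ge0.
apply: (aeS h) => t ht t0 tr; rewrite normrM -mulrA ler_wpM2l//; exact: ht.
Qed.

Lemma bigO_dom f g x : bigO g x ->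
 (exists2 r, 0 < r & {ae mu, forall t, 0 < t -> t < r -> `|f t| <= `|g t|}) -> bigO f x.
move=> [C [r [C0 r0 h]]] [r' r'0 h']; exists C, (Num.min r r').
split => //; first by rewrite lt_min r0.
apply: (aeS2 h h') => t ht ht' t0; rewrite lt_min => /andP[tr tr'].
by rewrite (le_trans (ht' t0 tr'))// ht.
Qed.

Lemma bigO_ext f g x :
 (exists2 r, 0 < r & {ae mu, forall t, 0 < t -> t < r -> f t = g t}) -> bigO g x -> bigO f x.
move=> [r r0 h] hg; apply: (bigO_dom hg); exists r => //.
by apply: (aeS h) => t ht t0 tr; rewrite ht.
Qed.

Lemma bigO_sum n (F : 'I_n -> R -> R) x : (forall i, bigO (F i) x) ->
 bigO (fun t => \sum_(i < n) F i t) x.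
elim: n F => [|n ih] F h.
 exists 0, 1; split => //; apply: aeW => t _ _; by rewrite big_ord0 normr0 mul0r.
have := bigO_D (ih (fun i => F (widen_ord (leqnSn n) i)) (fun i => h _)) (h ord_max).
by apply: bigO_ext; exists 1 => //; apply: aeW => t _ _; rewrite big_ord_recr.
Qed.

Lemma bigO_pow c x y : x <= y -> bigO (fun t => c * t `^ y) x.
move=> xy; apply: (bigO_le xy); exists `|c|, 1; split => //.
by apply: aeW => t _ _; rewrite normrM (ger0_norm (powR_ge0 _ _)).
Qed.

Lemma polyO_of_bigO f x : bigO f x -> polyO f x.
move=> h; exists 0; apply: bigO_ext h; exists 1 => //; apply: aeW => t _ _.
by rewrite horner0 subr0.
Qed.

Lemma polyO_D f g x : polyO f x -> polyO g x -> polyO (fun t => f t + g t) x.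
move=> [p hp] [q hq]; exists (p + q); apply: bigO_ext (bigO_D hp hq).
by exists 1 => //; apply: aeW => t _ _; rewrite hornerD; ring.
Qed.

Lemma polyO_Z f x c : polyO f x -> polyO (fun t => c * f t) x.
move=> [p hp]; exists (c *: p); apply: bigO_ext (bigO_Z c hp).
by exists 1 => //; apply: aeW => t _ _; rewrite hornerZ; ring.
Qed.

Lemma polyO_ext f g x :
 (exists2 r, 0 < r & {ae mu, forall t, 0 < t -> t < r -> f t = g t}) -> polyO g x -> polyO f x.
move=> [r r0 h] [p hp]; exists p; apply: bigO_ext hp; exists r => //.
by apply: (aeS h) => t ht t0 tr; rewrite ht.
Qed.

Lemma polyO_sum n (F : 'I_n -> R -> R) x : (forall i, polyO (F i) x) ->
 polyO (fun t => \sum_(i < n) F i t) x.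
elim: n F => [|n ih] F h.
 apply: polyO_of_bigO; exists 0, 1; split => //; apply: aeW => t _ _.
 by rewrite big_ord0 normr0 mul0r.
have := polyO_D (ih (fun i => F (widen_ord (leqnSn n) i)) (fun i => h _)) (h ord_max).
by apply: polyO_ext; exists 1 => //; apply: aeW => t _ _; rewrite big_ord_recr.
Qed.

Lemma polyO_le f x y : x <= y -> polyO f y -> polyO f x.
Proof. by move=> xy [p hp]; exists p; exact: bigO_le hp. Qed.

Lemma ae_near0 r (P : R -> Prop) : 0 < r ->
 {ae mu, forall t, 0 < t -> t < r -> P t} -> exists t, [/\ 0 < t, t < r & P t].
move=> r0 [A [mA A0 h]]; apply: contrapT => H.
have sub : `]0, r[%classic `<=` A.
 move=> s; rewrite /= in_itv/= => /andP[s0 sr]; apply: h => /= hs; apply: H.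
 by exists s; split => //; exact: hs.
have M1 : (r%:E <= mu `]0%R, r[)%E by rewrite lebesgue_measure_itv /= lte_fin r0 oppr0 adde0.
have M2 : (mu `]0%R, r[ <= mu A)%E by apply: le_measure; rewrite ?inE//; exact: measurable_itv.
have M3 : (mu A <= 0)%E by rewrite le_eqVlt; apply/orP; left; apply/eqP; exact: A0.
have := le_trans M1 (le_trans M2 M3).
by rewrite lee_fin leNgt r0.
Qed.

Lemma powR_small x e : 0 < x -> 0 < e -> exists2 r, 0 < r & forall t, 0 < t -> t < r -> t `^ x < e.
move=> x0 e0; exists (e `^ x^-1); first exact: powR_gt0.
move=> t t0 tr; have -> : e = (e `^ x^-1) `^ x.
 by rewrite -powRrM mulVf ?gt_eqF// powRr1// ltW.
by rewrite gt0_ltr_powR// nnegrE ?powR_ge0// ltW.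
Qed.

Lemma bigO_pow_inv c x y : x < y -> bigO (fun t => c * t `^ x) y -> c = 0.
move=> xy [C [r [C0 r0 h]]]; apply/eqP/negPn/negP => c0.
have c0' : 0 < `|c| by rewrite normr_gt0.
have C1 : 0 < C + 1 by rewrite ltr_wpDl.
have yx : 0 < y - x by rewrite subr_gt0.
have [r' r'0 h'] := powR_small yx (divr_gt0 c0' C1).
have rr : 0 < Num.min r r' by rewrite lt_min r0.
have [t [t0]] : exists t, [/\ 0 < t, t < Num.min r r' & (t < r -> `|c * t `^ x| <= C * t `^ y)].
 apply: ae_near0 => //; apply: (aeS h) => t ht t0 _ tr; exact: ht.
rewrite lt_min => /andP[tr tr'] /(_ tr).
have -> : y = x + (y - x) by ring.
have tx : 0 < t `^ x by exact: powR_gt0.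
rewrite powRD_pos// normrM (gtr0_norm tx) mulrCA [leLHS]mulrC ler_pM2l//.
apply/negP; rewrite -ltNge.
have := h' t t0 tr'; rewrite ltr_pdivlMr// mulrC => hh.
apply: le_lt_trans hh; rewrite ler_wpM2r ?powR_ge0// lerDl//.
Qed.

Lemma poly_bigO p x : (forall j, j%:R < x -> p`_j = 0) -> bigO (horner p) x.
move=> hp; apply: (@bigO_ext _ (fun t => \sum_(j < size p) p`_j * t `^ j%:R)).
 exists 1 => //; apply: aeW => t t0 _; rewrite horner_coef; apply: eq_bigr => j _.
 by rewrite powR_mulrn// ltW.
apply: bigO_sum => j; have [h|h] := ltP j%:R x; last exact: bigO_pow.
by rewrite hp//; exists 0, 1; split => //; apply: aeW => t _ _; rewrite !mul0r normr0.
Qed.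

Lemma bigO_poly p x : bigO (horner p) x -> forall j, j%:R < x -> p`_j = 0.
move=> h; elim/ltn_ind => j ih jx.
pose y := Num.min x (j.+1%:R : R).
have jy : j%:R < y by rewrite /y lt_min jx /= ltr_nat.
apply: (bigO_pow_inv jy).
have h1 : bigO (horner p) y by apply: bigO_le h; rewrite ge_min lexx.
pose q := p - p`_j *: 'X^j.
have h2 : bigO (horner q) y.
 apply: poly_bigO => i; rewrite lt_min => /andP[ix]; rewrite ltr_nat ltnS => ij.
 rewrite /q coefB coefZ coefXn; move: ij; rewrite leq_eqVlt => /orP[/eqP ->|ij].
  by rewrite eqxx mulr1 subrr.
 by rewrite (ltn_eqF ij) mulr0 subr0 ih.
apply: bigO_ext (bigO_D h1 (bigO_Z (-1) h2)).
exists 1 => //; apply: aeW => t t0 _; rewrite /q hornerD hornerN hornerZ hornerXn.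
by rewrite powR_mulrn ?ltW//; ring.
Qed.

(** The polynomial must vanish to order [x], hence, [x] not being an integer, to some larger order,
    and then nothing is left to cancel [c t^x]. This is the obstruction behind [boot_flat]. *)
Lemma polyO_pow_inv c x y : 0 <= x -> x < y -> (forall j : nat, j%:R != x) ->
 polyO (fun t => c * t `^ x) y -> c = 0.
move=> x0 xy xN [p hp].
have h1 : bigO (horner p) x.
 have := bigO_D (bigO_pow c (lexx x)) (bigO_Z (-1) (bigO_le (ltW xy) hp)).
 by apply: bigO_ext; exists 1 => //; apply: aeW => t _ _; ring.
have h2 := bigO_poly h1.
have /andP[tx1 tx2] := truncn_itv x0; set n := Num.trunc x in tx1 tx2.
pose z := Num.min y (n.+1%:R : R).
have xz : x < z by rewrite lt_min xy.
have h3 : bigO (horner p) z.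
 apply: poly_bigO => j; rewrite lt_min => /andP[jy]; rewrite ltr_nat ltnS => jx.
 by apply: h2; rewrite lt_neqAle xN /= (le_trans _ tx1)// ler_nat.
apply: (bigO_pow_inv xz).
apply: bigO_ext (bigO_D (bigO_le _ hp) h3); last by rewrite ge_min lexx.
by exists 1 => //; apply: aeW => t _ _; rewrite subrK.
Qed.

(** A global form of [f = O(s^x)] that includes vanishing outside []0, b[]; the shift by 1 matches
    the convention of [pp]. *)
Definition gb f C x b := {ae mu, forall s, `|f s| <= C * pp (x + 1) b s}.

Lemma gb_bigO f C x b : 0 <= C -> 0 < b -> gb f C x b -> bigO f x.
move=> C0 b0 h; exists C, b; split => //; apply: (aeS h) => t + t0 tb.
by rewrite /pp t0 tb /= addrK.
Qed.

Lemma bigO_gb f M x b : 0 <= M -> 0 < b -> 0 <= x -> gb f M 0 b -> bigO f x ->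
 exists2 C, 0 <= C & gb f C x b.
move=> M0 b0 x0 hM [C [r [C0 r0 h]]]; exists (C + M / r `^ x).
 by rewrite addr_ge0// divr_ge0// powR_ge0.
apply: (aeS2 hM h) => s hs1 hs2; rewrite /pp in hs1 *; rewrite addrK.
case: ifPn hs1 => [/andP[s0 sb]|_ hs1]; last by move: hs1; rewrite !mulr0.
rewrite add0r subrr powRr0 mulr1 => hs1.
have rx : 0 < r `^ x by exact: powR_gt0.
have [sr|rs] := ltP s r.
 rewrite (le_trans (hs2 s0 sr))// ler_wpM2r ?powR_ge0// lerDl divr_ge0//.
 exact: powR_ge0.
rewrite (le_trans hs1)// mulrDl ler_wpDl ?mulr_ge0 ?powR_ge0//.
rewrite mulrAC ler_pdivlMr// ler_wpM2l//.
by rewrite ge0_ler_powR// ?nnegrE ltW.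
Qed.

Lemma int_ae_dom f g : mfs f -> itg g ->
 {ae mu, forall s, `|f s| <= g s} -> itg f /\ `|\int[mu]_s f s| <= \int[mu]_s g s.
move=> mf ig h; have i1 := itg_ae_dom mf ig h; split => //.
by rewrite (le_trans (int_norm i1))// int_ae_le//; exact: itg_norm.
Qed.

Lemma mfs_le_ind b : mfs (fun s : R => (s <= b)%R%:R : R).
rewrite (_ : (fun s : R => _) = \1_[set s | s <= b]); last first.
 by apply/funext => s; rewrite indicE; congr (_%:R); rewrite mem_setE.
have e : [set s : R | s <= b] = `]-oo, b]%classic by apply/seteqP; split => s /=; rewrite in_itv.
by apply: measurable_indic; rewrite e.
Qed.

Lemma mfs_gt_ind b : mfs (fun s : R => (b < s)%R%:R : R).
rewrite (_ : (fun s : R => _) = fun s => 1 - (s <= b)%R%:R); last first.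
 by apply/funext => s; case: leP; rewrite ?subrr ?subr0.
by apply: mfsB => //; exact: mfs_le_ind.
Qed.

Definition rcv (q f : R -> R) t := \int[mu]_s (q (s - t) * f s).

Section convolution.
Variables (e : nat -> R) (L bt C m T : R).
Hypotheses (he : coefbd e L bt C) (L0 : 0 < L) (b0 : 0 < bt) (T0 : 0 < T) (TL : T < L)
 (m0 : 0 < m).
Let q := ker e bt m T.

Let mq : mfs q. Proof. exact: (mfs_ker m he L0 b0 T0 TL). Qed.

Let kC0 : 0 <= kC L bt C T. Proof. exact: (@kC_ge0 _ e L bt C T). Qed.

Lemma left_bigO f (A x : R) : mfs f -> 0 <= x -> 0 <= A -> gb f A x T -> bigO (cv q f) (x + m).
move=> mf x0 A0 hf; have x1 : 0 < x + 1 by rewrite ltr_wpDl.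
exists (kC L bt C T * A * Bt m (x + 1)), T; split => //.
 by apply: mulr_ge0; [exact: mulr_ge0|apply: ltW; exact: Bt_gt0].
apply: aeW => t t0 tT; have [ok e1] := pp_conv m0 x1 t0 tT.
have mi : mfs (fun s : R => q (t - s) * f s).
 by apply: mfsM mf; exact: mfs_subl mq.
have dom : {ae mu, forall s, `|q (t - s) * f s| <= kC L bt C T * A * (pp m T (t - s) * pp (x + 1) T s)}.
 apply: (aeS hf) => s hs; rewrite normrM.
 have -> : kC L bt C T * A * (pp m T (t - s) * pp (x + 1) T s) =
   (kC L bt C T * pp m T (t - s)) * (A * pp (x + 1) T s) by ring.
 by rewrite ler_pM//; exact: (ker_bound m he L0 b0 T0 TL).
have i1 := itg_ae_dom mi (itgZ _ ok) dom.
rewrite (le_trans (int_norm i1))// (le_trans (int_ae_le (itg_norm i1) (itgZ _ ok) dom))//.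
rewrite intZ// (_ : \int[mu]_s _ = cv (pp m T) (pp (x + 1) T) t)// e1 mulrA.
by have -> : m + (x + 1) - 1 = x + m by ring.
Qed.

Lemma right_near (f : R -> R) (A x c : R) : mfs f -> 0 <= x -> 0 <= A -> 1 < c ->
 gb f A x T ->
 exists2 D, 0 <= D & forall t, 0 < t -> c * t < T ->
  itg (fun s => q (s - t) * (f s * (s <= c * t)%R%:R)) /\
  `|\int[mu]_s (q (s - t) * (f s * (s <= c * t)%R%:R))| <= D * t `^ (x + m).
move=> mf x0 A0 c1 hf; have c0 : 0 < c by lra.
have c10 : 0 < c - 1 by lra.
exists (kC L bt C T * (A * c `^ x) * ((c - 1) `^ m / m)).
 by pos.
move=> t t0 ctT; have b'0 : 0 < (c - 1) * t by rewrite mulr_gt0.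
have P := pp_int m0 b'0; have i2 := itg_shift t P.1.
have mi : mfs (fun s : R => q (s - t) * (f s * (s <= c * t)%R%:R)).
 apply: mfsM; first by apply: mfsT => //; exact: mfsB.
 by apply: mfsM => //; exact: mfs_le_ind.
have dom : {ae mu, forall s, `|q (s - t) * (f s * (s <= c * t)%R%:R)| <=
  (kC L bt C T * (A * (c * t) `^ x)) * pp m ((c - 1) * t) (s - t)}.
 apply: (aeS2 hf (ae_neq (c * t))) => s hs sct; rewrite !normrM normr_nat.
 have [h|h] := leP s (c * t); last first.
  by rewrite !mulr0; pos.
 rewrite mulr1 [leRHS]mulrAC; apply: ler_pM => //.
  apply: le_trans (ker_bound m he L0 b0 T0 TL (s - t)) _; rewrite ler_wpM2l//.
  rewrite /pp; case: ifPn => [/andP[h1 h2]|_]; last exact: pp_ge0.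
  have -> : s - t < (c - 1) * t by rewrite mulrBl mul1r ltrD2r lt_neqAle sct.
  by rewrite h1.
 apply: (le_trans hs); rewrite ler_wpM2l//.
 rewrite /pp addrK; case: ifPn => [/andP[h1 h2]|_]; last exact: powR_ge0.
 by rewrite ge0_ler_powR ?nnegrE ?(ltW h1)// ltW// mulr_gt0.
have [i3 b3] := int_ae_dom mi (itgZ _ i2) dom; split => //.
rewrite (le_trans b3)// intZ// (int_shift t P.1) P.2 !powRM ?(ltW c0) ?(ltW c10) ?(ltW t0)//.
by rewrite powRD_pos//; apply: eqle; ring.
Qed.

Section expansion.
Variable v1 : R.
Hypotheses (v0 : 0 < v1) (v11 : v1 <= 1) (v1L : (1 + v1) * T < L).
(** For [s > c t] the ratio [t / s] is below [v1 / 2], the range of the coarse remainder bound. *)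
Let c := 2 / v1.
Variables (f : R -> R) (A x y : R) (N : nat).
Hypotheses (mf : mfs f) (A0 : 0 <= A) (hf : gb f A x T)
 (yx : y <= x + m) (Ny : forall j, (j < N)%N -> j%:R < y) (yN : y < N%:R).

(** Integrand of the coefficient of [t^j] in the expansion of the right convolution. Its bound is
    integrable at 0 while [j < y], which is why [N] is the first integer beyond [y]. *)
Definition hc j s := cs e bt m T j s * s `^ (- j%:R) * f s.
Definition ac j := \int[mu]_s hc j s.

Let K1 := kC1 L bt C m T v1.
Let K10 : 0 <= K1. Proof. exact: (@kC1_ge0 _ e). Qed.

Lemma ppM_le (j : nat) s : pp m T s * s `^ (- j%:R) * pp (x + 1) T s <= T `^ (x + m - y) * pp (y - j%:R) T s.
rewrite /pp; case: ifPn => [/andP[s0 sT]|_]; last by rewrite !mul0r mulr0.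
rewrite -!powRD_pos//.
have -> : m - 1 + - j%:R + (x + 1 - 1) = (x + m - y) + (y - j%:R - 1) by ring.
rewrite powRD_pos// ler_wpM2r ?powR_ge0//.
by rewrite ge0_ler_powR ?nnegrE ?subr_ge0// ltW.
Qed.

Lemma mfs_hc j : mfs (hc j).
apply: mfsM => //; apply: mfsM.
 exact: (mfs_cs he L0 b0 T0 m0 v0 v11 v1L).
exact: measurable_powR.
Qed.

Lemma hc_dom j : {ae mu, forall s, `|hc j s| <=
 (K1 * v1^-1 ^+ j * A * T `^ (x + m - y)) * pp (y - j%:R) T s}.
apply: (aeS hf) => s hs; rewrite /hc !normrM.
have vi : 0 <= v1^-1 ^+ j by rewrite exprn_ge0// invr_ge0 ltW.
have [sT|sT] := ltP s T; last first.
 move: hs; rewrite {1}/pp (ltNge s T) sT andbF mulr0 normr_le0 => /eqP ->.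
 by rewrite normr0 mulr0; pos.
have [s0|s0] := ltP 0 s; last first.
 move: hs; rewrite {1}/pp (ltNge 0 s) s0 /= mulr0 normr_le0 => /eqP ->.
 by rewrite normr0 mulr0; pos.
have h1 := cs_coarse he L0 b0 T0 m0 v0 v11 v1L j (ltW sT).
apply: (@le_trans _ _ ((K1 * v1^-1 ^+ j * pp m T s) * s `^ (- j%:R) * (A * pp (x + 1) T s))).
 apply: ler_pM; [by pos|by pos| |exact: hs].
 by rewrite (ger0_norm (powR_ge0 _ _)) ler_wpM2r ?powR_ge0.
have -> : K1 * v1^-1 ^+ j * pp m T s * s `^ (- j%:R) * (A * pp (x + 1) T s) =
 (K1 * v1^-1 ^+ j * A) * (pp m T s * s `^ (- j%:R) * pp (x + 1) T s) by ring.
rewrite -[leRHS]mulrA; apply: ler_wpM2l; first by pos.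
exact: ppM_le.
Qed.

Lemma hc_int j : (j < N)%N -> itg (hc j) /\ forall b, 0 < b -> b <= T ->
 `|\int[mu]_s (hc j s * (s <= b)%R%:R)| <=
  (K1 * v1^-1 ^+ j * A * T `^ (x + m - y)) * (b `^ (y - j%:R) / (y - j%:R)).
move=> jN; have yj : 0 < y - j%:R by rewrite subr_gt0 Ny.
have [i1 e1] := pp_int yj T0.
have dom := hc_dom j.
have [i2 _] := int_ae_dom (mfs_hc j) (itgZ _ i1) dom.
split => // b b'0 bT; have [i3 e3] := pp_int yj b'0.
have mi : mfs (fun s => hc j s * (s <= b)%R%:R).
 by apply: mfsM; [exact: mfs_hc|exact: mfs_le_ind].
rewrite -e3 -intZ//.
suff d2 : {ae mu, forall s, `|hc j s * (s <= b)%R%:R| <=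
  (K1 * v1^-1 ^+ j * A * T `^ (x + m - y)) * pp (y - j%:R) b s}.
 by have [_] := int_ae_dom mi (itgZ _ i3) d2.
apply: (aeS2 dom (ae_neq b)) => s hs sb; rewrite normrM normr_nat.
have D0 : 0 <= K1 * v1^-1 ^+ j * A * T `^ (x + m - y).
 by pos.
have [h|h] := leP s b; last by rewrite mulr0 mulr_ge0// pp_ge0.
rewrite mulr1 (le_trans hs)// ler_wpM2l// /pp.
have sb' : s < b by rewrite lt_neqAle sb.
by rewrite sb' (lt_le_trans sb' bT).
Qed.

Lemma rm_dom t : 0 < t -> {ae mu, forall s, c * t < s ->
 `|rm e bt m T N (t / s) s * f s| <=
 (K1 * v1^-1 ^+ N * A * T `^ (x + m - y)) * t ^+ N * pt (N%:R - y) (c * t) s}.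
move=> t0; have c0 : 0 < c by rewrite divr_gt0.
apply: (aeS hf) => s hs cs; have s0 : 0 < s by apply: lt_trans cs; rewrite mulr_gt0.
have D0 : 0 <= K1 * v1^-1 ^+ N * A * T `^ (x + m - y).
 by pos.
have [sT|sT] := ltP s T; last first.
 move: hs; rewrite {1}/pp (ltNge s T) sT andbF mulr0 normr_le0 => /eqP ->.
 by rewrite mulr0 normr0; pos.
have ts0 : 0 <= t / s by rewrite divr_ge0// ltW.
have ts1 : t / s <= v1 / 2.
 rewrite ler_pdivrMr// -ler_pdivrMl ?divr_gt0//.
 by rewrite invf_div; exact: ltW.
have h1 := rm_coarse he L0 b0 T0 m0 v0 v11 v1L N (ltW sT) ts0 ts1.
rewrite normrM; apply: (le_trans (ler_pM _ _ h1 hs)) => //.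
rewrite -/K1.
have -> : (t / s / v1) ^+ N = t ^+ N * s `^ (- N%:R) * v1^-1 ^+ N.
 by rewrite powRN powR_mulrn ?(ltW s0)// !exprMn !exprVn.
have -> : K1 * (t ^+ N * s `^ (- N%:R) * v1^-1 ^+ N) * pp m T s * (A * pp (x + 1) T s) =
 (K1 * v1^-1 ^+ N * A) * t ^+ N * (pp m T s * s `^ (- N%:R) * pp (x + 1) T s) by ring.
apply: (@le_trans _ _ ((K1 * v1^-1 ^+ N * A) * t ^+ N * (T `^ (x + m - y) * pp (y - N%:R) T s))).
 apply: ler_wpM2l; last exact: ppM_le.
 by pos.
have -> : pp (y - N%:R) T s = pt (N%:R - y) (c * t) s.
 by rewrite /pp /pt s0 sT cs /=; congr (_ `^ _); ring.
by apply: eqle; ring.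
Qed.

Lemma right_split t b : 0 < t -> t <= b -> {ae mu, forall s, q (s - t) * f s =
  q (s - t) * (f s * (s <= b)%R%:R) + (\sum_(j < N) t ^+ j * hc j s -
   \sum_(j < N) t ^+ j * (hc j s * (s <= b)%R%:R)) +
   rm e bt m T N (t / s) s * f s * (b < s)%R%:R}.
move=> t0 tb; apply: (aeS hf) => s hs.
have [h|h] := leP s b.
 rewrite mulr1 mulr0 addr0 (eq_bigr (fun j : 'I_N => t ^+ j * (hc j s * 1))).
  by rewrite subrr addr0.
 by move=> j _; rewrite mulr1.
rewrite !mulr0 add0r mulr1 [X in _ = _ - X + _](_ : _ = 0) ?subr0; last first.
 by rewrite big1// => j _; rewrite !mulr0.
have [sT|sT] := ltP s T; last first.
 move: hs; rewrite {1}/pp (ltNge s T) sT andbF mulr0 normr_le0 => /eqP e0.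
 by rewrite e0 !mulr0 addr0 big1// => j _; rewrite /hc e0 !mulr0.
have ts : t < s by exact: le_lt_trans h.
have s0 := lt_trans t0 ts.
rewrite /q (ker_taylor he L0 b0 T0 m0 TL v0 v11 v1L N (ltW t0) ts sT) mulrDl.
congr (_ + _); rewrite mulr_suml; apply: eq_bigr => j _; rewrite /hc.
by rewrite powRN powR_mulrn ?(ltW s0)// expr_div_n; ring.
Qed.

(** Beyond the cut [b] the kernel is replaced by its expansion. The polynomial takes the full
    moments [ac j], so the moments below [b] appear as an error. The cut is [c t] for the coarse
    expansion and [t] for the Carleman estimate. *)
Lemma right_split_int t b (g : R -> R) : 0 < t -> t <= b ->
 itg (fun s => q (s - t) * (f s * (s <= b)%R%:R)) -> itg g ->
 {ae mu, forall s, `|rm e bt m T N (t / s) s * f s * (b < s)%R%:R| <= g s} ->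
 `|rcv q f t - \sum_(j < N) ac j * t ^+ j| <=
  `|\int[mu]_s (q (s - t) * (f s * (s <= b)%R%:R))| +
  \sum_(j < N) t ^+ j * `|\int[mu]_s (hc j s * (s <= b)%R%:R)| + \int[mu]_s g s.
move=> t0 tb i1 ig hg; have spl := right_split t0 tb.
pose F s := \sum_(j < N) t ^+ j * hc j s - \sum_(j < N) t ^+ j * (hc j s * (s <= b)%R%:R).
have ihc (j : 'I_N) : itg (hc j) by have [] := hc_int (ltn_ord j).
have ihc2 (j : 'I_N) : itg (fun s => hc j s * (s <= b)%R%:R).
 apply: (itg_dom _ _ (itg_norm (ihc j))).
  by apply: mfsM; [exact: mfs_hc|exact: mfs_le_ind].
 move=> s; rewrite normrM normr_nat; case: (s <= b); first by rewrite mulr1.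
 by rewrite mulr0 normr_ge0.
have iF1 : itg (fun s => \sum_(j < N) t ^+ j * hc j s).
 by apply: itg_sum => j; apply: itgZ.
have iF2 : itg (fun s => \sum_(j < N) t ^+ j * (hc j s * (s <= b)%R%:R)).
 by apply: itg_sum => j; apply: itgZ.
have iF : itg F by exact: itgB.
pose G s := q (s - t) * f s - q (s - t) * (f s * (s <= b)%R%:R) - F s.
have mq1 : mfs (fun s : R => q (s - t)).
 by apply: mfsT mq _; exact: mfsB.
have mqf : mfs (fun s : R => q (s - t) * f s) by exact: mfsM.
have mG : mfs G.
 apply: mfsB; last exact: imeas.
 apply: mfsB; last exact: imeas i1.
 exact: mqf.
have dG : {ae mu, forall s, `|G s| <= g s}.
 apply: (aeS2 spl hg) => s h1 h2; rewrite (_ : G s = rm e bt m T N (t / s) s * f s * (b < s)%R%:R)//.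
 by rewrite /G /F h1; ring.
have [iG hG] := int_ae_dom mG ig dG.
have E : rcv q f t = \int[mu]_s (q (s - t) * (f s * (s <= b)%R%:R)) + \int[mu]_s F s + \int[mu]_s G s.
 rewrite -intD// -intD//; last exact: itgD.
 by apply: eqRint => s; rewrite /G; ring.
have EF : \int[mu]_s F s = \sum_(j < N) ac j * t ^+ j -
  \sum_(j < N) t ^+ j * \int[mu]_s (hc j s * (s <= b)%R%:R).
 rewrite intB// !int_sum; [|by move=> j; exact: itgZ..].
 congr (_ - _); apply: eq_bigr => j _; rewrite intZ//.
 by rewrite mulrC.
rewrite E EF.
rewrite (_ : _ - _ = \int[mu]_s (q (s - t) * (f s * (s <= b)%R%:R)) -
 \sum_(j < N) t ^+ j * (\int[mu]_s (hc j s * (s <= b)%R%:R)) + \int[mu]_s G s); last by ring.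
rewrite (le_trans (ler_normD _ _))// lerD// (le_trans (ler_normB _ _))// lerD2l.
rewrite (le_trans (ler_norm_sum _ _ _))//; apply: ler_sum => j _.
by rewrite normrM (ger0_norm (exprn_ge0 _ (ltW t0))).
Qed.

(** With the cut at [c t], the near part, the low moments and the remainder all scale like [t^y], up
    to powers that are bounded on []0, T[]. *)
Lemma right_expand : 0 <= x -> exists2 D, 0 <= D & forall t, 0 < t -> c * t < T ->
 `|rcv q f t - \sum_(j < N) ac j * t ^+ j| <= D * t `^ y.
move=> x0; have c0 : 0 < c by rewrite divr_gt0.
have c1 : 1 < c by rewrite /c ltr_pdivlMr// mul1r (le_lt_trans v11)// ltr1n.
have [D1 D10 hD1] := right_near mf x0 A0 c1 hf.
pose E j := (K1 * v1^-1 ^+ j * A * T `^ (x + m - y)).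
have E0 j : 0 <= E j by rewrite /E; pos.
pose D2 := \sum_(j < N) E j * (c `^ (y - j%:R) / (y - j%:R)).
have Ny0 : 0 < N%:R - y by rewrite subr_gt0.
pose D3 := E N * (c `^ (y - N%:R) / (N%:R - y)).
have D20 : 0 <= D2.
 apply: sumr_ge0 => j _; have h := Ny (ltn_ord j); have := E0 j => Ej; by pos.
have D30 : 0 <= D3 by have := E0 N => EN; rewrite /D3; pos.
exists (D1 * T `^ (x + m - y) + D2 + D3).
 by pos.
move=> t t0 ctT; have ct0 : 0 < c * t by rewrite mulr_gt0.
have [i1 b1] := hD1 t t0 ctT.
have tT : t < T by apply: lt_trans ctT; rewrite ltr_pMl.
have [i4 e4] := pt_int Ny0 ct0.
have := @right_split_int t (c * t) (fun s => E N * t ^+ N * pt (N%:R - y) (c * t) s) t0 _ i1 (itgZ _ i4).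
rewrite ler_pMl// (ltW c1) => /(_ isT) H; apply: (le_trans (H _)) => {H}.
 apply: (aeS (rm_dom t0)) => s hs; have [h|h] := ltP (c * t) s; first by rewrite mulr1 hs.
 by rewrite mulr0 normr0; have := E0 N => EN; pos.
rewrite intZ// e4 !mulrDl; apply: lerD; first apply: lerD.
- rewrite (le_trans b1)// (_ : x + m = (x + m - y) + y); last by ring.
 rewrite [in leLHS]powRD_pos// mulrA; apply: ler_wpM2r; first by pos.
 rewrite addrK; apply: ler_wpM2l => //.
 by rewrite ge0_ler_powR ?nnegrE ?subr_ge0 ?(ltW t0) ?(ltW tT) ?(ltW T0).
- rewrite /D2 mulr_suml; apply: ler_sum => j _.
 have [_ hj] := hc_int (ltn_ord j).
 have tj : 0 <= t ^+ j by rewrite exprn_ge0// ltW.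
 apply: (le_trans (ler_wpM2l tj (hj _ ct0 (ltW ctT)))).
 rewrite -/(E j) powRM ?(ltW c0) ?(ltW t0)//.
 have -> : t `^ y = t ^+ j * t `^ (y - j%:R).
  rewrite -powR_mulrn ?(ltW t0)// -powRD_pos//; congr (_ `^ _); ring.
 by apply: eqle; ring.
- rewrite /D3 opprB powRM ?(ltW c0) ?(ltW t0)//.
 have -> : t `^ y = t ^+ N * t `^ (y - N%:R).
  rewrite -powR_mulrn ?(ltW t0)// -powRD_pos//; congr (_ `^ _); ring.
 by apply: eqle; ring.
Qed.

End expansion.
End convolution.
End local_bounds.

#[local] Opaque powR ker kC kC1 kC2 cs rm Bt.

(** * Left and right convolutions of monomials *)

Section monomials.
Variable R : realType.
Notation mu := (@lebesgue_measure R).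
Implicit Types (f g : R -> R) (x y t s : R).

(** [y] is kept strictly between consecutive integers, so that none of the integrals of [s^(y-j-1)]
    becomes logarithmic. *)
Lemma pick_noninteger (u v : R) : 0 <= u -> u < v ->
 exists y N, [/\ u < y, y < v, (forall j, (j < N)%N -> j%:R < y) & y < N%:R].
move=> u0 uv; have /andP[h1 h2] := truncn_itv u0; set n := Num.trunc u in h1 h2.
set w := Num.min v n.+1%:R; have uw : u < w by rewrite lt_min uv.
have wn : w <= n.+1%:R by rewrite ge_min lexx orbT.
have wv : w <= v by rewrite ge_min lexx.
move: (w) uw wn wv => z uz zn zv; exists ((u + z) / 2), n.+1; split.
- by lra.
- by lra.
- move=> j; rewrite ltnS => jn; apply: (@le_lt_trans _ _ u); last by lra.
 by apply: le_trans h1; rewrite ler_nat.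
- by apply: lt_le_trans zn; lra.
Qed.

Lemma coefbd_leC (e : nat -> R) L bt C C' : C <= C' -> coefbd e L bt C -> coefbd e L bt C'.
Proof. by move=> h he n; exact: le_trans (he n) h. Qed.

Definition delta (n : nat) : R := (n == 0%N)%:R.

Lemma coefbd_delta (L bt : R) : coefbd delta L bt 1.
move=> [|n]; first by rewrite /delta /= mul0r powRr0 mulr1 normr1.
by rewrite /delta /= normr0 mul0r.
Qed.

Lemma ssum0 : ssum (fun=> 0 : R) = 0.
apply: ssum_lim; rewrite (_ : series _ = fun=> 0); first exact: cvg_cst.
by apply/funext => n; rewrite /series /= big1.
Qed.

Lemma ker_delta (bt m T s : R) :
 geo (fun n => kt delta m bt T n s * 1) -> ker delta bt m T s = pp m T s.
Transparent ker.
move=> g; rewrite /ker /kx (ssum_recl g) /kt /= mul1r mul0r addr0 mulr1.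
rewrite (_ : (fun n => _) = fun=> 0) ?ssum0 ?addr0//.
by apply/funext => n; rewrite /delta /= !mul0r.
Qed.

Lemma ker_recl (e : nat -> R) (bt m T s : R) : geo (fun n => kt e m bt T n s * 1) ->
 ker e bt m T s = e 0%N * pp m T s + ker (fun n => e n.+1) bt (m + bt) T s.
move=> g; rewrite /ker /kx (ssum_recl g) /kt mul0r addr0 mulr1; congr (_ + _).
congr ssum; apply/funext => n; congr (_ * pp _ _ _ * _).
by rewrite -natr1; ring.
Qed.
Opaque ker.

Section one_kernel.
Variables (e : nat -> R) (L bt C al T : R).
Hypotheses (he : coefbd e L bt C) (L0 : 0 < L) (b0 : 0 < bt) (T0 : 0 < T) (TL : T < L)
 (al0 : 0 < al).
Let k := ker e bt al T.
Let TL1 : 1 * T < L. Proof. by rewrite mul1r. Qed.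
Let C0 : 0 <= C.
Proof. by have := he 0; apply: le_trans; rewrite mulr_ge0// powR_ge0. Qed.

Let gk s : geo (fun n => kt e al bt T n s * 1).
Proof. exact: (kx_geo he L0 b0 T0 s ltr01 TL1 (one_bd bt al)). Qed.

Let mk : mfs k. Proof. exact: (mfs_ker al he L0 b0 T0 TL). Qed.
Let ik : itg k. Proof. exact: (itg_ker he L0 b0 T0 al0 TL). Qed.

Lemma coefbd_shift : coefbd (fun n => e n.+1) L bt (C / L `^ bt).
move=> n; have Lb : 0 < L `^ bt by exact: powR_gt0.
rewrite ler_pdivlMr// -mulrA -powRD_pos//.
by have -> : n%:R * bt + bt = n.+1%:R * bt by rewrite -natr1; ring.
Qed.

(** The leading term of the kernel gives the Beta value times [t^(al+i)]; what remains is a kernel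
    of order [al + bt] and gains [bt]. *)
Lemma mono_left (T' : R) (i : nat) : 0 < T' -> T' < T ->
 bigO (fun t => cv k (pp i.+1%:R T') t - e 0%N * Bt al i.+1%:R * t `^ (al + i%:R)) (al + i%:R + bt).
move=> T'0 T'T; set k1 := ker (fun n => e n.+1) bt (al + bt) T.
have ab0 : 0 < al + bt by rewrite addr_gt0.
have hk1 := coefbd_shift.
have ik1 : itg k1 by exact: (itg_ker hk1 L0 b0 T0 ab0 TL).
have i0 : 0 < i.+1%:R :> R by rewrite ltr0n.
have [ipp _] := pp_int i0 T'0.
have mono1 (m b b' s : R) : b <= b' -> pp m b s <= pp m b' s.
 move=> bb; rewrite {1}/pp; case: ifPn => [/andP[s0 sb]|_]; last exact: pp_ge0.
 by rewrite /pp s0 (lt_le_trans sb bb).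
have hg : gb (pp i.+1%:R T') 1 i%:R T.
 apply: aeW => s; rewrite ger0_norm ?pp_ge0// mul1r natr1; exact: mono1 (ltW T'T).
have hb := left_bigO hk1 L0 b0 T0 TL ab0 (mfs_pp _ _) (ler0n _ i) ler01 hg.
apply: bigO_ext (bigO_le _ hb); last by apply: eqle; ring.
exists T' => //; apply: (aeS (cvok_ae ik1 ipp)) => t ok1 t0 tT'.
have [ok2 E2] := pp_conv al0 i0 t0 (lt_trans tT' T'T).
have E3 s : pp al T (t - s) * pp i.+1%:R T s = pp al T (t - s) * pp i.+1%:R T' s.
 rewrite /pp; case: ifPn => [/andP[h1 h2]|_]; last by rewrite !mul0r.
 have sT : s < T' by rewrite (lt_trans _ tT')// -subr_gt0.
 by rewrite sT (lt_trans sT T'T).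
have ok3 : itg (fun s => pp al T (t - s) * pp i.+1%:R T' s).
 by move: ok2; rewrite /cvok; under eq_fun do rewrite E3.
have E : cv k (pp i.+1%:R T') t = e 0%N * cv (pp al T) (pp i.+1%:R T) t + cv k1 (pp i.+1%:R T') t.
 rewrite /cv -intZ// -intD//; last exact: itgZ.
 by apply: eqRint => s; rewrite E3 /k ker_recl// -/k1; ring.
by rewrite E E2 -natr1 (_ : al + (i%:R + 1) - 1 = al + i%:R); ring.
Qed.

Section right.
Variable v1 : R.
Hypotheses (v0 : 0 < v1) (v11 : v1 <= 1) (v1L : (1 + v1) * T < L).

(** At the distance [T' > 0] from its singularity the kernel has a convergent Taylor expansion in
    [t], hence is a polynomial up to any order. *)
Lemma ker_refl_polyO (e' : nat -> R) (m L' C' T' z : R) : coefbd e' L' bt C' -> 0 < L' -> 0 < m ->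
 T < L' -> 0 < T' -> T' < T -> (1 + v1) * T < L' -> polyO (fun t => ker e' bt m T (T' - t)) z.
move=> he' L'0 m0 TL' T'0 T'T v1L'.
have [N Nz] : exists N : nat, z <= N%:R.
 by exists (Num.bound `|z|); rewrite ltW// (le_lt_trans (ler_norm _))// archi_boundP.
exists (\poly_(j < N) (cs e' bt m T j T' / T' ^+ j)).
have vi : 0 < v1^-1 by rewrite invr_gt0.
have Ti : 0 < T'^-1 by rewrite invr_gt0.
have K0 := kC1_ge0 m he' L'0 b0 T0 v0 v1L'.
exists (kC1 L' bt C' m T v1 * (T'^-1 / v1) ^+ N * pp m T T'), (Num.min 1 (T' * (v1 / 2))); split.
- by pos.
- by rewrite lt_min ltr01 mulr_gt0// divr_gt0.
apply: aeW => t t0; rewrite lt_min => /andP[t1 tT].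
have h12 : v1 / 2 <= 1 by rewrite ler_pdivrMr// mul1r (le_trans v11)// ler1n.
have tT' : t < T' by rewrite (lt_le_trans tT)// ler_piMr ?(ltW T'0).
rewrite (ker_taylor he' L'0 b0 T0 m0 TL' v0 v11 v1L' N (ltW t0) tT' T'T).
have -> : (\poly_(j < N) (cs e' bt m T j T' / T' ^+ j)).[t] = \sum_(j < N) cs e' bt m T j T' * (t / T') ^+ j.
 by rewrite horner_poly; apply: eq_bigr => j _; rewrite expr_div_n; ring.
rewrite addrC addKr.
have h1 : 0 <= t / T' by pos.
have h2 : t / T' <= v1 / 2 by rewrite ler_pdivrMr// mulrC ltW.
apply: (le_trans (rm_coarse he' L'0 b0 T0 m0 v0 v11 v1L' N (ltW T'T) h1 h2)).
have -> : (t / T' / v1) ^+ N = (T'^-1 / v1) ^+ N * t ^+ N by rewrite -exprMn; congr (_ ^+ _); ring.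
have tn : t ^+ N <= t `^ z by rewrite -powR_mulrn ?(ltW t0)// powR_le_exp// ltW.
rewrite [leRHS]mulrAC; apply: ler_wpM2r; first by pos.
rewrite mulrA; apply: ler_wpM2l => //; by pos.
Qed.

(** Expand [s^i] in powers of [T' - s]. After reflection each power becomes a left convolution
    evaluated at [T' - t], that is another kernel at a point away from 0, so no noninteger power of
    [t] can occur. *)
Lemma mono_right (T' z : R) (i : nat) : 0 < T' -> T' < T -> polyO (rcv k (pp i.+1%:R T')) z.
move=> T'0 T'T.
have [L1 L1a L1b] : exists2 L1, L1 < L & (1 + v1) * T < L1.
 by move: ((1 + v1) * T) v1L => X XL; exists ((X + L) / 2); lra.
have TvT : T < (1 + v1) * T by rewrite mulrDl mul1r ltrDl mulr_gt0.
have TL1' := lt_trans TvT L1b.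
have L10 := lt_trans T0 TL1'.
pose c (l : nat) : R := (-1) ^+ l * T' ^+ (i - l) *+ 'C(i, l).
pose P (l : nat) t := cv k (pp l.+1%:R T') (T' - t).
have hP (l : nat) : polyO (P l) z.
 have l0 : 0 < l.+1%:R :> R by rewrite ltr0n.
 have hC : C <= Num.max C 1 by rewrite le_max lexx.
 have hd : coefbd delta L bt (Num.max C 1) by apply: (coefbd_leC _ (coefbd_delta L bt)); rewrite le_max lexx orbT.
 have [C' hC'] := gcoef_bd L0 b0 al0 l0 (coefbd_leC hC he) hd L10 L1a.
 have hm : 0 < al + l.+1%:R by rewrite addr_gt0.
 apply: polyO_ext (ker_refl_polyO z hC' L10 hm TL1' T'0 T'T L1b).
 exists T' => //; apply: aeW => t t0 tT'.
 have a1 : 0 < T' - t by rewrite subr_gt0.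
 have a2 : T' - t < T by apply: lt_trans T'T; rewrite gtrBl.
 rewrite -(ker_conv L0 b0 T0 TL al0 l0 (coefbd_leC hC he) hd a1 a2) /P /cv.
 apply: eqRint => s.
 rewrite ker_delta; last exact: (kx_geo hd L0 b0 T0 s ltr01 TL1 (one_bd bt _)).
 have [h|h] := ltP 0 (T' - t - s); last first.
  have := ker_bound al he L0 b0 T0 TL (T' - t - s).
  rewrite -/k {1}/pp (ltNge 0) h /= mulr0 normr_le0 => /eqP ->; by rewrite !mul0r.
 congr (_ * _); rewrite /pp; case: (ltP 0 s) => s0 //=.
 have sT' : s < T' by lra.
 by rewrite sT' (lt_trans sT').
apply: polyO_ext (polyO_sum (F := fun (l : 'I_i.+1) t => c l * P l t) (fun l => polyO_Z (c l) (hP l))).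
have okl (l : nat) : {ae mu, forall t, cvok k (pp l.+1%:R T') (T' - t)}.
 have l0 : 0 < l.+1%:R :> R by rewrite ltr0n.
 have [il _] := pp_int l0 T'0.
 exact: (ae_refl T' (cvok_ae ik il)).
exists T' => //; apply: (aeS (aeN okl)) => t okt t0 tT'.
rewrite /P /cv.
transitivity (\sum_(l < i.+1) \int[mu]_s (c l * (k (T' - t - s) * pp l.+1%:R T' s))).
 rewrite -int_sum; last by move=> l; apply: itgZ; exact: okt.
 have iS : itg (fun s => \sum_(l < i.+1) c l * (k (T' - t - s) * pp l.+1%:R T' s)).
  by apply: itg_sum => l; apply: itgZ; exact: okt.
 rewrite -(int_refl T' iS); apply: eqRint => s.
 have -> : T' - t - (T' - s) = s - t by ring.
 rewrite -[RHS](_ : k (s - t) * \sum_(l < i.+1) c l * pp l.+1%:R T' (T' - s) = _); last first.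
  by rewrite mulr_sumr; apply: eq_bigr => l _; ring.
 congr (_ * _); rewrite /pp subr_gt0 gtrBl.
 have [s0|s0] := ltP 0 s; last by rewrite /= big1// => l _; rewrite andbF mulr0.
 have [sT|sT] := ltP s T'; last by rewrite /= big1// => l _; rewrite mulr0.
 rewrite /= -[X in _ `^ X]/(i.+1%:R - 1) -natr1 addrK powR_mulrn ?(ltW s0)//.
 have {1}-> : s = T' - (T' - s) by ring.
 rewrite exprBn; apply: eq_bigr => l _; rewrite /c -natr1 addrK powR_mulrn; last by rewrite subr_ge0 ltW.
 by rewrite mulrnAl.
by apply: eq_bigr => l _; rewrite intZ//; exact: okt.
Qed.

End right.
End one_kernel.
End monomials.

#[local] Opaque powR ker kC kC1 kC2 cs rm Bt.

(** * Flatness at 0 and local vanishing *)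

Section bootstrap.
Variable R : realType.

Lemma int_lin (c : R) (f g h : R -> R) : itg f -> itg g -> (forall s, h s = c * f s + g s) ->
 \int[@lebesgue_measure R]_s h s = c * \int[@lebesgue_measure R]_s f s + \int[@lebesgue_measure R]_s g s.
Proof. by move=> hf hg E; rewrite -intZ// -intD ?(eqRint E)//; exact: itgZ. Qed.

Lemma sixth (l : R) : 0 < l -> 3 * (l / 6) < l.
Proof. lra. Qed.

Lemma half_le (s t : R) : 2 * t <= s -> s / 2 <= s - t.
Proof. lra. Qed.

Lemma half_step1 (a i d x : R) : 0 < d -> d <= x - i -> a + i + d / 2 <= x + a.
Proof. lra. Qed.

Lemma half_step2 (a i d : R) : 0 < d -> d <= 1 - a -> a + i + d / 2 < i + 1.
Proof. lra. Qed.

Notation mu := (@lebesgue_measure R).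
Implicit Types (f g : R -> R) (x y t s : R).
Variables (e eq : nat -> R) (L bt C al mq T T' : R).
Hypotheses (he : coefbd e L bt C) (heq : coefbd eq L bt C) (L0 : 0 < L) (b0 : 0 < bt)
 (T0 : 0 < T) (TL : T < L) (al0 : 0 < al) (al1 : al < 1) (mq0 : 0 < mq)
 (T'0 : 0 < T') (T'T : T' < T) (e0 : e 0%N != 0).
Variable v1 : R.
Hypotheses (v0 : 0 < v1) (v11 : v1 <= 1) (v1L : (1 + v1) * T < L).
Let k := ker e bt al T.
Let q := ker eq bt mq T.
Variables (phi : R -> R) (M c0 g0 ga gb' K : R).
Hypotheses (mphi : mfs phi) (M0 : 0 <= M) (hM : gb phi M 0 T')
 (E1 : {ae mu, forall t, 0 < t -> t < T' -> cv k phi t - rcv k phi t = c0})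
 (K0 : 0 <= K) (g00 : g0 != 0)
 (E2 : {ae mu, forall t, 0 < t -> t < T' ->
   `|g0 * phi t + ga * cv q phi t + gb' * rcv q phi t| <= K * `|cv k phi t|}).

Lemma gb_widen f (A x : R) : 0 <= A -> gb f A x T' -> gb f A x T.
move=> A0 hf; apply: (aeS hf) => s hs; apply: (le_trans hs); apply: ler_wpM2l => //.
rewrite {1}/pp; case: ifPn => [/andP[s0 sb]|_]; last exact: pp_ge0.
by rewrite /pp s0 (lt_trans sb T'T).
Qed.

Let mk : mfs k. Proof. exact: (mfs_ker al he L0 b0 T0 TL). Qed.
Let ik : itg k. Proof. exact: (itg_ker he L0 b0 T0 al0 TL). Qed.
Let iq : itg q. Proof. exact: (itg_ker heq L0 b0 T0 mq0 TL). Qed.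

Lemma rcv_ok f : itg f -> {ae mu, forall t, itg (fun s => k (s - t) * f s)}.
move=> hf; have ik' : itg (fun u => k (- u)).
 by have := itg_refl 0 ik; congr itg; apply/funext => u; rewrite sub0r.
apply: (aeS (cvok_ae ik' hf)) => t; rewrite /cvok; congr itg.
by apply/funext => s; rewrite opprB.
Qed.

Lemma gb_itg f A x : mfs f -> 0 <= x -> gb f A x T' -> itg f.
move=> mf x0 hf; have x1 : 0 < x + 1 by rewrite ltr_wpDl.
have [i1 _] := pp_int x1 T'0.
exact: (itg_ae_dom mf (itgZ A i1)).
Qed.

Lemma iphi : itg phi. Proof. exact: (gb_itg mphi (lexx 0) hM). Qed.

Lemma right_polyO (e' : nat -> R) (m C' f : _) (A x y : R) (N : nat) : coefbd e' L bt C' -> 0 < m ->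
 mfs f -> 0 <= A -> gb f A x T' -> 0 <= x -> y <= x + m ->
 (forall j, (j < N)%N -> j%:R < y) -> y < N%:R -> polyO (rcv (ker e' bt m T) f) y.
move=> he' m0 mf A0 hf x0 yx Ny yN.
have [D D0 h] := right_expand he' L0 b0 T0 TL m0 v0 v11 v1L mf A0 (gb_widen A0 hf) yx Ny yN x0.
exists (\poly_(j < N) ac e' bt m T f j); exists D, (T / (2 / v1)); split => //.
 by rewrite divr_gt0// divr_gt0.
apply: aeW => t t0 tT; rewrite horner_poly; apply: h => //.
by rewrite mulrC -ltr_pdivlMr// divr_gt0.
Qed.

Let th := Num.min al mq.
Let th0 : 0 < th. Proof. by rewrite lt_min al0. Qed.

(** In (E2) every term other than [g0 phi] is a polynomial up to an order improved by the
    convolution; dividing by [g0] expands [phi]. The gain is at least [th / 2], a fixed amount,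
    which also leaves room for a noninteger [y]. *)
Lemma boot_expand A x : 0 <= x -> 0 <= A -> gb phi A x T' ->
 exists y, [/\ x + th / 2 < y & polyO phi y].
move=> x0 A0 hA; have xu : 0 <= x + th / 2 by pos.
have uv : x + th / 2 < x + th by rewrite ltrD2l ltr_pdivrMr// ltr_pMr// ltr1n.
have [y [N [uy yv Ny yN]]] := pick_noninteger xu uv.
exists y; split => //.
have ya : y <= x + al by rewrite (le_trans (ltW yv))// lerD2l ge_min lexx.
have yq : y <= x + mq by rewrite (le_trans (ltW yv))// lerD2l ge_min lexx orbT.
have hA' := gb_widen A0 hA.
have h1 := bigO_le ya (left_bigO he L0 b0 T0 TL al0 mphi x0 A0 hA').
have h2 := bigO_le yq (left_bigO heq L0 b0 T0 TL mq0 mphi x0 A0 hA').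
have h3 := right_polyO heq mq0 mphi A0 hA x0 yq Ny yN.
pose D t := g0 * phi t + ga * cv q phi t + gb' * rcv q phi t.
have hD : bigO D y.
 apply: (bigO_dom (bigO_Z K h1)); exists T' => //.
 by apply: (aeS E2) => t h t0 tT'; rewrite normrM (ger0_norm K0) h.
have := polyO_Z g0^-1 (polyO_D (polyO_of_bigO (bigO_D hD (bigO_Z (- ga) h2))) (polyO_Z (- gb') h3)).
apply: polyO_ext; exists 1 => //; apply: aeW => t _ _.
by rewrite /D -/q; field.
Qed.

(** Strong induction on the degree: the coefficient of [t^i] enters (E1) through the left
    convolution as a nonzero multiple of [t^(al+i)], while everything else in (E1) is a polynomial
    up to a higher order. By [polyO_pow_inv] the coefficient is 0. *)
Lemma boot_flat y : polyO phi y -> bigO phi y.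
move=> [p hp].
suff H : forall j, j%:R < y -> p`_j = 0.
 apply: bigO_ext (bigO_D hp (poly_bigO H)).
 by exists 1 => //; apply: aeW => t _ _; rewrite subrK.
elim/ltn_ind => i ih iy.
pose x := Num.min (i.+1%:R) y.
have ix : i%:R < x by rewrite /x lt_min iy ltr_nat ltnSn.
have x0 : 0 <= x by rewrite (le_trans _ (ltW ix)).
pose P := pp i.+1%:R T'.
have i0 : 0 < i.+1%:R :> R by rewrite ltr0n.
have [iP _] := pp_int i0 T'0.
pose psi t := phi t - p`_i * P t.
have mpsi : mfs psi.
 by apply: mfsB => //; apply: mfsM => //; exact: mfs_pp.
have psiM : gb psi (M + `|p`_i| * T' `^ i%:R) 0 T'.
 apply: (aeS hM) => s hs; rewrite (le_trans (ler_normB _ _))// mulrDl lerD// normrM.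
 rewrite -mulrA; apply: ler_wpM2l => //; rewrite ger0_norm ?pp_ge0// /P /pp add0r subrr powRr0.
 case: ifPn => [/andP[s0 sT]|_]; last by rewrite mulr0.
 by rewrite mulr1 -natr1 addrK ge0_ler_powR ?nnegrE ?(ltW s0) ?(ltW sT) ?(ltW T'0).
have psiO : bigO psi x.
 have hq : bigO (horner (p - p`_i *: 'X^i)) x.
  apply: poly_bigO => j jx; rewrite coefB coefZ coefXn.
  have : (j <= i)%N by move: jx; rewrite lt_min ltr_nat ltnS => /andP[].
  rewrite leq_eqVlt => /orP[/eqP ->|ij]; first by rewrite eqxx mulr1 subrr.
  by rewrite (ltn_eqF ij) mulr0 subr0 ih// (lt_trans _ iy)// ltr_nat.
 apply: bigO_ext (bigO_D (bigO_le _ hp) hq); last by rewrite /x ge_min lexx orbT.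
 exists T' => //; apply: aeW => t t0 tT; rewrite /psi /P /pp t0 tT /= -natr1 addrK.
 rewrite hornerD hornerN hornerZ hornerXn powR_mulrn ?(ltW t0)//; ring.
have M'0 : 0 <= M + `|p`_i| * T' `^ i%:R by pos.
have [A A0 hA] := bigO_gb M'0 T'0 x0 psiM psiO.
have ipsi : itg psi by exact: (gb_itg mpsi x0 hA).
have hA' := gb_widen A0 hA.
(* The half of [d] puts [z = al + i + d / 2] strictly above [al + i], strictly below [i + 1], and
   within the order [x + al] to which convolutions of [psi] are known. *)
pose d := Num.min (x - i%:R) (1 - al).
have d0 : 0 < d by rewrite lt_min !subr_gt0 ix.
pose z := al + i%:R + d / 2.
have dx : d <= x - i%:R by rewrite ge_min lexx.
have da : d <= 1 - al by rewrite ge_min lexx orbT.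
have zx : z <= x + al by exact: half_step1.
have iz : al + i%:R < z by rewrite ltrDl divr_gt0.
have zi : z < i.+1%:R.
 by rewrite -natr1; exact: half_step2.
have Ny j : (j < i.+1)%N -> j%:R < z.
 rewrite ltnS => ji; apply: (@le_lt_trans _ _ i%:R); first by rewrite ler_nat.
 by apply: lt_trans iz; rewrite ltrDr.
have h_r := right_polyO he al0 mpsi A0 hA x0 zx Ny zi.
have h_l := bigO_le zx (left_bigO he L0 b0 T0 TL al0 mpsi x0 A0 hA').
have h_ml := mono_left he L0 b0 T0 TL al0 i T'0 T'T.
have h_mr := mono_right he L0 b0 T0 TL al0 v0 v11 v1L z i T'0 T'T.
pose z' := Num.min z (al + i%:R + bt).
have z'1 : z' <= z by rewrite ge_min lexx.
have z'2 : z' <= al + i%:R + bt by rewrite ge_min lexx orbT.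
have iz' : al + i%:R < z' by rewrite lt_min iz ltrDl.
have hc0 : polyO (fun=> c0) z'.
 exists c0%:P; exists 0, 1; split => //; apply: aeW => t _ _.
 by rewrite hornerC subrr normr0 mul0r.
have B0 := Bt_gt0 al0 i0.
have : p`_i * (e 0%N * Bt al i.+1%:R) = 0.
 apply: (@polyO_pow_inv _ _ (al + i%:R) z') => //; first by pos.
  move=> j; apply/eqP => ji.
  have [h|h] := leqP j i.
   have : (j%:R : R) <= i%:R by rewrite ler_nat.
   by rewrite ji gerDr leNgt al0.
  have : (i.+1%:R : R) <= j%:R by rewrite ler_nat.
  by rewrite ji -natr1 addrC lerD2r leNgt al1.
 have := polyO_D (polyO_D hc0 (polyO_of_bigO (bigO_Z (-1) (bigO_le z'1 h_l))))
  (polyO_D (polyO_D (polyO_le z'1 h_r) (polyO_Z p`_i (polyO_le z'1 h_mr)))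
    (polyO_of_bigO (bigO_Z (- p`_i) (bigO_le z'2 h_ml)))).
 apply: polyO_ext; exists T' => //.
 have ok1 := cvok_ae ik iP; have ok2 := cvok_ae ik ipsi.
 have ok3 := rcv_ok iP; have ok4 := rcv_ok ipsi.
 apply: (aeS2 (aeS2 ok1 ok2 (fun t a b => conj a b)) (aeS2 (aeS2 ok3 ok4 (fun t a b => conj a b)) E1 (fun t a b => conj a b))).
 move=> t ho hoe t0 tT; case: ho => o1 o2; case: hoe => ho3 E; case: ho3 => o3 o4.
 have El : cv k phi t = p`_i * cv k P t + cv k psi t.
  by apply: (int_lin (c := p`_i) (h := fun s => k (t - s) * phi s) o1 o2) => s; rewrite /psi /P; ring.
 have Er : rcv k phi t = p`_i * rcv k P t + rcv k psi t.
  by apply: (int_lin (c := p`_i) (h := fun s => k (s - t) * phi s) o3 o4) => s; rewrite /psi /P; ring.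
 by rewrite -(E t0 tT) El Er -/P -/k; ring.
by move/eqP; rewrite !mulf_eq0 (negbTE e0) (gt_eqF B0) !orbF => /eqP.
Qed.

(** Each round of [boot_expand] and [boot_flat] raises the order by [th / 2]. *)
Lemma flat x : 0 <= x -> exists2 A, 0 <= A & gb phi A x T'.
have H (n : nat) : exists2 A, 0 <= A & gb phi A (n%:R * (th / 2)) T'.
 elim: n => [|n [A A0 hA]]; first by exists M; rewrite // mul0r.
 have x0 : 0 <= n%:R * (th / 2) by pos.
 have [y [hy /boot_flat hp]] := boot_expand x0 A0 hA.
 have x1 : 0 <= n.+1%:R * (th / 2) by pos.
 apply: (bigO_gb M0 T'0 x1 hM); apply: bigO_le hp.
 by rewrite -natr1 mulrDl mul1r ltW.
move=> x0; have t2 : 0 < th / 2 by rewrite divr_gt0.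
have := archi_boundP (divr_ge0 x0 (ltW t2)); set n := Num.bound _ => hn.
have [A A0 hA] := H n; apply: (bigO_gb M0 T'0 x0 hM).
by apply: bigO_le (gb_bigO A0 T'0 hA); rewrite -ler_pdivrMr// ltW.
Qed.

(** * A Carleman type estimate for the right convolution *)

Section carleman.
Variables (sh rs r : R).
Hypotheses (sh0 : 0 < sh) (sh1 : sh <= 2^-1) (shm : sh <= mq) (rs0 : 0 < rs) (rsL : 3 * rs < L)
 (rsT : rs <= T') (r0 : 0 < r) (rrs : r <= rs).
Let K2 := kC2 L bt C mq rs.
Let K1 := kC1 L bt C mq T v1.
Let K20 : 0 <= K2. Proof. exact: (kC2_ge0 mq heq L0 b0 rs0 rsL). Qed.
Let K10 : 0 <= K1. Proof. exact: (kC1_ge0 mq heq L0 b0 T0 v0 v1L). Qed.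
(** Contributions of the low moments, of [t < s < 2 t] and of [s >= 2 t], in this order; none of
    them depends on [N]. *)
Let Dc := 4 / sh + sh^-1 + 4.

Lemma powR_half_le s : 0 < s -> (s / 2) `^ (sh - 1) <= 2 * s `^ (sh - 1).
move=> s0; rewrite powRM ?invr_ge0 ?(ltW s0)// mulrC ler_wpM2r ?powR_ge0//.
by apply: half_powR_le => //; rewrite invf_le1 ?ler1n.
Qed.

Variables (B A : R) (N : nat) (t : R).
(** A half-integer stays at distance at least 1/2 from every integer, so
    [1 / (y - j) <= 2 / (N - j)], the weights of [bc_sum_refl]. *)
Let y : R := N%:R - 2^-1.
Let lam : R := y - mq.
Hypotheses (B0 : 0 <= B) (lam0 : 0 <= lam) (A0 : 0 <= A) (hA : gb phi A lam T')
 (hB : {ae mu, forall s, 0 < s -> s < r -> `|phi s| <= B * s `^ lam})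
 (t0 : 0 < t) (tr : t <= r * (v1 / 2)).

Let h2 : 0 < 2^-1 :> R. Proof. by rewrite invr_gt0. Qed.
Let v12 : v1 / 2 <= 1. Proof. by rewrite ler_pdivrMr// mul1r (le_trans v11)// ler1n. Qed.
Let tr' : t <= r. Proof. by rewrite (le_trans tr)// ler_piMr// ltW. Qed.
Let y0 : 0 < y. Proof. by have := lam0; rewrite /lam subr_ge0; exact: lt_le_trans. Qed.
Let Ny j : (j < N)%N -> j%:R < y.
move=> jN; rewrite /y ltrBrDr; apply: (@lt_le_trans _ _ (j.+1%:R)); last by rewrite ler_nat.
by rewrite -[in ltRHS]natr1 ltrD2l invf_lt1// ltr1n.
Qed.
Let yN : y < N%:R. Proof. by rewrite gtrBl. Qed.
Let ylam : y <= lam + mq. Proof. by rewrite subrK. Qed.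
Let rT1 : r <= T. Proof. exact: (le_trans (le_trans rrs rsT) (ltW T'T)). Qed.
Let rsT1 : rs <= T. Proof. exact: (le_trans rsT (ltW T'T)). Qed.

Lemma carl_hc j : (j < N)%N -> `|\int[mu]_s (hc eq bt mq T phi j s * (s <= t)%R%:R)| <=
  K2 * bc sh j * B * (t `^ (y - j%:R) / (y - j%:R)).
move=> jN; have yj : 0 < y - j%:R by rewrite subr_gt0 Ny.
have b0' : 0 <= bc sh j by apply: bc_ge0 => //; apply: (le_trans sh1); rewrite invf_le1// ler1n.
have [i3 e3] := pp_int yj t0.
have mi : mfs (fun s => hc eq bt mq T phi j s * (s <= t)%R%:R).
 apply: mfsM; last exact: mfs_le_ind.
 exact: (mfs_hc heq L0 b0 T0 mq0 v0 v11 v1L mphi).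
rewrite -e3 -intZ//.
suff d2 : {ae mu, forall s, `|hc eq bt mq T phi j s * (s <= t)%R%:R| <=
  (K2 * bc sh j * B) * pp (y - j%:R) t s}.
 by have [_] := int_ae_dom mi (itgZ _ i3) d2.
apply: (aeS2 hB (ae_neq t)) => s hs st; rewrite normrM normr_nat.
have [h|h] := leP s t; last by rewrite mulr0; pos.
have st' : s < t by rewrite lt_neqAle st.
have sr : s <= r by exact: le_trans tr'.
have h1 := cs_sharp heq L0 b0 sh0 sh1 shm rs0 rsL rsT1 j (le_trans sr rrs).
rewrite mulr1 /hc !normrM (ger0_norm (powR_ge0 _ _)).
have [s0|s0] := ltP 0 s; last first.
 have -> : cs eq bt mq T j s = 0.
  apply/eqP; rewrite -normr_le0; apply: (le_trans h1).
  by rewrite /pp (ltNge 0 s) s0 /= mulr0.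
 by rewrite normr0 !mul0r; pos.
have {}hs := hs s0 (lt_le_trans st' tr').
apply: (@le_trans _ _ ((K2 * bc sh j * pp mq T s) * s `^ (- j%:R) * (B * s `^ lam))).
 apply: ler_pM; [by pos|by pos| |exact: hs].
 by rewrite ler_wpM2r ?powR_ge0.
rewrite /pp s0 st' (lt_le_trans st' (le_trans tr' rT1)) /=.
have -> : K2 * bc sh j * s `^ (mq - 1) * s `^ (- j%:R) * (B * s `^ lam) =
 K2 * bc sh j * B * (s `^ (mq - 1) * s `^ (- j%:R) * s `^ lam) by ring.
rewrite -!powRD_pos//; apply: eqle; congr (_ * _ `^ _).
by rewrite /lam; ring.
Qed.

(** Majorant of the remainder on three ranges: the singular part [t < s < 2 t], the tail from [2 t]
    up to [r], and [s >= r], where [|phi| <= M] is combined with the coarse bound. *)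
Let G s := K2 * B * (t `^ (y - sh) * pp sh t (s - t) + 2 * t ^+ N * pt (2^-1) (2 * t) s) +
 K1 * M * (t / (r * v1)) ^+ N * pp mq T s.

Lemma carl_rm : {ae mu, forall s, `|rm eq bt mq T N (t / s) s * phi s * (t < s)%R%:R| <= G s}.
have q0 : 0 <= t / (r * v1) by pos.
apply: (aeS2 (aeS2 hB hM (fun s a b => conj a b)) (ae_neq (2 * t))) => s h1h3 s2t.
case: h1h3 => h1 h3.
have G1 : 0 <= K2 * B * (t `^ (y - sh) * pp sh t (s - t) + 2 * t ^+ N * pt (2^-1) (2 * t) s) by pos.
have G2 : 0 <= K1 * M * (t / (r * v1)) ^+ N * pp mq T s by pos.
have [ts|ts] := ltP t s; last by rewrite mulr0 normr0 /G; pos.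
have s0 : 0 < s by exact: lt_trans ts.
have q1 : 0 <= t / s by pos.
have q2 : t / s < 1 by rewrite ltr_pdivrMr// mul1r.
rewrite mulr1 normrM.
have [sT|sT] := ltP s T'; last first.
 move: h3; rewrite {1}/pp (ltNge s T') sT andbF mulr0 normr_le0 => /eqP ->.
 by rewrite normr0 mulr0 /G; pos.
have sT1 : s < T by exact: lt_trans T'T.
have [sr|rs'] := ltP s r; last first.
 rewrite /G; apply: (@le_trans _ _ (K1 * M * (t / (r * v1)) ^+ N * pp mq T s)); last by rewrite lerDr.
 have q3 : t / s <= v1 / 2.
  rewrite ler_pdivrMr//; apply: (le_trans tr); rewrite mulrC; apply: ler_wpM2l => //; by pos.
 have hr := rm_coarse heq L0 b0 T0 mq0 v0 v11 v1L N (ltW sT1) q1 q3.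
 have hm : `|phi s| <= M.
  apply: (le_trans h3); rewrite /pp s0 sT add0r subrr powRr0 mulr1; exact: lexx.
 apply: (le_trans (ler_pM _ _ hr hm)); [by pos|by pos|].
 rewrite -/K1 [leRHS](_ : _ = K1 * (t / (r * v1)) ^+ N * pp mq T s * M); last by ring.
 apply: ler_wpM2r => //; apply: ler_wpM2r; first by pos.
 apply: ler_wpM2l => //; rewrite lerXn2r ?nnegrE//; first by pos.
 rewrite -mulrA invfM; apply: ler_wpM2l; first exact: ltW.
 apply: ler_wpM2r; first by pos.
 by rewrite lef_pV2 ?posrE.
rewrite /G; apply: ler_wpDr => //.
have hr := rm_sharp heq L0 b0 sh0 sh1 shm rs0 rsL rsT1 N (le_trans (ltW sr) rrs) q1 q2.
apply: (le_trans (ler_pM _ _ hr (h1 s0 sr))); [by pos|by pos|].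
have st0 : 0 < s - t by rewrite subr_gt0.
(* The choice [lam = y - mq] cancels both [N] and [mq] from the power of [s], leaving a majorant
   whose shape does not change with [N]. *)
have E : (t / s) ^+ N * (1 - t / s) `^ (sh - 1) * pp mq T s * s `^ lam =
  t ^+ N * ((s - t) `^ (sh - 1) * s `^ (- sh - 2^-1)).
 have -> : 1 - t / s = (s - t) / s by field; rewrite gt_eqF.
 rewrite powRM ?invr_ge0 ?(ltW st0) ?(ltW s0)// /pp s0 sT1 /= expr_div_n.
 have -> : (s ^+ N)^-1 = s `^ (- N%:R) by rewrite powRN powR_mulrn// ltW.
 have -> : s^-1 `^ (sh - 1) = s `^ (1 - sh).
  by rewrite -powR_inv1 ?(ltW s0)// -powRrM; congr (_ `^ _); ring.
 have -> : t ^+ N * s `^ (- N%:R) * ((s - t) `^ (sh - 1) * s `^ (1 - sh)) * s `^ (mq - 1) * s `^ lam =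
  t ^+ N * ((s - t) `^ (sh - 1) * (s `^ (- N%:R) * s `^ (1 - sh) * s `^ (mq - 1) * s `^ lam)) by ring.
 rewrite -!powRD_pos//; congr (_ * (_ * _ `^ _)).
 by rewrite /lam /y; ring.
have -> : kC2 L bt C mq rs * ((t / s) ^+ N * (1 - t / s) `^ (sh - 1)) * pp mq T s * (B * s `^ lam) =
 K2 * B * ((t / s) ^+ N * (1 - t / s) `^ (sh - 1) * pp mq T s * s `^ lam) by rewrite /K2; ring.
rewrite E; apply: ler_wpM2l; first by pos.
have [h|h] := ltP s (2 * t).
 apply: ler_wpDr; first by pos.
 rewrite /pp st0 (_ : s - t < t); last by rewrite ltrBlDr -mulr2n -mulr_natl.
 rewrite /= [in leRHS]mulrC mulrCA; apply: ler_wpM2l; first by pos.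
 have -> : y - sh = N%:R + (- sh - 2^-1) by rewrite /y; ring.
 rewrite (powRD_pos N%:R)// powR_mulrn ?(ltW t0)//; apply: ler_wpM2l; first by pos.
 rewrite -opprD !powRN lef_pV2 ?posrE ?powR_gt0//.
 by rewrite ge0_ler_powR ?nnegrE ?(ltW t0) ?(ltW s0) ?(ltW ts)//; pos.
apply: ler_wpDl; first by pos.
have h' : 2 * t < s by rewrite lt_neqAle eq_sym s2t.
rewrite /pt h' [2 * _]mulrC -mulrA; apply: ler_wpM2l; first by pos.
have -> : - 2^-1 - 1 = (sh - 1) + (- sh - 2^-1) :> R by ring.
rewrite (powRD_pos (sh - 1))// mulrA; apply: ler_wpM2r; first by pos.
apply: (le_trans _ (powR_half_le s0)).
have s20 : 0 < s / 2 by rewrite divr_gt0.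
have e1 z : 0 < z -> z `^ (sh - 1) = (z `^ (1 - sh))^-1 by move=> z0; rewrite -powRN opprB.
rewrite !e1// lef_pV2 ?posrE ?powR_gt0//.
have sh1' : 0 <= 1 - sh by rewrite subr_ge0 (le_trans sh1)// invf_le1// ler1n.
rewrite ge0_ler_powR ?nnegrE ?(ltW s20) ?(ltW st0)//.
exact: half_le.
Qed.

(** The factor of [B] is uniform in [N], which the coarse expansion does not give. The cut is at
    [s = t], where the kernel begins, so the near part is empty; [M] enters only through a term
    small like [(t / (r v1))^N]. *)
Lemma carl_right : `|rcv q phi t - \sum_(j < N) ac eq bt mq T phi j * t ^+ j| <=
 K2 * B * Dc * t `^ y + K1 * M * (T `^ mq / mq) * (t / (r * v1)) ^+ N.
have shi : sh <= 1 by apply: (le_trans sh1); rewrite invf_le1// ler1n.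
have z0 s : q (s - t) * (phi s * (s <= t)%R%:R) = 0.
 have [h|h] := leP s t; last by rewrite !mulr0.
 suff -> : q (s - t) = 0 by rewrite mul0r.
 apply/eqP; rewrite -normr_le0; apply: (le_trans (ker_bound mq heq L0 b0 T0 TL (s - t))).
 by rewrite /pp subr_gt0 (ltNge t s) h /= mulr0.
have i1 : itg (fun s => q (s - t) * (phi s * (s <= t)%R%:R)).
 by rewrite (funext z0); exact: itg0.
have P1 := pp_int sh0 t0; have P3 := pp_int mq0 T0; have g3 := P3.1.
have t20 : 0 < 2 * t by rewrite mulr_gt0.
have P2 := pt_int h2 t20; have g2 := P2.1; have g1' := itg_shift t P1.1.
have ig12 : itg (fun s => t `^ (y - sh) * pp sh t (s - t) + 2 * t ^+ N * pt (2^-1) (2 * t) s).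
 by apply: itgD; apply: itgZ.
have iG : itg G by apply: itgD; apply: itgZ.
have H := right_split_int heq L0 b0 T0 TL mq0 v0 v11 v1L mphi A0 (gb_widen A0 hA) ylam Ny t0 (lexx t) i1 iG carl_rm.
apply: (le_trans H) => {H}.
rewrite (eqRint z0) (_ : \int[mu]_x 0 = 0); last by rewrite /Rintegral integral0.
rewrite normr0 add0r /G intD; [|exact: itgZ..].
rewrite !intZ// intD; [|exact: itgZ..].
rewrite !intZ// (int_shift t P1.1) P1.2 P2.2 P3.2 addrA; apply: lerD; last by apply: eqle; ring.
have S1 : \sum_(j < N) t ^+ j * `|\int[mu]_s (hc eq bt mq T phi j s * (s <= t)%R%:R)| <=
  K2 * B * (4 / sh) * t `^ y.
 apply: (@le_trans _ _ (\sum_(j < N) K2 * B * t `^ y * 2 * (bc sh j / (N - j)%:R))).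
  apply: ler_sum => j _.
  have tj : 0 <= t ^+ j by rewrite exprn_ge0// ltW.
  apply: (le_trans (ler_wpM2l tj (carl_hc (ltn_ord j)))).
  have b0' : 0 <= bc sh j by exact: bc_ge0.
  have -> : t `^ (y - j%:R) = t `^ y / t ^+ j.
   by rewrite powRD_pos// powRN powR_mulrn// ltW.
  have tjn : t ^+ j != 0 by rewrite expf_neq0// gt_eqF.
  have -> : t ^+ j * (K2 * bc sh j * B * (t `^ y / t ^+ j / (y - j%:R))) =
    K2 * B * t `^ y * (bc sh j * (y - j%:R)^-1).
   by move: ((y - j%:R)^-1) => Y; field.
  have -> : K2 * B * t `^ y * 2 * (bc sh j / (N - j)%:R) =
    K2 * B * t `^ y * (bc sh j * (2 / (N - j)%:R)) by ring.
  apply: ler_wpM2l; first by pos.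
  apply: ler_wpM2l => //.
  have jN : (0 < N - j)%N by rewrite subn_gt0.
  have yj : 0 < y - j%:R by rewrite subr_gt0 Ny.
  rewrite -[leRHS]invrK lef_pV2 ?posrE ?invr_gt0 ?divr_gt0 ?ltr0n//.
  rewrite invf_div /y natrB ?(ltnW (ltn_ord j))//.
  have : (1 : R) <= (N - j)%:R by rewrite ler1n.
  rewrite natrB ?(ltnW (ltn_ord j))//; move: (N%:R : R) ((nat_of_ord j)%:R : R) => a b'; lra.
 rewrite -mulr_sumr.
 have hs := bc_sum_refl N sh0 shi.
 have -> : K2 * B * (4 / sh) * t `^ y = K2 * B * t `^ y * 2 * (2 / sh) by ring.
 by apply: ler_wpM2l => //; pos.
have -> : K2 * B * Dc * t `^ y = K2 * B * (4 / sh) * t `^ y + K2 * B * ((sh^-1 + 4) * t `^ y).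
 by rewrite /Dc; ring.
apply: lerD => //; apply: ler_wpM2l; first by pos.
rewrite [leRHS]mulrDl; apply: lerD.
 by rewrite mulrA -powRD_pos// subrK mulrC.
have -> : 4 * t `^ y = 2 * t ^+ N * (t `^ (- 2^-1) * 2).
 rewrite /y powRD_pos// powR_mulrn ?(ltW t0)//; ring.
rewrite ler_wpM2l//; first by pos.
rewrite invrK ler_wpM2r// !powRN lef_pV2 ?posrE ?powR_gt0//.
rewrite ge0_ler_powR ?nnegrE ?(ltW t0) ?(ltW t20) ?(ltW h2)//.
by rewrite ler_pMl// ler1n.
Qed.

End carleman.

Lemma left_bound (e' : nat -> R) (m r lam B t : R) : coefbd e' L bt C -> 0 < m -> 0 <= lam -> 0 <= B ->
 {ae mu, forall s, 0 < s -> s < r -> `|phi s| <= B * s `^ lam} -> 0 < t -> t < r -> t < T ->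
 `|cv (ker e' bt m T) phi t| <= kC L bt C T * B * t `^ lam * (t `^ m / m).
move=> he' m0 lam0 B0 hB t0 tr tT.
have K0' : 0 <= kC L bt C T by exact: (kC_ge0 he' L0 b0 T0 TL).
have [i1 e1] := pp_int m0 t0.
have i2 := itg_refl t i1; have e2 := int_refl t i1.
have mi : mfs (fun s : R => ker e' bt m T (t - s) * phi s).
 apply: mfsM mphi; apply: mfs_subl.
 exact: (mfs_ker m he' L0 b0 T0 TL).
rewrite -e1 -e2 -intZ//.
suff d : {ae mu, forall s, `|ker e' bt m T (t - s) * phi s| <= kC L bt C T * B * t `^ lam * pp m t (t - s)}.
 by have [_] := int_ae_dom mi (itgZ _ i2) d.
apply: (aeS2 hB hM) => s h1 h2.
have [s0|s0] := ltP 0 s; last first.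
 move: h2; rewrite {1}/pp (ltNge 0 s) s0 /= mulr0 normr_le0 => /eqP ->.
 by rewrite mulr0 normr0; pos.
have hk := ker_bound m he' L0 b0 T0 TL (t - s).
have [ts|st] := leP t s.
 move: hk; rewrite /pp subr_gt0 (ltNge s t) ts /= mulr0 normr_le0 => /eqP ->.
 by rewrite mul0r normr0 mulr0.
rewrite normrM.
have -> : kC L bt C T * B * t `^ lam * pp m t (t - s) = (kC L bt C T * pp m t (t - s)) * (B * t `^ lam) by ring.
apply: ler_pM; [by pos|by pos| |].
 apply: (le_trans hk); apply: ler_wpM2l => //.
 by rewrite /pp subr_gt0 st gtrBl s0 (lt_trans _ tT) ?gtrBl.
apply: (le_trans (h1 s0 (lt_trans st tr))); apply: ler_wpM2l => //.
by rewrite ge0_ler_powR ?nnegrE ?(ltW s0) ?(ltW t0) ?(ltW st).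
Qed.

(** By flatness all terms of (E2) except the polynomial are [O(t^y)], and a polynomial of degree
    below [N] that is [O(t^y)] with [y > N - 1] is 0. The factor [gb'] stays inside because it may
    be 0. *)
Lemma poly_vanish (N : nat) (A : R) : let y := N%:R - 2^-1 in 0 <= y - mq -> 0 <= A ->
 gb phi A (y - mq) T' -> forall t, gb' * \sum_(j < N) ac eq bt mq T phi j * t ^+ j = 0.
move=> y lam0 A0 hA t.
have y0 : 0 < y by apply: (lt_le_trans mq0); rewrite -subr_ge0.
have Ny j : (j < N)%N -> j%:R < y.
 move=> jN; rewrite /y ltrBrDr; apply: (@lt_le_trans _ _ (j.+1%:R)); last by rewrite ler_nat.
 by rewrite -[in ltRHS]natr1 ltrD2l invf_lt1// ltr1n.
have yN : y < N%:R by rewrite gtrBl invr_gt0.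
have ylam : y <= y - mq + mq by rewrite subrK.
have [D D0 h] := right_expand heq L0 b0 T0 TL mq0 v0 v11 v1L mphi A0 (gb_widen A0 hA) ylam Ny yN lam0.
have h3 : bigO (fun t => rcv q phi t - \sum_(j < N) ac eq bt mq T phi j * t ^+ j) y.
 exists D, (T / (2 / v1)); split => //; first by rewrite divr_gt0// divr_gt0.
 apply: aeW => u u0 uT; apply: h => //.
 by rewrite mulrC -ltr_pdivlMr// divr_gt0.
have [A' A'0 hA'] := flat (ler0n R N).
have NA : y <= N%:R + al by rewrite (le_trans (ltW yN))// lerDl ltW.
have NQ : y <= N%:R + mq by rewrite (le_trans (ltW yN))// lerDl ltW.
have hA'' := gb_widen A'0 hA'.
have h1 := bigO_le NA (left_bigO he L0 b0 T0 TL al0 mphi (ler0n R N) A'0 hA'').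
have h2 := bigO_le NQ (left_bigO heq L0 b0 T0 TL mq0 mphi (ler0n R N) A'0 hA'').
have h4 := bigO_le (ltW yN) (gb_bigO A'0 T'0 hA').
pose D' u := g0 * phi u + ga * cv q phi u + gb' * rcv q phi u.
have hD : bigO D' y.
 apply: (bigO_dom (bigO_Z K h1)); exists T' => //.
 by apply: (aeS E2) => u hu u0 uT'; rewrite normrM (ger0_norm K0) hu.
pose p := \poly_(j < N) (gb' * ac eq bt mq T phi j).
have pE u : p.[u] = gb' * \sum_(j < N) ac eq bt mq T phi j * u ^+ j.
 by rewrite horner_poly mulr_sumr; apply: eq_bigr => j _; ring.
have hp : bigO (horner p) y.
 have := bigO_D (bigO_D hD (bigO_D (bigO_Z (- g0) h4) (bigO_Z (- ga) h2))) (bigO_Z (- gb') h3).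
 apply: bigO_ext; exists 1 => //; apply: aeW => u _ _; rewrite pE /D' -/q; ring.
have hp0 := bigO_poly hp.
rewrite -pE horner_poly big1// => j _.
by have := hp0 j (Ny _ (ltn_ord j)); rewrite coef_poly ltn_ord => ->; rewrite mul0r.
Qed.

(** For each large [N] a bound [|phi| <= B s^lam] near 0 improves to [B / 2 + A1 / ro^lam];
    iteration from the flatness bound removes its unknown constant and leaves
    [(2 A1 + 1) (s / ro)^lam]. As [A1], [r] and [ro] do not depend on [N], letting [N] grow gives 0
    for [s < ro]. *)
Lemma local_vanish : exists2 r, 0 < r & {ae mu, forall t, 0 < t -> t < r -> phi t = 0}.
pose sh := Num.min 2^-1 mq.
have sh0 : 0 < sh by rewrite /sh lt_min invr_gt0 ltr0n.
have sh1 : sh <= 2^-1 by rewrite ge_min lexx.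
have shm : sh <= mq by rewrite ge_min lexx orbT.
pose rs := Num.min (L / 6) T'.
have rs0 : 0 < rs by rewrite /rs lt_min divr_gt0.
have rsL : 3 * rs < L.
 apply: (@le_lt_trans _ _ (3 * (L / 6))); last exact: sixth.
 by rewrite ler_wpM2l// /rs ge_min lexx.
have rsT : rs <= T' by rewrite /rs ge_min lexx orbT.
have g0' : 0 < `|g0| by rewrite normr_gt0.
set KC := kC L bt C T; have KC0 : 0 <= KC by exact: (kC_ge0 he L0 b0 T0 TL).
set K2 := kC2 L bt C mq rs; have K20 : 0 <= K2 by exact: (kC2_ge0 mq heq L0 b0 rs0 rsL).
set K1 := kC1 L bt C mq T v1; have K10 : 0 <= K1 by exact: (kC1_ge0 mq heq L0 b0 T0 v0 v1L).
set Dc := 4 / sh + sh^-1 + 4; have Dc0 : 0 <= Dc by rewrite /Dc; pos.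
pose S := K * KC / al + `|ga| * KC / mq + `|gb'| * K2 * Dc.
have S0 : 0 <= S by rewrite /S; pos.
have S1 : 0 < S + 1 by rewrite ltr_wpDl.
(* Below [r1] the total coefficient [S t^th] of the three convolutions is at most half of [|g0|],
   whatever [N]. *)
have [r1 r10 hr1] := powR_small th0 (divr_gt0 g0' (mulr_gt0 (ltr0n R 2) S1)).
pose r := Num.min 1 (Num.min rs r1).
have r0 : 0 < r by rewrite /r lt_min ltr01 lt_min rs0.
have rrs : r <= rs by rewrite /r ge_min ge_min lexx orbT.
have rr1 : r <= r1 by rewrite /r ge_min ge_min lexx !orbT.
have rle1 : r <= 1 by rewrite /r ge_min lexx.
have rT : r < T := le_lt_trans (le_trans rrs rsT) T'T.
have rT' : r <= T' := le_trans rrs rsT.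
pose ro := r * (v1 / 2).
have ro0 : 0 < ro by rewrite mulr_gt0// divr_gt0.
have v12 : v1 / 2 < 1 by rewrite ltr_pdivrMr// mul1r (le_lt_trans v11)// ltr1n.
have ror : ro < r by rewrite /ro gtr_pMr.
pose A1 := `|gb'| * K1 * M * (T `^ mq / mq) / `|g0| + M.
have A10 : 0 <= A1 by rewrite /A1; pos.
pose y (N : nat) : R := N%:R - 2^-1.
pose lam N := y N - mq.
pose SS N B := {ae mu, forall s, 0 < s -> s < r -> `|phi s| <= B * s `^ lam N}.
have step N A B : 0 <= lam N -> 0 <= A -> gb phi A (lam N) T' -> 0 <= B -> SS N B ->
  SS N (B / 2 + A1 / ro `^ lam N).
 move=> lam0 A0 hA B0 hB.
 apply: (aeS2 E2 hM) => t hE2 hMt t0 tr.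
 have tlam : 0 < t `^ lam N by exact: powR_gt0.
 have rolam : 0 < ro `^ lam N by exact: powR_gt0.
 have [tro|tro] := leP t ro; last first.
  have h : `|phi t| <= M.
   apply: (le_trans hMt); rewrite /pp t0 (lt_le_trans tr rT') add0r subrr powRr0 mulr1; exact: lexx.
  apply: (le_trans h); rewrite mulrDl; apply: ler_wpDl; first by pos.
  rewrite mulrAC ler_pdivlMr//; apply: ler_pM; [by []|by pos| |].
   by rewrite /A1 lerDr; pos.
  by rewrite ge0_ler_powR ?nnegrE ?(ltW t0) ?(ltW ro0) ?(ltW tro).
 have tT := lt_trans tr rT; have tT' := lt_le_trans tr rT'.
 have c1 := left_bound he al0 lam0 B0 hB t0 tr tT.
 have c2 := left_bound heq mq0 lam0 B0 hB t0 tr tT.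
 have c3 := carl_right sh0 sh1 shm rs0 rsL rsT r0 rrs B0 A0 hA hB t0 tro.
 have pv := poly_vanish lam0 A0 hA t.
 have t1 : t <= 1 by exact: le_trans (ltW tr) rle1.
 have tal : t `^ al <= t `^ th by rewrite powR_le_exp// ge_min lexx.
 have tmq : t `^ mq <= t `^ th by rewrite powR_le_exp// ge_min lexx orbT.
 have tth : t `^ th * (S + 1) * 2 <= `|g0|.
  have := hr1 t t0 (lt_le_trans tr rr1); rewrite ltr_pdivlMr ?mulr_gt0// => /ltW.
  by rewrite (mulrC 2) mulrA.
 have E : g0 * phi t = (g0 * phi t + ga * cv q phi t + gb' * rcv q phi t) - ga * cv q phi t -
   gb' * (rcv q phi t - \sum_(j < N) ac eq bt mq T phi j * t ^+ j).
  by rewrite [X in _ = _ - X]mulrBr pv subr0; ring.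
 have hg : `|g0| * `|phi t| <= K * (KC * B * t `^ lam N * (t `^ al / al)) +
   `|ga| * (KC * B * t `^ lam N * (t `^ mq / mq)) +
   `|gb'| * (K2 * B * Dc * t `^ y N + K1 * M * (T `^ mq / mq) * (t / (r * v1)) ^+ N).
  rewrite -normrM E; apply: (le_trans (ler_normB _ _)); apply: lerD; last first.
   by rewrite normrM; apply: ler_wpM2l.
  apply: (le_trans (ler_normB _ _)); apply: lerD; last first.
   by rewrite normrM; apply: ler_wpM2l.
  by apply: (le_trans (hE2 t0 tT')); apply: ler_wpM2l.
 (* As [ro = r v1 / 2] and [lam <= N], the far contribution takes the form [(t / ro)^lam] of the
    target. *)
 have tN : (t / (r * v1)) ^+ N <= t `^ lam N / ro `^ lam N.
  have q0 : 0 < t / ro by rewrite divr_gt0.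
  apply: (@le_trans _ _ ((t / ro) ^+ N)).
   rewrite lerXn2r ?nnegrE ?(ltW q0)//; first by pos.
   apply: ler_wpM2l; first by pos.
   by rewrite lef_pV2 ?posrE ?mulr_gt0// /ro ler_wpM2l ?(ltW r0)// ler_pdivrMr// ler_peMr ?(ltW v0)// ler1n.
  have -> : t `^ lam N / ro `^ lam N = (t / ro) `^ lam N.
   rewrite powRM ?(ltW t0) ?invr_ge0 ?(ltW ro0)//; congr (_ * _).
   by rewrite -powRN -(powR_inv1 (ltW ro0)) -powRrM mulN1r.
  rewrite -powR_mulrn ?(ltW q0)//; apply: powR_le_exp => //; first by rewrite ler_pdivrMr// mul1r.
  rewrite /lam /y -addrA gerDl -opprD oppr_le0; by pos.
 have ty : t `^ y N = t `^ lam N * t `^ mq by rewrite -powRD_pos// subrK.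
 rewrite -(ler_pM2l g0'); apply: (le_trans hg).
 rewrite ty mulrDl mulrDr [leRHS]mulrDr addrA; apply: lerD.
  apply: (@le_trans _ _ (B * t `^ lam N * (t `^ th * S))).
   have -> : B * t `^ lam N * (t `^ th * S) = B * t `^ lam N * (t `^ th * (K * KC / al)) +
     B * t `^ lam N * (t `^ th * (`|ga| * KC / mq)) +
     B * t `^ lam N * (t `^ th * (`|gb'| * K2 * Dc)) by rewrite /S; ring.
   apply: lerD; first apply: lerD.
   - rewrite (_ : K * _ = B * t `^ lam N * (t `^ al * (K * KC / al))); last by ring.
    by apply: ler_wpM2l; [pos|apply: ler_wpM2r => //; pos].
   - rewrite (_ : `|ga| * _ = B * t `^ lam N * (t `^ mq * (`|ga| * KC / mq))); last by ring.
    by apply: ler_wpM2l; [pos|apply: ler_wpM2r => //; pos].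
   - rewrite (_ : `|gb'| * _ = B * t `^ lam N * (t `^ mq * (`|gb'| * K2 * Dc))); last by ring.
    by apply: ler_wpM2l; [pos|apply: ler_wpM2r => //; pos].
  have -> : `|g0| * (B / 2 * t `^ lam N) = B * t `^ lam N * (`|g0| / 2) by ring.
  apply: ler_wpM2l; first by pos.
  rewrite ler_pdivlMr//; apply: le_trans tth.
  rewrite ler_wpM2r// ler_wpM2l ?powR_ge0// lerDl//.
 have -> : `|g0| * (A1 / ro `^ lam N * t `^ lam N) = `|g0| * A1 * (t `^ lam N / ro `^ lam N) by ring.
 rewrite [leLHS]mulrA; apply: ler_pM; [by pos|by pos| |exact: tN].
 rewrite /A1 mulrDr (mulrC `|g0| (_ / _)) divfK ?gt_eqF//.
 apply: ler_wpDr; first by pos.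
 by rewrite !mulrA.
have main N : 0 <= lam N -> SS N ((2 * A1 + 1) / ro `^ lam N).
 move=> lam0; have [A A0 hA] := flat lam0.
 have rolam : 0 < ro `^ lam N by exact: powR_gt0.
 (* The constant [A] of flatness is halved at each round, and [2 A1 / ro^lam] is the fixed point of
    the recursion. *)
 have iter n : SS N (2 * A1 / ro `^ lam N + A / 2 ^+ n).
  elim: n => [|n ih].
   apply: (aeS hA) => s hs s0 sr; apply: (le_trans hs).
   rewrite /pp s0 (lt_le_trans sr rT') addrK expr0 divr1 mulrDl.
   by apply: ler_wpDl => //; pos.
  have Bn : 0 <= 2 * A1 / ro `^ lam N + A / 2 ^+ n by pos.
  have := step N A _ lam0 A0 hA Bn ih; rewrite /SS.
  set b1 := (_ / 2 + _); set b2 := (_ + _ / 2 ^+ n.+1).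
  suff -> : b1 = b2 by [].
  rewrite /b1 /b2 exprS; field.
  by rewrite expf_neq0 ?pnatr_eq0// gt_eqF.
 have := archi_boundP (mulr_ge0 A0 (ltW rolam)); set n := Num.bound _ => hn.
 apply: (aeS (iter n)) => s hs s0 sr; apply: (le_trans (hs s0 sr)).
 rewrite ler_wpM2r ?powR_ge0// (mulrDl (2 * A1) 1) lerD2l ler_pdivrMr ?exprn_gt0//.
 rewrite div1r mulrC ler_pdivlMr//; apply: (le_trans (ltW hn)).
 by rewrite -natrX ler_nat ltnW// ltn_expl.
exists ro => //.
have big : exists N0, forall N, (N0 <= N)%N -> 0 <= lam N.
 have h : 0 <= mq + 2^-1 by pos.
 have := archi_boundP h; set n := Num.bound _ => hn; exists n => N nN.
 rewrite /lam /y -addrA -opprD subr_ge0 addrC (le_trans (ltW hn))// ler_nat//.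
have [N0 hN0] := big.
have all : {ae mu, forall s, forall n, 0 < s -> s < r -> `|phi s| <= (2 * A1 + 1) / ro `^ lam (n + N0)%N * s `^ lam (n + N0)%N}.
 by apply: aeN => n; apply: main; apply: hN0; rewrite leq_addl.
apply: (aeS all) => t ht t0 tro; apply/eqP; rewrite -normr_le0.
have v'0 : 0 < t / ro by rewrite divr_gt0.
have v'1 : t / ro < 1 by rewrite ltr_pdivrMr// mul1r.
pose cst' := (2 * A1 + 1) * (t / ro) `^ (N0%:R - 2^-1 - mq).
have hlim : (fun n => cst' * (t / ro) ^+ n) @ \oo --> (0 : R).
 rewrite -(mulr0 cst'); apply: cvgM; first exact: cvg_cst.
 by apply: cvg_expr; rewrite gtr0_norm.
apply: (ler_cvg_to (cvg_cst _) hlim); apply: nearW => n.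
apply: (le_trans (ht n t0 (lt_trans tro ror))).
have E3 : (t / ro) `^ (N0%:R - 2^-1 - mq) * (t / ro) ^+ n = (t / ro) `^ lam (n + N0)%N.
 rewrite -powR_mulrn ?(ltW v'0)// -powRD_pos//; congr (_ `^ _).
 by rewrite /lam /y natrD; ring.
have E4 : (t / ro) `^ lam (n + N0)%N = t `^ lam (n + N0)%N / ro `^ lam (n + N0)%N.
 rewrite powRM ?(ltW t0) ?invr_ge0 ?(ltW ro0)//; congr (_ * _).
 by rewrite -powRN -(powR_inv1 (ltW ro0)) -powRrM mulN1r.
rewrite /cst' -[leRHS]mulrA E3 E4; apply: eqle.
by move: (_ `^ _) (_ `^ _) => a b; ring.
Qed.

End bootstrap.

#[local] Opaque powR ker kC kC1 kC2 cs rm Bt.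
Lemma mid_lt (R : realType) (a b : R) : a < b -> a + (b - a) / 2 < b.
Proof. lra. Qed.

(** * Unique continuation *)

Section global.
Variable R : realType.
Notation mu := (@lebesgue_measure R).
Implicit Types (f g : R -> R) (x y t s : R).
Variables (e eq : nat -> R) (L bt C al mq T T' : R).
Hypotheses (he : coefbd e L bt C) (heq : coefbd eq L bt C) (L0 : 0 < L) (b0 : 0 < bt)
 (T0 : 0 < T) (TL : T < L) (al0 : 0 < al) (al1 : al < 1) (mq0 : 0 < mq)
 (T'0 : 0 < T') (T'T : T' < T) (e0 : e 0%N != 0).
Let k := ker e bt al T.
Let q := ker eq bt mq T.

Lemma cv_shift f g (c : R) t : itg (fun s => f (t + c - s) * g s) ->
 cv f (fun s => g (s + c)) t = cv f g (t + c).
move=> ok; rewrite /cv -(int_shift (- c) ok); apply: eqRint => s.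
by rewrite opprK; congr (f _ * _); ring.
Qed.

Lemma rcv_shift f g (c : R) t : itg (fun s => f (s - (t + c)) * g s) ->
 rcv f (fun s => g (s + c)) t = rcv f g (t + c).
move=> ok; rewrite /rcv -(int_shift (- c) ok); apply: eqRint => s.
by rewrite opprK; congr (f _ * _); ring.
Qed.

Lemma rcv_ok_ae f g : itg f -> itg g -> {ae mu, forall t, itg (fun s => f (s - t) * g s)}.
move=> hf hg; have hf' : itg (fun u => f (- u)).
 by have := itg_refl 0 hf; congr itg; apply/funext => u; rewrite sub0r.
apply: (aeS (cvok_ae hf' hg)) => t; rewrite /cvok; congr itg.
by apply/funext => s; rewrite opprB.
Qed.

Lemma ae_translate (c : R) (P : R -> Prop) : {ae mu, forall x, P x} -> {ae mu, forall x, P (x + c)}.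
move=> h; apply: (aeS (ae_affine c (oner_neq0 _) h)) => x.
by rewrite mul1r.
Qed.

(** Let [c] be the supremum of the points up to which [phi] vanishes. Convolutions commute with
    translations, and vanishing before [c] gives the translate its support in []0, T' - c[]; so
    [local_vanish] applies to it and pushes [c] further, unless [c = T']. *)
Lemma unique_continuation (phi : R -> R) (M c0 g0 ga gb' K : R) :
 mfs phi -> 0 <= M -> gb phi M 0 T' ->
 {ae mu, forall t, 0 < t -> t < T' -> cv k phi t - rcv k phi t = c0} ->
 0 <= K -> g0 != 0 ->
 {ae mu, forall t, 0 < t -> t < T' ->
   `|g0 * phi t + ga * cv q phi t + gb' * rcv q phi t| <= K * `|cv k phi t|} ->
 {ae mu, forall t, phi t = 0}.
move=> mphi M0 hM E1 K0 g00 E2.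
have [v1 v0 [v11 v1L]] : exists2 v1 : R, 0 < v1 & v1 <= 1 /\ (1 + v1) * T < L.
 exists (Num.min 1 ((L - T) / (2 * T))); first by rewrite lt_min ltr01 divr_gt0 ?subr_gt0// mulr_gt0.
 split; first by rewrite ge_min lexx.
 apply: (@le_lt_trans _ _ (T + (L - T) / 2)); last first.
  exact: mid_lt.
 rewrite mulrDl mul1r lerD2l; apply: (@le_trans _ _ ((L - T) / (2 * T) * T)).
  by rewrite ler_wpM2r ?(ltW T0)// ge_min lexx orbT.
 by apply: eqle; field; rewrite gt_eqF.
have iphi : itg phi by exact: (gb_itg T'0 mphi (lexx 0) hM).
have ik : itg k by exact: (itg_ker he L0 b0 T0 al0 TL).
have iq : itg q by exact: (itg_ker heq L0 b0 T0 mq0 TL).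
pose S := [set c : R | 0 <= c <= T' /\ van phi c].
have vanS c d : d <= c -> van phi c -> van phi d.
 by move=> dc h; apply: (aeS h) => x hx xd; apply: hx; exact: lt_le_trans dc.
have S0 : S 0.
 split; first by rewrite lexx ltW.
 apply: (aeS hM) => x + x0; rewrite /pp (ltNge 0 x) (ltW x0) /= mulr0 normr_le0.
 by move=> /eqP.
have supS : has_sup S by split; [exists 0|exists T' => c [/andP[_ cT] _]].
pose c := sup S.
have c0' : 0 <= c by apply: ub_le_sup => //; exact: supS.2.
have cT : c <= T' by apply: ge_sup; [exists 0|move=> d [/andP[_ dT] _]].
have vc : van phi c.
 have h n : van phi (c - n.+1%:R^-1).
  have hc : c - n.+1%:R^-1 < c by rewrite gtrBl.
  by have [d [_ Vd] /ltW dc] := sup_gt supS.1 hc; exact: vanS Vd.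
 apply: (aeS (aeN h)) => x hx xc.
 have xc' : 0 < c - x by rewrite subr_gt0.
 have [n _ hn] := near_infty_natSinv_lt (PosNum xc').
 by apply: (hx n); rewrite ltrBrDr -ltrBrDl; exact: (hn n (leqnn n)).
have vT : van phi T' -> {ae mu, forall t, phi t = 0}.
 move=> h; apply: (aeS2 h hM) => x h1 h2; have [xT|xT] := ltP x T'; first exact: h1.
 by move: h2; rewrite /pp (ltNge x) xT andbF mulr0 normr_le0 => /eqP.
have [cT'|cT'] := ltP c T'; last by apply: vT; exact: vanS vc.
exfalso.
pose psi s := phi (s + c); pose T2 := T' - c.
have T20 : 0 < T2 by rewrite subr_gt0.
have T2T : T2 < T by apply: le_lt_trans T'T; rewrite gerBl.
have mpsi : mfs psi.
 by apply: mfsT => //; exact: mfsD.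
have hM2 : gb psi M 0 T2.
 apply: (aeS2 (ae_translate c hM) (aeS2 (ae_translate c vc) (ae_neq 0) (fun t a b => conj a b))) => s h1 h23.
 case: h23 => h2 sn.
 move: h1 h2; rewrite /pp add0r subrr powRr0 /psi => h1 h2.
 have [s0|s0] := ltP 0 s; last first.
  have [s1|s1] := ltP s 0; first by rewrite h2 ?gtrDr// normr0 mulr0.
  by move: s1; rewrite le_eqVlt eq_sym (negbTE sn) /= ltNge s0.
 apply: (le_trans h1); apply: ler_wpM2l => //.
 by rewrite /T2 ltrBrDr (lt_le_trans s0) ?lerDl//= powRr0.
have E1' : {ae mu, forall t, 0 < t -> t < T2 -> cv k psi t - rcv k psi t = c0}.
 apply: (aeS2 (ae_translate c E1) (aeS2 (ae_translate c (cvok_ae ik iphi)) (ae_translate c (rcv_ok_ae ik iphi)) (fun t a b => conj a b))).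
 move=> t E12 ok t0 tT2; case: ok => ok1 ok2.
 rewrite [cv k psi t](cv_shift ok1) [rcv k psi t](rcv_shift ok2); apply: E12; first by rewrite (lt_le_trans t0)// lerDl.
 by move: tT2; rewrite ltrBrDr.
have E2' : {ae mu, forall t, 0 < t -> t < T2 ->
   `|g0 * psi t + ga * cv q psi t + gb' * rcv q psi t| <= K * `|cv k psi t|}.
 apply: (aeS2 (ae_translate c E2) (aeS2 (ae_translate c (cvok_ae ik iphi))
  (aeS2 (ae_translate c (cvok_ae iq iphi)) (ae_translate c (rcv_ok_ae iq iphi)) (fun t a b => conj a b)) (fun t a b => conj a b))).
 move=> t E12 ok t0 tT2; case: ok => ok1 ok2; case: ok2 => ok2 ok3.
 rewrite [cv q psi t](cv_shift ok2) [rcv q psi t](rcv_shift ok3) [cv k psi t](cv_shift ok1); apply: E12; first by rewrite (lt_le_trans t0)// lerDl.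
 by move: tT2; rewrite ltrBrDr.
have [r r0 hr] := local_vanish he heq L0 b0 T0 TL al0 al1 mq0 T20 T2T e0 v0 v11 v1L mpsi M0 hM2 E1' K0 g00 E2'.
pose r' := Num.min r T2.
have r'0 : 0 < r' by rewrite lt_min r0.
have vcr : van phi (c + r').
 apply: (aeS2 vc (aeS2 (ae_translate (- c) hr) (ae_neq c) (fun t a b => conj a b))).
 move=> x h1 h2 xc; case: h2 => h2 xnc; have [xc'|xc'] := ltP x c; first exact: h1.
 have := h2; rewrite /psi subrK; apply; first by rewrite subr_gt0 lt_neqAle eq_sym xnc.
 by rewrite ltrBlDl (lt_le_trans xc)// lerD2l ge_min lexx.
have : c + r' <= c.
 apply: ub_le_sup; first exact: supS.2.
 split => //; rewrite addr_ge0 ?(ltW r'0)//=.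
 by rewrite -lerBrDl ge_min lexx orbT.
by rewrite gerDl leNgt r'0.
Qed.

End global.

#[local] Opaque powR ker kC kC1 kC2 cs rm Bt itg.

(** * Odd kernels, their primitives, and weighted averages *)

Section primitives.
Variable R : realType.
Notation mu := (@lebesgue_measure R).
Notation mu2 := (mu \x mu)%E.
Implicit Types (f g : R -> R) (x y t s v z : R).

Lemma int2_bound (F : R * R -> R) (g : R -> R) : mfs F -> itg g ->
 {ae mu, forall v, itg (fun x => F (v, x)) /\ \int[mu]_x `|F (v, x)| <= g v} -> mu2.-integrable setT (EFin \o F).
move=> mF ig hg.
have mF' : mfs (EFin \o F) by exact/measurable_EFinP.
apply/(integrable12ltyP mu mu mF').
have mn : mfs (fun p => `|(EFin \o F) p|%E) by exact: mfsT.
have mi : mfs (fun v => (\int[mu]_x `|(EFin \o F) (v, x)|)%E).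
 exact: (@measurable_fun_fubini_tonelli_F _ _ _ _ R mu _ mn (fun=> abse_ge0 _)).
apply: (@le_lt_trans _ _ (\int[mu]_v (`|g v|)%:E)%E).
 apply: ae_ge0_le_integral => //.
 - by move=> v _; apply: integral_ge0.
 - by apply/measurable_EFinP; apply: mfsT => //; exact: imeas ig.
 - apply: (aeS hg) => v iFhv _; case: iFhv => iF hv.
  have E : (\int[mu]_x `|(EFin \o F) (v, x)| = (\int[mu]_x `|F (v, x)|)%:E)%E.
   by rewrite -intE//; exact: itg_norm.
  by rewrite E lee_fin (le_trans hv)// ler_norm.
by rewrite intE ?ltry//; exact: itg_norm.
Qed.

(** Convolution with [oddf k] is left minus right convolution with [k], the operator of (E1). *)
Definition oddf f z := f z - f (- z).
Definition prim f y := \int[mu]_z (f z * (z < y)%R%:R).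

Lemma mfs_lt_ind y : mfs (fun z : R => (z < y)%R%:R : R).
rewrite (_ : (fun z : R => _) = fun z => 1 - (y <= z)%R%:R); last first.
 by apply/funext => z; case: leP; rewrite ?subrr ?subr0.
rewrite (_ : (fun z : R => _) = fun z => 1 - (- z <= - y)%R%:R); last first.
 by apply/funext => z; rewrite lerN2.
apply: mfsB => //.
apply: (@mfsT _ _ _ _ _ _ (fun z : R => (z <= - y)%R%:R : R)) => //.
exact: mfs_le_ind.
Qed.

Lemma itg_ind f (b : R -> bool) : mfs (fun z => (b z)%:R : R) -> itg f ->
 itg (fun z => f z * (b z)%:R).
move=> mb hf; apply: (itg_dom _ _ (itg_norm hf)).
 by apply: mfsM => //; exact: imeas.
by move=> z; rewrite normrM normr_nat; case: (b z); rewrite ?mulr1// mulr0 normr_ge0.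
Qed.

Lemma itg_lt f y : itg f -> itg (fun z => f z * (z < y)%R%:R).
Proof. by move=> hf; apply: itg_ind hf; exact: mfs_lt_ind. Qed.

Lemma mfs_itvind y1 y2 : mfs (fun z : R => ((y1 <= z) && (z < y2))%R%:R : R).
rewrite (_ : (fun z : R => _) = fun z => (1 - (z < y1)%R%:R) * (z < y2)%R%:R); last first.
 apply/funext => z; rewrite leNgt; case: (z < y1); case: (z < y2);
 by rewrite /= ?subrr ?subr0 ?mul0r ?mulr0 ?mul1r.
apply: mfsM; last exact: mfs_lt_ind.
by apply: mfsB => //; exact: mfs_lt_ind.
Qed.

Lemma itg_itv f y1 y2 : itg f -> itg (fun z => f z * ((y1 <= z) && (z < y2))%R%:R).
Proof. by move=> hf; apply: itg_ind hf; exact: mfs_itvind. Qed.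

Lemma itg_opp f : itg f -> itg (fun z => f (- z)).
Proof. by move=> /(itg_refl 0); congr itg; apply/funext => z; rewrite sub0r. Qed.

Lemma int_opp f : itg f -> \int[mu]_z f (- z) = \int[mu]_z f z.
Proof. by move=> /(int_refl 0) <-; apply: eqRint => z; rewrite sub0r. Qed.

Lemma itg_odd f : itg f -> itg (oddf f).
Proof. by move=> hf; apply: itgB => //; exact: itg_opp. Qed.

Lemma oddfN f z : oddf f (- z) = - oddf f z.
Proof. by rewrite /oddf opprK opprB. Qed.

(** The primitive of an odd function is even; the constant comes from the normalization of [prim] at
    [-oo]. *)
Lemma prim_odd f y : itg f -> (forall z, z <= 0 -> f z = 0) ->
 prim (oddf f) y = prim f `|y| - \int[mu]_z f z.
move=> hf f0; have hf' := itg_opp hf.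
have E1 : prim (oddf f) y = prim f y - \int[mu]_z (f (- z) * (z < y)%R%:R).
 rewrite /prim -intB; [|exact: itg_lt..].
 by apply: eqRint => z; rewrite /oddf mulrBl.
rewrite E1; have [y0|y0] := leP 0 y.
 rewrite ger0_norm//; congr (_ - _); rewrite -(int_opp hf); apply: int_ae_eq.
 - by apply: mfsM; [exact: imeas|exact: mfs_lt_ind].
 - exact: imeas.
 - apply: aeW => z; have [zy|zy] := ltP z y; first by rewrite mulr1.
  by rewrite mulr0 f0// oppr_le0 (le_trans y0).
rewrite ltr0_norm//.
have -> : prim f y = 0.
 rewrite /prim (eqRint (g := fun=> 0)) ?/Rintegral ?integral0// => z.
 have [zy|zy] := ltP z y; last by rewrite mulr0.
 by rewrite f0 ?mul0r// ltW// (lt_trans zy).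
rewrite sub0r.
have -> : \int[mu]_z (f (- z) * (z < y)%R%:R) = \int[mu]_z (f z * (- y < z)%R%:R).
 rewrite -[LHS]int_opp; last exact: itg_lt.
 by apply: eqRint => z; rewrite opprK ltrNl.
have -> : \int[mu]_z f z = prim f (- y) + \int[mu]_z (f z * (- y < z)%R%:R).
 rewrite /prim -intD; [|exact: itg_lt|]; last first.
  by apply: itg_ind hf; exact: mfs_gt_ind.
 apply: int_ae_eq; first exact: imeas.
  apply: mfsD; apply: mfsM; rewrite ?(imeas hf)//;
  [exact: imeas|exact: mfs_lt_ind|exact: imeas|exact: mfs_gt_ind].
 apply: (aeS (ae_neq (- y))) => z zy.
 by case: (ltgtP z (- y)) zy => // _ _; rewrite ?mulr1 ?mulr0 ?addr0 ?add0r.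
by ring.
Qed.

Lemma prim_itv f y1 y2 : itg f -> y1 <= y2 ->
 \int[mu]_z (f z * ((y1 <= z) && (z < y2))%R%:R) = prim f y2 - prim f y1.
move=> hf y12; rewrite /prim -intB; [|exact: itg_lt..].
apply: eqRint => z; rewrite leNgt -mulrBr; congr (_ * _).
have [h|h] := ltP z y1; first by rewrite (lt_le_trans h y12) subrr.
by rewrite /= subr0.
Qed.

Lemma odd_itv f y1 y2 : itg f -> (forall z, z <= 0 -> f z = 0) -> y1 <= y2 ->
 \int[mu]_z (oddf f z * ((y1 <= z) && (z < y2))%R%:R) = prim f `|y2| - prim f `|y1|.
move=> hf f0 y12; rewrite prim_itv//; last exact: itg_odd.
by rewrite !prim_odd//; ring.
Qed.

Lemma odd_itv_shift f x t1 t2 : itg f -> (forall z, z <= 0 -> f z = 0) -> t1 <= t2 ->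
 \int[mu]_v (oddf f (v + x) * ((t1 <= v) && (v < t2))%R%:R) = prim f `|t2 + x| - prim f `|t1 + x|.
move=> hf f0 t12; rewrite -odd_itv ?lerD2r//.
rewrite -[RHS](int_shift (- x)); last by apply: itg_itv; exact: itg_odd.
by apply: eqRint => v; rewrite opprK lerD2r ltrD2r.
Qed.

Definition chi x z : R := ((- x <= z) && (z < x))%R%:R.

Lemma mfs_chi x : mfs (chi x).
Proof. exact: mfs_itvind. Qed.

Lemma itg_chi x : 0 < x -> itg (chi x) /\ \int[mu]_z chi x z = 2 * x.
move=> x0; have [ip ep] := pe_int ltr01 x0.
have E : {ae mu, forall z, chi x z = pe 1 x z}.
 apply: (aeS2 (ae_neq 0) (ae_neq (- x))) => z z0 zx.
 rewrite /chi /pe /pp subrr !powRr0 oppr_gt0 ltrNl.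
 move: z0 zx; have [z0|z0|//] := ltgtP z 0 => _ zx /=.
  by rewrite (lt_trans z0 x0) andbT le_eqVlt eq_sym (negbTE zx) add0r /=; case: (- x < z).
 have -> : - x <= z by rewrite (le_trans _ (ltW z0))// oppr_le0 ltW.
 by rewrite addr0; case: (z < x).
have i : itg (chi x).
 apply: (itg_ae_dom (mfs_chi x) ip); apply: (aeS E) => z ->.
 by rewrite ger0_norm// pe_ge0.
split => //; by rewrite (int_ae_eq (mfs_chi x) (imeas ip) E) ep powRr1 ?(ltW x0)// divr1.
Qed.

Lemma cv_chi f t x : 0 < x -> itg f -> (forall z, z <= 0 -> f z = 0) ->
 cv (chi x) (oddf f) t = prim f `|t + x| - prim f `|t - x|.
move=> x0 hf f0; rewrite -odd_itv//; last first.
 by rewrite lerD2l ge0_cp// ltW.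
rewrite /cv; apply: int_ae_eq.
- apply: mfsM; last exact: imeas (itg_odd hf).
 by apply: mfs_subl; exact: mfs_chi.
- by apply: mfsM; [exact: imeas (itg_odd hf)|exact: mfs_itvind].
apply: (aeS2 (ae_neq (t - x)) (ae_neq (t + x))) => z z1 z2; rewrite /chi mulrC; congr (_ * (nat_of_bool _)%:R).
have -> : (- x <= t - z) = (z < t + x) by rewrite lerBrDr addrC -lerBrDr opprK le_eqVlt (negbTE z2).
have -> : (t - z < x) = (t - x <= z) by rewrite ltrBlDr addrC -ltrBlDr le_eqVlt eq_sym (negbTE z1).
by rewrite andbC.
Qed.

(* An absolutely continuous dependence of [S (t + x) - S (t - x)] on [t] is inherited
  by weighted averages in [x]. *)
Lemma weighted_diff (w s S : R -> R) (g : R -> R) t1 t2 : mfs w ->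
 mfs s -> (forall x, x <= 0 -> w x = 0) ->
 (forall x, 0 < x -> (S (t2 + x) - S (t2 - x)) - (S (t1 + x) - S (t1 - x)) =
   \int[mu]_v ((s (v + x) - s (v - x)) * ((t1 <= v) && (v < t2))%R%:R)) ->
 (forall x, 0 < x -> itg (fun v => (s (v + x) - s (v - x)) * ((t1 <= v) && (v < t2))%R%:R)) ->
 itg (fun x => w x * (S (t1 + x) - S (t1 - x))) ->
 itg (fun x => w x * (S (t2 + x) - S (t2 - x))) -> itg g -> (forall v, 0 <= g v) ->
 {ae mu, forall v, t1 <= v -> v < t2 -> itg (fun x => w x * (s (v + x) - s (v - x))) /\
   \int[mu]_x `|w x * (s (v + x) - s (v - x))| <= g v} ->
 itg (fun v => (\int[mu]_x (w x * (s (v + x) - s (v - x)))) * ((t1 <= v) && (v < t2))%R%:R) /\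
 \int[mu]_x (w x * (S (t2 + x) - S (t2 - x))) - \int[mu]_x (w x * (S (t1 + x) - S (t1 - x))) =
 \int[mu]_v ((\int[mu]_x (w x * (s (v + x) - s (v - x)))) * ((t1 <= v) && (v < t2))%R%:R).
move=> mw ms w0 hS hI i1 i2 ig g0 hg.
pose b v : R := ((t1 <= v) && (v < t2))%R%:R.
pose F (p : R * R) := w p.2 * (s (p.1 + p.2) - s (p.1 - p.2)) * b p.1.
have mF : mfs F.
 apply: mfsM; last first.
  by apply: (mfsT (f := b)) => //; exact: mfs_itvind.
 apply: mfsM; first exact: mfsT.
 apply: mfsB.
  by apply: (mfsT (f := s)) => //; exact: mfsD.
 by apply: (mfsT (f := s)) => //; exact: mfsB.
have bE v : b v = 0 \/ b v = 1 /\ t1 <= v /\ v < t2.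
 by rewrite /b; have [h1|h1] := leP t1 v; have [h2|h2] := ltP v t2; [right|left|left|left].
have iF : mu2.-integrable setT (EFin \o F).
 apply: (int2_bound mF ig); apply: (aeS hg) => v hv; rewrite /F /=.
 have [b0|b1] := bE v.
  rewrite b0 (_ : (fun x => _) = fun=> 0); last by apply/funext => x; rewrite mulr0.
  split; first exact: itg0.
  by rewrite (eqRint (g := fun=> 0)) ?/Rintegral ?integral0// => x; rewrite mulr0 normr0.
 case: b1 => b1 v12; case: v12 => v1 v2; have hv12 := hv v1 v2; case: hv12 => h1 h2; rewrite b1.
 rewrite (_ : (fun x => _) = fun x => w x * (s (v + x) - s (v - x))); last first.
  by apply/funext => x; rewrite mulr1.
 split => //; rewrite (le_trans _ h2)//; apply: eqle; apply: eqRint => x.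
 by rewrite mulr1.
have F1 v : \int[mu]_x F (v, x) = (\int[mu]_x (w x * (s (v + x) - s (v - x)))) * b v.
 rewrite /F /=; have [b0|b1] := bE v.
  rewrite b0 mulr0 (eqRint (g := fun=> 0)) ?/Rintegral ?integral0// => x.
  by rewrite mulr0.
 case: b1 => -> _; rewrite mulr1; apply: eqRint => x.
 by rewrite mulr1.
split; first by have := Rfubini_itg1 iF; congr itg; apply/funext => v; exact: F1.
rewrite -intB//.
have E x : w x * (S (t2 + x) - S (t2 - x)) - w x * (S (t1 + x) - S (t1 - x)) = \int[mu]_v F (v, x).
 rewrite -mulrBr; have [x0|x0] := ltP 0 x; last first.
  rewrite w0// mul0r (eqRint (g := fun=> 0)) ?/Rintegral ?integral0// => v.
  by rewrite /F /= w0// !mul0r.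
 by rewrite hS// -intZ ?hI//; apply: eqRint => v; rewrite /F /b /=; ring.
rewrite (eqRint E) -(Rfubini iF); exact: eqRint.
Qed.

Lemma int_gt0 f : itg f -> (forall z, 0 <= f z) -> (forall z, 0 < z -> z < 1 -> 0 < f z) ->
 0 < \int[mu]_z f z.
move=> hf f0 f1; rewrite lt_neqAle int_ge0// andbT; apply/negP => /eqP /esym e.
have [z [z0 z1 fz]] : exists z, [/\ 0 < z, z < 1 & f z = 0].
 by apply: ae_near0 => //; apply: (aeS (int_eq0_ae hf f0 e)).
by have := f1 z z0 z1; rewrite fz ltxx.
Qed.

Section weight.
Variable al : R.
Hypotheses (al0 : 0 < al) (al1 : al < 1).

(** The model case of the pure power [s^(al-1)]: [q0] is the even primitive, [s0] the odd kernel,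
    and [om] the weight of the averages. *)
Definition q0 y := `|y| `^ al / al.
Definition s0 z := Num.sg z * `|z| `^ (al - 1).
Definition om x := if 0 < x then x `^ (- al - 1) else 0.

Lemma om_ge0 x : 0 <= om x.
Proof. by rewrite /om; case: ifP => // _; exact: powR_ge0. Qed.

Lemma mfs_om : mfs om.
Proof. by apply: mfs_if => //; exact: measurable_fun_ltr. Qed.

Lemma mfs_q0 : mfs q0.
apply: mfsM => //.
exact: (mfsT (f := fun y => y `^ al)).
Qed.

Lemma q0N y : q0 (- y) = q0 y. Proof. by rewrite /q0 normrN. Qed.

Lemma q0_ge0 y : 0 <= q0 y.
Proof. by rewrite /q0; pos. Qed.

Lemma q0_le y1 y2 : `|y1| <= `|y2| -> q0 y1 <= q0 y2.
move=> h; rewrite /q0 ler_wpM2r ?invr_ge0 ?(ltW al0)//.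
by rewrite ge0_ler_powR ?nnegrE// ltW.
Qed.

Lemma prim_pp B y : `|y| <= B -> prim (pp al B) `|y| = q0 y.
move=> yB; have E z : pp al B z * (z < `|y|)%R%:R = pp al `|y| z.
 rewrite /pp; have [zy|zy] := ltP z `|y|; last by rewrite mulr0 andbF.
 by rewrite mulr1 (lt_le_trans zy yB).
rewrite /prim (eqRint E) /q0; have [->|y0] := eqVneq y 0.
 rewrite normr0 powR0 ?gt_eqF// mul0r (eqRint (g := fun=> 0)) ?/Rintegral ?integral0// => z.
 by rewrite /pp; case: ifPn => // /andP[h1 h2]; have := lt_trans h1 h2; rewrite ltxx.
have yp : 0 < `|y| by rewrite normr_gt0.
by have [_ ->] := pp_int al0 yp.
Qed.

End weight.
End primitives.

#[local] Opaque powR ker kC kC1 kC2 cs rm Bt itg.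

(** * Averages of the model kernel and of its perturbations *)

Section weight.
Variable R : realType.
Notation mu := (@lebesgue_measure R).
Implicit Types (f g : R -> R) (x y t s v z : R).
Variable al : R.
Hypotheses (al0 : 0 < al) (al1 : al < 1).
Local Notation q0_ := q0.
Local Notation s0_ := s0.
Local Notation om_ := om.
Local Notation q0 := (q0 al).
Local Notation s0 := (s0 al).
Local Notation om := (om al).

Lemma pp_mono m b b' x : b <= b' -> pp m b x <= pp m b' x.
move=> bb; rewrite {1}/pp; case: ifPn => [/andP[x0 xb]|_]; last exact: pp_ge0.
by rewrite /pp x0 (lt_le_trans xb bb).
Qed.

Lemma pp_le0 m b z : z <= 0 -> pp m b z = 0.
Proof. by move=> z0; rewrite /pp ltNge z0. Qed.

(** A bound by [s^(al-1)] on the kernel passes to increments of its primitive, so general averages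
    are controlled by the model one. *)
Lemma prim_diff_le f (C B y1 y2 : R) : itg f -> 0 <= C -> 0 < B -> (forall z, `|f z| <= C * pp al B z) ->
 `|prim f `|y2| - prim f `|y1| | <= C * `|q0 y2 - q0 y1|.
move=> hf C0 B0 hC; wlog y12 : y1 y2 / `|y1| <= `|y2|.
 move=> H; have [h|h] := leP `|y1| `|y2|; first exact: H.
 by rewrite distrC (distrC (q0 y2)); apply: H; exact: ltW.
pose B' := Num.max B `|y2|.
have B'0 : 0 < B' by rewrite lt_max B0.
have y2B : `|y2| <= B' by rewrite le_max lexx orbT.
have y1B := le_trans y12 y2B.
have [ip _] := pp_int al0 B'0.
rewrite -prim_itv//.
rewrite (ger0_norm (x := q0 y2 - q0 y1)); last by rewrite subr_ge0 q0_le.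
rewrite -(prim_pp al0 y2B) -(prim_pp al0 y1B) -prim_itv// -intZ; last exact: itg_itv.
apply: (le_trans (int_norm (itg_itv _ _ hf))).
apply: int_le; [exact: itg_norm (itg_itv _ _ hf)|by apply: itgZ; exact: itg_itv|].
move=> z; rewrite normrM normr_nat mulrA; apply: ler_wpM2r => //.
apply: (le_trans (hC z)); apply: ler_wpM2l => //; apply: pp_mono.
by rewrite le_max lexx.
Qed.

Lemma q0_lip (a b : R) : 0 < a -> a <= b -> q0 b - q0 a <= (b - a) * a `^ (al - 1).
move=> a0; rewrite le_eqVlt => /predU1P[->|ab]; first by rewrite !subrr mul0r.
have b0 := lt_trans a0 ab.
have [xi] : exists2 xi, xi \in `]a, b[%R & b `^ al - a `^ al = al * xi `^ (al - 1) * (b - a).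
 apply: (@MVT R (fun x => x `^ al) (fun x => al * x `^ (al - 1)) a b ab).
  by move=> x; rewrite in_itv/= => /andP[ax _]; apply: is_derive1_powR; exact: lt_trans ax.
 apply: derivable_within_continuous => x; rewrite in_itv/= => /andP[ax _].
 by have [] := is_derive1_powR al (lt_le_trans a0 ax).
rewrite in_itv/= => /andP[axi xib] E.
rewrite /q0_ !gtr0_norm// -mulrBl E.
have -> : al * xi `^ (al - 1) * (b - a) / al = (b - a) * xi `^ (al - 1) by field; rewrite gt_eqF.
apply: ler_wpM2l; first by rewrite subr_ge0 ltW.
have e1 z : z `^ (al - 1) = (z `^ (1 - al))^-1 by rewrite -powRN opprB.
have xi0 := lt_trans a0 axi.
rewrite !e1 lef_pV2 ?posrE ?powR_gt0// ge0_ler_powR ?nnegrE ?(ltW a0) ?(ltW xi0) ?(ltW axi)//.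
by rewrite subr_ge0 ltW.
Qed.

Lemma powR_neg_le (c a b : R) : 0 < a -> a <= b -> c <= 0 -> b `^ c <= a `^ c.
move=> a0 ab c0; have b0 := lt_le_trans a0 ab.
have e1 z : z `^ c = (z `^ (- c))^-1 by rewrite -powRN opprK.
by rewrite !e1 lef_pV2 ?posrE ?powR_gt0// ge0_ler_powR ?nnegrE ?(ltW a0) ?(ltW b0) ?oppr_ge0.
Qed.

Definition f1 x := om x * (q0 (1 + x) - q0 (1 - x)).

Lemma f1_ge0 x : 0 <= f1 x.
rewrite /f1 /om_; case: ifPn => [x0|_]; last by rewrite mul0r.
apply: mulr_ge0; first exact: powR_ge0.
rewrite subr_ge0; apply: q0_le => //; rewrite (ger0_norm (x := 1 + x)); last by rewrite addr_ge0// ltW.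
by rewrite ler_norml; apply/andP; split; lra.
Qed.

Lemma powR_half (a : R) : 0 < a -> a `^ (al - 1) <= 2 * (2 * a) `^ (al - 1).
move=> a0; have -> : a `^ (al - 1) = 2^-1 `^ (al - 1) * (2 * a) `^ (al - 1).
 by rewrite -powRM ?invr_ge0 ?mulr_ge0 ?(ltW a0)//; congr (_ `^ _); field.
apply: ler_wpM2r; first exact: powR_ge0.
by apply: half_powR_le => //; rewrite invf_le1 ?ler1n.
Qed.

(** The difference is [O(x)] at 0 and [O(x^(al-1))] at infinity; against [x^(-al-1)] both ends are
    integrable, and in between the difference is bounded. *)
Lemma f1_int : itg f1.
have o1 : 0 < 1 - al by rewrite subr_gt0.
have [i1 _] := pp_int o1 ltr01.
have h2 : 0 < 2^-1 :> R by rewrite invr_gt0.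
have [i2 _] := pt_int al0 h2.
have [i3 _] := pt_int (ltr01 : 0 < 1 :> R) (ltr0n R 2).
have ig : itg (fun x => (4 * pp (1 - al) 1 x + (3 `^ al / al) * pt al 2^-1 x) + 4 * pt 1 2 x).
 by apply: itgD; [apply: itgD|]; exact: itgZ.
apply: (itg_dom _ _ ig).
 apply: mfsM; first exact: mfs_om.
 apply: mfsB; apply: (mfsT (mfs_q0 al)) => //.
  exact: mfsD.
 exact: mfsB.
move=> x; rewrite (ger0_norm (f1_ge0 x)).
have p1 : 0 <= 4 * pp (1 - al) 1 x by pos.
have p2 : 0 <= (3 `^ al / al) * pt al 2^-1 x by pos.
have p3 : 0 <= 4 * pt 1 2 x by pos.
rewrite /f1 /om_; case: ifPn => [x0|_]; last by rewrite mul0r !addr_ge0.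
have [xh|xh] := leP x 2^-1.
 have x1 : x < 1 by apply: le_lt_trans xh _; rewrite invf_lt1// ltr1n.
 apply: (@le_trans _ _ (4 * pp (1 - al) 1 x)); last by move: (4 * _) (_ * pt _ _ _) (4 * pt _ _ _) p1 p2 p3 => a b c; lra.
 have a0 : 0 < 1 - x by rewrite subr_gt0.
 have ab : 1 - x <= 1 + x by lra.
 have h := q0_lip a0 ab.
 have h3 : (1 - x) `^ (al - 1) <= 2 by apply: half_powR_le => //; lra.
 have h4 : q0 (1 + x) - q0 (1 - x) <= 4 * x.
  apply: (le_trans h); have -> : 1 + x - (1 - x) = 2 * x by ring.
  by move: (_ `^ _) h3 => u hu; nra.
 apply: (le_trans (ler_wpM2l (powR_ge0 _ _) h4)).
 rewrite /pp x0 x1 /= mulrCA ler_wpM2l// -{2}(powRr1 (ltW x0)) -powRD_pos//.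
 by apply: eqle; congr (_ `^ _); ring.
have q00 := q0_ge0 al0 (1 - x).
have [x2|x2] := leP x 2.
 apply: (@le_trans _ _ ((3 `^ al / al) * pt al 2^-1 x)); last by move: (4 * pp _ _ _) (_ * pt _ _ _) (4 * pt _ _ _) p1 p2 p3 => a b c; lra.
 rewrite /pt xh mulrC; apply: ler_wpM2r; first exact: powR_ge0.
 rewrite (@le_trans _ _ (q0 (1 + x)))//; first by rewrite gerBl.
 rewrite /q0_ ler_wpM2r ?invr_ge0 ?(ltW al0)// ger0_norm; last by rewrite addr_ge0// ltW.
 by rewrite ge0_ler_powR ?nnegrE ?(ltW al0)//; lra.
apply: (@le_trans _ _ (4 * pt 1 2 x)); last by move: (4 * pp _ _ _) (_ * pt _ _ _) (4 * pt _ _ _) p1 p2 p3 => a b c; lra.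
have a0 : 0 < x - 1 by lra.
have ab : x - 1 <= 1 + x by lra.
have h := q0_lip a0 ab.
have xx : 0 < x / 2 by rewrite divr_gt0.
have h3 : (x - 1) `^ (al - 1) <= 2 * x `^ (al - 1).
 apply: (@le_trans _ _ ((x / 2) `^ (al - 1))).
  by apply: powR_neg_le => //; [lra|rewrite subr_le0 ltW].
 by have := powR_half xx; rewrite mulrCA divff ?mulr1.
have h4 : q0 (1 + x) - q0 (1 - x) <= 4 * x `^ (al - 1).
 rewrite -(q0N _ (1 - x)) opprB; apply: (le_trans h); have -> : 1 + x - (x - 1) = 2 by ring.
 by move: (_ `^ _) (_ `^ _) h3 => u w hu; lra.
apply: (le_trans (ler_wpM2l (powR_ge0 _ _) h4)).
rewrite /pt x2 mulrCA ler_wpM2l// -powRD_pos//.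
by apply: eqle; congr (_ `^ _); ring.
Qed.

Definition c0 : R := \int[mu]_x f1 x.

Lemma c0_gt0 : 0 < c0.
apply: int_gt0; [exact: f1_int|exact: f1_ge0|move=> z z0 z1].
rewrite /f1 /om_ z0 mulr_gt0 ?powR_gt0// subr_gt0 /q0_ ltr_pM2r ?invr_gt0//.
rewrite !gtr0_norm ?subr_gt0 ?addr_gt0// gt0_ltr_powR ?nnegrE ?subr_ge0 ?(ltW z1) ?addr_ge0 ?(ltW z0)//.
by lra.
Qed.

(** Homogeneity: degree [-al-1] from the weight, [al] from [q0] and 1 from the measure add up to 0,
    and the integral is odd in [t]. *)
Lemma scale_int t : t != 0 -> itg (fun x => om x * (q0 (t + x) - q0 (t - x))) /\
 \int[mu]_x (om x * (q0 (t + x) - q0 (t - x))) = Num.sg t * c0.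
have pos_case u : 0 < u -> itg (fun x => om x * (q0 (u + x) - q0 (u - x))) /\
  \int[mu]_x (om x * (q0 (u + x) - q0 (u - x))) = c0.
 move=> u0; have ui : 0 < u^-1 by rewrite invr_gt0.
 have un : u^-1 != 0 by rewrite gt_eqF.
 have E : (fun x => om x * (q0 (u + x) - q0 (u - x))) = fun x => u^-1 * f1 (u^-1 * x + 0).
  apply/funext => x; rewrite addr0 /f1 /om_ pmulr_rgt0//; case: ifPn => [x0|_]; last by rewrite !mul0r mulr0.
  have qs y : q0 (u * y) = u `^ al * q0 y.
   by rewrite /q0_ normrM (gtr0_norm u0) powRM ?(ltW u0)// mulrA.
  have -> : u + x = u * (1 + u^-1 * x) by field; rewrite gt_eqF.
  have -> : u - x = u * (1 - u^-1 * x) by field; rewrite gt_eqF.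
  rewrite !qs -mulrBr powRM ?(ltW ui) ?(ltW x0)//.
  have -> : u^-1 `^ (- al - 1) = u `^ al * u.
   rewrite -[X in _ = _ * X](powRr1 (ltW u0)) -powRD_pos// -(powR_inv1 (ltW u0)) -powRrM.
   by congr (_ `^ _); ring.
  by field; rewrite gt_eqF.
 rewrite E; split; first by apply: itgZ; exact: itg_affine un f1_int.
 rewrite intZ; last exact: itg_affine un f1_int.
 by rewrite /c0 (int_affine 0 un f1_int) (gtr0_norm ui).
move=> tn; have [t0|t0|t0] := ltgtP t 0; last by rewrite t0 eqxx in tn.
- have nt : 0 < - t by rewrite oppr_gt0.
 have h := pos_case _ nt.
 have E : (fun x => om x * (q0 (t + x) - q0 (t - x))) = fun x => - (om x * (q0 (- t + x) - q0 (- t - x))).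
  apply/funext => x; rewrite -(q0N _ (- t + x)) -(q0N _ (- t - x)) !opprD !opprK; ring.
 rewrite E; split; first exact: itgN h.1.
 by rewrite (intN h.1) h.2 ltr0_sg// mulN1r.
- by rewrite gtr0_sg// mul1r; exact: pos_case.
Qed.

Lemma om_split (d x : R) : 0 < d -> x != d -> om x = pp (- al) d x + pt al d x.
move=> d0 xd; rewrite /om_ /pp /pt; move: xd; have [xd|xd|//] := ltgtP x d => _.
 by rewrite andbT addr0.
by rewrite andbF add0r (lt_trans d0 xd).
Qed.

Lemma mfs_s0 : mfs s0.
apply: mfsM; last exact: (mfsT (f := fun y => y `^ (al - 1))).
rewrite (_ : Num.sg = fun z : R => (0 < z)%R%:R - (z < 0)%R%:R).
 by apply: mfsB; [exact: mfs_gt_ind|exact: mfs_lt_ind].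
apply/funext => z; have [z0|z0|z0] := ltgtP z 0.
- by rewrite ltr0_sg// sub0r.
- by rewrite gtr0_sg// subr0.
- by rewrite z0 sgr0 subrr.
Qed.

Lemma s0_odd B z : `|z| < B -> oddf (pp al B) z = s0 z.
move=> zB; rewrite /oddf /s0_; have [z0|z0|->] := ltgtP z 0.
- rewrite (pp_le0 _ _ (ltW z0)) sub0r ltr0_sg// mulN1r ltr0_norm// /pp oppr_gt0 z0.
 by rewrite -(ltr0_norm z0) zB.
- rewrite (pp_le0 _ _ (z := - z)) ?oppr_le0 ?(ltW z0)// subr0 gtr0_sg// mul1r /pp z0.
 by rewrite gtr0_norm// -(gtr0_norm z0) zB.
- by rewrite oppr0 subrr sgr0 mul0r.
Qed.

Lemma diff_int f x t1 t2 : itg f -> (forall z, z <= 0 -> f z = 0) -> t1 <= t2 ->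
 itg (fun v => (oddf f (v + x) - oddf f (v - x)) * ((t1 <= v) && (v < t2))%R%:R) /\
 prim f `|t2 + x| - prim f `|t2 - x| - (prim f `|t1 + x| - prim f `|t1 - x|) =
   \int[mu]_v ((oddf f (v + x) - oddf f (v - x)) * ((t1 <= v) && (v < t2))%R%:R).
move=> hf f0 t12; have io := itg_odd hf.
have i1 : itg (fun v => oddf f (v + x) * ((t1 <= v) && (v < t2))%R%:R).
 by apply: itg_itv; have := itg_shift (- x) io; congr itg; apply/funext => v; rewrite opprK.
have i2 : itg (fun v => oddf f (v - x) * ((t1 <= v) && (v < t2))%R%:R).
 by apply: itg_itv; exact: itg_shift.
have E : (fun v => (oddf f (v + x) - oddf f (v - x)) * ((t1 <= v) && (v < t2))%R%:R) =
 fun v => oddf f (v + x) * ((t1 <= v) && (v < t2))%R%:R - oddf f (v - x) * ((t1 <= v) && (v < t2))%R%:R.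
 by apply/funext => v; rewrite mulrBl.
rewrite E; split; first exact: itgB.
rewrite intB// odd_itv_shift//.
have -> : \int[mu]_v (oddf f (v - x) * ((t1 <= v) && (v < t2))%R%:R) = prim f `|t2 - x| - prim f `|t1 - x|.
 by rewrite -odd_itv_shift.
by ring.
Qed.

Lemma diff_int0 x t1 t2 : t1 <= t2 ->
 itg (fun v => (s0 (v + x) - s0 (v - x)) * ((t1 <= v) && (v < t2))%R%:R) /\
 q0 (t2 + x) - q0 (t2 - x) - (q0 (t1 + x) - q0 (t1 - x)) =
   \int[mu]_v ((s0 (v + x) - s0 (v - x)) * ((t1 <= v) && (v < t2))%R%:R).
move=> t12; pose B := `|t1| + `|t2| + `|x| + 1.
have B0 : 0 < B by rewrite ltr_wpDl// !addr_ge0.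
have [ip _] := pp_int al0 B0.
have p0 z : z <= 0 -> pp al B z = 0 by exact: pp_le0.
have [h1 h2] := diff_int x ip p0 t12.
have E v : (oddf (pp al B) (v + x) - oddf (pp al B) (v - x)) * ((t1 <= v) && (v < t2))%R%:R =
  (s0 (v + x) - s0 (v - x)) * ((t1 <= v) && (v < t2))%R%:R.
 have [v1|v1] := leP t1 v; last by rewrite !mulr0.
 have [v2|v2] := ltP v t2; last by rewrite !mulr0.
 have vb : `|v| <= `|t1| + `|t2|.
  rewrite ler_norml; apply/andP; split.
   rewrite opprD; apply: le_trans v1; rewrite (@le_trans _ _ (- `|t1|))//; first by rewrite gerBl.
   by rewrite lerNl (le_trans (ler_norm _))// normrN.
  by rewrite (le_trans (ltW v2))// (le_trans (ler_norm _))// lerDr.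
 rewrite !s0_odd//.
  rewrite /B (le_lt_trans (ler_normB _ _))// (@le_lt_trans _ _ (`|t1| + `|t2| + `|x|))//.
   by rewrite lerD2r.
  by rewrite ltrDl.
 rewrite /B (le_lt_trans (ler_normD _ _))// (@le_lt_trans _ _ (`|t1| + `|t2| + `|x|))//.
  by rewrite lerD2r.
 by rewrite ltrDl.
have nb y : `|y| <= `|t1| + `|t2| + `|x| -> `|y| <= B by move=> h; rewrite (le_trans h)// lerDl.
have nb1 : `|t1 + x| <= B by apply: nb; rewrite (le_trans (ler_normD _ _))// lerD2r lerDl.
have nb2 : `|t1 - x| <= B by apply: nb; rewrite (le_trans (ler_normB _ _))// lerD2r lerDl.
have nb3 : `|t2 + x| <= B by apply: nb; rewrite (le_trans (ler_normD _ _))// lerD2r lerDr.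
have nb4 : `|t2 - x| <= B by apply: nb; rewrite (le_trans (ler_normB _ _))// lerD2r lerDr.
rewrite -(eqRint E) -h2 !prim_pp//; split => //.
by move: h1; rewrite (funext E).
Qed.

(** By [prim_diff_le] the integrand is at most [C] times the model one, whose integral has modulus
    [c0] for every [t != 0]; at [t = 0] it vanishes identically. *)
Lemma W_bound f (C B d t : R) : itg f -> 0 <= C -> 0 < B -> (forall z, `|f z| <= C * pp al B z) ->
 mfs (fun y => prim f `|y|) ->
 itg (fun x => pp (- al) d x * (prim f `|t + x| - prim f `|t - x|)) /\
 \int[mu]_x `|pp (- al) d x * (prim f `|t + x| - prim f `|t - x|)| <= C * c0.
move=> hf C0 B0 hC mP.
have mi : mfs (fun x => pp (- al) d x * (prim f `|t + x| - prim f `|t - x|)).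
 apply: mfsM; first exact: mfs_pp.
 apply: mfsB; apply: (mfsT mP) => //.
  exact: mfsD.
 exact: mfsB.
have [->|t0] := eqVneq t 0.
 have E x : pp (- al) d x * (prim f `|0 + x| - prim f `|0 - x|) = 0.
  by rewrite add0r sub0r normrN subrr mulr0.
 rewrite (funext E); split; first exact: itg0.
 rewrite (eqRint (g := fun=> 0)) => [|x]; last by rewrite E normr0.
 by rewrite /Rintegral integral0 mulr_ge0// ltW// c0_gt0.
have [i1 e1] := scale_int t0.
have nn x : `|om x * (q0 (t + x) - q0 (t - x))| = Num.sg t * (om x * (q0 (t + x) - q0 (t - x))).
 rewrite normrM (ger0_norm (om_ge0 _ _)) /om_; case: ifPn => [x0|_]; last by rewrite !mul0r mulr0.
 rewrite mulrCA; congr (_ * _).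
 have [tn|tp|tz] := ltgtP t 0; last by rewrite tz eqxx in t0.
  rewrite ltr0_sg// mulN1r ler0_norm// subr_le0 q0_le//.
  rewrite (ltr0_norm (x := t - x)); last by rewrite subr_lt0 (lt_trans tn).
  by rewrite ler_norml; apply/andP; split; lra.
 rewrite gtr0_sg// mul1r ger0_norm// subr_ge0 q0_le//.
 rewrite (gtr0_norm (x := t + x)); last by rewrite addr_gt0.
 by rewrite ler_norml; apply/andP; split; lra.
have dom x : `|pp (- al) d x * (prim f `|t + x| - prim f `|t - x|)| <= C * (Num.sg t * (om x * (q0 (t + x) - q0 (t - x)))).
 rewrite -nn !normrM (ger0_norm (pp_ge0 _ _ _)) (ger0_norm (om_ge0 _ _)) [leRHS]mulrCA.
 apply: ler_pM => //; first exact: pp_ge0.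
  by rewrite /pp /om_; case: (0 < x) => //=; case: (x < d) => //; exact: powR_ge0.
 exact: prim_diff_le hf C0 B0 hC.
have ig : itg (fun x => C * (Num.sg t * (om x * (q0 (t + x) - q0 (t - x))))) by do 2 apply: itgZ.
have i2 := itg_dom mi dom ig.
split => //; apply: (le_trans (int_le (itg_norm i2) ig dom)).
rewrite !intZ//; last by apply: itgZ.
by rewrite e1 (mulrA (Num.sg t)) -expr2 sqr_sg t0 mul1r.
Qed.

(** What the cut of the weight at [d] removes has a bounded density: the weight is bounded and
    integrable on [x > d], and [s0] is a locally integrable singularity plus a bounded function. *)
Lemma rho0_bound (d : R) : 0 < d -> exists2 D, 0 <= D & forall v,
 itg (fun x => pt al d x * (s0 (v + x) - s0 (v - x))) /\
 \int[mu]_x `|pt al d x * (s0 (v + x) - s0 (v - x))| <= D.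
move=> d0; have pI := pe_int al0 ltr01; have tI := pt_int al0 d0; have ie := pI.1; have it := tI.1.
set w := d `^ (- al - 1); have w0 : 0 <= w by exact: powR_ge0.
exists (w * (2 * (2 * (1 `^ al / al))) + 2 * (d `^ (- al) / al)); first by pos.
move=> v; have ie1 : itg (fun x => pe al 1 (v + x)).
 by have := itg_shift (- v) ie; congr itg; apply/funext => x; rewrite opprK addrC.
have ie2 : itg (fun x => pe al 1 (v - x)) by exact: itg_refl.
have iS : itg (fun x => pe al 1 (v + x) + pe al 1 (v - x)) by exact: itgD.
have ig : itg (fun x => w * (pe al 1 (v + x) + pe al 1 (v - x)) + 2 * pt al d x).
 by apply: itgD; apply: itgZ.
have hs z : `|s0 z| <= pe al 1 z + 1.
 rewrite /s0_ normrM (ger0_norm (powR_ge0 _ _)) normr_sg.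
 have [->|z0] := eqVneq z 0; first by rewrite mul0r addr_ge0// pe_ge0.
 rewrite mul1r; have [z1|z1] := ltP `|z| 1; first by rewrite peE// lerDl.
 rewrite ler_wpDl ?pe_ge0// (@le_trans _ _ (1 `^ (al - 1)))//; last by rewrite powR1.
 by apply: powR_neg_le => //; rewrite subr_le0 ltW.
have mi : mfs (fun x => pt al d x * (s0 (v + x) - s0 (v - x))).
 apply: mfsM; first exact: mfs_pt.
 apply: mfsB; apply: (mfsT mfs_s0) => //.
  exact: mfsD.
 exact: mfsB.
have dom x : `|pt al d x * (s0 (v + x) - s0 (v - x))| <= w * (pe al 1 (v + x) + pe al 1 (v - x)) + 2 * pt al d x.
 rewrite normrM (ger0_norm (pt_ge0 _ _ _)).
 have h : `|s0 (v + x) - s0 (v - x)| <= (pe al 1 (v + x) + pe al 1 (v - x)) + 2.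
  apply: (le_trans (ler_normB _ _)); have := hs (v + x); have := hs (v - x).
  by move: `|s0 _| `|s0 _| (pe _ _ _) (pe _ _ _) => a b c e; lra.
 have pw : pt al d x <= w.
  rewrite /pt; case: ifPn => [dx|_] //; apply: powR_neg_le => //; first exact: ltW.
  by rewrite subr_le0; apply: (@le_trans _ _ 0) => //; rewrite oppr_le0 ltW.
 apply: (le_trans (ler_wpM2l (pt_ge0 _ _ _) h)); rewrite mulrDr; apply: lerD; last by rewrite mulrC.
 by apply: ler_wpM2r => //; rewrite addr_ge0// pe_ge0.
have i1 := itg_dom mi dom ig; split => //.
apply: (le_trans (int_le (itg_norm i1) ig dom)).
rewrite intD; [|exact: itgZ|exact: itgZ].
have ee1 : \int[mu]_x pe al 1 (v + x) = \int[mu]_x pe al 1 x.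
 by rewrite -(int_shift (- v) ie); apply: eqRint => x; rewrite opprK addrC.
have ee2 : \int[mu]_x pe al 1 (v - x) = \int[mu]_x pe al 1 x by exact: int_refl.
rewrite (intZ _ iS) (intZ _ it) (intD ie1 ie2) ee1 ee2 pI.2 tI.2 {ee1 ee2}; apply: eqle; ring.
Qed.

(** By scaling, the surplus order [th] makes the density [O(|v|^(th-1))]. For [x <= lam v] the
    hypothesis of Lipschitz type gains a power of [x], which the weight can take; beyond, the kernel
    is split into its singularity near [v + x = 0] or [v - x = 0] and its size elsewhere. Negative
    [v] follow by oddness. *)
Lemma rhop_bound f (D D' lam th T T' d : R) : mfs f -> 0 <= D -> 0 <= D' -> 0 < lam -> lam <= 2^-1 ->
 0 < th -> al + th <= 1 -> (forall z, `|f z| <= D * pp (al + th) T z) ->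
 (forall v x, 0 < v -> v < T' -> 0 < x -> x < d -> x <= lam * v ->
   `|f (v + x) - f (v - x)| <= D' * x * v `^ (al + th - 2)) ->
 exists2 E, 0 <= E & forall v, v != 0 -> `|v| < T' ->
 itg (fun x => pp (- al) d x * (oddf f (v + x) - oddf f (v - x))) /\
 \int[mu]_x `|pp (- al) d x * (oddf f (v + x) - oddf f (v - x))| <= E * `|v| `^ (th - 1).
move=> mf D0 D'0 lam0 lam2 th0 m1 hD hL.
set m := al + th; have m0 : 0 < m by rewrite addr_gt0.
have o1 : 0 < 1 - al by rewrite subr_gt0.
pose E1 := D' * (lam `^ (1 - al) / (1 - al)).
pose E2 := lam `^ (- al - 1) * D * (4 / m).
pose E3 := 2 * D * (lam `^ (- al) / al).
have E10 : 0 <= E1 by rewrite /E1; pos.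
have E20 : 0 <= E2 by rewrite /E2; pos.
have E30 : 0 <= E3 by rewrite /E3; pos.
exists (E1 + E2 + E3); first by pos.
have modf : mfs (oddf f).
 by apply: mfsB => //; exact: (mfsT mf).
have mi v : mfs (fun x => pp (- al) d x * (oddf f (v + x) - oddf f (v - x))).
 apply: mfsM; first exact: mfs_pp.
 apply: mfsB; apply: (mfsT modf) => //.
  exact: mfsD.
 exact: mfsB.
suff pos_case v : 0 < v -> v < T' -> itg (fun x => pp (- al) d x * (oddf f (v + x) - oddf f (v - x))) /\
 \int[mu]_x `|pp (- al) d x * (oddf f (v + x) - oddf f (v - x))| <= (E1 + E2 + E3) * v `^ (th - 1).
 move=> v vn vT; have [v0|v0|v0] := ltgtP v 0; last by rewrite v0 eqxx in vn.
  rewrite ltr0_norm// in vT *; have nv : 0 < - v by rewrite oppr_gt0.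
  have [h1 h2] := pos_case _ nv vT.
  have E x : pp (- al) d x * (oddf f (v + x) - oddf f (v - x)) = pp (- al) d x * (oddf f (- v + x) - oddf f (- v - x)).
   have -> : oddf f (v + x) = - oddf f (- v - x) by rewrite -oddfN; congr oddf; ring.
   have -> : oddf f (v - x) = - oddf f (- v + x) by rewrite -oddfN; congr oddf; ring.
   by congr (_ * _); ring.
  rewrite (funext E); split => //.
  by rewrite (le_trans _ h2)//; apply: eqle; apply: eqRint => x; rewrite E.
 by rewrite gtr0_norm// in vT *; exact: pos_case.
move=> v0 vT; have lv : 0 < lam * v by rewrite mulr_gt0.
have aI := pp_int o1 lv; have pI := pe_int m0 v0; have tI := pt_int al0 lv.
have ia := aI.1; have ie := pI.1; have it := tI.1.
have ie1 : itg (fun x => pe m v (v + x)).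
 by have := itg_shift (- v) ie; congr itg; apply/funext => x; rewrite opprK addrC.
have ie2 : itg (fun x => pe m v (v - x)) by exact: itg_refl.
set w := (lam * v) `^ (- al - 1); have w0 : 0 <= w by exact: powR_ge0.
have iS : itg (fun x => pe m v (v + x) + pe m v (v - x)) by exact: itgD.
pose g x := D' * v `^ (m - 2) * pp (1 - al) (lam * v) x + (w * D * (pe m v (v + x) + pe m v (v - x)) + 2 * D * v `^ (m - 1) * pt al (lam * v) x).
have ig : itg g by apply: itgD; [|apply: itgD]; apply: itgZ.
have ho z : z != 0 -> `|oddf f z| <= D * (pe m v z + v `^ (m - 1)).
 move=> z0; have h : `|oddf f z| <= D * `|z| `^ (m - 1).
  have ha y : `|f y| <= D * ((0 < y)%R%:R * `|y| `^ (m - 1)).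
   apply: (le_trans (hD y)); apply: ler_wpM2l => //; rewrite /pp.
   case: ifPn => [/andP[y0 _]|_]; last by apply: mulr_ge0 => //; exact: powR_ge0.
   by rewrite y0 mul1r gtr0_norm.
  apply: (le_trans (ler_normB _ _)); apply: (le_trans (lerD (ha z) (ha (- z)))).
  rewrite normrN -mulrDr -mulrDl oppr_gt0; apply: ler_wpM2l => //.
  move: z0; case: (ltgtP z 0) => // _ _; by rewrite ?add0r ?addr0 mul1r.
 apply: (le_trans h); apply: ler_wpM2l => //.
 have [zv|zv] := ltP `|z| v; first by rewrite peE// lerDl powR_ge0.
 rewrite ler_wpDl ?pe_ge0//; apply: powR_neg_le => //; rewrite subr_le0; exact: m1.
have dom : {ae mu, forall x, `|pp (- al) d x * (oddf f (v + x) - oddf f (v - x))| <= g x}.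
 apply: (aeS2 (aeS2 (ae_neq v) (ae_neq (- v)) (fun x a b => conj a b)) (ae_neq (lam * v))) => x xvv xl.
 case: xvv => xv xv'.
 have vx1 : v + x != 0 by rewrite addr_eq0 -eqr_oppLR eq_sym.
 have vx2 : v - x != 0 by rewrite subr_eq0 eq_sym.
 rewrite normrM (ger0_norm (pp_ge0 _ _ _)).
 have g1 : 0 <= D' * v `^ (m - 2) * pp (1 - al) (lam * v) x by pos.
 have g2 : 0 <= w * D * (pe m v (v + x) + pe m v (v - x)) + 2 * D * v `^ (m - 1) * pt al (lam * v) x.
  by apply: addr_ge0; [apply: mulr_ge0; [by pos|by rewrite addr_ge0// pe_ge0]|by pos].
 have [x0|x0] := ltP 0 x; last by rewrite pp_le0// mul0r /g addr_ge0.
 have [xd|xd] := ltP x d; last by rewrite {1}/pp (ltNge x d) xd andbF mul0r /g addr_ge0.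
 rewrite {1}/pp x0 xd /=.
 move: xl; have [xl|xl|//] := ltgtP x (lam * v) => _.
  have xv2 : x < v by rewrite (lt_le_trans xl)// ler_piMl ?(ltW v0)// (le_trans lam2)// invf_le1// ler1n.
  rewrite /oddf.
  have f0 z : z <= 0 -> f z = 0.
   by move=> z0; apply/eqP; rewrite -normr_le0 (le_trans (hD z))// pp_le0// mulr0.
  rewrite (f0 (- (v + x))) ?oppr_le0 ?addr_ge0 ?(ltW v0) ?(ltW x0)//.
  rewrite (f0 (- (v - x))) ?oppr_le0 ?subr_ge0 ?(ltW xv2)// !subr0.
  apply: (@le_trans _ _ (D' * v `^ (m - 2) * pp (1 - al) (lam * v) x)); last by rewrite /g lerDl.
  apply: (le_trans (ler_wpM2l (powR_ge0 _ _) (hL v x v0 vT x0 xd (ltW xl)))).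
  rewrite /pp x0 xl /=.
  have -> : x `^ (- al - 1) * (D' * x * v `^ (al + th - 2)) = D' * v `^ (al + th - 2) * (x `^ (- al - 1) * x) by ring.
  rewrite -{2}(powRr1 (ltW x0)) -powRD_pos//; apply: eqle; congr (_ * _ `^ _); ring.
 apply: (@le_trans _ _ (w * D * (pe m v (v + x) + pe m v (v - x)) + 2 * D * v `^ (m - 1) * pt al (lam * v) x)); last by rewrite /g lerDr.
 have hx : x `^ (- al - 1) = pt al (lam * v) x by rewrite /pt xl.
 have pw : x `^ (- al - 1) <= w.
  apply: powR_neg_le => //; first exact: ltW.
  by rewrite subr_le0; apply: (@le_trans _ _ 0) => //; rewrite oppr_le0 ltW.
 have h : `|oddf f (v + x) - oddf f (v - x)| <= D * (pe m v (v + x) + pe m v (v - x)) + 2 * D * v `^ (m - 1).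
  apply: (le_trans (ler_normB _ _)); apply: (le_trans (lerD (ho _ vx1) (ho _ vx2))).
  by apply: eqle; ring.
 apply: (le_trans (ler_wpM2l (powR_ge0 _ _) h)); rewrite mulrDr; apply: lerD; last by rewrite hx mulrC.
 rewrite -mulrA; apply: ler_wpM2r => //.
 by apply: mulr_ge0 => //; rewrite addr_ge0// pe_ge0.
have [i1 _] := int_ae_dom (mi v) ig dom; split => //.
apply: (le_trans (int_ae_le (itg_norm i1) ig dom)).
rewrite /g intD; [|exact: itgZ|by apply: itgD; apply: itgZ].
rewrite intD; [|exact: itgZ|exact: itgZ].
have ee1 : \int[mu]_x pe m v (v + x) = \int[mu]_x pe m v x.
 by rewrite -(int_shift (- v) ie); apply: eqRint => x; rewrite opprK addrC.
have ee2 : \int[mu]_x pe m v (v - x) = \int[mu]_x pe m v x by exact: int_refl.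
rewrite (intZ _ ia) (intZ _ iS) (intZ _ it) (intD ie1 ie2) ee1 ee2 pI.2 aI.2 tI.2 /w {ee1 ee2}.
rewrite !(powRM _ (ltW lam0) (ltW v0)) (mulrDl (E1 + E2)) (mulrDl E1) -(addrA (E1 * _)); apply: lerD; last apply: lerD.
- apply: eqle; rewrite /E1; have -> : v `^ (th - 1) = v `^ (m - 2) * v `^ (1 - al).
  by rewrite -powRD_pos//; congr (_ `^ _); rewrite /m; ring.
 by ring.
- apply: eqle; rewrite /E2; have -> : v `^ (th - 1) = v `^ (- al - 1) * v `^ m.
  by rewrite -powRD_pos//; congr (_ `^ _); rewrite /m; ring.
 by ring.
- apply: eqle; rewrite /E3; have -> : v `^ (th - 1) = v `^ (m - 1) * v `^ (- al).
  by rewrite -powRD_pos//; congr (_ `^ _); rewrite /m; ring.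
 by ring.
Qed.

End weight.

#[local] Opaque powR ker kC kC1 kC2 cs rm Bt itg.
Lemma lin1 (R : realType) (T d u : R) : 0 < d -> u < T -> - T < d - u.
Proof. by move=> ? ?; lra. Qed.

(** * The parametrix: inverting the odd kernel up to a weakly singular one *)

Section parametrix.
Variable R : realType.
Notation mu := (@lebesgue_measure R).
Notation mu2 := (mu \x mu)%E.
Implicit Types (f g : R -> R) (x y t s v z : R).

(** The primitive is a difference of two monotone functions, those of [|f| + f] and [|f|]. *)
Lemma mfs_prim f : itg f -> mfs (fun y => prim f `|y|).
move=> hf; have mono g : itg g -> (forall z, 0 <= g z) -> mfs (prim g).
 move=> ig g0; apply: nondecreasing_measurable => // y1 y2 y12.
 apply: int_le; [exact: itg_lt|exact: itg_lt|move=> z].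
 apply: ler_wpM2l => //; rewrite ler_nat; case: (ltP z y1) => // h.
 by rewrite (lt_le_trans h y12).
have i1 := itg_norm hf; have i2 := itgD i1 hf.
have E : prim f = fun y => prim (fun z => `|f z| + f z) y - prim (fun z => `|f z|) y.
 apply/funext => y; rewrite /prim -intB; [|exact: itg_lt i2|exact: itg_lt i1].
 by apply: eqRint => z; ring.
have mp : mfs (prim f).
 rewrite E; apply: mfsB; apply: mono => // z.
 by rewrite -lerBlDr sub0r -normrN ler_norm.
by apply: (mfsT mp); exact: normr_measurable.
Qed.

Lemma chi_le1 x z : `|chi x z| <= 1.
Proof. by rewrite /chi normr_nat; case: (_ && _); rewrite /= ?lexx ?ler01. Qed.

Definition Wt (al d : R) (P : R -> R) t := \int[mu]_x (pp (- al) d x * (P (t + x) - P (t - x))).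

Variables (al T T' d : R).
Hypotheses (al0 : 0 < al) (al1 : al < 1) (T'0 : 0 < T') (d0 : 0 < d) (dT : T' + d <= T).
Let T0 : 0 < T. Proof. by apply: lt_le_trans dT; rewrite addr_gt0. Qed.

(** The integral of (E1) over []t - x, t + x[] is [2 x c]. Associativity moves the window onto the
    odd kernel, where it yields increments of the even primitive, and Fubini brings in the weight.
    The result does not involve [t] as long as the window stays in []0, T'[]. *)
Lemma Wt_const (k : R -> R) (Ck c : R) (phi : R -> R) t : itg k -> 0 <= Ck -> (forall z, `|k z| <= Ck * pp al T z) ->
 itg phi -> {ae mu, forall s, 0 < s -> s < T' -> cv k phi s - rcv k phi s = c} ->
 d <= t -> t <= T' - d ->
 itg (fun u => Wt al d (fun y => prim k `|y|) (t - u) * phi u) /\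
 \int[mu]_u (Wt al d (fun y => prim k `|y|) (t - u) * phi u) = \int[mu]_x (pp (- al) d x * (2 * x * c)).
move=> ik Ck0 hk iphi E1 dt td.
have k0 z : z <= 0 -> k z = 0.
 by move=> z0; apply/eqP; rewrite -normr_le0 (le_trans (hk z))// pp_le0// mulr0.
have mP := mfs_prim ik; set P := fun y => prim k `|y|.
have mphi := imeas iphi.
pose F (p : R * R) := pp (- al) d p.2 * (P (t - p.1 + p.2) - P (t - p.1 - p.2)) * phi p.1.
have mF : mfs F.
 apply: mfsM; last exact: mfsT.
 apply: mfsM; first by apply: mfsT => //; exact: mfs_pp.
 have ms : mfs (fun p : R * R => t - p.1) by exact: mfsB.
 by apply: mfsB; apply: (mfsT mP); [exact: mfsD|exact: mfsB].
have hW v := W_bound al0 al1 d v ik Ck0 T0 hk mP.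
have iF : mu2.-integrable setT (EFin \o F).
 apply: (int2_bound mF (itgZ (Ck * c0 al) (itg_norm iphi))); apply: aeW => v.
 have [h1 h2] := hW (t - v); rewrite /F /=; split.
  by have := itgZ (phi v) h1; congr itg; apply/funext => x; rewrite mulrC.
 rewrite (eqRint (g := fun x => `|phi v| * `|pp (- al) d x * (P (t - v + x) - P (t - v - x))|)).
  by rewrite intZ ?itg_norm// mulrC ler_wpM2r.
 by move=> x; rewrite normrM mulrC.
have E u : Wt al d P (t - u) * phi u = \int[mu]_x F (u, x).
 have [h1 _] := hW (t - u); rewrite /Wt -intZr//.
have iW := Rfubini_itg1 iF.
rewrite (funext E); split => //.
rewrite (Rfubini iF); apply: eqRint => x.
have [x0|x0] := ltP 0 x; last first.
 rewrite pp_le0// mul0r (eqRint (g := fun=> 0)) ?/Rintegral ?integral0// => u.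
 by rewrite /F /= pp_le0// !mul0r.
have [xd|xd] := ltP x d; last first.
 have z0 : pp (- al) d x = 0 by rewrite /pp (ltNge x d) xd andbF.
 rewrite z0 mul0r (eqRint (g := fun=> 0)) ?/Rintegral ?integral0// => u.
 by rewrite /F /= z0 !mul0r.
have io := itg_odd ik; have cI := itg_chi x0; have ic := cI.1.
have iop := cv_itg io iphi; have ioa := cv_itg (itg_norm io) (itg_norm iphi).
have mop := imeas iop.
have cb f : itg f -> cvok (chi x) f t.
 move=> hf; apply: (itg_dom _ _ (itg_norm hf)).
  apply: mfsM; last exact: imeas.
  by apply: mfs_subl; exact: mfs_chi.
 by move=> s; rewrite normrM ler_piMl// chi_le1.
have ok : cvok (fun z => `|chi x z|) (cv (fun z => `|oddf k z|) (fun z => `|phi z|)) t.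
 have := cb _ ioa; congr itg; apply/funext => s; congr (_ * _).
 by rewrite /chi normr_nat.
have A := cvA_at ic io iphi ok.
have -> : \int[mu]_u F (u, x) = pp (- al) d x * cv (cv (chi x) (oddf k)) phi t.
 have E3 : (fun u => F (u, x)) = fun u => pp (- al) d x * (cv (chi x) (oddf k) (t - u) * phi u).
  by apply/funext => u; rewrite /F /= cv_chi// mulrA.
 rewrite E3; have [p0|p0] := eqVneq (pp (- al) d x) 0.
  by rewrite p0 mul0r (eqRint (g := fun=> 0)) ?/Rintegral ?integral0// => u; rewrite mul0r.
 rewrite intZ//.
 apply: (itg_dom (g := fun u => norm1 (oddf k) * `|phi u|)); last by apply: itgZ; exact: itg_norm.
  apply: mfsM => //; apply: mfs_subl; exact: imeas (cv_itg ic io).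
 move=> u; rewrite normrM; apply: ler_wpM2r => //.
 rewrite /cv; have ii : itg (fun s => chi x (t - u - s) * oddf k s).
  apply: (itg_dom _ _ (itg_norm io)).
   apply: mfsM; last exact: imeas.
   by apply: mfs_subl; exact: mfs_chi.
  by move=> s; rewrite normrM ler_piMl// chi_le1.
 apply: (le_trans (int_norm ii)); apply: int_le; [exact: itg_norm|exact: itg_norm|].
 by move=> s; rewrite normrM ler_piMl// chi_le1.
rewrite -A; congr (_ * _); rewrite -cI.2 -intZr// /cv.
have icc : itg (fun z => chi x z * c) by have := itgZ c ic; congr itg; apply/funext => z; rewrite mulrC.
rewrite -(@int_refl _ (fun z => chi x z * c) t icc).
apply: int_ae_eq.
- by apply: mfsM => //; apply: mfs_subl; exact: mfs_chi.
- by apply: mfsM => //; apply: mfs_subl; exact: mfs_chi.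
have oc f : itg f -> itg phi -> {ae mu, forall s, cvok f phi s /\ itg (fun u => f (u - s) * phi u)}.
 by move=> hf _; apply: (aeS2 (cvok_ae hf iphi) (rcv_ok_ae hf iphi) (fun s a b => conj a b)).
apply: (aeS2 E1 (oc k ik iphi)) => s Es oo; case: oo => o1 o2.
rewrite /chi; have [c1|c1] := leP (- x) (t - s); last by rewrite !mul0r.
have [c2|c2] := ltP (t - s) x; last by rewrite !mul0r.
have s0 : 0 < s by move: c2 xd dt {iF mF hW E}; lra.
have sT : s < T' by move: c1 xd td {iF mF hW E}; lra.
rewrite /= !mul1r -(Es s0 sT).
rewrite /cv /rcv -intB//; apply: eqRint => u; rewrite /oddf opprB; ring.
Qed.

Variables (kp : R -> R) (a0 D D' lam th : R).
Let k z := a0 * pp al T z + kp z.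
Hypotheses (mkp : mfs kp) (D0 : 0 <= D) (D'0 : 0 <= D') (lam0 : 0 < lam) (lam2 : lam <= 2^-1)
 (th0 : 0 < th) (m1 : al + th <= 1) (hD : forall z, `|kp z| <= D * pp (al + th) T z)
 (hL : forall v x, 0 < v -> v < T' -> 0 < x -> x < d -> x <= lam * v ->
   `|kp (v + x) - kp (v - x)| <= D' * x * v `^ (al + th - 2)).

(** Density of the absolutely continuous part of [Wt]: the perturbation averaged over [x < d], minus
    the part of the model average that is lost by cutting the weight at [d]. *)
Definition rhoker v := if (v != 0) && (`|v| < T') then
 \int[mu]_x (pp (- al) d x * (oddf kp (v + x) - oddf kp (v - x))) -
 a0 * \int[mu]_x (pt al d x * (s0 al (v + x) - s0 al (v - x))) else 0.

Lemma kp_le z : `|kp z| <= (D * T `^ th) * pp al T z.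
apply: (le_trans (hD z)); rewrite -mulrA; apply: ler_wpM2l => //.
rewrite /pp; case: ifPn => [/andP[z0 zT]|_]; last by rewrite mulr0.
rewrite (_ : al + th - 1 = th + (al - 1)); last by ring.
rewrite powRD_pos//; apply: ler_wpM2r; first exact: powR_ge0.
by rewrite ge0_ler_powR ?nnegrE ?(ltW z0) ?(ltW th0) ?(ltW T0) ?(ltW zT).
Qed.

Lemma itg_kp : itg kp.
Proof. by apply: (itg_dom mkp hD); apply: itgZ; have [] := pp_int (addr_gt0 al0 th0) T0. Qed.

Lemma kp_neg z : z <= 0 -> kp z = 0.
Proof. by move=> z0; apply/eqP; rewrite -normr_le0 (le_trans (hD z))// pp_le0// mulr0. Qed.

Lemma sing_ge1 v : v != 0 -> `|v| < T' -> 1 <= T' `^ (1 - th) * `|v| `^ (th - 1).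
move=> v0 vT; have v0' : 0 < `|v| by rewrite normr_gt0.
rewrite (_ : th - 1 = - (1 - th)); last by ring.
rewrite powRN -[leRHS]/(_ / _) ler_pdivlMr ?powR_gt0// mul1r.
rewrite ge0_ler_powR ?nnegrE ?(ltW vT) ?(ltW T'0)// subr_ge0; move: m1 (ltW al0); lra.
Qed.

Lemma rhoker_bound : exists2 E, 0 <= E & itg rhoker /\ forall v, `|rhoker v| <= E * pe th T' v.
have [E1 E10 h1] := rhop_bound al0 al1 mkp D0 D'0 lam0 lam2 th0 m1 hD hL.
have [E2 E20 h2] := rho0_bound al0 al1 d0.
pose E := E1 + `|a0| * E2 * T' `^ (1 - th).
have E0 : 0 <= E by rewrite /E; pos.
have bd v : `|rhoker v| <= E * pe th T' v.
 rewrite /rhoker; case: ifPn => [/andP[v0 vT]|_]; last by rewrite normr0 mulr_ge0// pe_ge0.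
 have H1 := h1 v v0 vT; have H2 := h2 v.
 rewrite peE// (le_trans (ler_normB _ _))// mulrDl; apply: lerD.
  exact: le_trans (int_norm H1.1) H1.2.
 rewrite normrM -!mulrA; apply: ler_wpM2l => //.
 apply: (le_trans (le_trans (int_norm H2.1) H2.2)); rewrite ler_peMr//.
 exact: sing_ge1.
have ie := (pe_int th0 T'0).1; exists E => //; split => //.
pose G (p : R * R) := (if (p.1 != 0) && (`|p.1| < T') then 1 else 0) *
 (pp (- al) d p.2 * (oddf kp (p.1 + p.2) - oddf kp (p.1 - p.2)) - a0 * (pt al d p.2 * (s0 al (p.1 + p.2) - s0 al (p.1 - p.2)))).
have mo : mfs (oddf kp) by exact: imeas (itg_odd itg_kp).
have mdiff f : mfs f -> mfs (fun p : R * R => f (p.1 + p.2) - f (p.1 - p.2)).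
 by move=> mf; apply: mfsB; apply: (mfsT mf); [exact: mfsD|exact: mfsB].
have mG : mfs G.
 apply: mfsM.
  have mb : mfs (fun v : R => if (v != 0) && (`|v| < T') then 1 else 0 : R); last exact: (mfsT mb).
  apply: mfs_if => //; apply: measurable_and.
   apply: measurable_neg; apply: measurable_fun_eqr => //.
  by apply: measurable_fun_ltr => //; exact: normr_measurable.
 apply: mfsB; last apply: mfsM => //; apply: mfsM.
 - by apply: mfsT => //; exact: mfs_pp.
 - exact: mdiff.
 - by apply: mfsT => //; exact: mfs_pt.
 - exact: mdiff (mfs_s0 _).
have HG v : itg (fun x => G (v, x)) /\ rhoker v = \int[mu]_x G (v, x) /\ \int[mu]_x `|G (v, x)| <= E * pe th T' v.
 rewrite /G /rhoker /=; case: ifPn => [/andP[v0 vT]|_]; last first.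
  rewrite (_ : (fun x => _) = fun=> 0); last by apply/funext => x; rewrite mul0r.
  split; [exact: itg0|split].
   by rewrite (eqRint (g := fun=> 0)) ?/Rintegral ?integral0// => x; rewrite mul0r.
  rewrite (eqRint (g := fun=> 0)) => [|x]; last by rewrite mul0r normr0.
  by rewrite /Rintegral integral0 mulr_ge0// pe_ge0.
 have H1 := h1 v v0 vT; have H2 := h2 v; have H2' := itgZ a0 H2.1.
 rewrite (_ : (fun x => _) = fun x => pp (- al) d x * (oddf kp (v + x) - oddf kp (v - x)) -
  a0 * (pt al d x * (s0 al (v + x) - s0 al (v - x)))); last by apply/funext => x; rewrite mul1r.
 have H3 := itgB H1.1 H2'; split => //; split.
  by rewrite -intZ ?H2.1// -intB ?H1.1//; apply: eqRint => x; rewrite mul1r.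
 have n1 := itg_norm H1.1; have n2 := itgZ `|a0| (itg_norm H2.1).
 apply: (@le_trans _ _ (\int[mu]_x (`|pp (- al) d x * (oddf kp (v + x) - oddf kp (v - x))| +
  `|a0| * `|pt al d x * (s0 al (v + x) - s0 al (v - x))|))).
  apply: int_le; [|exact: itgD|].
   by have := itg_norm H3; congr itg; apply/funext => x; rewrite mul1r.
  by move=> x; rewrite mul1r (le_trans (ler_normB _ _))// (normrM a0).
 rewrite intD// intZ ?itg_norm ?H2.1//.
 rewrite peE// mulrDl; apply: lerD; first exact: H1.2.
 rewrite -!mulrA; apply: ler_wpM2l => //.
 apply: (le_trans H2.2); rewrite ler_peMr//.
 exact: sing_ge1.
have iG := int2_bound mG (itgZ E ie) (aeW (fun v => conj (HG v).1 (HG v).2.2)).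
have := Rfubini_itg1 iG; congr itg; apply/funext => v; exact: esym (HG v).2.1.
Qed.

Lemma prim_k y : prim k y = a0 * prim (pp al T) y + prim kp y.
have ip := (pp_int al0 T0).1.
rewrite /prim -intZ; last exact: itg_lt.
rewrite -intD; [|by apply: itgZ; exact: itg_lt|exact: itg_lt itg_kp].
by apply: eqRint => z; rewrite /k; ring.
Qed.

Lemma itg_k : itg k.
Proof. by apply: itgD; [apply: itgZ; exact: (pp_int al0 T0).1|exact: itg_kp]. Qed.

Lemma Wt_k t : Wt al d (fun y => prim k `|y|) t =
 a0 * Wt al d (fun y => prim (pp al T) `|y|) t + Wt al d (fun y => prim kp `|y|) t.
have ip := (pp_int al0 T0).1.
have h0 z : `|pp al T z| <= 1 * pp al T z by rewrite mul1r ger0_norm// pp_ge0.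
have H0 := W_bound al0 al1 d t ip ler01 T0 h0 (mfs_prim ip).
have c1 : 0 <= D * T `^ th by rewrite mulr_ge0// powR_ge0.
have H1 := W_bound al0 al1 d t itg_kp c1 T0 kp_le (mfs_prim itg_kp).
rewrite /Wt -intZ ?H0.1// -intD; [|exact: itgZ H0.1|exact: H1.1].
by apply: eqRint => x; rewrite !prim_k; ring.
Qed.

Lemma Wt_pow t1 t2 : t1 != 0 -> t2 != 0 -> - T' < t1 -> t1 <= t2 -> t2 < T' ->
 itg (fun v => (\int[mu]_x (pt al d x * (s0 al (v + x) - s0 al (v - x)))) * ((t1 <= v) && (v < t2))%R%:R) /\
 Wt al d (fun y => prim (pp al T) `|y|) t2 - Wt al d (fun y => prim (pp al T) `|y|) t1 =
 c0 al * (Num.sg t2 - Num.sg t1) -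
 \int[mu]_v ((\int[mu]_x (pt al d x * (s0 al (v + x) - s0 al (v - x)))) * ((t1 <= v) && (v < t2))%R%:R).
move=> t10 t20 Tt1 t12 t2T.
have ip := (pp_int al0 T0).1.
have h0 z : `|pp al T z| <= 1 * pp al T z by rewrite mul1r ger0_norm// pp_ge0.
have H0 t := W_bound al0 al1 d t ip ler01 T0 h0 (mfs_prim ip).
have E0 t x : `|t| < T' -> pp (- al) d x * (prim (pp al T) `|t + x| - prim (pp al T) `|t - x|) =
  pp (- al) d x * (q0 al (t + x) - q0 al (t - x)).
 move=> tT; have [->|pn] := eqVneq (pp (- al) d x) 0; first by rewrite !mul0r.
 have /andP[x0 xd] : (0 < x) && (x < d) by move: pn; rewrite /pp; case: ifP => //; rewrite eqxx.
 have tx : `|t| + `|x| <= T by rewrite (gtr0_norm x0) (le_trans _ dT)// lerD// ltW.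
 by rewrite !prim_pp// (le_trans _ tx)// ?ler_normD ?ler_normB.
have key t : t != 0 -> `|t| < T' -> itg (fun x => pt al d x * (q0 al (t + x) - q0 al (t - x))) /\
 Wt al d (fun y => prim (pp al T) `|y|) t = Num.sg t * c0 al - \int[mu]_x (pt al d x * (q0 al (t + x) - q0 al (t - x))).
 move=> t0 tT; have S := scale_int al0 al1 t0.
 have iP : itg (fun x => pp (- al) d x * (q0 al (t + x) - q0 al (t - x))).
  by have := (H0 t).1; congr itg; apply/funext => x; exact: E0.
 have mq : mfs (fun x => q0 al (t + x) - q0 al (t - x)).
  apply: mfsB; apply: (mfsT (mfs_q0 _)); [exact: mfsD|exact: mfsB].
 have mpt : mfs (fun x => pt al d x * (q0 al (t + x) - q0 al (t - x))).
  by apply: mfsM => //; exact: mfs_pt.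
 have Eo : {ae mu, forall x, om al x * (q0 al (t + x) - q0 al (t - x)) - pp (- al) d x * (q0 al (t + x) - q0 al (t - x)) = pt al d x * (q0 al (t + x) - q0 al (t - x))}.
  by apply: (aeS (ae_neq d)) => x xd; rewrite (om_split _ d0 xd); ring.
 have iD := itgB S.1 iP.
 have iT : itg (fun x => pt al d x * (q0 al (t + x) - q0 al (t - x))).
  apply: (itg_ae_dom mpt (itg_norm iD)); apply: (aeS Eo) => x h.
  by rewrite -h.
 split => //; rewrite -(int_ae_eq (imeas iD) mpt Eo) intB ?S.1// S.2 opprB addrCA subrr addr0.
 by apply: eqRint => x; exact: E0.
have nT t : t1 <= t -> t <= t2 -> `|t| < T'.
 by move=> a b; rewrite ltr_norml (lt_le_trans Tt1 a) (le_lt_trans b t2T).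
have K1 := key _ t10 (nT _ (lexx _) t12); have K2 := key _ t20 (nT _ t12 (lexx _)).
have [E2 E20 h2] := rho0_bound al0 al1 d0.
have ic := itgZ E2 (itg_chi T'0).1.
have pt0 x : x <= 0 -> pt al d x = 0.
 by move=> x0; rewrite /pt ltNge (le_trans x0)// ltW.
have bd : {ae mu, forall v, t1 <= v -> v < t2 -> itg (fun x => pt al d x * (s0 al (v + x) - s0 al (v - x))) /\
  \int[mu]_x `|pt al d x * (s0 al (v + x) - s0 al (v - x))| <= E2 * chi T' v}.
 apply: aeW => v v1 v2; split; first exact: (h2 v).1.
 apply: (le_trans (h2 v).2); rewrite /chi.
 have := nT v v1 (ltW v2); rewrite ltr_norml => /andP[a ->].
 by rewrite (ltW a) /= mulr1.
have g0 v : 0 <= E2 * chi T' v by rewrite mulr_ge0// ler0n.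
have wd := weighted_diff (mfs_pt al d) (mfs_s0 al) pt0 (fun x _ => (diff_int0 al0 x t12).2)
 (fun x _ => (diff_int0 al0 x t12).1) K1.1 K2.1 ic g0 bd.
split; first exact: wd.1.
rewrite K1.2 K2.2 -wd.2; set A1 := \int[mu]_x _; set A2 := \int[mu]_x _.
by move: A1 A2 (c0 al) (Num.sg t1) (Num.sg t2) => A1 A2 x y z; clear; ring.
Qed.

(** [Wt] jumps by [2 a0 c0] at 0 and has density [rhoker] elsewhere, so the derivative of its
    convolution with [phi] contains a multiple of [phi] itself. *)
Lemma Wt_diff t1 t2 : t1 != 0 -> t2 != 0 -> - T' < t1 -> t1 <= t2 -> t2 < T' ->
 Wt al d (fun y => prim k `|y|) t2 - Wt al d (fun y => prim k `|y|) t1 =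
 a0 * c0 al * (Num.sg t2 - Num.sg t1) + \int[mu]_v (rhoker v * ((t1 <= v) && (v < t2))%R%:R).
move=> t10 t20 Tt1 t12 t2T.
have [E1 E10 h1] := rhop_bound al0 al1 mkp D0 D'0 lam0 lam2 th0 m1 hD hL.
have ie := itgZ E1 (pe_int th0 T'0).1.
have c1 : 0 <= D * T `^ th by rewrite mulr_ge0// powR_ge0.
have H1 t := W_bound al0 al1 d t itg_kp c1 T0 kp_le (mfs_prim itg_kp).
have ho := imeas (itg_odd itg_kp).
have nT t : t1 <= t -> t <= t2 -> `|t| < T'.
 by move=> a b; rewrite ltr_norml (lt_le_trans Tt1 a) (le_lt_trans b t2T).
have bd : {ae mu, forall v, t1 <= v -> v < t2 -> itg (fun x => pp (- al) d x * (oddf kp (v + x) - oddf kp (v - x))) /\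
  \int[mu]_x `|pp (- al) d x * (oddf kp (v + x) - oddf kp (v - x))| <= E1 * pe th T' v}.
 apply: (aeS (ae_neq 0)) => v v0 v1 v2; have vT := nT v v1 (ltW v2).
 by rewrite peE//; exact: h1.
have wd := weighted_diff (S := fun y => prim kp `|y|) (mfs_pp (- al) d) ho (fun x => @pp_le0 _ (- al) d x)
 (fun x _ => (diff_int x itg_kp kp_neg t12).2) (fun x _ => (diff_int x itg_kp kp_neg t12).1)
 (H1 t1).1 (H1 t2).1 ie (fun v => mulr_ge0 E10 (pe_ge0 th T' v)) bd.
have wp := Wt_pow t10 t20 Tt1 t12 t2T.
rewrite !Wt_k.
have -> : \int[mu]_v (rhoker v * ((t1 <= v) && (v < t2))%R%:R) =
 \int[mu]_v ((\int[mu]_x (pp (- al) d x * (oddf kp (v + x) - oddf kp (v - x)))) * ((t1 <= v) && (v < t2))%R%:R) -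
 a0 * \int[mu]_v ((\int[mu]_x (pt al d x * (s0 al (v + x) - s0 al (v - x)))) * ((t1 <= v) && (v < t2))%R%:R).
 have [_ _ [ir _]] := rhoker_bound.
 have iz := itgZ a0 wp.1; rewrite -(intZ _ wp.1) -(intB wd.1 iz); apply: int_ae_eq.
 - exact: imeas (itg_itv _ _ ir).
 - exact: imeas (itgB wd.1 iz).
 apply: (aeS (ae_neq 0)) => v v0; have [v1|v1] := leP t1 v; last by rewrite !mulr0 subr0.
 have [v2|v2] := ltP v t2; last by rewrite !mulr0 subr0.
 by rewrite /rhoker v0 (nT v v1 (ltW v2)) /= !mulr1.
rewrite -wd.2 -/(Wt al d (fun y => prim kp `|y|) t2) -/(Wt al d (fun y => prim kp `|y|) t1).
have -> : Wt al d (fun y => prim (pp al T) `|y|) t2 = Wt al d (fun y => prim (pp al T) `|y|) t1 + (c0 al * (Num.sg t2 - Num.sg t1) -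
 \int[mu]_v ((\int[mu]_x (pt al d x * (s0 al (v + x) - s0 al (v - x)))) * ((t1 <= v) && (v < t2))%R%:R)).
 rewrite -wp.2; move: (Wt _ _ _ _) (Wt _ _ _ _) => x y; clear; ring.
set A1 := \int[mu]_v _; move: A1 (Wt _ _ _ _) (Wt _ _ _ _) (Wt _ _ _ _) => A1 x y z.
by move: (c0 al) (Num.sg t1) (Num.sg t2) a0 => a b c d'; clear; ring.
Qed.

Lemma sg_ind t1 t2 u : t1 < t2 -> u != t1 -> u != t2 ->
 Num.sg (t2 - u) - Num.sg (t1 - u) = 2 * ((t1 <= u) && (u < t2))%R%:R.
move=> t12 u1 u2; have [a|a|a] := ltgtP u t1; last by rewrite a eqxx in u1.
 rewrite (lt_trans a t12) /= mulr0 !gtr0_sg ?subrr// subr_gt0//; exact: lt_trans t12.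
rewrite (ltr0_sg (x := t1 - u)) ?subr_lt0//.
have [b|b|b] := ltgtP u t2; last by rewrite b eqxx in u2.
 by rewrite gtr0_sg ?subr_gt0//= mulr1 opprK.
by rewrite ltr0_sg ?subr_lt0// subrr mulr0.
Qed.

(** By [Wt_const] the convolution of [Wt] with [phi] has increment 0 from [d] to [x]; by [Wt_diff]
    this increment is the integral over []d, x[] of the function claimed to vanish. *)
Lemma parametrix0 (phi : R -> R) (c : R) : itg phi -> (forall t, ~~ ((0 < t) && (t < T')) -> phi t = 0) ->
 {ae mu, forall s, 0 < s -> s < T' -> cv k phi s - rcv k phi s = c} ->
 {ae mu, forall t, d < t -> t < T' - d -> 2 * a0 * c0 al * phi t + cv rhoker phi t = 0}.
move=> iphi sphi E1; have [E E0 [ir bd]] := rhoker_bound.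
have mphi := imeas iphi.
pose Ck := `|a0| + D * T `^ th.
have Ck0 : 0 <= Ck by rewrite /Ck; pos.
have hk z : `|k z| <= Ck * pp al T z.
 rewrite /k (le_trans (ler_normD _ _))// mulrDl; apply: lerD; last exact: kp_le.
 by rewrite normrM (ger0_norm (pp_ge0 _ _ _)).
have HW t dt td := Wt_const itg_k Ck0 hk iphi E1 (t := t) dt td.
have icv := cv_itg ir iphi.
apply: ae_zero_itv; first by apply: itgD => //; exact: itgZ.
move=> x dx xT.
set f := fun t => 2 * a0 * c0 al * phi t + cv rhoker phi t.
have i_f : itg f by apply: itgD => //; exact: itgZ.
pose b s : R := ((d <= s) && (s < x))%R%:R.
have mb : mfs b by exact: mfs_itvind.
have -> : \int[mu]_(y in `]d, x]) f y = \int[mu]_y (f y * b y).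
 rewrite Rintegral_mkcond; apply: int_ae_eq.
 - by apply: mfs_patch0 => //; exact: imeas.
 - by apply: mfsM => //; exact: imeas.
 apply: (aeS2 (ae_neq d) (ae_neq x)) => y yd yx; rewrite patchE /b.
 have -> : (y \in `]d, x]%classic) = ((d < y) && (y <= x)) by apply/idP/idP; rewrite inE/= in_itv.
 by rewrite (le_eqVlt d y) (eq_sym d) (negbTE yd) (le_eqVlt y x) (negbTE yx) /=; case: ifPn => _; rewrite ?mulr1 ?mulr0.
have dT' : d <= T' - d by exact: ltW (lt_trans dx xT).
have W1 := HW d (lexx d) dT'; have W2 := HW x (ltW dx) (ltW xT).
pose F (p : R * R) := b p.1 * (rhoker (p.1 - p.2) * phi p.2).
have iF : mu2.-integrable setT (EFin \o F).
 apply: (le_integrable _ _ _ (cv_itg2 ir iphi)) => //.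
  apply/measurable_EFinP; apply: mfsM; first exact: (mfsT mb).
  by apply: mfs_cv2 => //; exact: imeas.
 move=> p _ /=; rewrite lee_fin /F normrM ler_piMl// /b normr_nat.
 by case: (_ && _); rewrite /= ?lexx ?ler01.
have K u : \int[mu]_s F (s, u) = (\int[mu]_v (rhoker v * ((d - u <= v) && (v < x - u))%R%:R)) * phi u.
 rewrite -(int_shift u (itg_itv _ _ ir)) -intZr; last exact: itg_shift (itg_itv _ _ ir).
 by apply: eqRint => s; rewrite /F /b /= lerD2r ltrD2r; ring.
have iK := Rfubini_itg1 (int2_swap iF).
(* [Wt_diff] is valid between points of []-T', T'[]; for [u] outside []0, T'[], where [d - u] or
   [x - u] could leave that range, [phi u] is 0. *)
have eW : {ae mu, forall u, Wt al d (fun y => prim k `|y|) (x - u) * phi u - Wt al d (fun y => prim k `|y|) (d - u) * phi u =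
  2 * a0 * c0 al * phi u * b u + \int[mu]_s F (s, u)}.
 apply: (aeS2 (ae_neq d) (ae_neq x)) => u ud ux; rewrite K.
 have [/andP[u0 uT]|nu] := boolP ((0 < u) && (u < T')); last first.
  rewrite (sphi _ nu); set A := \int[mu]_v _; move: A (Wt _ _ _ _) (Wt _ _ _ _) (b u) (c0 al) a0 => q w e r z y.
  by clear; ring.
 rewrite -mulrBl Wt_diff.
 - rewrite (sg_ind dx ud ux) -/(b u); set A := \int[mu]_v _; move: (b u) A (phi u) (c0 al) a0 => q w e r z; clear; ring.
 - by rewrite subr_eq0 eq_sym.
 - by rewrite subr_eq0 eq_sym.
 - exact: lin1.
 - by rewrite lerD2r ltW.
 - by rewrite ltrBlDl (lt_le_trans xT)// (@le_trans _ _ T') ?gerBl ?(ltW d0)// lerDr ltW.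
have iL := itgB W2.1 W1.1.
have i1 : itg (fun u => 2 * a0 * c0 al * phi u * b u) by apply: itg_itv; exact: itgZ.
have iR := itgD i1 iK.
have Z : \int[mu]_u (2 * a0 * c0 al * phi u * b u + \int[mu]_s F (s, u)) = 0.
 apply: etrans (esym (int_ae_eq (imeas iL) (imeas iR) eW)) _.
 apply: etrans (intB W2.1 W1.1) _; apply/eqP; rewrite subr_eq0; apply/eqP.
 exact: etrans W2.2 (esym W1.2).
have i2 := Rfubini_itg1 iF; have i3 := itgD i1 i2.
rewrite -[RHS]Z (intD i1 iK) -(Rfubini iF) -(intD i1 i2); apply: int_ae_eq.
- by apply: mfsM => //; exact: imeas.
- exact: imeas.
apply: (aeS (cvok_ae ir iphi)) => s ok; rewrite /f mulrDl; congr (_ + _); rewrite /F /= intZ//.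
exact: mulrC.
Qed.

End parametrix.

Lemma pick_v1 (R : realType) (T L : R) : 0 < T -> T < L -> exists2 v1 : R, 0 < v1 & v1 <= 1 /\ (1 + v1) * T < L.
move=> T0 TL.
exists (Num.min 1 ((L - T) / (2 * T))); first by rewrite lt_min ltr01 divr_gt0 ?subr_gt0// mulr_gt0.
split; first by rewrite ge_min lexx.
apply: (@le_lt_trans _ _ (T + (L - T) / 2)); last exact: mid_lt.
rewrite mulrDl mul1r lerD2l; apply: (@le_trans _ _ ((L - T) / (2 * T) * T)).
 by rewrite ler_wpM2r ?(ltW T0)// ge_min lexx orbT.
by apply: eqle; field; rewrite gt_eqF.
Qed.

Transparent ker cs.
Lemma cs0 (R : realType) (e : nat -> R) (bt m T s : R) : cs e bt m T 0 s = ker e bt m T s.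
Proof. by rewrite /cs /ker; congr (kx _ _ _ _ _ _); apply/funext => n; exact: bc0. Qed.
#[local] Opaque ker cs.

(** * The parametrix for a fractional power series kernel *)

Section ker_parametrix.
Variable R : realType.
Notation mu := (@lebesgue_measure R).
Variables (e : nat -> R) (L bt C al T T' d : R).
Hypotheses (he : coefbd e L bt C) (L0 : 0 < L) (b0 : 0 < bt) (T0 : 0 < T) (TL : T < L)
 (al0 : 0 < al) (al1 : al < 1) (e0 : e 0%N != 0) (T'0 : 0 < T') (d0 : 0 < d) (dT : T' + d <= T).

Lemma powR_cutoff (m a s : R) : 0 <= a -> 0 < s -> s <= T -> s `^ (m + a) <= T `^ a * s `^ m.
move=> a0 s0 sT; rewrite addrC powRD_pos//; apply: ler_wpM2r; first exact: powR_ge0.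
by rewrite ge0_ler_powR ?nnegrE ?(ltW s0) ?(ltW T0).
Qed.

(* The bound is the mean value estimate for a power series, obtained by expanding at [v + x]. *)
Lemma ker_lip (e' : nat -> R) (m C' v1 v x : R) : coefbd e' L bt C' -> 0 < m -> 0 < v1 -> v1 <= 1 -> (1 + v1) * T < L ->
 0 < x -> x < v -> x <= v1 / 4 * v -> v + x < T ->
 `|ker e' bt m T (v + x) - ker e' bt m T (v - x)| <= (2 * kC1 L bt C' m T v1 / v1) * x * (v + x) `^ (m - 2).
move=> he' m0 v10 v11 v1L x0 xv xl vT.
have v0 := lt_trans x0 xv; have s0 : 0 < v + x by rewrite addr_gt0.
have ts : 2 * x < v + x by rewrite mulrDl !mul1r ltrD2r.
have t0 : 0 <= 2 * x by rewrite mulr_ge0// ltW.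
have := ker_taylor he' L0 b0 T0 m0 TL v10 v11 v1L 1 t0 ts vT.
have -> : v + x - 2 * x = v - x by ring.
rewrite big_ord1 expr0 mulr1.
rewrite cs0.
move=> ->; rewrite opprD addNKr normrN.
have c0 := kC1_ge0 m he' L0 b0 T0 v10 v1L.
have q0 : 0 <= 2 * x / (v + x) by rewrite divr_ge0// ltW.
have q1 : 2 * x / (v + x) <= v1 / 2.
 rewrite ler_pdivrMr//; apply: (@le_trans _ _ (v1 / 2 * v)); last first.
  by apply: ler_wpM2l; [rewrite divr_ge0// ltW|rewrite lerDl ltW].
 by move: xl; rewrite -(ler_pM2l (ltr0Sn R 1)) => /le_trans; apply; apply: eqle; field.
apply: (le_trans (rm_coarse he' L0 b0 T0 m0 v10 v11 v1L 1 (ltW vT) q0 q1)).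
rewrite expr1 /pp s0 vT /= (_ : m - 1 = (m - 2) + 1); last by ring.
rewrite powRD_pos// powRr1 ?(ltW s0)//.
apply: eqle.
have -> : kC1 L bt C' m T v1 * (2 * x / (v + x) / v1) * ((v + x) `^ (m - 2) * (v + x)) =
  2 * kC1 L bt C' m T v1 / v1 * x * (v + x) `^ (m - 2).
 by field; rewrite !gt_eqF.
by [].
Qed.

(** The kernel is its leading power plus a kernel of order [al + bt]. The surplus is lowered to
    [th = min bt (1 - al)] because the estimates of the perturbation use that [v^(al+th-1)] is
    nonincreasing. *)
Lemma parametrix : exists th C1 E : R, exists rho : R -> R,
 [/\ (0 < th) && (th <= 1), C1 != 0, 0 <= E, itg rho & forall v, `|rho v| <= E * pe th T' v] /\
 forall (phi : R -> R) (c : R), itg phi -> (forall t, ~~ ((0 < t) && (t < T')) -> phi t = 0) ->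
 {ae mu, forall s, 0 < s -> s < T' -> cv (ker e bt al T) phi s - rcv (ker e bt al T) phi s = c} ->
 {ae mu, forall t, d < t -> t < T' - d -> C1 * phi t + cv rho phi t = 0}.
have [v1 v10 [v11 v1L]] := pick_v1 T0 TL.
pose th := Num.min bt (1 - al); have th0 : 0 < th by rewrite lt_min b0 subr_gt0.
have thb : th <= bt by rewrite ge_min lexx.
have m1 : al + th <= 1 by rewrite -lerBrDl ge_min lexx orbT.
have ab0 : 0 < al + bt by rewrite addr_gt0.
have he1 := coefbd_shift he L0.
set e1 := fun n => e n.+1; pose kp := ker e1 bt (al + bt) T.
have TL1 : 1 * T < L by rewrite mul1r.
have mkp : mfs kp by exact: (mfs_ker _ he1 L0 b0 T0 TL).
pose D := kC L bt (C / L `^ bt) T * T `^ (bt - th).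
have D0 : 0 <= D by rewrite mulr_ge0 ?powR_ge0// (kC_ge0 he1 L0 b0 T0 TL).
have bth : 0 <= bt - th by rewrite subr_ge0.
have hD z : `|kp z| <= D * pp (al + th) T z.
 apply: (le_trans (ker_bound (al + bt) he1 L0 b0 T0 TL z)); rewrite /D -mulrA; apply: ler_wpM2l.
  exact: (kC_ge0 he1 L0 b0 T0 TL).
 rewrite /pp; case: ifPn => [/andP[z0 zT]|_]; last by rewrite mulr0.
 have -> : al + bt - 1 = (al + th - 1) + (bt - th) by ring.
 by apply: powR_cutoff => //; exact: ltW.
set v2 := v1 / 4; have v20 : 0 < v2 by rewrite divr_gt0.
have v22 : v2 <= 2^-1.
 by apply: (@le_trans _ _ (1 / 4)); [rewrite ler_wpM2r|rewrite div1r lef_pV2 ?posrE// ler_nat].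
pose D' := (2 * kC1 L bt (C / L `^ bt) (al + bt) T v1 / v1) * T `^ (bt - th).
have D'0 : 0 <= D'.
 by rewrite mulr_ge0 ?powR_ge0// divr_ge0 ?(ltW v10)// mulr_ge0// (kC1_ge0 _ he1 L0 b0 T0 v10 v1L).
have hL v x : 0 < v -> v < T' -> 0 < x -> x < d -> x <= v2 * v ->
  `|kp (v + x) - kp (v - x)| <= D' * x * v `^ (al + th - 2).
 move=> v0 vT x0 xd xv.
 have xv' : x < v by rewrite (le_lt_trans xv)// gtr_pMl// (le_lt_trans v22)// invf_lt1// ltr1n.
 have vxT : v + x < T by rewrite (lt_le_trans _ dT)// ltrD.
 apply: (le_trans (ker_lip he1 ab0 v10 v11 v1L x0 xv' xv vxT)).
 set w := 2 * _ / v1; have w0 : 0 <= w.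
  by rewrite divr_ge0 ?(ltW v10)// mulr_ge0// (kC1_ge0 _ he1 L0 b0 T0 v10 v1L).
 have h1 : (v + x) `^ (al + bt - 2) <= T `^ (bt - th) * (v + x) `^ (al + th - 2).
  have -> : al + bt - 2 = (al + th - 2) + (bt - th) by ring.
  by apply: powR_cutoff => //; [rewrite addr_gt0|exact: ltW].
 have h2 : (v + x) `^ (al + th - 2) <= v `^ (al + th - 2).
  by apply: powR_neg_le => //; [rewrite lerDl ltW|rewrite subr_le0 (le_trans m1)// ler1n].
 have -> : D' * x * v `^ (al + th - 2) = w * x * (T `^ (bt - th) * v `^ (al + th - 2)) by rewrite /D' -/w; ring.
 apply: ler_wpM2l; first by rewrite mulr_ge0// ltW.
 by apply: (le_trans h1); apply: ler_wpM2l => //; exact: powR_ge0.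
have F0 := parametrix0 al0 al1 T'0 d0 dT mkp D0 D'0 v20 v22 th0 m1 hD hL.
have [E E0 [ir bd]] := rhoker_bound al0 al1 T'0 d0 dT (e 0%N) mkp D0 D'0 v20 v22 th0 m1 hD hL.
exists th, (2 * e 0%N * c0 al), E, (rhoker al T' d kp (e 0%N)).
split.
 split => //; last by rewrite !mulf_neq0 ?pnatr_eq0// gt_eqF// c0_gt0.
 by rewrite th0 (le_trans _ m1)// lerDr ltW.
have kE : ker e bt al T = fun z => e 0%N * pp al T z + kp z.
 by apply/funext => z; apply: ker_recl; exact: (kx_geo he L0 b0 T0 z ltr01 TL1 (one_bd bt al)).
by move=> phi c; rewrite kE; exact: F0.
Qed.
End ker_parametrix.

#[local] Opaque powR itg.
Lemma arith1 (R : realType) (x y z u v w m a : R) : x <= y + m / 2 + z -> 0 <= u + v -> m = 2 * z + 2 * a + 2 * (u + v) ->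
 x + a + w <= y + w + m.
Proof. by move=> ? ? ?; lra. Qed.

Lemma min_lip (R : realType) (a b c d l : R) : `|a - c| <= l -> `|b - d| <= l -> `|Num.min a b - Num.min c d| <= l.
rewrite !ler_norml => /andP[? ?] /andP[? ?]; rewrite /Num.min; apply/andP; split;
 case: (ltP a b) => ?; case: (ltP c d) => ?; lra.
Qed.

Lemma max0_lip (R : realType) (x y l : R) : `|x - y| <= l -> `|Num.max 0 x - Num.max 0 y| <= l.
rewrite !ler_norml => /andP[? ?]; rewrite /Num.max; apply/andP; split;
 case: (ltP 0 x) => ?; case: (ltP 0 y) => ?; lra.
Qed.

Lemma clip_lip (R : realType) (x y : R) : `|Num.max 0 (Num.min 1 x) - Num.max 0 (Num.min 1 y)| <= `|x - y|.
Proof. by apply: max0_lip; apply: min_lip => //; rewrite subrr normr0. Qed.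

Lemma arith2 (R : realType) (t d T : R) : 0 < d -> 2 * d < t -> t < T - 2 * d ->
 Num.max 0 (Num.min 1 (Num.min (t - d) (T - d - t) / d)) = 1.
move=> d0 t1 t2; have h : 1 <= Num.min (t - d) (T - d - t) / d.
 by rewrite ler_pdivlMr// mul1r le_min; apply/andP; split; lra.
by rewrite (min_l h) max_r.
Qed.

Lemma divr_gt0_iff (R : realType) (x d : R) : 0 < d -> (0 < x / d) = (0 < x).
Proof. by move=> d0; rewrite pmulr_lgt0// invr_gt0. Qed.

(** * Bounds from weakly singular inequalities *)

Section smoothing.
Variable R : realType.
Notation mu := (@lebesgue_measure R).
Implicit Types (f g h psi phi : R -> R) (x y t s a : R).

Lemma ae_and (P Q : R -> Prop) : {ae mu, forall x, P x} -> {ae mu, forall x, Q x} -> {ae mu, forall x, P x /\ Q x}.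
Proof. by move=> h1 h2; apply: (aeS2 h1 h2). Qed.

Lemma pe_out (th T t : R) : t != 0 -> T <= `|t| -> pe th T t = 0.
rewrite /pe /pp (ltNge t) (ltNge (- t)) oppr_gt0; have [t0|t0|//] := ltgtP t 0 => _ tT.
 by rewrite -(ltr0_norm t0) tT /= addr0.
by rewrite -{1}(gtr0_norm t0) tT /= addr0.
Qed.

(** A part near 0, of small integral when [d] is small, plus a bounded part. *)
Lemma pe_split (th T d t : R) : 0 < d -> d <= T -> th <= 1 -> pe th T t <= pe th d t + d `^ (th - 1).
move=> d0 dT th1; have [->|t0] := eqVneq t 0.
 by rewrite {1}/pe oppr0 pp_le0// addr0 addr_ge0 ?pe_ge0 ?powR_ge0.
have [td|td] := ltP `|t| d; first by rewrite !peE// ?(lt_le_trans td)// lerDl powR_ge0.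
rewrite ler_wpDl ?pe_ge0//; have [tT|tT] := ltP `|t| T.
 by rewrite peE//; apply: powR_neg_le => //; rewrite subr_le0.
rewrite (pe_out th t0 tT); exact: powR_ge0.
Qed.

Lemma small_kernel (th T C : R) : 0 < th -> 0 < T -> 0 <= C ->
 exists d, [/\ 0 < d, d <= T & C * \int[mu]_x pe th d x <= 2^-1].
move=> th0 T0 C0; have C1 : 0 < 4 * (C + 1) by rewrite mulr_gt0// ltr_wpDl.
pose d0 := (th / (4 * (C + 1))) `^ (th^-1); have q0 : 0 < th / (4 * (C + 1)) by rewrite divr_gt0.
have d00 : 0 < d0 by exact: powR_gt0.
exists (Num.min T d0); have m0 : 0 < Num.min T d0 by rewrite lt_min T0.
split => //; first by rewrite ge_min lexx.
rewrite (pe_int th0 m0).2.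
have h : (Num.min T d0) `^ th <= th / (4 * (C + 1)).
 apply: (@le_trans _ _ (d0 `^ th)).
  by rewrite ge0_ler_powR ?nnegrE ?(ltW th0) ?(ltW m0) ?(ltW d00)// ge_min lexx orbT.
 by rewrite /d0 -powRrM mulVf ?gt_eqF// powRr1// ltW.
apply: (@le_trans _ _ (C * (2 * (th / (4 * (C + 1)) / th)))).
 by do 2 apply: ler_wpM2l => //; apply: ler_wpM2r => //; rewrite invr_ge0 ltW.
have -> : C * (2 * (th / (4 * (C + 1)) / th)) = 2^-1 * (C / (C + 1)).
 by field; rewrite !gt_eqF// ltr_wpDl.
by rewrite ler_piMr// ler_pdivrMr ?mul1r ?lerDl// ltr_wpDl.
Qed.

(** The inequality is tested on the excess of [psi] over the level [m]. The near part of the kernel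
    has norm at most 1/2 and is absorbed; its action on the level, the bounded part and [a] are
    covered by [m]. Only [h] remains, doubled by the absorption. *)
Lemma smooth_bound (th T C : R) : 0 < th -> th <= 1 -> 0 < T -> 0 <= C -> exists2 M, 0 <= M &
 forall psi h a, itg psi -> (forall t, 0 <= psi t) -> itg h -> (forall t, 0 <= h t) -> 0 <= a ->
 {ae mu, forall t, psi t <= C * cv (pe th T) psi t + a + h t} ->
 \int[mu]_t Num.max (psi t - M * (norm1 psi + a)) 0 <= 2 * \int[mu]_t h t.
move=> th0 th1 T0 C0; have [d [d0 dT hd]] := small_kernel th0 T0 C0.
have w0 : 0 <= C * d `^ (th - 1) by rewrite mulr_ge0// powR_ge0.
exists (2 * (C * d `^ (th - 1) + 1)); first by rewrite mulr_ge0// addr_ge0.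
move=> psi h a ipsi psi0 ih h0 a0 H; set M := 2 * _.
have n0 := norm1_ge0 psi; set m := M * _.
have m0 : 0 <= m by rewrite mulr_ge0 ?addr_ge0// mulr_ge0// addr_ge0.
pose P t := Num.max (psi t - m) 0.
have P0 t : 0 <= P t by rewrite le_max lexx orbT.
have Pp t : P t <= psi t by rewrite ge_max psi0 lerBlDr lerDl m0.
have mpsi := imeas ipsi.
have mP : mfs P by apply: measurable_maxr => //; exact: mfsB.
have iP : itg P.
 by apply: (itg_dom mP _ ipsi) => t; rewrite ger0_norm.
have iw := (pe_int th0 d0).1; have iwT := (pe_int th0 T0).1.
have wd0 t : 0 <= pe th d t by exact: pe_ge0.
have key : {ae mu, forall t, P t <= C * cv (pe th d) P t + h t}.
 apply: (aeS2 H (ae_and (cvok_ae iwT ipsi) (ae_and (cvok_ae iw ipsi) (cvok_ae iw iP)))).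
 move=> t Ht ok; have ok1 := ok.1; have ok2 := ok.2.1; have ok3 := ok.2.2.
 have c0 : 0 <= cv (pe th d) P t by apply: int_ge0 => s; rewrite mulr_ge0.
 rewrite ge_max addr_ge0 ?mulr_ge0// andbT.
 have i1 : itg (fun s => d `^ (th - 1) * psi s) by exact: itgZ.
 have s1 : cv (pe th T) psi t <= cv (pe th d) psi t + d `^ (th - 1) * norm1 psi.
  rewrite /norm1 (eqRint (g := psi)) => [|s]; last by rewrite ger0_norm.
  rewrite -intZ// /cv -intD//; apply: int_le => //; first exact: itgD.
  by move=> s; rewrite -mulrDl; apply: ler_wpM2r => //; exact: pe_split.
 have ir : itg (fun s => pe th d (t - s)) by exact: itg_refl.
 have s2 : cv (pe th d) psi t <= cv (pe th d) P t + m * \int[mu]_x pe th d x.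
  rewrite -(int_refl t iw) -intZ// /cv -intD//; last exact: itgZ.
  apply: int_le => //; first by apply: itgD => //; exact: itgZ.
  move=> s; rewrite (mulrC m) -mulrDr; apply: ler_wpM2l => //.
  by rewrite -lerBlDr le_max lexx.
 have s3 : C * cv (pe th T) psi t <= C * cv (pe th d) P t + m / 2 + C * d `^ (th - 1) * norm1 psi.
  apply: (le_trans (ler_wpM2l C0 s1)); rewrite mulrDr mulrA lerD2r.
  apply: (le_trans (ler_wpM2l C0 s2)); rewrite mulrDr lerD2l mulrCA.
  by apply: ler_wpM2l.
 have e1 : m = 2 * (C * d `^ (th - 1) * norm1 psi) + 2 * a + 2 * (C * d `^ (th - 1) * a + norm1 psi).
  by rewrite /m /M; ring.
 have s4 : 0 <= C * d `^ (th - 1) * a + norm1 psi by rewrite addr_ge0// mulr_ge0.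
 rewrite lerBlDr; apply: (le_trans Ht); exact: arith1 s3 s4 e1.
have ic := cv_itg iw iP.
have := int_ae_le iP (itgD (itgZ C ic) ih) key.
rewrite (intD (itgZ C ic) ih) (intZ _ ic) (int_cv iw iP) mulrA.
have := ler_wpM2r (int_ge0 P0) hd; move: (C * _ * _) (\int[mu]_t h t) => x y; rewrite -/P.
by move: (\int[mu]_x P x) => z; lra.
Qed.

(** With [h = 0] the excess has integral 0, so the level is an essential bound. *)
Lemma smooth_bound0 (th T C : R) : 0 < th -> th <= 1 -> 0 < T -> 0 <= C -> exists2 M, 0 <= M &
 forall psi a, itg psi -> (forall t, 0 <= psi t) -> 0 <= a ->
 {ae mu, forall t, psi t <= C * cv (pe th T) psi t + a} ->
 {ae mu, forall t, psi t <= M * (norm1 psi + a)}.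
move=> th0 th1 T0 C0; have [M M0 HM] := smooth_bound th0 th1 T0 C0.
exists M => // psi a ipsi psi0 a0 H.
have H' : {ae mu, forall t, psi t <= C * cv (pe th T) psi t + a + 0}.
 by apply: (aeS H) => t; rewrite addr0.
have := HM psi (fun=> 0) a ipsi psi0 (itg0 R) (fun=> lexx _) a0 H'.
rewrite {2}/Rintegral integral0 mulr0; set P := fun t => Num.max _ _ => h.
have m0 : 0 <= M * (norm1 psi + a) by rewrite mulr_ge0// addr_ge0// norm1_ge0.
have P0 t : 0 <= P t by rewrite le_max lexx orbT.
have mP : mfs P.
 by apply: measurable_maxr => //; apply: mfsB => //; exact: imeas.
have iP : itg P.
 apply: (itg_dom mP _ ipsi) => t; rewrite ger0_norm// ge_max psi0 lerBlDr lerDl m0//.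
have e : \int[mu]_t P t = 0 by apply: le_anti; rewrite h int_ge0.
apply: (aeS (int_eq0_ae iP P0 e)) => t Pt.
by rewrite -subr_le0 -Pt /P le_max lexx.
Qed.

(* Cutting off with a Lipschitz function costs only a bounded commutator, whatever [phi] does elsewhere. *)
Lemma interior_bound (th T T' C d : R) : 0 < th -> th <= 1 -> 0 < T -> 0 <= C -> 0 < d -> exists2 M, 0 <= M &
 forall phi, itg phi ->
 {ae mu, forall t, d < t -> t < T' - d -> `|phi t| <= C * cv (pe th T) (fun s => `|phi s|) t} ->
 {ae mu, forall t, 2 * d < t -> t < T' - 2 * d -> `|phi t| <= M * norm1 phi}.
move=> th0 th1 T0 C0 d0; have [M M0 HM] := smooth_bound0 th0 th1 T0 C0.
pose B := C * (d^-1 * T `^ th); have B0 : 0 <= B by rewrite !mulr_ge0 ?powR_ge0// invr_ge0 ltW.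
exists (M * (1 + B)); first by rewrite mulr_ge0// addr_ge0.
move=> phi iphi H; have n0 := norm1_ge0 phi.
pose chi t := Num.max 0 (Num.min 1 (Num.min (t - d) (T' - d - t) / d)).
have chi0 t : 0 <= chi t by rewrite le_max lexx.
have chi1 t : chi t <= 1 by rewrite ge_max ler01 ge_min lexx.
have chiL s t : `|chi s - chi t| <= `|s - t| / d.
 apply: (le_trans (clip_lip _ _)); rewrite -mulrBl normrM [`|d^-1|]gtr0_norm ?invr_gt0//.
 rewrite ler_pM2r ?invr_gt0//; apply: min_lip.
  by apply: eqle; congr `|_|; ring.
 by rewrite -[leRHS]normrN; apply: eqle; congr `|_|; ring.
pose psi t := chi t * `|phi t|.
have psi0 t : 0 <= psi t by rewrite mulr_ge0.
have psiL t : psi t <= `|phi t| by rewrite ler_piMl.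
have ip1 := itg_norm iphi; have mp1 := imeas ip1.
have ipsi : itg psi.
 apply: (itg_dom _ _ ip1) => [|t]; last by rewrite ger0_norm.
 apply: mfsM => //; apply: measurable_maxr => //; apply: measurable_minr => //.
 apply: mfsM => //; apply: measurable_minr; exact: mfsB.
have iw := (pe_int th0 T0).1.
have H2 : {ae mu, forall t, psi t <= C * cv (pe th T) psi t + B * norm1 phi}.
 apply: (aeS2 H (ae_and (cvok_ae iw ip1) (cvok_ae iw ipsi))) => t Ht ok; have ok1 := ok.1; have ok2 := ok.2.
 have r0 : 0 <= C * cv (pe th T) psi t + B * norm1 phi.
  have : 0 <= cv (pe th T) psi t by apply: int_ge0 => s; rewrite mulr_ge0// pe_ge0.
  by move=> hc; apply: addr_ge0; apply: mulr_ge0.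
 have [c0|c0] := eqVneq (chi t) 0; first by rewrite {1}/psi c0 mul0r.
 have : 0 < chi t by rewrite lt_neqAle eq_sym c0 chi0.
 rewrite lt_max ltxx /= lt_min ltr01 /= divr_gt0_iff// lt_min !subr_gt0 => /andP[t1 t2].
 apply: (le_trans (ler_wpM2l (chi0 t) (Ht t1 t2))).
 have i2 : itg (fun s => T `^ th / d * `|phi s|) by exact: itgZ.
 have i3 : itg (fun s => chi t * (pe th T (t - s) * `|phi s|)) by exact: itgZ.
 rewrite mulrCA /B -!mulrA -mulrDr; apply: ler_wpM2l => //.
 rewrite (mulrCA d^-1) mulrA /norm1 -intZ// -intZ// /cv -intD//; apply: int_le => //; first exact: itgD.
 move=> s; rewrite /psi !mulrA -mulrDl; apply: ler_wpM2r => //.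
 have h1 : chi t <= chi s + `|t - s| / d.
  by rewrite -lerBlDl (le_trans (ler_norm _)).
 apply: (le_trans (ler_wpM2r (pe_ge0 _ _ _) h1)); rewrite mulrDl [chi s * _]mulrC lerD2l.
 rewrite mulrAC; apply: ler_wpM2r; first by rewrite invr_ge0 ltW.
 have [ts|ts] := eqVneq (t - s) 0; first by rewrite ts normr0 mul0r powR_ge0.
 have ts0 : 0 < `|t - s| by rewrite normr_gt0.
 have [tT|tT] := ltP `|t - s| T.
  rewrite peE// -{1}(powRr1 (ltW ts0)) -powRD_pos// (_ : 1 + (th - 1) = th); last by ring.
  by rewrite ge0_ler_powR ?nnegrE ?(ltW th0) ?(ltW T0) ?(ltW tT).
 by rewrite pe_out// mulr0 powR_ge0.
apply: (aeS (HM psi (B * norm1 phi) ipsi psi0 (mulr_ge0 B0 n0) H2)) => t ht t1 t2.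
have : psi t <= M * (1 + B) * norm1 phi.
 apply: (le_trans ht); rewrite -mulrA; apply: ler_wpM2l => //; rewrite mulrDl mul1r lerD2r.
 apply: int_le => // [|s]; first exact: itg_norm.
 by rewrite ger0_norm.
rewrite /psi; suff -> : chi t = 1 by rewrite mul1r.
by apply: arith2 => //.
Qed.

End smoothing.

#[local] Opaque powR itg.

(** * Limits along an ultrafilter *)

Section ultralimit.
Variables (R : realType) (U : set_system nat).
Hypothesis UU : UltraFilter U.

(** Compactness of a segment. Ultrafilters replace subsequences, so that the integrals over all
    measurable sets converge at once. *)
Lemma ultra_cvg (u : nat -> R) (B : R) : (forall n, `|u n| <= B) -> cvg (u n @[n --> U]).
move=> hu; have UF : UltraFilter (u n @[n --> U]).
 split; first exact: fmap_proper_filter.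
 move=> G GP sFG; apply/seteqP; split => A; last exact: sFG.
 move=> GA; have [//|h] := in_ultra_setVsetC (u @^-1` A) UU.
 have : G (~` A) by apply: sFG.
 move=> GA'; have h0 : G set0 by rewrite -(setICr A); exact: filterI.
 by case: (@filter_not_empty _ G GP h0).
have := @segment_compact R (- B) B; rewrite compact_ultra => /(_ _ UF) [|l [_ hl]].
 suff : U (u @^-1` `[- B, B]) by [].
 by apply: (@filterS _ U _ setT) => [n _ /=|]; [rewrite in_itv/= -ler_norml|exact: filterT].
by apply/cvg_ex; exists l.
Qed.
End ultralimit.

Lemma cvg_sumn (R : realType) (U : set_system nat) (FU : Filter U) (u : nat -> nat -> R) (l : nat -> R) n :
 (forall i, u k i @[k --> U] --> l i) -> (\sum_(0 <= i < n) u k i) @[k --> U] --> \sum_(0 <= i < n) l i.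
move=> h; elim: n => [|n ih].
 rewrite big_geq//; under eq_fun do rewrite big_geq//; exact: cvg_cst.
rewrite big_nat_recr//=; under eq_fun do rewrite big_nat_recr//=.
exact: cvgD.
Qed.

Lemma ucvg_le (R : realType) (U : set_system nat) (PU : ProperFilter U) (u : nat -> R) (l e : R) :
 u k @[k --> U] --> l -> (forall k, `|u k| <= e) -> `|l| <= e.
move=> h hu; have c : `|u k| @[k --> U] --> `|l| by exact: cvg_norm h.
by apply: (ler_cvg_to c (cvg_cst e)); exact: nearW.
Qed.

(** * Weak limits of dominated sequences *)

Section weak.
Variable R : realType.
Notation mu := (@lebesgue_measure R).
Variables (U : set_system nat) (M T : R) (psi : nat -> R -> R).
Hypotheses (UU : UltraFilter U) (M0 : 0 <= M) (T0 : 0 < T)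
 (mpsi : forall n, mfs (psi n))
 (bd : forall n t, `|psi n t| <= M * pp 1 T t).

Let dom t := M * pp 1 T t.
Let idom : itg dom. Proof. by apply: itgZ; exact: (pp_int ltr01 T0).1. Qed.

Let ipsi n : itg (psi n). Proof. exact: (itg_dom (mpsi n) (bd n)). Qed.

Let Is n (A : set R) := \int[mu]_t (psi n t * \1_A t).

Lemma itg_ind1 f (A : set R) : measurable A -> itg f -> itg (fun t => f t * \1_A t : R).
move=> mA hf; apply: (itg_dom _ _ (itg_norm hf)).
 by apply: mfsM; [exact: imeas|exact: measurable_indic].
by move=> t; rewrite normrM ler_piMr// indicE normr_nat; case: (_ \in _); rewrite /= ?lexx ?ler01.
Qed.

Let Is_cvg A : measurable A -> cvg (Is n A @[n --> U]).
move=> mA; apply: (@ultra_cvg _ _ UU _ (\int[mu]_t dom t)) => n.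
have i1 := itg_ind1 mA (ipsi n).
apply: (le_trans (int_norm i1)); apply: int_le => //; first exact: itg_norm.
move=> t; rewrite normrM (le_trans _ (bd n t))// ler_piMr// indicE normr_nat.
by case: (_ \in _); rewrite /= ?lexx ?ler01.
Qed.

Definition ulim A : R := lim (Is n A @[n --> U]).

Lemma ulim_cvg A : measurable A -> Is n A @[n --> U] --> ulim A.
Proof. exact: Is_cvg. Qed.

Let nu (A : set (measurableTypeR R)) : \bar R := (ulim A)%:E.

Let UP : ProperFilter U. Proof. exact: ultra_proper. Qed.

Let ulim0 : nu set0 = 0%E.
congr EFin; apply/cvg_lim => //.
rewrite (_ : (fun n => Is n set0) = fun=> 0); first exact: cvg_cst.
apply/funext => n; rewrite /Is (eqRint (g := fun=> 0)) ?/Rintegral ?integral0// => t.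
by rewrite indic0 mulr0.
Qed.

Let nufin A : measurable A -> nu A \is a fin_num.
Proof. by []. Qed.

(** The tail of a disjoint union has an indicator with values 0 and 1, equal to 1 only through an
    index at least [n]: it is dominated and tends to 0 pointwise. *)
Lemma trivIset_ind (F : nat -> set R) n x : trivIset setT F ->
 exists b : bool, \1_(\bigcup_i F i) x - \sum_(i < n) \1_(F i) x = b%:R :> R /\
 (b = false \/ exists2 j, F j x & (n <= j)%N).
move=> tF; have [[j _ Fj]|nF] := pselect ((\bigcup_i F i) x).
 exists (~~ (j < n)%N); rewrite (indicE _ (\bigcup_i F i)) mem_set; last by exists j.
 have E i : \1_(F i) x = (i == j)%:R :> R.
  rewrite indicE; congr (nat_of_bool _)%:R; apply/idP/eqP; last by move=> ->; rewrite inE.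
  rewrite inE => Fi; apply: (tF i j) => //; by exists x.
 rewrite (eq_bigr (fun i : 'I_n => (i == j :> nat)%:R)) => [|i _]; last exact: E.
 split; last first.
  by case: ltnP => h; [left|right; exists j].
 case: ltnP => h; last first.
  rewrite big1 ?subr0// => i _; rewrite (_ : (i == j :> nat) = false)//.
  by apply/negbTE; rewrite neq_ltn (leq_trans (ltn_ord i) h).
 rewrite (bigD1 (Ordinal h))//= eqxx big1 ?addr0 ?subrr// => i ij.
 by rewrite (_ : (i == j :> nat) = false)//; apply/negbTE.
exists false; rewrite (indicE _ (\bigcup_i F i)) memNset//; split; last by left.
rewrite big1 ?subr0// => i _; rewrite indicE memNset// => Fi; apply: nF; by exists i.
Qed.

(** Countable additivity survives the limit because the tails are bounded, uniformly along the
    sequence, by those of the dominating function. *)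
Let nuadd : semi_sigma_additive nu.
move=> F0; set F : nat -> set R := F0 => mF0 tF mU0; rewrite /nu.
have mF : forall i, measurable (F i) := mF0; have mU : measurable (\bigcup_i F i) := mU0.
pose e n := \int[mu]_t (dom t * (\1_(\bigcup_i F i) t - \sum_(i < n) \1_(F i) t)).
have mI n : mfs (fun t : R => \1_(\bigcup_i F i) t - \sum_(i < n) \1_(F i) t : R).
 apply: mfsB; first exact: measurable_indic.
 by apply: measurable_sum => i; apply: measurable_indic; exact: mF.
have e0 : e n @[n --> \oo] --> 0.
 rewrite (_ : 0 = \int[mu]_t (0 : R)); last by rewrite /Rintegral integral0.
 apply: (Rdct (g := dom)) => //.
 - by move=> n; apply: mfsM; [exact: imeas|exact: mI].
 - apply: aeW => t; have [[j _ Fj]|nF] := pselect ((\bigcup_i F i) t).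
   apply: cvg_near_cst; exists j.+1 => // n /= jn.
   have [b [-> h]] := trivIset_ind n t tF; case: h => [->|[i Fi ni]]; first by rewrite mulr0.
   have ij : i = j by apply: (tF i j) => //; exists t.
   by move: ni; rewrite ij leqNgt jn.
  apply: cvg_near_cst; exists 0%N => // n _.
  have [b [-> h]] := trivIset_ind n t tF; case: h => [->|[i Fi _]]; first by rewrite mulr0.
  by exfalso; apply: nF; exists i.
 - move=> n; apply: aeW => t; have [b [-> _]] := trivIset_ind n t tF.
  have d0 : 0 <= dom t by rewrite mulr_ge0// pp_ge0.
  by rewrite normrM (ger0_norm d0) ler_piMr// normr_nat; case: b; rewrite /= ?lexx ?ler01.
have key n : `|\sum_(0 <= i < n) ulim (F i) - ulim (\bigcup_i F i)| <= e n.
 have c1 : (Is k (\bigcup_i F i) - \sum_(0 <= i < n) Is k (F i)) @[k --> U] -->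
   ulim (\bigcup_i F i) - \sum_(0 <= i < n) ulim (F i).
  apply: cvgB; first exact: ulim_cvg.
  by apply: cvg_sumn => i; exact: ulim_cvg.
 rewrite distrC; apply: (ucvg_le UP c1) => k; rewrite big_mkord.
 have -> : Is k (\bigcup_i F i) - \sum_(i < n) Is k (F i) =
   \int[mu]_t (psi k t * (\1_(\bigcup_i F i) t - \sum_(i < n) \1_(F i) t)).
  rewrite /Is -int_sum; last by move=> i; exact: itg_ind1.
  rewrite -intB; [|exact: itg_ind1|by apply: itg_sum => i; exact: itg_ind1].
  by apply: eqRint => t; rewrite mulrBr mulr_sumr.
 have ib f : itg f -> itg (fun t => f t * (\1_(\bigcup_i F i) t - \sum_(i < n) \1_(F i) t)).
  move=> hf; apply: (itg_dom _ _ (itg_norm hf)).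
   by apply: mfsM; [exact: imeas|exact: mI].
  move=> t; have [b [-> _]] := trivIset_ind n t tF.
  by rewrite normrM ler_piMr// normr_nat; case: b; rewrite /= ?lexx ?ler01.
 apply: (le_trans (int_norm (ib _ (ipsi k)))); apply: int_le.
 - exact: itg_norm (ib _ (ipsi k)).
 - exact: ib.
 - move=> t; have [b [-> _]] := trivIset_ind n t tF; rewrite normrM normr_nat.
  by apply: ler_wpM2r; rewrite ?ler0n// bd.
under eq_fun do rewrite sumEFin.
apply: cvg_EFin; first exact: nearW.
exact: (cvg_dist_dom key e0).
Qed.

HB.instance Definition _ := isCharge.Build _ (measurableTypeR R) R nu ulim0 nufin nuadd.

(** The setwise limits form a charge that is absolutely continuous with respect to Lebesgue measure;
    its Radon-Nikodym density is the weak limit. *)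
Lemma weak_limit : exists phi : R -> R, itg phi /\
 forall A, measurable A -> Is n A @[n --> U] --> \int[mu]_t (phi t * \1_A t).
have dm : nu `<< mu.
 move=> A hA B mB BA; congr EFin; apply/cvg_lim => //.
 rewrite (_ : (fun n => Is n B) = fun=> 0); first exact: cvg_cst.
 apply/funext => n; rewrite -[RHS](_ : \int[mu]_t (0 : R) = 0); last by rewrite /Rintegral integral0.
 apply: int_ae_eq => //; first exact: imeas (itg_ind1 mB (ipsi n)).
 exists B; split => //; first exact: hA.
 move=> t /= ht; apply: contrapT => nB; apply: ht.
 by rewrite indicE memNset// mulr0.
have [f [ffin fi fE]] : exists f : R -> \bar R, [/\ (forall x, f x \is a fin_num),
  mu.-integrable setT f & forall A, measurable A -> nu A = (\int[mu]_(x in A) f x)%E].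
 exists (Radon_Nikodym nu mu); split.
 - by move=> x; exact: Radon_Nikodym_fin_num.
 - exact: Radon_Nikodym_integrable.
 - by move=> A mA; exact: Radon_Nikodym_integral.
exists (fine \o f); have iphi : itg (fine \o f).
 Transparent itg.
 by rewrite /itg; move: fi; congr (_.-integrable _ _); apply/funext => x /=; rewrite fineK.
Opaque itg.
split => // A mA.
have -> : \int[mu]_t ((fine \o f) t * \1_A t) = ulim A.
 have i1 := itg_ind1 mA iphi.
 apply: EFin_inj; rewrite -(intE i1) -[RHS]/(nu A) fE// [RHS]integral_mkcond; apply: eqint => t.
 rewrite patchE /= indicE; case: (t \in A); first by rewrite mulr1 fineK.
 by rewrite mulr0.
exact: ulim_cvg.
Qed.
End weak.

#[local] Opaque powR itg.

Lemma arith3 (R : realType) (N x e : R) : N != 0 -> x + 1 != 0 ->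
 N * (2 * (e / (4 * N * (x + 1))) * x) = e / 2 * (x / (x + 1)).
Proof. by move=> N0 x0; field; rewrite x0 N0. Qed.

(** * Mollification and convolutions with small primitives *)

Section mollify.
Variable R : realType.
Notation mu := (@lebesgue_measure R).
Implicit Types (f g h chi : R -> R) (x y t s a : R).

Lemma cvok_bd f chi (M : R) t : itg f -> mfs chi -> (forall s, `|chi s| <= M) -> cvok f chi t.
move=> hf mc hM; apply: (itg_dom (g := fun s => M * `|f (t - s)|)).
- by apply: mfsM => //; apply: mfs_subl; exact: imeas.
- by move=> s; rewrite normrM mulrC; apply: ler_wpM2r.
- by apply: itgZ; exact: itg_norm (itg_refl t hf).
Qed.

Lemma cv_bd f chi (M : R) t : itg f -> mfs chi -> (forall s, `|chi s| <= M) ->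
 `|cv f chi t| <= M * norm1 f.
move=> hf mc hM; have ok := cvok_bd t hf mc hM.
have i1 := itg_norm hf; have i2 := itg_refl t i1.
apply: (le_trans (int_norm ok)); rewrite /norm1 -(int_refl t i1) -intZ//.
apply: int_le; [exact: itg_norm|exact: itgZ|].
by move=> s; rewrite normrM mulrC; apply: ler_wpM2r.
Qed.

(** A one-sided window: convolving with it gives an increment of the primitive, by [cv_box]. *)
Definition box (d z : R) : R := ((0 <= z) && (z < d))%R%:R.

Lemma mfs_box d : mfs (box d).
Proof. exact: mfs_itvind. Qed.

Lemma box_int d : 0 < d -> itg (box d) /\ \int[mu]_z box d z = d.
move=> d0; have ip := pp_int ltr01 d0.
have E : {ae mu, forall z, box d z = pp 1 d z}.
 apply: (aeS (ae_neq 0)) => z z0; rewrite /box /pp subrr powRr0 (le_eqVlt 0) (eq_sym 0) (negbTE z0) /=.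
 by case: (_ && _).
have i : itg (box d).
 by apply: (itg_ae_dom (mfs_box d) ip.1); apply: (aeS E) => z ->; rewrite ger0_norm// pp_ge0.
by split => //; rewrite (int_ae_eq (mfs_box d) (imeas ip.1) E) ip.2 powRr1 ?(ltW d0)// divr1.
Qed.

Lemma cv_box f d t : 0 < d -> itg f -> cv (box d) f t = prim f t - prim f (t - d).
move=> d0 hf; rewrite -prim_itv//; last by rewrite gerBl ltW.
have mf := imeas hf.
rewrite /cv; apply: int_ae_eq.
- by apply: mfsM => //; apply: mfs_subl; exact: mfs_box.
- by apply: mfsM => //; exact: mfs_itvind.
apply: (aeS2 (ae_neq (t - d)) (ae_neq t)) => z z1 z2; rewrite /box mulrC; congr (_ * (nat_of_bool _)%:R).
have -> : (0 <= t - z) = (z < t) by rewrite subr_ge0 le_eqVlt (negbTE z2).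
have -> : (t - z < d) = (t - d <= z) by rewrite ltrBlDr addrC -ltrBlDr le_eqVlt eq_sym (negbTE z1).
by rewrite andbC.
Qed.

Lemma prim_derive f : itg f -> {ae mu, forall t, derivable (prim f) t 1 /\ 'D_1 (prim f) t = f t}.
move=> hf.
have hl : locally_integrable setT f.
 Transparent itg.
 by apply: open_integrable_locally => //; exact: openT.
have hi y : mu.-integrable [set` Interval -oo%O (BRight y)] (EFin \o f) by apply: integrableS hf.
Opaque itg.
pose F y := \int[mu]_(t in [set` Interval -oo%O (BRight y)]) f t.
have FE : prim f = F.
 apply/funext => y; apply/esym; rewrite /F Rintegral_mkcond; apply: int_ae_eq.
 - by apply: mfs_patch0 => //; exact: imeas.
 - exact: imeas (itg_lt _ hf).
 apply: (aeS (ae_neq y)) => z zy; rewrite patchE.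
 have -> : (z \in [set` Interval -oo%O (BRight y)]) = (z < y).
  by apply/idP/idP; rewrite inE/= in_itv/= le_eqVlt (negbTE zy).
 by case: ifP => _; rewrite ?mulr1 ?mulr0.
rewrite FE; apply: (aeS (FTC1 hi hl)) => t H; have [|dF <-] := H; first by rewrite ltNye.
by rewrite -derive1E.
Qed.

Lemma prim_diff f : itg f -> {ae mu, forall t, (n.+1%:R * (prim f t - prim f (t - n.+1%:R^-1))) @[n --> \oo] --> f t}.
move=> hf; apply: (aeS (prim_derive hf)) => t H; have [dF <-] := H.
have {}dF : h^-1 *: (prim f (h + t) - prim f t) @[h --> 0^'] --> 'D_1 (prim f) t.
 have E : (fun h : R => h^-1 *: (prim f (h + t) - prim f t)) = (fun h : R => h^-1 *: ((prim f \o shift t) (h *: (1 : R)) - prim f t)).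
  by apply/funext => h /=; rewrite /GRing.scale /= mulr1.
 by rewrite E; exact: dF.
have -> : (fun n => n.+1%:R * (prim f t - prim f (t - n.+1%:R^-1))) =
  (fun h : R => h^-1 *: (prim f (h + t) - prim f t)) \o (fun n => - n.+1%:R^-1 : R).
 apply/funext => n /=; rewrite /GRing.scale /= invrN invrK [- _ + t]addrC; ring.
apply: cvg_comp dF => A [e /= e0 hA].
have [N _ hN] := near_infty_natSinv_lt (PosNum e0).
exists N => // n Nn /=; apply: hA; last by rewrite oppr_eq0 invr_eq0 pnatr_eq0.
by rewrite /= sub0r opprK gtr0_norm ?invr_gt0//; exact: (hN n Nn).
Qed.

Lemma mollify_bd f (B N : R) : itg f -> 0 <= B -> 0 < N -> (forall t, `|f t| <= B * chi N t) ->
 norm1 (fun t => n.+1%:R * cv (box n.+1%:R^-1) f t - f t) @[n --> \oo] --> 0.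
move=> hf B0 N0 hB; have mf := imeas hf.
have d0 n : 0 < n.+1%:R^-1 :> R by rewrite invr_gt0.
have d1 n : n.+1%:R^-1 <= 1 :> R by rewrite invf_le1// ler1n.
have N2 : 0 < N + 2 by rewrite addr_gt0.
have ib n := (box_int (d0 n)).1.
have mcv n : mfs (cv (box n.+1%:R^-1) f) := imeas (cv_itg (ib n) hf).
rewrite (_ : 0 = \int[mu]_t (0 : R)); last by rewrite /Rintegral integral0.
apply: (Rdct (g := fun t => 2 * B * chi (N + 2) t)).
- move=> n; apply: mfsT => //; apply: mfsB => //; exact: mfsM.
- exact: measurable_cst.
- by apply: itgZ; exact: (itg_chi N2).1.
- apply: (aeS (prim_diff hf)) => t ht.
 rewrite -(@normr0 _ R) -(subrr (f t)); apply: cvg_norm; apply: cvgB; last exact: cvg_cst.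
 by under eq_fun do rewrite cv_box//.
- move=> n; apply: aeW => t; rewrite normr_id.
 have fB s : `|f s| <= B.
  apply: (le_trans (hB s)); rewrite ler_piMr//; exact: le_trans (ler_norm _) (chi_le1 _ _).
 have c0 : 0 <= chi (N + 2) t by rewrite ler0n.
 have fc : `|f t| <= B * chi (N + 2) t.
  apply: (le_trans (hB t)); apply: ler_wpM2l => //; rewrite /chi ler_nat.
  case: (boolP (_ && _)) => // /andP[h1 h2].
  by rewrite (le_trans _ h1) ?(lt_trans h2)// ?ltrDl// lerN2 lerDl.
 rewrite mulrAC -[2]/(1 + 1) mulrDl mul1r mulrDl.
 apply: (le_trans (ler_normB _ _)); rewrite [leRHS](_ : _ = B * chi (N + 2) t + B * chi (N + 2) t); last by ring.
 apply: lerD => //.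
 have ok := cvok_bd t (ib n) mf fB.
 have [t1|t1] := boolP ((- (N + 2) <= t) && (t < N + 2)).
  rewrite /chi t1 mulr1 normrM ger0_norm//.
  have := cv_bd t (ib n) mf fB; rewrite /norm1 (eqRint (g := box n.+1%:R^-1)) => [|z]; last by rewrite ger0_norm// ler0n.
  rewrite (box_int (d0 n)).2 => h; apply: (le_trans (ler_wpM2l _ h)) => //.
  by rewrite mulrCA divff ?mulr1// pnatr_eq0.
 rewrite /chi (negbTE t1) mulr0 /cv (eqRint (g := fun=> 0)) ?/Rintegral ?integral0 ?mulr0 ?normr0// => s.
 rewrite /box; case: (boolP (_ && _)) => [/andP[h1 h2]|_]; last by rewrite mul0r.
 have : `|f s| <= 0.
  apply: (le_trans (hB s)); rewrite /chi; case: (boolP (_ && _)) => [/andP[h3 h4]|_]; last by rewrite mulr0.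
  exfalso; move/negP: t1; apply; move: (d1 n) h1 h2 h3 h4; clear; set e := n.+1%:R^-1; move: e => e *.
  by apply/andP; split; lra.
 by rewrite normr_le0 => /eqP ->; rewrite mulr0.
Qed.

Lemma trunc_L1 f : itg f ->
 norm1 (fun t => f t - (if `|f t| <= n.+1%:R then f t * chi n.+1%:R t else 0)) @[n --> \oo] --> 0.
move=> hf; have mf := imeas hf.
rewrite [X in _ --> X](_ : 0 = \int[mu]_t (0 : R)); last by rewrite /Rintegral integral0.
apply: (Rdct (g := fun t => `|f t|)).
- move=> n; apply: mfsT => //; apply: mfsB => //.
 apply: mfs_if => //; first by apply: measurable_fun_ler => //; exact: mfsT.
 by apply: mfsM => //; exact: mfs_chi.
- exact: measurable_cst.
- exact: itg_norm.
- apply: aeW => t; apply: cvg_near_cst.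
 have h1 : 0 <= Num.max `|f t| (`|t| + 1) by rewrite le_max normr_ge0.
 exists (Num.bound (Num.max `|f t| (`|t| + 1))) => // n /= Nn.
 have : Num.max `|f t| (`|t| + 1) <= n.+1%:R.
  by apply: (le_trans (ltW (archi_boundP h1))); rewrite ler_nat leqW.
 rewrite ge_max => /andP[-> tn]; have tn' : `|t| < n.+1%:R by rewrite (lt_le_trans _ tn)// ltrDl.
 move: tn'; rewrite ltr_norml /chi => /andP[/ltW -> ->].
 by rewrite mulr1 subrr normr0.
- move=> n; apply: aeW => t; rewrite normr_id; case: ifP => _; last by rewrite subr0.
 have -> : f t - f t * chi n.+1%:R t = f t * (1 - chi n.+1%:R t) by ring.
 rewrite normrM ler_piMr// /chi; case: (_ && _); rewrite /= ?subrr ?normr0 ?ler01// subr0 normr1//.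
Qed.

Lemma cvg0_lt (u : nat -> R) (e : R) : u n @[n --> \oo] --> 0 -> 0 < e -> exists n, `|u n| < e.
move=> h e0; have [N _ hN] := cvgr0_norm_lt _ h e e0.
by exists N; exact: hN (leqnn N).
Qed.

(** Replacing [f] by its average transfers the window to [psi], where it sees an increment of the
    primitive, at most [2 d]; the replacement costs [M] times an [L^1] distance. *)
Lemma small_conv_bd f (M B N e : R) : itg f -> 0 <= B -> 0 < N -> (forall t, `|f t| <= B * chi N t) -> 0 <= M -> 0 < e ->
 exists2 d, 0 < d & forall psi, itg psi -> (forall t, `|psi t| <= M) -> (forall y, `|prim psi y| <= d) ->
  forall t, `|cv f psi t| <= e.
move=> hf B0 N0 hB M0 e0; have M1 : 0 < 2 * (M + 1) by rewrite mulr_gt0// ltr_wpDl.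
have [n hn] := cvg0_lt (mollify_bd hf B0 N0 hB) (divr_gt0 e0 M1).
have f0 : 0 < norm1 f + 1 by rewrite ltr_wpDl ?norm1_ge0.
exists (e / (4 * n.+1%:R * (norm1 f + 1))); first by rewrite divr_gt0// !mulr_gt0.
set d := e / _ => psi ipsi hM hP t; have mpsi := imeas ipsi.
have d0 : 0 < n.+1%:R^-1 :> R by rewrite invr_gt0.
have ib := (box_int d0).1; have ic := cv_itg ib hf; have icc := cv_itg hf ib.
set g := fun t => n.+1%:R * cv (box n.+1%:R^-1) f t - f t.
have ig : itg g by apply: itgB => //; exact: itgZ.
have okg := cvok_bd t ig mpsi hM; have okc := cvok_bd t ic mpsi hM; have okf := cvok_bd t hf mpsi hM.
have E : cv f psi t = n.+1%:R * cv (cv (box n.+1%:R^-1) f) psi t - cv g psi t.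
 rewrite /cv -intZ// -intB//; last exact: itgZ.
 by apply: eqRint => s; rewrite /g /cv; ring.
have fb s : `|f s| <= B.
 apply: (le_trans (hB s)); rewrite ler_piMr//; exact: le_trans (ler_norm _) (chi_le1 _ _).
have Ec : cv (box n.+1%:R^-1) f = cv f (box n.+1%:R^-1).
 by apply/funext => s; apply: cvC; exact: cvok_bd (imeas hf) fb.
have bb s : `|cv (box n.+1%:R^-1) psi s| <= 2 * d.
 rewrite cv_box// (le_trans (ler_normB _ _))// (_ : 2 * d = d + d); last by ring.
 by apply: lerD; exact: hP.
have A : cv (cv f (box n.+1%:R^-1)) psi t = cv f (cv (box n.+1%:R^-1) psi) t.
 apply: esym; apply: cvA_at => //.
 apply: (@cvok_bd _ _ (M * norm1 (box n.+1%:R^-1))); first exact: itg_norm.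
  exact: imeas (cv_itg (itg_norm ib) (itg_norm ipsi)).
 move=> s; have := @cv_bd (fun x => `|box n.+1%:R^-1 x|) (fun x => `|psi x|) M s (itg_norm ib).
 rewrite /norm1 [X in _ -> _ -> _ <= M * X](eqRint (g := fun x => `|box n.+1%:R^-1 x|)) => [|x]; last by rewrite normr_id.
 by apply; [exact: mfsT|move=> x; rewrite normr_id].
have h1 : `|cv f (cv (box n.+1%:R^-1) psi) t| <= 2 * d * norm1 f.
 exact: cv_bd hf (imeas (cv_itg ib ipsi)) bb.
have h2 : `|cv g psi t| <= M * norm1 g by exact: cv_bd.
have h3 : M * norm1 g <= e / 2.
 apply: (@le_trans _ _ (M * (e / (2 * (M + 1))))).
  apply: ler_wpM2l => //; exact: le_trans (ler_norm _) (ltW hn).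
 have -> : M * (e / (2 * (M + 1))) = e / 2 * (M / (M + 1)) by field; rewrite gt_eqF// ltr_wpDl.
 by rewrite ler_piMr ?divr_ge0 ?(ltW e0)// ler_pdivrMr ?mul1r ?lerDl// ltr_wpDl.
have h4 : n.+1%:R * (2 * d * norm1 f) <= e / 2.
 have -> : n.+1%:R * (2 * d * norm1 f) = e / 2 * (norm1 f / (norm1 f + 1)).
  by apply: arith3; [rewrite pnatr_eq0|rewrite gt_eqF].
 by rewrite ler_piMr ?divr_ge0 ?(ltW e0)// ?norm1_ge0// ler_pdivrMr ?mul1r ?lerDl.
rewrite E Ec A (le_trans (ler_normB _ _))// normrM normr_nat [leRHS](_ : e = e / 2 + e / 2); last by field.
apply: lerD; last exact: le_trans h2 h3.
by apply: le_trans h4; apply: ler_wpM2l.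
Qed.

Lemma small_conv f (M e : R) : itg f -> 0 <= M -> 0 < e ->
 exists2 d, 0 < d & forall psi, itg psi -> (forall t, `|psi t| <= M) -> (forall y, `|prim psi y| <= d) ->
  forall t, `|cv f psi t| <= e.
move=> hf M0 e0; have mf := imeas hf; have M1 : 0 < 2 * (M + 1) by rewrite mulr_gt0// ltr_wpDl.
have [n hn] := cvg0_lt (trunc_L1 hf) (divr_gt0 e0 M1).
set fn := fun t => if `|f t| <= n.+1%:R then f t * chi n.+1%:R t else 0.
have mfn : mfs fn.
 apply: mfs_if => //; first by apply: measurable_fun_ler => //; exact: mfsT.
 by apply: mfsM => //; exact: mfs_chi.
have ifn : itg fn.
 apply: (itg_dom mfn _ (itg_norm hf)) => t; rewrite /fn; case: ifP => _; last by rewrite normr0.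
 by rewrite normrM ler_piMr// chi_le1.
have hfn t : `|fn t| <= n.+1%:R * chi n.+1%:R t.
 rewrite /fn; case: ifP => h; last by rewrite normr0 mulr_ge0// ler0n.
 by rewrite normrM {2}/chi normr_nat; apply: ler_wpM2r => //; rewrite ler0n.
have e2 : 0 < e / 2 by rewrite divr_gt0.
have [d d0 hd] := small_conv_bd ifn (ler0n _ _) (ltr0Sn _ _) hfn M0 e2.
exists d => // psi ipsi hM hP t; have mpsi := imeas ipsi.
have ir := itgB hf ifn.
have -> : cv f psi t = cv fn psi t + cv (fun s => f s - fn s) psi t.
 rewrite /cv -intD; [|exact: cvok_bd ifn mpsi hM|exact: cvok_bd ir mpsi hM].
 by apply: eqRint => s; ring.
rewrite (le_trans (ler_normD _ _))// [leRHS](_ : e = e / 2 + e / 2); last by field.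
apply: lerD; first exact: hd.
apply: (le_trans (cv_bd t ir mpsi hM)).
apply: (@le_trans _ _ (M * (e / (2 * (M + 1))))).
 apply: ler_wpM2l => //; exact: le_trans (ler_norm _) (ltW hn).
have -> : M * (e / (2 * (M + 1))) = e / 2 * (M / (M + 1)) by field; rewrite gt_eqF// ltr_wpDl.
by rewrite ler_piMr ?(ltW e2)// ler_pdivrMr ?mul1r ?lerDl// ltr_wpDl.
Qed.

End mollify.

Lemma ucvg_ub (R : realType) (U : set_system nat) (PU : ProperFilter U) (u : nat -> R) (l c : R) :
 u k @[k --> U] --> l -> (forall k, u k <= c) -> l <= c.
Proof. by move=> h hu; apply: (ler_cvg_to h (cvg_cst c)); exact: nearW. Qed.

(** * Weak compactness with uniform convergence of convolutions *)

Section compactness.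
Variable R : realType.
Notation mu := (@lebesgue_measure R).
Implicit Types (f g h phi : R -> R) (x y t s a : R).

Lemma int_ind_lt f (y : R) : \int[mu]_t (f t * \1_(`]-oo, y[%classic : set R) t) = prim f y.
Proof. by apply: eqRint => t; rewrite indicE mem_setE in_itv/=. Qed.

(** The set where the inequality fails is a test set. *)
Lemma ae_le_test f g : itg f -> itg g ->
 (forall A : set R, measurable A -> \int[mu]_t (f t * \1_A t) <= \int[mu]_t (g t * \1_A t)) -> {ae mu, forall t, f t <= g t}.
move=> hf hg h; have mf := imeas hf; have mg := imeas hg.
pose A := [set t | g t < f t].
have mA : measurable A.
 have := measurable_fun_ltr mg mf; move=> /(_ measurableT [set true] I).
 by rewrite setTI; congr measurable; apply/seteqP; split => t /=.
have i1 := itgB (itg_ind1 mA hf) (itg_ind1 mA hg).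
have p0 t : 0 <= f t * \1_A t - g t * \1_A t.
 rewrite -mulrBl indicE; case: (boolP (t \in A)) => [|_]; last by rewrite mulr0.
 by rewrite inE /A /= => h1; rewrite mulr1 subr_ge0 ltW.
have e0 : \int[mu]_t (f t * \1_A t - g t * \1_A t) = 0.
 apply: le_anti; rewrite int_ge0// andbT intB; [|exact: itg_ind1|exact: itg_ind1].
 by rewrite subr_le0; exact: h.
apply: (aeS (int_eq0_ae i1 p0 e0)) => t; rewrite leNgt => ht; apply/negP => ft.
by move: ht; rewrite indicE mem_set// !mulr1 => /eqP; rewrite subr_eq0 gt_eqF.
Qed.

Lemma prim_lip f (M y1 y2 : R) : itg f -> (forall t, `|f t| <= M) -> y1 <= y2 -> `|prim f y2 - prim f y1| <= M * (y2 - y1).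
move=> hf hM y12; have mf := imeas hf.
have [->|ny] := eqVneq y1 y2; first by rewrite !subrr normr0 mulr0.
have d0 : 0 < y2 - y1 by rewrite subr_gt0 lt_neqAle ny.
have := cv_bd y2 (box_int d0).1 mf hM; rewrite cv_box// (_ : y2 - (y2 - y1) = y1); last by ring.
rewrite /norm1 (eqRint (g := box (y2 - y1))) => [|z]; last by rewrite ger0_norm// ler0n.
by rewrite (box_int d0).2.
Qed.

(** Primitives of [psi n - phi] tend to 0 pointwise, by weak convergence on half-lines, and are
    equi-Lipschitz. Smallness on a finite grid of [[0, T]] therefore makes them uniformly small, and
    [small_conv] turns this into uniform convergence of convolutions. *)
Lemma weak_compact (M T : R) (psi : nat -> R -> R) : 0 <= M -> 0 < T ->
 (forall n, mfs (psi n)) -> (forall n t, `|psi n t| <= M * pp 1 T t) ->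
 exists U : set_system nat, exists phi : R -> R, [/\ ProperFilter U, (forall N, U [set n | (N <= n)%N]) &
 [/\ itg phi, (forall t, `|phi t| <= M * pp 1 T t),
  (forall A, measurable A -> \int[mu]_t (psi n t * \1_A t) @[n --> U] --> \int[mu]_t (phi t * \1_A t)) &
  forall f e, itg f -> 0 < e -> U [set n | forall t, `|cv f (psi n) t - cv f phi t| <= e]]].
move=> M0 T0 mpsi bd.
have [U [UU hU]] := ultraFilterLemma eventually_filter.
have PU : ProperFilter U by exact: ultra_proper.
have [phi0 [iphi0 w0]] := weak_limit UU M0 T0 mpsi bd.
have idom : itg (fun t => M * pp 1 T t) by apply: itgZ; exact: (pp_int ltr01 T0).1.
have ipsi n : itg (psi n) by exact: (itg_dom (mpsi n) (bd n)).
have b1 : {ae mu, forall t, phi0 t <= M * pp 1 T t}.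
 apply: ae_le_test => // A mA; apply: (ucvg_ub PU (w0 A mA)) => n.
 apply: int_le; [exact: itg_ind1|exact: itg_ind1|move=> t].
 by apply: ler_wpM2r; [rewrite indicE ler0n|exact: le_trans (ler_norm _) (bd n t)].
have b2 : {ae mu, forall t, - phi0 t <= M * pp 1 T t}.
 apply: ae_le_test => //; first exact: itgN.
 move=> A mA; have c : (- (\int[mu]_t (psi n t * \1_A t))) @[n --> U] --> - \int[mu]_t (phi0 t * \1_A t).
  by apply: cvgN; exact: w0.
 rewrite (eqRint (g := fun t => - (phi0 t * \1_A t))) => [|t]; last by rewrite mulNr.
 rewrite intN; last exact: itg_ind1.
 apply: (ucvg_ub PU c) => n; rewrite -intN; last exact: itg_ind1.
 apply: int_le; [by apply: itgN; exact: itg_ind1|exact: itg_ind1|move=> t].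
 rewrite -mulNr; apply: ler_wpM2r; first by rewrite indicE ler0n.
 by rewrite (le_trans (ler_norm _))// normrN.
(* The density is altered on a null set so that its bound holds at every point. *)
pose phi t := if `|phi0 t| <= M * pp 1 T t then phi0 t else 0.
have mphi : mfs phi.
 apply: mfs_if => //; last exact: imeas.
 apply: measurable_fun_ler; last exact: imeas.
 by apply: mfsT => //; exact: imeas.
have pb t : `|phi t| <= M * pp 1 T t.
 by rewrite /phi; case: ifP => // _; rewrite normr0 mulr_ge0// pp_ge0.
have iphi : itg phi := itg_dom mphi pb idom.
have aephi : {ae mu, forall t, phi0 t = phi t}.
 apply: (aeS (ae_and b1 b2)) => t [h1 h2].
 by rewrite /phi ler_norml lerNl h1 h2.
have w A : measurable A -> \int[mu]_t (psi n t * \1_A t) @[n --> U] --> \int[mu]_t (phi t * \1_A t).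
 move=> mA; have -> : \int[mu]_t (phi t * \1_A t) = \int[mu]_t (phi0 t * \1_A t).
  apply: int_ae_eq; [exact: imeas (itg_ind1 _ _)|exact: imeas (itg_ind1 _ _)|].
  by apply: (aeS aephi) => t ->.
 exact: w0.
exists U, phi; split => //; first by move=> N; apply: hU; exists N.
split => // f e hf e0.
have M2 : 0 <= 2 * M by rewrite mulr_ge0.
have [d d0 hd] := small_conv hf M2 e0.
have ib n : itg (fun t => psi n t - phi t) by exact: itgB.
have bM n t : `|psi n t - phi t| <= 2 * M.
 have p1 : pp 1 T t <= 1 by rewrite /pp subrr powRr0; case: ifP => _; rewrite ?lexx ?ler01.
 have h : M * pp 1 T t <= M by rewrite ler_piMr.
 rewrite (le_trans (ler_normB _ _))// mulrDl mul1r.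
 by apply: lerD; [exact: le_trans (bd n t) h|exact: le_trans (pb t) h].
have PE n y : prim (fun t => psi n t - phi t) y = prim (psi n) y - prim phi y.
 rewrite /prim -intB; [|exact: itg_lt|exact: itg_lt].
 by apply: eqRint => t; rewrite mulrBl.
have Uy y : U [set n | `|prim (fun t => psi n t - phi t) y| <= d / 2].
 have d2 : 0 < d / 2 by rewrite divr_gt0.
 have c := w _ (measurable_itv `]-oo, y[); rewrite int_ind_lt in c.
 move/cvgrPdist_le : c => /(_ _ d2) c; apply: filterS c => n /=.
 by rewrite int_ind_lt distrC PE.
suff : U [set n | forall y, `|prim (fun t => psi n t - phi t) y| <= d].
 apply: filterS => n /= hn t; have := hd _ (ib n) (bM n) hn t.
 rewrite (_ : cv f (fun t => psi n t - phi t) t = cv f (psi n) t - cv f phi t)//.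
 have p1 s : M * pp 1 T s <= M by rewrite ler_piMr// /pp subrr powRr0; case: ifP => _; rewrite ?lexx ?ler01.
 have o1 : cvok f (psi n) t by apply: (cvok_bd t hf (mpsi n)) => s; exact: le_trans (bd n s) (p1 s).
 have o2 : cvok f phi t by apply: (cvok_bd t hf mphi) => s; exact: le_trans (pb s) (p1 s).
 by rewrite /cv -intB//; apply: eqRint => s; rewrite mulrBr.
(* A mesh over which a function with Lipschitz constant [2 M] varies by at most [d / 2]. *)
pose eta := d / (4 * (M + 1)); have eta0 : 0 < eta by rewrite divr_gt0// mulr_gt0// ltr_wpDl.
pose N := Num.bound (T / eta).
have UN m : U [set n | forall i, (i <= m)%N -> `|prim (fun t => psi n t - phi t) (i%:R * eta)| <= d / 2].
 elim: m => [|m ih].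
  by apply: filterS (Uy (0%:R * eta)) => n hn i; rewrite leqn0 => /eqP ->.
 apply: filterS (filterI ih (Uy (m.+1%:R * eta))) => n hn i; have h1 := hn.1; have h2 := hn.2.
 by rewrite leq_eqVlt => /predU1P[->//|]; exact: h1.
apply: filterS (UN N) => n /= hn.
have base y : 0 < y -> y <= T -> `|prim (fun t => psi n t - phi t) y| <= d.
 move=> y0 yT; have q0 : 0 <= y / eta by rewrite divr_ge0 ?ltW.
 have /andP[i1 i2] := truncn_itv q0; set i := Num.trunc (y / eta) in i1 i2.
 have iN : (i <= N)%N.
  rewrite -(ler_nat R); apply: (le_trans i1); apply: ltW; apply: le_lt_trans (archi_boundP _); last by rewrite divr_ge0 ?ltW.
  by rewrite ler_pM2r ?invr_gt0.
 have y1 : i%:R * eta <= y by rewrite -ler_pdivlMr.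
 have y2 : y - i%:R * eta <= eta.
  by rewrite lerBlDr -[X in X + _]mul1r -mulrDl -ler_pdivrMr// addrC natr1 ltW.
 have := prim_lip (ib n) (bM n) y1 => h.
 have h' : 2 * M * (y - i%:R * eta) <= d / 2.
  apply: (@le_trans _ _ (2 * M * eta)); first by apply: ler_wpM2l.
  have -> : 2 * M * eta = d / 2 * (M / (M + 1)) by rewrite /eta; field; rewrite gt_eqF// ltr_wpDl.
  by rewrite ler_piMr ?divr_ge0 ?(ltW d0)// ler_pdivrMr ?mul1r ?lerDl// ltr_wpDl.
 have h2 := hn i iN; rewrite -(subrK (prim (fun t => psi n t - phi t) (i%:R * eta)) (prim _ y)).
 rewrite (le_trans (ler_normD _ _))// [leRHS](_ : d = d / 2 + d / 2); last by field.
 by apply: lerD => //; exact: le_trans h h'.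
have z0 t : ~~ ((0 < t) && (t < T)) -> psi n t - phi t = 0.
 move=> nt; have pz : pp 1 T t = 0 by rewrite /pp (negbTE nt).
 have := bd n t; have := pb t; rewrite pz mulr0 !normr_le0 => /eqP -> /eqP ->.
 by rewrite subrr.
move=> y; have [y0|y0] := leP y 0.
 rewrite /prim (eqRint (g := fun=> 0)) ?/Rintegral ?integral0 ?normr0 ?(ltW d0)// => t.
 have [ty|ty] := ltP t y; last by rewrite mulr0.
 by rewrite z0 ?mul0r// negb_and -leNgt (ltW (lt_le_trans ty y0)).
have [yT|yT] := leP y T; first exact: base.
rewrite (_ : prim _ y = prim (fun t => psi n t - phi t) T); first exact: base.
apply: eqRint => t; have [tT|tT] := ltP t T; first by rewrite (lt_trans tT yT).
by rewrite z0 ?mul0r// negb_and -leNgt -leNgt tT orbT.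
Qed.
End compactness.

#[local] Opaque powR itg.

Lemma arith4 (R : realType) (a b c d v K p q e g H dn : R) : b <= q * e + g * e ->
 K * c <= K * (p * e + g * e) -> K * (dn * H) <= K * e -> d <= v * (2 * e) ->
 a + K * c + K * dn * H + d + b <= a + (K * (p + g) + K + 2 * v + (q + g)) * e.
Proof. by move=> *; lra. Qed.

(** * The bound on the density, by contradiction *)

Section quantitative.
Variable R : realType.
Notation mu := (@lebesgue_measure R).
Implicit Types (f g phi psi : R -> R) (x y t s : R).
Variables (P Q O h : R -> R) (D th T T' g0 K : R).
Hypotheses (iP : itg P) (iQ : itg Q) (iO : itg O) (ih : itg h) (h0 : forall t, 0 <= h t)
 (th0 : 0 < th) (th1 : th <= 1) (T0 : 0 < T) (T'0 : 0 < T') (D0 : 0 <= D) (g00 : g0 != 0) (K0 : 0 <= K)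
 (PD : forall v, `|P v| <= D * pe th T v) (QD : forall v, `|Q v| <= D * pe th T v).

Definition supp phi := forall t, ~~ ((0 < t) && (t < T')) -> phi t = 0.

Definition E1 phi c := {ae mu, forall t, 0 < t -> t < T' -> cv O phi t = c}.
(** In the application [d] is [|eps|] and [h] is the modulus of the control variation. *)
Definition E2 phi d := {ae mu, forall t, 0 < t -> t < T' ->
 `|g0 * phi t + cv Q phi t| <= K * (`|cv P phi t| + d * h t)}.

Lemma cvZ f phi (r : R) t : cvok f phi t -> cv f (fun s => r * phi s) t = r * cv f phi t.
Proof. by move=> ok; rewrite /cv -intZ//; apply: eqRint => s; ring. Qed.

Lemma E1_scale phi c r : itg phi -> E1 phi c -> E1 (fun t => r * phi t) (r * c).
Proof. by move=> ip H1; apply: (aeS2 H1 (cvok_ae iO ip)) => t H ok t0 tT; rewrite cvZ// H. Qed.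

Lemma E2_scale phi d r : itg phi -> 0 <= r -> E2 phi d -> E2 (fun t => r * phi t) (r * d).
move=> ip r0 H1; apply: (aeS2 H1 (ae_and (cvok_ae iP ip) (cvok_ae iQ ip))) => t H ok t0 tT.
have {}H := H t0 tT; rewrite (cvZ _ ok.1) (cvZ _ ok.2).
have -> : g0 * (r * phi t) + r * cv Q phi t = r * (g0 * phi t + cv Q phi t) by ring.
rewrite !normrM ger0_norm//; apply: (le_trans (ler_wpM2l r0 H)).
by apply: eqle; ring.
Qed.

Lemma cv_pe_bd f phi t : (forall v, `|f v| <= D * pe th T v) -> itg f -> cvok f phi t -> cvok (pe th T) (fun s => `|phi s|) t ->
 `|cv f phi t| <= D * cv (pe th T) (fun s => `|phi s|) t.
move=> hf if_ ok ok'; apply: (le_trans (int_norm ok)); rewrite /cv -intZ//.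
apply: int_le; [exact: itg_norm|exact: itgZ|move=> s].
by rewrite normrM mulrA; apply: ler_wpM2r.
Qed.

Lemma E2_bound : exists2 C, 0 <= C & forall phi d, itg phi -> supp phi -> E2 phi d -> 0 <= d ->
 {ae mu, forall t, `|phi t| <= C * cv (pe th T) (fun s => `|phi s|) t + C * d * h t}.
have gp : 0 < `|g0| by rewrite normr_gt0.
exists ((D + K * D + K) / `|g0|); first by rewrite divr_ge0// !addr_ge0// mulr_ge0.
move=> phi d iphi sphi H d0; have ip := (pe_int th0 T0).1; have ia := itg_norm iphi.
apply: (aeS2 H (ae_and (cvok_ae iP iphi) (ae_and (cvok_ae iQ iphi) (cvok_ae ip ia)))) => t Ht ok.
have c0 : 0 <= cv (pe th T) (fun s => `|phi s|) t by apply: int_ge0 => s; rewrite mulr_ge0// pe_ge0.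
have hd : 0 <= d * h t by exact: mulr_ge0.
have [/andP[t0 tT]|nt] := boolP ((0 < t) && (t < T')); last first.
 rewrite sphi// normr0 -mulrA -mulrDr mulr_ge0 ?addr_ge0// divr_ge0// !addr_ge0// mulr_ge0//.
have h1 := cv_pe_bd PD iP ok.1 ok.2.2; have h2 := cv_pe_bd QD iQ ok.2.1 ok.2.2.
have h3 := Ht t0 tT.
rewrite -mulrA -mulrDr mulrAC ler_pdivlMr//.
have h4 : `|phi t| * `|g0| <= `|g0 * phi t + cv Q phi t| + `|cv Q phi t|.
 by rewrite mulrC -normrM -{1}(addrK (cv Q phi t) (g0 * phi t)) ler_normB.
have h5 := ler_wpM2l K0 h1.
move: h2 h3 h4 h5 c0 hd; move: (cv (pe th T) _ t) (`|phi t| * _) `|_ + _| `|cv Q phi t| `|cv P phi t| (d * h t) => a b c e f g h2 h3 h4 h5 c0 hd.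
have := mulr_ge0 D0 c0; have := mulr_ge0 D0 hd; have := mulr_ge0 K0 c0; have := mulr_ge0 K0 hd; have := mulr_ge0 K0 (mulr_ge0 D0 hd).
by nra.
Qed.

Definition clip (M z : R) := Num.max (- M) (Num.min M z).

Lemma clip_le M z : 0 <= M -> `|clip M z| <= M.
Proof. by move=> M0; rewrite ler_norml /clip le_max lexx /= ge_max ge_min lexx /= andbT; lra. Qed.

Lemma clip0 M : 0 <= M -> clip M 0 = 0.
Proof. by move=> M0; rewrite /clip (min_r M0) max_r// oppr_le0. Qed.

Lemma le0_eps (x A : R) : (forall e, 0 < e -> x <= A * e) -> x <= 0.
move=> h1; rewrite leNgt; apply/negP => x0.
have A1 : 0 < 2 * (`|A| + 1) by rewrite mulr_gt0// ltr_wpDl.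
have e0 : 0 < x / (2 * (`|A| + 1)) by rewrite divr_gt0.
have := h1 _ e0; apply/negP; rewrite -ltNge.
apply: (@le_lt_trans _ _ (`|A| * (x / (2 * (`|A| + 1))))); first by apply: ler_wpM2r; [exact: ltW|exact: ler_norm].
have -> : `|A| * (x / (2 * (`|A| + 1))) = x / 2 * (`|A| / (`|A| + 1)) by field; rewrite gt_eqF// ltr_wpDl.
apply: (@le_lt_trans _ _ (x / 2)); last by rewrite ltr_pdivrMr// ltr_pMr// ltr1n.
by rewrite ler_piMr ?divr_ge0 ?(ltW x0)// ler_pdivrMr ?mul1r ?lerDl// ltr_wpDl.
Qed.

Lemma clip_diff M z : 0 <= M -> `|z - clip M z| = Num.max (`|z| - M) 0.
move=> M0; rewrite /clip.
have [z0|z0] := leP 0 z.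
 rewrite (ger0_norm z0); have [zM|zM] := leP z M.
  rewrite (max_r (_ : - M <= z)) ?subrr ?normr0 ?max_r//; first by rewrite subr_le0.
  by apply: le_trans z0; rewrite oppr_le0.
 rewrite (@max_r _ _ (- M) M); last by lra.
 by rewrite ger0_norm ?max_l// subr_ge0 ltW.
rewrite (ltr0_norm z0) min_r; last by apply: le_trans M0; exact: ltW.
have [zM|zM] := leP (- M) z.
 by rewrite subrr normr0 max_r// lerBlDr add0r lerNl.
rewrite ler0_norm; last by rewrite subr_le0 ltW.
by rewrite max_l ?opprB; [ring|move: zM; lra].
Qed.

Lemma mfs_clip M f : mfs f -> mfs (fun t => clip M (f t)).
Proof. by move=> mf; apply: measurable_maxr => //; exact: measurable_minr. Qed.

Let J t := pp 1 T' t.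
Let iJ : itg J := (pp_int ltr01 T'0).1.
Let J1 t : 0 < t -> t < T' -> J t = 1.
Proof. by move=> t0 tT; rewrite /J /pp t0 tT subrr powRr0. Qed.
Let J0 t : ~~ ((0 < t) && (t < T')) -> J t = 0.
Proof. by move=> h1; rewrite /J /pp (negbTE h1). Qed.
Let JE t : J t = 0 \/ (0 < t /\ t < T') /\ J t = 1.
Proof. by have [/andP[t0 tT]|h1] := boolP ((0 < t) && (t < T')); [right; rewrite J1|left; exact: J0]. Qed.
Let intJ : \int[mu]_t J t = T'.
Proof. by rewrite (pp_int ltr01 T'0).2 powRr1 ?(ltW T'0)// divr1. Qed.

Lemma close_L1 f phi psi chi e e' : itg f -> itg phi -> itg psi -> itg chi ->
 norm1 (fun t => phi t - psi t) <= e' -> (forall t, `|cv f psi t - cv f chi t| <= e) ->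
 \int[mu]_t (`|cv f phi t - cv f chi t| * J t) <= norm1 f * e' + T' * e.
move=> hf hp hs hc h1 h2; have ib := itgB hp hs.
have i1 := itg_norm (cv_itg hf ib).
have i2 : itg (fun t => e * J t) by exact: itgZ.
apply: (@le_trans _ _ (\int[mu]_t (`|cv f (fun s => phi s - psi s) t| + e * J t))).
 have ia := itg_norm (itgB (cv_itg hf hp) (cv_itg hf hc)).
 apply: int_ae_le.
 - apply: (itg_dom _ _ ia); first by apply: mfsM; exact: imeas.
  by move=> t; rewrite normrM normr_id ler_piMr//; case: (JE t) => [->|[_ ->]]; rewrite ?normr0 ?normr1.
 - exact: itgD.
 apply: (aeS (ae_and (cvok_ae hf hp) (cvok_ae hf hs))) => t ok; have o1 := ok.1; have o2 := ok.2.
 have E : cv f (fun s => phi s - psi s) t = cv f phi t - cv f psi t.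
  by rewrite /cv -intB//; apply: eqRint => s; ring.
 case: (JE t) => [->|[_ ->]]; first by rewrite !mulr0 addr0.
 rewrite !mulr1 E; have -> : cv f phi t - cv f chi t = (cv f phi t - cv f psi t) + (cv f psi t - cv f chi t) by ring.
 by rewrite (le_trans (ler_normD _ _))// lerD2l.
rewrite intD// intZ// intJ (mulrC e); apply: lerD => //.
apply: (le_trans (norm1_cv hf ib)); apply: ler_wpM2l => //; exact: norm1_ge0.
Qed.

Hypothesis UCP : forall phi M c, mfs phi -> 0 <= M -> (forall t, `|phi t| <= M * J t) ->
 E1 phi c -> E2 phi 0 -> {ae mu, forall t, phi t = 0}.

(** Take normalized counterexamples with [d] tending to 0. By [smooth_bound], clipping them at a
    fixed level costs [O(1 / n)] in [L^1], so they have a weak limit along which all convolutions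
    converge. The limit solves the homogeneous problem, hence is 0 by [UCP]; then (E2) bounds [|g0|]
    times the norm 1 by quantities tending to 0. *)
Lemma quant0 : exists2 C, 0 <= C & forall phi c d, itg phi -> supp phi -> 0 <= d -> E1 phi c -> E2 phi d ->
 norm1 phi <= C * d.
apply: contrapT => nC.
have [B B0 HB] := E2_bound; have [M M0 HM] := smooth_bound th0 th1 T0 B0.
set H := \int[mu]_t h t; have H0 : 0 <= H by exact: int_ge0.
have seq n : exists p : (R -> R) * R * R, [/\ itg p.1.1, supp p.1.1, E1 p.1.1 p.1.2, E2 p.1.1 p.2 &
  [/\ 0 <= p.2, p.2 <= n.+1%:R^-1 & norm1 p.1.1 = 1]].
 (* Failure of the constant [n.+1] provides the [n]-th member, after division by its norm. *)
 apply: contrapT => nn; apply: nC; exists n.+1%:R => // phi c d ip sp d0 e1 e2.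
 rewrite leNgt; apply/negP => hn; apply: nn.
 have n0 : 0 < norm1 phi by apply: le_lt_trans hn; rewrite mulr_ge0.
 have r0 : 0 <= (norm1 phi)^-1 by rewrite invr_ge0 ltW.
 exists ((fun t => (norm1 phi)^-1 * phi t), (norm1 phi)^-1 * c, (norm1 phi)^-1 * d) => /=; split.
 - exact: itgZ.
 - by move=> t nt; rewrite sp// mulr0.
 - exact: E1_scale.
 - exact: E2_scale.
 split; first exact: mulr_ge0.
  by rewrite mulrC ler_pdivrMr// mulrC ler_pdivlMr// mulrC ltW.
 rewrite /norm1 (eqRint (g := fun t => (norm1 phi)^-1 * `|phi t|)) => [|t]; last by rewrite normrM ger0_norm.
 by rewrite intZ ?itg_norm// mulVf// gt_eqF.
have [F hF] := choice seq.
pose phi n := (F n).1.1; pose d n := (F n).2.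
have iphi n : itg (phi n) by case: (hF n).
pose psi n t := clip M (phi n t).
have mphi n := imeas (iphi n).
have mpsi n : mfs (psi n) := mfs_clip M (mphi n).
have psiJ n t : `|psi n t| <= M * pp 1 T' t.
 have [/andP[t0 tT]|nt] := boolP ((0 < t) && (t < T')).
  by rewrite -/(J t) J1// mulr1 clip_le.
 have [_ sp _ _ _] := hF n; rewrite /psi /phi sp// clip0// normr0.
 by apply: mulr_ge0 => //; exact: pp_ge0.
have ipsi n : itg (psi n) by apply: (itg_dom (mpsi n) (psiJ n)); exact: itgZ.
have dn n : 0 <= d n /\ d n <= n.+1%:R^-1 by case: (hF n) => _ _ _ _ [].
have n1 n : norm1 (phi n) = 1 by case: (hF n) => _ _ _ _ [].
have cl n : norm1 (fun t => phi n t - psi n t) <= 2 * (B * H * n.+1%:R^-1).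
 have [_ sp _ e2 _] := hF n; have ia := itg_norm (iphi n).
 have hB := HB _ _ (iphi n) sp e2 (dn n).1.
 have hB' : {ae mu, forall t, `|phi n t| <= B * cv (pe th T) (fun s => `|phi n s|) t + 0 + B * d n * h t}.
  by apply: (aeS hB) => t; rewrite addr0.
 have Bd : 0 <= B * d n by rewrite mulr_ge0// (dn n).1.
 have := HM _ (fun t => B * d n * h t) 0 ia (fun t => normr_ge0 _) (itgZ _ ih) (fun t => mulr_ge0 Bd (h0 t)) (lexx 0) hB'.
 have -> : norm1 (fun t => `|phi n t|) = 1.
  by rewrite -(n1 n); apply: eqRint => t; rewrite normr_id.
 rewrite addr0 mulr1 intZ// -/H => hh.
 rewrite /norm1 (eqRint (g := fun t => Num.max (`|phi n t| - M) 0)) => [|t]; last exact: clip_diff.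
 apply: (le_trans hh); rewrite ler_pM2l// mulrAC ler_wpM2l ?mulr_ge0//; exact: (dn n).2.
have [U [chi [PU UN [ichi bchi wchi cchi]]]] := weak_compact M0 T'0 mpsi psiJ.
(* [Z / (n + 1)] dominates both the clipping error and [d n * H]. *)
pose Z := 2 * (B * H) + H + 1; have Z1 : 1 <= Z by rewrite lerDr addr_ge0// mulr_ge0// mulr_ge0.
have good e (S : set nat) : 0 < e -> U S -> exists n, [/\ S n, norm1 (fun t => phi n t - psi n t) <= e, d n * H <= e &
  [/\ forall t, `|cv P (psi n) t - cv P chi t| <= e, forall t, `|cv Q (psi n) t - cv Q chi t| <= e &
   forall t, `|cv O (psi n) t - cv O chi t| <= e]].
 move=> e0 US; have q0 : 0 <= Z / e by rewrite divr_ge0 ?(ltW e0)// (le_trans ler01).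
 have UI : U ((S `&` [set n | (Num.bound (Z / e) <= n)%N]) `&` ([set n | forall t, `|cv P (psi n) t - cv P chi t| <= e] `&`
   ([set n | forall t, `|cv Q (psi n) t - cv Q chi t| <= e] `&` [set n | forall t, `|cv O (psi n) t - cv O chi t| <= e]))).
  by apply: filterI; [apply: filterI => //; exact: UN|apply: filterI; [exact: cchi|apply: filterI; exact: cchi]].
 have [n [[Sn Nn] [c1 [c2 c3]]]] := filter_ex UI.
 have hn : Z * n.+1%:R^-1 <= e.
  rewrite ler_pdivrMr// mulrC -ler_pdivrMr//; apply: (le_trans (ltW (archi_boundP q0))).
  by rewrite ler_nat; exact: leqW.
 have nn0 : 0 <= n.+1%:R^-1 :> R by rewrite invr_ge0.
 exists n; split => //.
  apply: (le_trans (cl n)); apply: le_trans hn; rewrite !mulrA; apply: ler_wpM2r => //.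
  by rewrite /Z -addrA mulrA lerDl addr_ge0.
 apply: le_trans hn; apply: (@le_trans _ _ (n.+1%:R^-1 * H)); first by apply: ler_wpM2r => //; exact: (dn n).2.
 rewrite mulrC; apply: ler_wpM2r => //.
 by rewrite /Z -addrA (addrCA _ H) lerDl addr_ge0// mulr_ge0// mulr_ge0.
have mchi := imeas ichi.
have icv f g : itg f -> itg g -> itg (fun t => `|cv f g t - cv f chi t| * J t).
 move=> hf hg; have ia := itg_norm (itgB (cv_itg hf hg) (cv_itg hf ichi)).
 apply: (itg_dom _ _ ia); first by apply: mfsM; exact: imeas.
 by move=> t; rewrite normrM normr_id ler_piMr//; case: (JE t) => [->|[_ ->]]; rewrite ?normr0 ?normr1.
have JJ t : 0 <= J t by exact: pp_ge0.
(* The constants along the sequence need not be followed: the convolution of the limit is compared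
   with its own mean value over []0, T'[]. *)
have [c E1c] : exists c, E1 chi c.
 have iOc := cv_itg iO ichi.
 have iOJ : itg (fun t => cv O chi t * J t).
  apply: (itg_dom _ _ (itg_norm iOc)); first by apply: mfsM; exact: imeas.
  by move=> t; rewrite normrM ler_piMr//; case: (JE t) => [->|[_ ->]]; rewrite ?normr0 ?normr1.
 have iD c : itg (fun t => `|cv O chi t - c| * J t).
  have ia := itg_norm (itgB iOJ (itgZ c iJ)).
  have := ia; congr itg; apply/funext => t.
  by rewrite -mulrBl normrM (ger0_norm (JJ t)).
 pose c := (\int[mu]_t (cv O chi t * J t)) / T'.
 exists c; have p0 t : 0 <= `|cv O chi t - c| * J t by rewrite mulr_ge0.
 have : \int[mu]_t (`|cv O chi t - c| * J t) <= 0.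
  apply: (@le0_eps _ (2 * (norm1 O + T'))) => e e0.
  have [n [_ hn1 _ [_ _ hO]]] := good e setT e0 filterT.
  have kO := close_L1 iO (iphi n) (ipsi n) ichi hn1 hO.
  have [_ _ e1 _ _] := hF n; set cn := (F n).1.2 in e1.
  have kn : \int[mu]_t (`|cv O chi t - cn| * J t) <= (norm1 O + T') * e.
   rewrite mulrDl; apply: le_trans kO; apply: (int_ae_le (iD cn) (icv _ _ iO (iphi n))).
   apply: (aeS e1) => t Ht; case: (JE t) => [->|[[t0 tT] ->]]; first by rewrite !mulr0.
   by rewrite !mulr1 distrC Ht.
  have cc : `|cn - c| * T' <= (norm1 O + T') * e.
   apply: le_trans kn; rewrite -{1}(gtr0_norm T'0) -normrM mulrBl /c divfK ?gt_eqF//.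
   rewrite -intJ -intZ// -intB//; last exact: itgZ.
   have iB := itgB (itgZ cn iJ) iOJ.
   apply: (le_trans (int_norm iB)); apply: int_le; [exact: itg_norm|exact: iD|move=> t].
   by rewrite -mulrBl normrM (ger0_norm (JJ t)) distrC.
  apply: (@le_trans _ _ (\int[mu]_t (`|cv O chi t - cn| * J t + `|cn - c| * J t))).
   apply: int_le; [exact: iD|by apply: itgD; [exact: iD|exact: itgZ]|move=> t].
   rewrite -mulrDl; apply: ler_wpM2r => //.
   by rewrite -{1}(subrK cn (cv O chi t)) -addrA ler_normD.
  rewrite (intD (iD cn) (itgZ _ iJ)) (intZ _ iJ) intJ.
  by apply: (le_trans (lerD kn cc)); apply: eqle; ring.
 move=> hle; have e0 : \int[mu]_t (`|cv O chi t - c| * J t) = 0 by apply: le_anti; rewrite hle int_ge0.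
 apply: (aeS (int_eq0_ae (iD c) p0 e0)) => t Ht t0 tT.
 by move: Ht; rewrite J1// mulr1 => /eqP; rewrite normr_eq0 subr_eq0 => /eqP.
have E2c : E2 chi 0.
 pose y t := g0 * chi t + cv Q chi t.
 have iy : itg y by apply: itgD; [exact: itgZ|exact: cv_itg].
 have iz := itgZ K (itg_norm (cv_itg iP ichi)).
 have iM f : itg f -> itg (fun t => f t * J t).
  move=> hf; apply: (itg_dom _ _ (itg_norm hf)); first by apply: mfsM; exact: imeas.
  by move=> t; rewrite normrM ler_piMr//; case: (JE t) => [->|[_ ->]]; rewrite ?normr0 ?normr1.
 (* Weak convergence only sees integrals over sets, so the absolute value in (E2) is opened into the
    two signs [s] and each inequality is tested on measurable sets. *)
 have key (s : R) : `|s| = 1 -> {ae mu, forall t, s * y t * J t <= K * `|cv P chi t| * J t}.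
  move=> s1; apply: ae_le_test; [exact: iM (itgZ s iy)|exact: iM iz|move=> A mA].
  rewrite -subr_le0; apply: (@le0_eps _ (K * (norm1 P + T') + K + 2 * `|g0| + (norm1 Q + T'))) => e e0.
  have UA : U [set n | `|\int[mu]_t (chi t * \1_A t) - \int[mu]_t (psi n t * \1_A t)| <= e].
   by move/cvgrPdist_le : (wchi A mA) => /(_ _ e0).
  have [n [hA hn1 hn2 [hP hQ _]]] := good e _ e0 UA.
  have [_ sp _ e2 _] := hF n.
  have kP := close_L1 iP (iphi n) (ipsi n) ichi hn1 hP; have kQ := close_L1 iQ (iphi n) (ipsi n) ichi hn1 hQ.
  have ib := itgB ichi (iphi n); have iA := itg_ind1 mA ib.
  have j1 := itg_ind1 mA (iM _ iz); have j2 := itgZ K (icv _ _ iP (iphi n)); have j3 := itgZ (K * d n) ih.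
  have j4 := itgZ (s * g0) iA; have j5 := icv _ _ iQ (iphi n).
  have pt1 : {ae mu, forall t, s * y t * J t * \1_A t <= K * `|cv P chi t| * J t * \1_A t + K * (`|cv P (phi n) t - cv P chi t| * J t)
    + K * d n * h t + s * g0 * ((chi t - phi n t) * \1_A t) + `|cv Q (phi n) t - cv Q chi t| * J t}.
   apply: (aeS e2) => t Ht; have dh : 0 <= K * d n * h t by rewrite !mulr_ge0// (dn n).1.
   have [/andP[t0 tT]|nt] := boolP ((0 < t) && (t < T')); last first.
    have ft : phi n t = 0 by exact: sp.
    have ct : chi t = 0 by apply/eqP; rewrite -normr_le0 (le_trans (bchi t))// -/(J t) J0// mulr0.
    by rewrite J0// ft ct subrr !(mulr0, mul0r) !addr0 add0r.
   have {}Ht := Ht t0 tT; rewrite J1// !mulr1 indicE; case: (t \in A); rewrite /= ?mulr0 ?mulr1; last first.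
    by rewrite add0r addr0 !addr_ge0// mulr_ge0.
   have y1 : s * (g0 * phi n t + cv Q (phi n) t) <= K * (`|cv P (phi n) t| + d n * h t).
    apply: le_trans Ht; rewrite -[leRHS]mul1r -s1 -normrM; exact: ler_norm.
   have y2 : s * (cv Q chi t - cv Q (phi n) t) <= `|cv Q (phi n) t - cv Q chi t|.
    by rewrite -[leRHS]mul1r -s1 distrC -normrM ler_norm.
   have y3 : K * `|cv P (phi n) t| <= K * `|cv P chi t| + K * `|cv P (phi n) t - cv P chi t|.
    rewrite -mulrDr; apply: ler_wpM2l => //; rewrite -{1}(subrK (cv P chi t) (cv P (phi n) t)) addrC.
    exact: ler_normD.
   have -> : s * y t = s * (g0 * phi n t + cv Q (phi n) t) + s * g0 * (chi t - phi n t) + s * (cv Q chi t - cv Q (phi n) t).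
    by rewrite /y; ring.
   rewrite lerD// lerD2r; apply: (le_trans y1); rewrite mulrDr mulrA lerD2r; exact: y3.
  have S1 := itgD j1 j2; have S2 := itgD S1 j3; have S3 := itgD S2 j4; have S4 := itgD S3 j5.
  have := int_ae_le (itg_ind1 mA (iM _ (itgZ s iy))) S4 pt1.
  rewrite (intD S3 j5) (intD S2 j4) (intD S1 j3) (intD j1 j2) (intZ _ (icv _ _ iP (iphi n))) (intZ _ ih) (intZ _ iA) -/H => hh.
  have h5 := ler_wpM2l K0 kP; have h6 := ler_wpM2l K0 hn2.
  have h7 : s * g0 * \int[mu]_t ((chi t - phi n t) * \1_A t) <= `|g0| * (2 * e).
   apply: (le_trans (ler_norm _)); rewrite normrM normrM s1 mul1r; apply: ler_wpM2l => //.
   have k1 := itg_ind1 mA ichi; have k2 := itg_ind1 mA (ipsi n); have k3 := itgB (iphi n) (ipsi n).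
   have -> : \int[mu]_t ((chi t - phi n t) * \1_A t) = (\int[mu]_t (chi t * \1_A t) - \int[mu]_t (psi n t * \1_A t)) -
     \int[mu]_t ((phi n t - psi n t) * \1_A t).
    have k4 := itg_ind1 mA k3; rewrite -(intB k1 k2) -(intB (itgB k1 k2) k4).
    by apply: eqRint => t; ring.
   rewrite (le_trans (ler_normB _ _))// mulrDl mul1r; apply: lerD => //.
   apply: le_trans hn1; apply: (le_trans (int_norm (itg_ind1 mA k3))).
   apply: int_le; [exact: itg_norm (itg_ind1 mA k3)|exact: itg_norm|move=> t].
   by rewrite normrM ler_piMr// indicE normr_nat; case: (_ \in _); rewrite /= ?lexx ?ler01.
  rewrite lerBlDl; apply: (le_trans hh).
  exact: arith4 kQ h5 h6 h7.
 apply: (aeS (ae_and (key 1 (normr1 _)) (key (- 1) (etrans (normrN _) (normr1 _))))) => t kk t0 tT.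
 have := kk.1; have := kk.2; rewrite J1// !mulr1 mul1r mulN1r mul0r addr0 => k1 k2.
 by rewrite ler_norml lerNl k1 k2.
have chi0 := UCP mchi M0 bchi E1c E2c.
have cv0 f t : itg f -> cv f chi t = 0.
 move=> hf; rewrite -[RHS](_ : \int[mu]_t (0 : R) = 0); last by rewrite /Rintegral integral0.
 apply: int_ae_eq => //; first by apply: mfsM => //; apply: mfs_subl; exact: imeas.
 by apply: (aeS chi0) => s ->; rewrite mulr0.
have : `|g0| <= 0.
 apply: (@le0_eps _ (norm1 Q + T' + K * (norm1 P + T' + 1))) => e e0.
 have [n [_ hn1 hn2 [hP hQ _]]] := good e setT e0 filterT.
 have [_ sp _ e2 _] := hF n.
 have kP := close_L1 iP (iphi n) (ipsi n) ichi hn1 hP; have kQ := close_L1 iQ (iphi n) (ipsi n) ichi hn1 hQ.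
 have i1 := icv _ _ iQ (iphi n); have i2 := itgZ K (icv _ _ iP (iphi n)); have i3 := itgZ (K * d n) ih.
 have i4 := itgD (itgD i1 i2) i3.
 have ia := itgZ `|g0| (itg_norm (iphi n)).
 have : \int[mu]_t (`|g0| * `|phi n t|) <= \int[mu]_t (`|cv Q (phi n) t - cv Q chi t| * J t +
   K * (`|cv P (phi n) t - cv P chi t| * J t) + K * d n * h t).
  apply: (int_ae_le ia i4); apply: (aeS e2) => t Ht; rewrite !cv0// !subr0.
  have dh : 0 <= K * d n * h t by rewrite !mulr_ge0// (dn n).1.
  have [/andP[t0 tT]|nt] := boolP ((0 < t) && (t < T')); last first.
   by rewrite J0// !mulr0 !add0r -/(phi n) /phi sp// normr0 mulr0.
  rewrite J1// !mulr1; have {}Ht := Ht t0 tT; rewrite -normrM.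
  rewrite -{1}(addrK (cv Q (phi n) t) (g0 * phi n t)) (le_trans (ler_normB _ _))// addrC -addrA lerD2l.
  by rewrite (le_trans Ht)// mulrDr mulrA.
 rewrite (intZ _ (itg_norm (iphi n))) -/(norm1 (phi n)) n1 mulr1.
 rewrite (intD (itgD i1 i2) i3) (intD i1 i2) (intZ _ (icv _ _ iP (iphi n))) (intZ _ ih) -/H => hh.
 apply: (le_trans hh).
 have h5 := ler_wpM2l K0 kP; have h6 := ler_wpM2l K0 hn2.
 apply: (le_trans (lerD (lerD kQ h5) (_ : _ <= K * e))); first by rewrite -mulrA.
 by apply: eqle; ring.
by rewrite normr_le0 (negbTE g00).
Qed.

End quantitative.

#[local] Opaque powR ker kC kC1 kC2 cs rm Bt itg.

Lemma core_arith (R : realType) (t t0 s d T' : R) : 4 * d <= t0 -> 4 * d <= T' - t0 -> `|t - t0| < d -> `|t - s| < d ->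
 2 * d < s /\ s < T' - 2 * d.
rewrite !ltr_norml => ? ? /andP[? ?] /andP[? ?]; split; lra.
Qed.

(** * From the density to the state difference *)

Section core.
Variable R : realType.
Notation mu := (@lebesgue_measure R).
Implicit Types (f g phi psi h : R -> R) (x y t s : R).
Variables (e eq : nat -> R) (L bt C al mq T T' : R).
Hypotheses (he : coefbd e L bt C) (heq : coefbd eq L bt C) (L0 : 0 < L) (b0 : 0 < bt)
 (T0 : 0 < T) (TL : T < L) (al0 : 0 < al) (al1 : al < 1) (mq0 : 0 < mq)
 (T'0 : 0 < T') (T'T : T' < T) (e0 : e 0%N != 0).
Let k := ker e bt al T.
Let q := ker eq bt mq T.
Let ik : itg k. Proof. exact: (itg_ker he L0 b0 T0 al0 TL). Qed.
Let iq : itg q. Proof. exact: (itg_ker heq L0 b0 T0 mq0 TL). Qed.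

Lemma pp_pe_le (m th v : R) : 0 < th -> th <= m -> pp m T v <= T `^ (m - th) * pe th T v.
move=> th0 thm; rewrite {1}/pp; case: ifPn => [/andP[v0 vT]|_]; last by rewrite mulr_ge0 ?powR_ge0 ?pe_ge0.
rewrite peE ?gtr0_norm ?gt_eqF//.
have -> : m - 1 = (th - 1) + (m - th) by ring.
by apply: powR_cutoff => //; [rewrite subr_ge0|exact: ltW].
Qed.

Lemma cv_odd_ae phi : itg phi -> {ae mu, forall t, cv (oddf k) phi t = cv k phi t - rcv k phi t}.
move=> ip; apply: (aeS (ae_and (cvok_ae ik ip) (rcv_ok_ae ik ip))) => t ok; have o1 := ok.1; have o2 := ok.2.
rewrite /cv /rcv -(intB o1 o2); apply: eqRint => s.
by rewrite /oddf opprB mulrBl.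
Qed.

Lemma cv_two_sided (ga gb' : R) phi : itg phi ->
 {ae mu, forall t, cv (fun v => ga * q v + gb' * q (- v)) phi t = ga * cv q phi t + gb' * rcv q phi t}.
move=> ip; apply: (aeS (ae_and (cvok_ae iq ip) (rcv_ok_ae iq ip))) => t ok; have o1 := ok.1; have o2 := ok.2.
rewrite /cv /rcv -(intZ _ o1) -(intZ _ o2) -(intD (itgZ ga o1) (itgZ gb' o2)); apply: eqRint => s.
by rewrite opprB mulrDl !mulrA.
Qed.

(** [quant0] with one even majorant of exponent [th = min al mq] for [k] and for the two-sided
    kernel [Q]; [unique_continuation] provides its hypothesis [UCP]. *)
Lemma core_norm (g0 ga gb' K : R) h : g0 != 0 -> 0 <= K -> itg h -> (forall t, 0 <= h t) ->
 exists2 B, 0 <= B & forall phi c d, itg phi -> supp T' phi -> 0 <= d ->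
 {ae mu, forall t, 0 < t -> t < T' -> cv k phi t - rcv k phi t = c} ->
 {ae mu, forall t, 0 < t -> t < T' ->
   `|g0 * phi t + ga * cv q phi t + gb' * rcv q phi t| <= K * (`|cv k phi t| + d * h t)} ->
 norm1 phi <= B * d.
move=> g00 K0 ih h0.
pose Q v := ga * q v + gb' * q (- v).
have iQ : itg Q by apply: itgD; apply: itgZ; [exact: iq|exact: itg_opp iq].
pose th := Num.min al mq; have th0 : 0 < th by rewrite lt_min al0.
have tha : th <= al by rewrite ge_min lexx.
have thq : th <= mq by rewrite ge_min lexx orbT.
have th1 : th <= 1 by rewrite (le_trans tha)// ltW.
have C0 := kC_ge0 he L0 b0 T0 TL.
pose D := kC L bt C T * T `^ (al - th) + (`|ga| + `|gb'|) * (kC L bt C T * T `^ (mq - th)).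
have d1 : 0 <= kC L bt C T * T `^ (al - th) by rewrite mulr_ge0// powR_ge0.
have d2 : 0 <= kC L bt C T * T `^ (mq - th) by rewrite mulr_ge0// powR_ge0.
have d3 : 0 <= (`|ga| + `|gb'|) * (kC L bt C T * T `^ (mq - th)) by rewrite mulr_ge0// addr_ge0.
have D0 : 0 <= D by rewrite addr_ge0.
have kD v : `|k v| <= D * pe th T v.
 apply: (le_trans (ker_bound al he L0 b0 T0 TL v)).
 apply: (le_trans (ler_wpM2l C0 (pp_pe_le v th0 tha))); rewrite mulrA; apply: ler_wpM2r; first exact: pe_ge0.
 by rewrite lerDl.
have qD v : `|q v| <= kC L bt C T * T `^ (mq - th) * pe th T v.
 apply: (le_trans (ker_bound mq heq L0 b0 T0 TL v)).
 by apply: (le_trans (ler_wpM2l C0 (pp_pe_le v th0 thq))); rewrite mulrA.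
have peN v : pe th T (- v) = pe th T v by rewrite /pe opprK addrC.
have QD v : `|Q v| <= D * pe th T v.
 rewrite /Q (le_trans (ler_normD _ _))// !normrM.
 apply: (le_trans (lerD (ler_wpM2l (normr_ge0 _) (qD v)) (ler_wpM2l (normr_ge0 _) (qD (- v))))).
 rewrite peN -mulrDl mulrA; apply: ler_wpM2r; first exact: pe_ge0.
 by rewrite lerDr.
have U phi M c : mfs phi -> 0 <= M -> (forall t, `|phi t| <= M * pp 1 T' t) ->
  E1 (oddf k) T' phi c -> E2 k Q h T' g0 K phi 0 -> {ae mu, forall t, phi t = 0}.
 move=> mphi M0 bphi e1 e2.
 have ip : itg phi by apply: (itg_dom mphi bphi); apply: itgZ; exact: (pp_int ltr01 T'0).1.
 have g1 : gb phi M 0 T' by apply: aeW => t; rewrite add0r.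
 have e1' : {ae mu, forall t, 0 < t -> t < T' -> cv k phi t - rcv k phi t = c}.
  by apply: (aeS2 e1 (cv_odd_ae ip)) => t H1 <-.
 have e2' : {ae mu, forall t, 0 < t -> t < T' ->
   `|g0 * phi t + ga * cv q phi t + gb' * rcv q phi t| <= K * `|cv k phi t|}.
  apply: (aeS2 e2 (cv_two_sided ga gb' ip)) => t H1 H2 t0 tT; have := H1 t0 tT.
  by rewrite H2 mul0r addr0 addrA.
 exact: (unique_continuation he heq L0 b0 T0 TL al0 al1 mq0 T'0 T'T e0 mphi M0 g1 e1' K0 g00 e2').
have [B B0 HB] := quant0 ik iQ (itg_odd ik) ih h0 th0 th1 T0 T'0 D0 g00 K0 kD QD U.
exists B => // phi c d ip sp d0 e1 e2; apply: (HB phi c d ip sp d0).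
 by apply: (aeS2 e1 (cv_odd_ae ip)) => t H1 ->.
apply: (aeS2 e2 (cv_two_sided ga gb' ip)) => t H1 H2 t0 tT; have := H1 t0 tT.
by rewrite H2 addrA.
Qed.

(** The constant [c] will be the state difference at [b]; integrating over []0, T'[] bounds it by
    the [L^1] norm of one convolution. *)
Lemma core_const phi c : itg phi -> {ae mu, forall t, 0 < t -> t < T' -> cv k phi t - rcv k phi t = c} ->
 `|c| * T' <= norm1 (oddf k) * norm1 phi.
move=> ip e1; have io := itg_odd ik; have J := pp_int ltr01 T'0.
have -> : `|c| * T' = \int[mu]_t (`|c| * pp 1 T' t) by rewrite (intZ _ J.1) J.2 powRr1 ?(ltW T'0)// divr1.
apply: le_trans (norm1_cv io ip); apply: int_ae_le; [exact: itgZ J.1|exact: itg_norm (cv_itg io ip)|].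
apply: (aeS2 e1 (cv_odd_ae ip)) => t H1 H2; rewrite /pp subrr powRr0.
case: ifPn => [/andP[t0 tT]|_]; last by rewrite mulr0.
by rewrite mulr1 H2 H1.
Qed.

(** The convolution is split at distance [d] from [t]: nearby the density is bounded by [parametrix]
    and [interior_bound], further away the kernel is bounded. *)
Lemma core_int t0 : 0 < t0 -> t0 < T' -> exists2 r, 0 < r & exists2 B, 0 <= B &
 forall phi c, itg phi -> supp T' phi ->
 {ae mu, forall t, 0 < t -> t < T' -> cv k phi t - rcv k phi t = c} ->
 {ae mu, forall t, `|t - t0| < r -> `|cv k phi t| <= B * norm1 phi}.
move=> t00 t0T.
(* With quarters, points within [d] of some [t] that is itself within [d] of [t0] lie in []2 d, T' -
   2 d[], where the density is bounded; the last entry ensures [T' + d <= T], as [parametrix]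
   requires. *)
pose d := Num.min (Num.min (t0 / 4) ((T' - t0) / 4)) (T - T').
have d0 : 0 < d by rewrite !lt_min !divr_gt0 ?subr_gt0.
have d1 : 4 * d <= t0 by rewrite -ler_pdivlMl// mulrC !ge_min lexx.
have d2 : 4 * d <= T' - t0 by rewrite -ler_pdivlMl// mulrC !ge_min lexx orbT.
have dT : T' + d <= T by rewrite -lerBrDl !ge_min lexx orbT.
have [th [C1 [E [rho [[/andP[th0 th1] C10 E0 irho hrho] HP]]]]] := parametrix he L0 b0 T0 TL al0 al1 e0 T'0 d0 dT.
have A0 : 0 <= E / `|C1| by rewrite divr_ge0.
have [M M0 HM] := interior_bound T' th0 th1 T'0 A0 d0.
have k0 := kC_ge0 he L0 b0 T0 TL.
exists d => //; exists (M * norm1 k + kC L bt C T * d `^ (al - 1)).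
 by apply: addr_ge0; apply: mulr_ge0 => //; [exact: norm1_ge0|exact: powR_ge0].
move=> phi c ip sp e1; have n0 := norm1_ge0 phi; have ia := itg_norm ip.
have iw := (pe_int th0 T'0).1.
have e2 : {ae mu, forall t, d < t -> t < T' - d -> `|phi t| <= E / `|C1| * cv (pe th T') (fun s => `|phi s|) t}.
 apply: (aeS2 (HP phi c ip sp e1) (ae_and (cvok_ae irho ip) (cvok_ae iw ia))) => t Ht ok t1 t2.
 have := Ht t1 t2 => /eqP; rewrite addr_eq0 => /eqP Hc.
 rewrite mulrAC ler_pdivlMr ?normr_gt0// mulrC -normrM Hc normrN.
 apply: (le_trans (int_norm ok.1)); rewrite /cv -(intZ _ ok.2); apply: int_le; [exact: itg_norm ok.1|exact: itgZ ok.2|].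
 by move=> s; rewrite normrM mulrA; apply: ler_wpM2r.
have bphi := HM phi ip e2.
apply: (aeS (cvok_ae ik ip)) => t ok tt.
have i1 := itg_refl t (itg_norm ik).
apply: (le_trans (int_norm ok)).
apply: (@le_trans _ _ (\int[mu]_s (M * norm1 phi * `|k (t - s)| + kC L bt C T * d `^ (al - 1) * `|phi s|))).
 apply: int_ae_le; [exact: itg_norm|by apply: itgD; exact: itgZ|].
 apply: (aeS bphi) => s hs; rewrite normrM.
 have p1 : 0 <= M * norm1 phi * `|k (t - s)| by apply: mulr_ge0 => //; exact: mulr_ge0.
 have p2 : 0 <= kC L bt C T * d `^ (al - 1) * `|phi s| by apply: mulr_ge0 => //; apply: mulr_ge0 => //; exact: powR_ge0.
 have [ts|ts] := ltP `|t - s| d.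
  have [s1 s2] := core_arith d1 d2 tt ts.
  by rewrite (@le_trans _ _ (M * norm1 phi * `|k (t - s)|)) ?lerDl// mulrC; apply: ler_wpM2r => //; exact: hs.
 rewrite (@le_trans _ _ (kC L bt C T * d `^ (al - 1) * `|phi s|)) ?lerDr//; apply: ler_wpM2r => //.
 apply: (le_trans (ker_bound al he L0 b0 T0 TL _)); apply: ler_wpM2l => //.
 rewrite /pp; case: ifPn => [/andP[v0 vT]|_]; last exact: powR_ge0.
 by apply: powR_neg_le => //; [rewrite gtr0_norm in ts|rewrite subr_le0 ltW].
rewrite intD; [|exact: itgZ|exact: itgZ].
rewrite intZ// intZ// (int_refl t (itg_norm ik)) -/(norm1 k) -/(norm1 phi) mulrDl; apply: lerD => //.
by rewrite mulrAC.
Qed.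

End core.

#[local] Opaque powR itg.

(** * Power series with oscillating coefficients in the logarithm *)

Section dominated_series.
Variable R : realType.
Notation mu := (@lebesgue_measure R).
Implicit Types (x y t l : R).

Lemma ae_dense (P : R -> Prop) x y : {ae mu, forall t, P t} -> x < y -> exists t, [/\ x < t, t < y & P t].
move=> h xy; have h' : {ae mu, forall t, P (1 * t + x)} by exact: ae_affine (oner_neq0 _) h.
have xy0 : 0 < y - x by rewrite subr_gt0.
have [|t [t0 t1 Pt]] := ae_near0 (P := fun t => P (1 * t + x)) xy0.
 by apply: (aeS h') => t ht _ _.
by exists (1 * t + x); split => //; move: t0 t1; lra.
Qed.

Lemma ssum_cont (f : nat -> R -> R) x (C y : R) : 0 <= y -> y < 1 ->
 (\forall t \near x, forall n, `|f n t| <= C * y ^+ n) -> (forall n, {for x, continuous (f n)}) ->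
 {for x, continuous (fun t => ssum (f ^~ t))}.
move=> y0 y1 hf cf; apply/cvgrPdist_lt => e e0.
have C0 : 0 <= C by have := nbhs_singleton hf 0%N; rewrite expr0 mulr1; exact: le_trans.
have y1' : 0 < 1 - y by rewrite subr_gt0.
have c0 : C / (1 - y) * y ^+ n @[n --> \oo] --> 0.
 rewrite -[X in _ --> X](mulr0 (C / (1 - y))); apply: cvgM; first exact: cvg_cst.
 by apply: cvg_expr; rewrite ger0_norm.
have e3 : 0 < e / 3 by rewrite divr_gt0.
have [N _ hN] := cvgr0_norm_lt _ c0 _ e3.
have {}hN := hN N (leqnn N).
have p0 : 0 <= C / (1 - y) * y ^+ N by rewrite mulr_ge0 ?exprn_ge0// divr_ge0// ltW.
rewrite (ger0_norm p0) in hN.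
have tail t : (forall n, `|f n t| <= C * y ^+ n) -> `|ssum (f ^~ t) - \sum_(j < N) f j t| < e / 3.
 move=> ht; have g : geo (f ^~ t) by exists C, y.
 have [-> _] := ssum_tail N g; apply: le_lt_trans hN.
 have := @ssum_bound _ (fun n => f (n + N)%N t) (C * y ^+ N) y y0 y1; rewrite mulrAC; apply => n.
 by rewrite -mulrA -exprD addnC.
have cs : \sum_(j < N) f j t @[t --> x] --> \sum_(j < N) f j x.
 by apply: cvg_big => [|j _]; [exact: add_continuous|exact: cf].
have hx := nbhs_singleton hf.
near=> t.
have ht : forall n, `|f n t| <= C * y ^+ n by near: t.
have h1 : `|\sum_(j < N) f j x - \sum_(j < N) f j t| < e / 3.
 by near: t; move/cvgrPdist_lt : cs; apply.
have h2 := tail _ ht; have h3 := tail _ hx.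
move: h1 h2 h3; rewrite !ltr_norml => /andP[? ?] /andP[? ?] /andP[? ?]; apply/andP; split; lra.
Unshelve. all: by end_near. Qed.

Lemma sin2pi_n (n : nat) : sin (2 * pi * n%:R : R) = 0 /\ cos (2 * pi * n%:R : R) = 1.
elim: n => [|n [ih1 ih2]]; first by rewrite mulr0 sin0 cos0.
rewrite -[n.+1%:R]natr1 (mulrDr (2 * pi)) mulr1 sinD cosD ih1 ih2.
have -> : 2 * pi = pi *+ 2 :> R by rewrite mulr2n mulrDl mul1r.
by rewrite sin2pi cos2pi; split; ring.
Qed.

Variables (p r : nat -> R) (C X s w : R).
Hypotheses (X0 : 0 < X) (hp : forall n, `|p n| <= C * X^-1 ^+ n) (hr : forall n, `|r n| <= C * X^-1 ^+ n).

(** Imaginary part of [(p_n + i r_n) e^(i n w l)]. *)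
Definition osc n l := p n * sin (n%:R * w * l) + r n * cos (n%:R * w * l).

Lemma osc_bd n l : `|osc n l| <= 2 * C * X^-1 ^+ n.
rewrite /osc (le_trans (ler_normD _ _))// !normrM.
rewrite [leRHS](_ : _ = C * X^-1 ^+ n + C * X^-1 ^+ n); last by ring.
apply: lerD.
 by apply: le_trans (hp n); rewrite ler_piMr// ler_norml sin_geN1 sin_le1.
by apply: le_trans (hr n); rewrite ler_piMr// ler_norml cos_geN1 cos_le1.
Qed.

(** Imaginary part of the kernel series in [t^beta] with [beta = s + i w]; with [(- r, p)] in place
    of [(p, r)] it is the real part. *)
Definition oscs t := ssum (fun n => t `^ (n%:R * s) * osc n (ln t)).

Lemma oscs_term t T n : 0 <= s -> 0 < t -> t <= T -> `|t `^ (n%:R * s) * osc n (ln t)| <= 2 * C * (T `^ s / X) ^+ n.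
move=> s0 t0 tT; have T0 := lt_le_trans t0 tT.
rewrite normrM ger0_norm ?powR_ge0// expr_div_n mulrCA -exprVn; apply: ler_pM => //.
- exact: powR_ge0.
- rewrite mulrC powRrM powR_mulrn ?powR_ge0//; apply: lerXn2r; rewrite ?nnegrE ?powR_ge0//.
 by rewrite ge0_ler_powR ?nnegrE ?(ltW t0) ?(ltW T0).
- exact: osc_bd.
Qed.

Lemma oscs_zero (d T : R) : 0 <= s -> 0 < d -> d <= T -> T `^ s < X ->
 {ae mu, forall t, 0 < t -> t < d -> oscs t = 0} -> forall t, 0 < t -> t < d -> oscs t = 0.
move=> s0 d0 dT TX h t t0 td.
have y1 : T `^ s / X < 1 by rewrite ltr_pdivrMr// mul1r.
have y0 : 0 <= T `^ s / X by rewrite divr_ge0 ?powR_ge0// ltW.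
have c : {for t, continuous oscs}.
 apply: (@ssum_cont (fun n t => t `^ (n%:R * s) * osc n (ln t)) t (2 * C) _ y0 y1).
  near=> x; move=> n; apply: oscs_term => //.
   by near: x; exact: lt_nbhsr.
  apply: ltW; apply: (@lt_le_trans _ _ d) => //; near: x; exact: lt_nbhsl.
 move=> n.
 have cl : {for t, continuous (@ln R)} by exact: continuous_ln.
 have cp : {for t, continuous (fun x : R => x `^ (n%:R * s))}.
  apply: differentiable_continuous; apply/derivable1_diffP.
  by have [] := is_derive1_powR (n%:R * s) t0.
 apply: cvgM; first exact: cp.
 have cm : {for t, continuous (fun x => n%:R * w * ln x)} by apply: cvgM; [exact: cvg_cst|exact: cl].
 apply: cvgD; apply: cvgM; (try exact: cvg_cst).
  by apply: (continuous_comp cm); exact: continuous_sin.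
 by apply: (continuous_comp cm); exact: continuous_cos.
apply/eqP; apply: contrapT => /negP ne; have e0 : 0 < `|oscs t| by rewrite normr_gt0.
move/cvgrPdist_lt : c => /(_ _ e0) [a /= a0 ha].
have m0 : 0 < Num.min a (d - t) by rewrite lt_min a0 subr_gt0.
have [x [x1 x2 hx]] := @ae_dense _ t (t + Num.min a (d - t)) h (ltr_pwDr m0 (lexx t)).
have xd : x < d by move: x2; rewrite -ltrBlDl lt_min => /andP[_]; rewrite ltrD2r.
have hb : `|oscs t - oscs x| < `|oscs t|.
 apply: ha; rewrite /= distrC gtr0_norm ?subr_gt0//.
 by move: x2; rewrite -ltrBlDl lt_min => /andP[].
by move: hb; rewrite hx ?(lt_trans t0 x1)// subr0 ltxx.
Unshelve. all: by end_near. Qed.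

Lemma expRN_le (y : R) : 0 <= y -> expR (- y) <= (1 + y)^-1.
move=> y0; have h := expR_ge1Dx y; have p1 : 0 < 1 + y by rewrite ltr_wpDr.
by rewrite expRN lef_pV2 ?posrE ?expR_gt0.
Qed.

Lemma le0_arch (z B P : R) : 0 < P -> 0 <= B -> (forall j : nat, z <= B * (1 + j%:R * P)^-1) -> z <= 0.
move=> P0 B0 h; rewrite leNgt; apply/negP => z0.
have c := cvg_inv1Dn B P0; have [N _ hN] := cvgr0_norm_lt _ c _ z0.
have := hN N (leqnn N); rewrite ger0_norm; last by rewrite mulr_ge0// invr_ge0 addr_ge0// mulr_ge0// ltW.
by rewrite ltNge h.
Qed.

Lemma osc_period n l : exists2 P, 0 < P & forall j : nat, osc n (l - j%:R * P) = osc n l.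
have [nw|nw] := eqVneq (n%:R * w) 0.
 by exists 1 => // j; rewrite /osc nw !mul0r.
have p2 : 0 < 2 * pi :> R by rewrite mulr_gt0// pi_gt0.
have [nw0|nw0|nw0] := ltgtP (n%:R * w) 0; last by rewrite nw0 eqxx in nw.
 exists (2 * pi / - (n%:R * w)); first by rewrite divr_gt0// oppr_gt0.
 move=> j; rewrite /osc; have [s1 c1] := sin2pi_n j.
 have -> : n%:R * w * (l - j%:R * (2 * pi / - (n%:R * w))) = n%:R * w * l + 2 * pi * j%:R.
  by field; move: nw; rewrite mulf_eq0 negb_or => /andP[-> ->].
 by rewrite sinD cosD s1 c1; ring.
exists (2 * pi / (n%:R * w)); first by rewrite divr_gt0.
move=> j; rewrite /osc; have [s1 c1] := sin2pi_n j.
have -> : n%:R * w * (l - j%:R * (2 * pi / (n%:R * w))) = n%:R * w * l - 2 * pi * j%:R.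
 by field; move: nw; rewrite mulf_eq0 negb_or => /andP[-> ->].
by rewrite sinB cosB s1 c1; ring.
Qed.

(** Strong induction on [n]: once the lower terms are gone, division by [t^(n s)] leaves
    [osc n (ln t)] plus [O(t^s)]. Along [ln t = l - j P] the first is constant in [j] by periodicity
    while the second tends to 0. *)
Lemma osc_lead (d T : R) : 0 < s -> 0 < d -> d <= T -> T `^ s < X ->
 (forall t, 0 < t -> t < d -> oscs t = 0) -> forall n l, osc n l = 0.
move=> s0 d0 dT TX h n; elim/ltn_ind: n => n ih l.
have T0 := lt_le_trans d0 dT.
have y1 : T `^ s / X < 1 by rewrite ltr_pdivrMr// mul1r.
have y0 : 0 <= T `^ s / X by rewrite divr_ge0 ?powR_ge0// ltW.
have C0 : 0 <= C by have := hp 0%N; rewrite expr0 mulr1; exact: le_trans.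
pose B := 2 * C * X^-1 ^+ n.+1 / (1 - T `^ s / X).
have B0 : 0 <= B by rewrite divr_ge0 ?subr_ge0 ?(ltW y1)// !mulr_ge0// exprn_ge0// invr_ge0 ltW.
have key m : m < ln d -> `|osc n m| <= B * expR (s * m).
 move=> md; set t := expR m; have t0 : 0 < t by exact: expR_gt0.
 have td : t < d by rewrite -(lnK d0) ltr_expR.
 have tT := le_trans (ltW td) dT.
 have g : geo (fun k => t `^ (k%:R * s) * osc k (ln t)).
  by exists (2 * C), (T `^ s / X); split => // k; apply: oscs_term => //; exact: ltW.
 have [E _] := ssum_tail n.+1 g; move: E; rewrite -/(oscs t) h// sub0r big_ord_recr /= big1 => [|i _]; last first.
  by rewrite (ih i (ltn_ord i)) mulr0.
 rewrite add0r => E.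
 have tn : 0 < t `^ (n%:R * s) by exact: powR_gt0.
 have q0 : 0 <= t `^ s by exact: powR_ge0.
 have qT : t `^ s / X <= T `^ s / X.
  by rewrite ler_pM2r ?invr_gt0// ge0_ler_powR ?nnegrE ?(ltW s0) ?(ltW t0) ?(ltW T0).
 have bd : `|t `^ (n%:R * s) * osc n (ln t)| <= B * t `^ s * t `^ (n%:R * s).
  rewrite -normrN E.
  apply: (le_trans (@ssum_bound _ _ (2 * C * X^-1 ^+ n.+1 * t `^ (n.+1%:R * s)) _ y0 y1 _)).
   move=> k; rewrite normrM (ger0_norm (powR_ge0 _ _)).
   apply: (le_trans (ler_wpM2l (powR_ge0 _ _) (osc_bd _ _))).
   rewrite natrD mulrDl powRD_pos// exprD.
   have -> : t `^ (k%:R * s) = (t `^ s) ^+ k by rewrite mulrC powRrM powR_mulrn.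
   have -> : (t `^ s) ^+ k * t `^ (n.+1%:R * s) * (2 * C * (X^-1 ^+ k * X^-1 ^+ n.+1)) =
    2 * C * X^-1 ^+ n.+1 * t `^ (n.+1%:R * s) * (t `^ s / X) ^+ k by rewrite expr_div_n exprVn; ring.
   apply: ler_wpM2l; first by rewrite !mulr_ge0 ?powR_ge0// exprn_ge0// invr_ge0 ltW.
   by apply: lerXn2r; rewrite ?nnegrE// divr_ge0// ltW.
  have -> : n.+1%:R * s = n%:R * s + s by rewrite -natr1; ring.
  by rewrite (powRD_pos (n%:R * s))// /B; apply: eqle; ring.
 move: bd; rewrite normrM (gtr0_norm tn) mulrC ler_pM2r// /t expRK => bd.
 by rewrite (le_trans bd)// powR_expR.
have [P P0 hP] := osc_period n l.
pose j0 := Num.bound (`|l - ln d| / P).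
have j0P : `|l - ln d| < j0%:R * P by rewrite -ltr_pdivrMr// archi_boundP// divr_ge0// ltW.
have hl : l - j0%:R * P < ln d.
 by rewrite ltrBlDl -ltrBlDr; exact: le_lt_trans (ler_norm _) j0P.
apply/eqP; rewrite -normr_le0.
have sP : 0 < s * P by rewrite mulr_gt0.
apply: (@le0_arch _ (B * expR (s * (l - j0%:R * P))) _ sP); first by rewrite mulr_ge0// expR_ge0.
move=> j; rewrite -(hP (j0 + j)%N).
have -> : l - (j0 + j)%:R * P = l - j0%:R * P - j%:R * P by rewrite natrD; ring.
apply: (le_trans (key _ _)); first by rewrite (le_lt_trans _ hl)// gerBl mulr_ge0// ltW.
rewrite -mulrA; apply: ler_wpM2l => //; rewrite (mulrBr s) expRD; apply: ler_wpM2l; first exact: expR_ge0.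
have -> : j%:R * (s * P) = s * (j%:R * P) by ring.
by apply: expRN_le; rewrite !mulr_ge0// ltW.
Qed.

End dominated_series.

(** * Uniqueness of Fourier coefficients *)

Section fourier.
Variable R : realType.
Notation mu := (@lebesgue_measure R).

Lemma ae_and0 (P Q : R -> Prop) : {ae mu, forall x, P x} -> {ae mu, forall x, Q x} -> {ae mu, forall x, P x /\ Q x}.
Proof. by move=> h1 h2; apply: (aeS2 h1 h2). Qed.

Let J (t : R) : R := \1_(`[0, 2 * pi]%classic : set R) t.
Let pi20 : 0 < 2 * pi :> R. Proof. by rewrite mulr_gt0// pi_gt0. Qed.

Lemma int_J : itg J /\ \int[mu]_t J t = 2 * pi.
have ip := pp_int ltr01 pi20; have mJ : mfs J by exact: measurable_indic.
have E : {ae mu, forall t, J t = pp 1 (2 * pi) t}.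
 apply: (aeS (ae_and0 (ae_neq 0) (ae_neq (2 * pi)))) => t [t0 t1].
 rewrite /J indicE mem_setE in_itv/= /pp subrr powRr0 (le_eqVlt 0) (eq_sym 0) (negbTE t0) (le_eqVlt t) (negbTE t1) /=.
 by case: (_ && _).
have i : itg J.
 by apply: (itg_ae_dom mJ ip.1); apply: (aeS E) => t ->; rewrite ger0_norm// pp_ge0.
by split => //; rewrite (int_ae_eq mJ (imeas ip.1) E) ip.2 powRr1 ?(ltW pi20)// divr1.
Qed.

Lemma itg_J (f : R -> R) (B : R) : mfs f -> (forall t, `|f t| <= B) -> itg (fun t => f t * J t).
move=> mf hB; apply: (itg_dom _ _ (itgZ B int_J.1)).
 by apply: mfsM => //; exact: measurable_indic.
move=> t; rewrite normrM (ger0_norm (x := J t)); last by rewrite /J indicE ler0n.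
by apply: ler_wpM2r; rewrite // /J indicE ler0n.
Qed.

Lemma int_FTC (f F : R -> R) (B : R) : continuous f -> (forall t, `|f t| <= B) -> (forall t : R, is_derive t (1 : R) F (f t)) ->
 \int[mu]_t (f t * J t) = F (2 * pi) - F 0.
move=> cf hB dF; have i := itg_J (continuous_measurable_fun cf) hB.
have cF : continuous F.
 move=> x; apply: differentiable_continuous; apply/derivable1_diffP.
 by have [] := dF x.
apply: EFin_inj; rewrite -(intE i) EFinB -(@continuous_FTC2 _ f F 0 (2 * pi))//.
- rewrite [RHS]integral_mkcond; apply: eqint => t.
 by rewrite patchE /J indicE; case: (t \in _); rewrite ?mulr1 ?mulr0.
- by apply: continuous_subspaceT => x; exact: cf.
- split.
 + by move=> x _; have [] := dF x.
 + by apply: cvg_at_right_filter; exact: cF.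
 + by apply: cvg_at_left_filter; exact: cF.
- by move=> x _; rewrite derive1E; have [_ ->] := dF x.
Qed.

Lemma cont_lin (g : R -> R) (m : R) : continuous g -> continuous (fun t => g (m * t)).
Proof. by move=> cg t; apply: (continuous_comp (g := g)); [apply: cvgM; [exact: cvg_cst|exact: cvg_id]|exact: cg]. Qed.

Lemma is_derive_lin (g : R -> R) (m t dg : R) : is_derive (m * t) (1 : R) g dg -> is_derive t (1 : R) (fun t => g (m * t)) (dg * m).
move=> h; have d : is_derive t (1 : R) (fun t => m * t) m.
 have -> : (fun t => m * t) = m *: id :> (R -> R) by apply/funext.
 by apply: is_derive_eq; rewrite /GRing.scale /= mulr1.
have k := @is_derive1_comp _ g (fun t => m * t) t dg m h d.
by move: k; rewrite /comp.
Qed.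

Lemma int_cos (m : R) : m != 0 -> sin (m * (2 * pi)) = 0 -> \int[mu]_t (cos (m * t) * J t) = 0.
move=> m0 hs.
have hd t : is_derive t (1 : R) (fun t => m^-1 * sin (m * t)) (cos (m * t)).
 have d := is_derive_lin (is_derive_sin (m * t)).
 have -> : (fun t => m^-1 * sin (m * t)) = m^-1 *: (fun t => sin (m * t)) by apply/funext.
 by apply: is_derive_eq; rewrite /GRing.scale /= mulrCA mulVf// mulr1.
have hb t : `|cos (m * t)| <= 1 by rewrite ler_norml cos_geN1 cos_le1.
by rewrite (int_FTC (cont_lin (@continuous_cos R)) hb hd) mulr0 sin0 hs !mulr0 subrr.
Qed.

Variables (p r : nat -> R) (C X : R).
Hypotheses (X1 : 1 < X) (hp : forall n, `|p n| <= C * X^-1 ^+ n) (hr : forall n, `|r n| <= C * X^-1 ^+ n).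
Let v n t := p n * sin (n%:R * t) + r n * cos (n%:R * t).

Lemma sin2pi_half (n : nat) : sin (n%:R * (2 * pi) : R) = 0 /\ cos (n%:R * (2 * pi) : R) = 1.
Proof. by rewrite mulrC; exact: sin2pi_n. Qed.

Lemma cos_J m : itg (fun t => cos (m * t) * J t).
apply: (@itg_J _ 1); first exact: continuous_measurable_fun (cont_lin (m := m) (@continuous_cos R)).
by move=> t; rewrite ler_norml cos_geN1 cos_le1.
Qed.

Lemma cos_prod (k n : nat) t : cos (k%:R * t) * cos (n%:R * t) * J t =
 2^-1 * (cos ((k%:R - n%:R) * t) * J t) + 2^-1 * (cos ((k%:R + n%:R) * t) * J t).
Proof. by rewrite mulrBl mulrDl cosB cosD; field. Qed.

Lemma int_cos_prod (k n : nat) : (0 < n)%N ->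
 itg (fun t => cos (k%:R * t) * cos (n%:R * t) * J t) /\
 \int[mu]_t (cos (k%:R * t) * cos (n%:R * t) * J t) = if k == n then pi else 0.
move=> n0; have [s1 _] := sin2pi_half k; have [s2 _] := sin2pi_half n.
have E : (fun t => cos (k%:R * t) * cos (n%:R * t) * J t) = _ := funext (cos_prod k n).
have j1 := itgZ 2^-1 (cos_J (k%:R - n%:R)); have j2 := itgZ 2^-1 (cos_J (k%:R + n%:R)).
rewrite E; split; first exact: itgD.
rewrite (intD j1 j2) !intZ; [|exact: cos_J..].
rewrite (@int_cos (k%:R + n%:R)); first last.
- by rewrite mulrDl sinD s1 s2 mul0r mulr0 addr0.
- by rewrite -natrD pnatr_eq0 addn_eq0 (gtn_eqF n0) andbF.
rewrite mulr0 addr0; have [->|kn] := eqVneq k n.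
 rewrite (eqRint (g := J)) => [|t]; last by rewrite subrr mul0r cos0 mul1r.
 by rewrite int_J.2; field.
rewrite int_cos ?mulr0 ?subr_eq0 ?eqr_nat//.
by rewrite mulrBl sinB s1 s2 mul0r mulr0 subr0.
Qed.

Lemma v_bd n t : `|v n t| <= 2 * C * X^-1 ^+ n.
rewrite /v (le_trans (ler_normD _ _))// !normrM.
rewrite [leRHS](_ : _ = C * X^-1 ^+ n + C * X^-1 ^+ n); last by ring.
apply: lerD.
 by apply: le_trans (hp n); rewrite ler_piMr// ler_norml sin_geN1 sin_le1.
by apply: le_trans (hr n); rewrite ler_piMr// ler_norml cos_geN1 cos_le1.
Qed.

(* Symmetrizing in the increment [h] turns the series into [sum_n v n t * cos (n h)], to which orthogonality applies. *)
Lemma fourier_unique : (forall t, ssum (v ^~ t) = 0) -> forall n t, v n t = 0.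
move=> h n t; have X0 : 0 < X := lt_trans ltr01 X1.
have y1 : X^-1 < 1 by rewrite invf_lt1.
have y0 : 0 <= X^-1 by rewrite invr_ge0 ltW.
have g s : geo (v ^~ s) by exists (2 * C), X^-1; split => // k; exact: v_bd.
pose w k u := v k t * cos (k%:R * u).
have wb k u : `|w k u| <= 2 * C * X^-1 ^+ k.
 by rewrite normrM (le_trans _ (v_bd k t))// ler_piMr// ler_norml cos_geN1 cos_le1.
have gw u : geo (w ^~ u) by exists (2 * C), X^-1; split => // k; exact: wb.
have w0 u : ssum (w ^~ u) = 0.
 apply: (mulfI (x := 2)) => //; rewrite -ssumZ// mulr0 -[RHS](addr0 0) -{1}(h (t + u)) -(h (t - u)) -ssumD//.
 congr ssum; apply/funext => k; rewrite /w /v (mulrDr k%:R) (mulrBr k%:R) sinD cosD sinB cosB; ring.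
have pos m : (0 < m)%N -> v m t = 0.
 move=> m0; pose F N u := series (w ^~ u) N * cos (m%:R * u) * J u.
 have mc k : mfs (fun u : R => cos (k%:R * u)).
  exact: continuous_measurable_fun (cont_lin (@continuous_cos R)).
 have FE N : \int[mu]_u F N u = \sum_(k < N) v k t * (if k == m :> nat then pi else 0).
  transitivity (\int[mu]_u (\sum_(k < N) v k t * (cos (k%:R * u) * cos (m%:R * u) * J u))).
   apply: eqRint => u; rewrite /F /series /= big_mkord !mulr_suml.
   by apply: eq_bigr => k _; rewrite /w !mulrA.
  rewrite int_sum => [|k]; last exact: itgZ (int_cos_prod k m0).1.
  by apply: eq_bigr => k _; have H := int_cos_prod k m0; rewrite (intZ _ H.1) H.2.
 have c1 : \int[mu]_u F N u @[N --> \oo] --> \int[mu]_u (0 : R).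
  apply: (Rdct (g := fun u => 2 * C / (1 - X^-1) * 1 * J u)).
  - move=> N; apply: mfsM; last exact: measurable_indic.
   apply: mfsM => //; rewrite /series /=.
   have -> : (fun x => \sum_(0 <= k < N) w k x) = (fun x => \sum_(k < N) w k x) by apply/funext => x; rewrite big_mkord.
   by apply: measurable_sum => k; exact: mfsM.
  - exact: measurable_cst.
  - by apply: itgZ; exact: int_J.1.
  - apply: aeW => u; rewrite -[X in _ --> X](mul0r (J u)) -(mul0r (cos (m%:R * u))) -(w0 u).
   by apply: cvgM; [apply: cvgM; [exact: geo_cvg|exact: cvg_cst]|exact: cvg_cst].
  - move=> N; apply: aeW => u; rewrite /F normrM normrM (ger0_norm (x := J u)); last by rewrite /J indicE ler0n.
   apply: ler_wpM2r; first by rewrite /J indicE ler0n.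
   apply: ler_pM => //; last by rewrite ler_norml cos_geN1 cos_le1.
   by apply: (@series_geo_le _ _ (2 * C) X^-1 N y0 y1) => k; exact: wb.
 have c2 : \int[mu]_u F N u @[N --> \oo] --> v m t * pi.
  apply: cvg_near_cst; exists m.+1 => // N /= mN.
  rewrite FE (bigD1 (Ordinal mN))//= eqxx big1 ?addr0// => k km.
  by rewrite ifN ?mulr0//; apply: contra km => /eqP e; apply/eqP/val_inj.
 have E0 : \int[mu]_u (0 : R) = v m t * pi by apply: (cvg_unique (@Rhausdorff R) c1 c2).
 move: E0; rewrite /Rintegral integral0 => /esym/eqP.
 by rewrite mulf_eq0 (gt_eqF (pi_gt0 R)) orbF => /eqP.
(* Orthogonality was used for positive indices; with those terms gone, the series reduces to its
   term of index 0. *)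
case: n => [|n]; last exact: pos.
have := ssum_recl (g t); rewrite h (_ : (fun n => v n.+1 t) = fun=> 0); last by apply/funext => n; exact: pos.
rewrite (@ssum_lim _ (fun=> 0) 0) ?addr0//.
by rewrite (_ : series _ = fun=> 0); [exact: cvg_cst|apply/funext => n; rewrite /series /= big1].
Qed.

End fourier.

#[local] Opaque powR itg ker.

(** * When the complex kernel is real near 0 *)

Section complex_series.
Variable R : realType.
Notation mu := (@lebesgue_measure R).
Notation Re := complex.Re.
Notation Im := complex.Im.
Implicit Types (z : R[i]) (c : nat -> R[i]).

Lemma ReB z1 z2 : Re (z1 - z2) = Re z1 - Re z2. Proof. by case: z1 z2 => [? ?] [? ?]. Qed.
Lemma ImB z1 z2 : Im (z1 - z2) = Im z1 - Im z2. Proof. by case: z1 z2 => [? ?] [? ?]. Qed.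
Lemma ReM z1 z2 : Re (z1 * z2) = Re z1 * Re z2 - Im z1 * Im z2. Proof. by case: z1 z2 => [? ?] [? ?]. Qed.
Lemma ImM z1 z2 : Im (z1 * z2) = Re z1 * Im z2 + Im z1 * Re z2. Proof. by case: z1 z2 => [? ?] [? ?]. Qed.

Lemma Re_sum (F : nat -> R[i]) n : Re (\sum_(0 <= k < n) F k) = \sum_(0 <= k < n) Re (F k).
elim: n => [|n ih]; first by rewrite !big_nil.
by rewrite !big_nat_recr //= -ih; case: (\sum_(0 <= i < n) F i) (F n) => [? ?] [? ?].
Qed.

Lemma Im_sum (F : nat -> R[i]) n : Im (\sum_(0 <= k < n) F k) = \sum_(0 <= k < n) Im (F k).
elim: n => [|n ih]; first by rewrite !big_nil.
by rewrite !big_nat_recr //= -ih; case: (\sum_(0 <= i < n) F i) (F n) => [? ?] [? ?].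
Qed.

Lemma normC_normc z : `|z| = (normc z)%:C%C. Proof. by []. Qed.

Lemma Re_le_normc z : `|Re z| <= normc z.
Proof. by have := normc_ge_Re z; rewrite normC_normc lecR. Qed.

Lemma Im_le_normc z : `|Im z| <= normc z.
Proof. by case: z => a b /=; rewrite -sqrtr_sqr ler_wsqrtr// lerDr sqr_ge0. Qed.

Lemma cvg_ReIm (u : nat -> R[i]^o) (l : R[i]^o) : u n @[n --> \oo] --> l ->
 (Re (u n) @[n --> \oo] --> Re l) /\ (Im (u n) @[n --> \oo] --> Im l).
move=> h; have k (e : R) : 0 < e -> \forall n \near \oo, normc (l - u n) < e.
 move=> e0; have e0' : 0 < e%:C%C :> R[i] by rewrite ltcR.
 move/cvgrPdist_lt : h => /(_ _ e0'); apply: filterS => n /=.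
 by rewrite normC_normc ltcR.
split; apply/cvgrPdist_lt => e e0; near do rewrite -(ReB, ImB).
- by near=> n; apply: le_lt_trans (Re_le_normc _) _; near: n; exact: k.
- by near=> n; apply: le_lt_trans (Im_le_normc _) _; near: n; exact: k.
Unshelve. all: by end_near. Qed.

Lemma power_sum_ReIm c rho z : analytic_on_disc c rho -> normc z < rho ->
 (series (fun k => Re (c k * z ^+ k)) @ \oo --> Re (power_sum c z)) /\
 (series (fun k => Im (c k * z ^+ k)) @ \oo --> Im (power_sum c z)).
move=> h /h hz; have := cvg_ReIm hz.
have -> : (fun n => Re (power_series c z n)) = series (fun k => Re (c k * z ^+ k)).
 by apply/funext => n; rewrite /power_series Re_sum.
have -> // : (fun n => Im (power_series c z n)) = series (fun k => Im (c k * z ^+ k)).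
by apply/funext => n; rewrite /power_series Im_sum.
Qed.

Lemma cpowX (t : R) (b : R[i]) n : 0 < t ->
 cpow t b ^+ n = (t `^ (n%:R * Re b) * cos (n%:R * Im b * ln t) +i* (t `^ (n%:R * Re b) * sin (n%:R * Im b * ln t)))%C.
move=> t0; elim: n => [|n ih].
 by rewrite expr0 !mul0r powRr0 cos0 sin0 mulr1 mulr0.
rewrite exprS ih -[n.+1%:R]natr1.
have -> : (n%:R + 1) * Re b = Re b + n%:R * Re b by ring.
have -> : (n%:R + 1) * Im b * ln t = Im b * ln t + n%:R * Im b * ln t by ring.
rewrite !powRD; last by rewrite (gt_eqF t0) implybT.
rewrite cosD sinD; apply/eqP; rewrite eq_complex !ReM !ImM /= !mul0r ?subr0 ?addr0.
by apply/andP; split; apply/eqP; ring.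
Qed.

Lemma normc_cpow (t : R) (b : R[i]) : 0 < t -> normc (cpow t b) = t `^ Re b.
move=> t0; rewrite /cpow normcM /= expr0n /= addr0 sqrtr_sqr ger0_norm ?powR_ge0//.
by rewrite cos2Dsin2 sqrtr1 mulr1.
Qed.

(** The terms of a series convergent at the radius [X], midway between [T^s] and [rho], are
    bounded. *)
Lemma coef_bd c rho (T s : R) : analytic_on_disc c rho -> 0 < T -> T `^ s < rho ->
 exists C X, [/\ 0 < X, T `^ s < X, forall n, `|Re (c n)| <= C * X^-1 ^+ n & forall n, `|Im (c n)| <= C * X^-1 ^+ n].
move=> h T0 Tr; pose X := (T `^ s + rho) / 2.
have p0 : 0 < T `^ s by exact: powR_gt0.
have X0 : 0 < X by rewrite /X; lra.
have TX : T `^ s < X by rewrite /X; lra.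
have Xr : normc X%:C%C < rho by rewrite /= expr0n /= addr0 sqrtr_sqr ger0_norm ?(ltW X0)// /X; lra.
have [c1 c2] := power_sum_ReIm h Xr.
have bd (u : nat -> R) (l : R) : series u @ \oo --> l -> exists C, forall n, `|u n| <= C.
 move=> cu; have /cvg_series_cvg_0 cz : cvgn (series u) by apply/cvg_ex; exists l.
 have /cvg_seq_bounded : cvgn u by apply/cvg_ex; exists 0.
 by case=> M [_ hM]; exists (M + 1) => n; apply: (hM (M + 1)) => //; lra.
have pw n : (X%:C%C ^+ n : R[i]) = (X ^+ n)%:C%C by rewrite rmorphXn.
have [C1 h1] := bd _ _ c1; have [C2 h2] := bd _ _ c2.
exists (Num.max C1 C2), X; split => // n.
- have := h1 n; rewrite pw ReM /= mulr0 subr0 normrM (ger0_norm (exprn_ge0 _ (ltW X0))) => h3.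
 rewrite exprVn ler_pdivlMr ?exprn_gt0//; apply: le_trans h3 _; by rewrite le_max lexx.
- have := h2 n; rewrite pw ImM /= mulr0 add0r normrM (ger0_norm (exprn_ge0 _ (ltW X0))) => h3.
 rewrite exprVn ler_pdivlMr ?exprn_gt0//; apply: le_trans h3 _; by rewrite le_max lexx orbT.
Qed.

Lemma power_sum_oscs c rho (t : R) (b : R[i]) : analytic_on_disc c rho -> 0 < t -> t `^ Re b < rho ->
 Im (power_sum c (cpow t b)) = oscs (fun n => Re (c n)) (fun n => Im (c n)) (Re b) (Im b) t /\
 Re (power_sum c (cpow t b)) = oscs (fun n => - Im (c n)) (fun n => Re (c n)) (Re b) (Im b) t.
move=> h t0 tr; have zr : normc (cpow t b) < rho by rewrite normc_cpow.
have [c1 c2] := power_sum_ReIm h zr; rewrite /oscs -(ssum_lim c1) -(ssum_lim c2).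
by split; congr ssum; apply/funext => n; rewrite cpowX// ?ReM ?ImM /osc /=; ring.
Qed.

Lemma oscs_kernel (p r : nat -> R) (C X s w m T : R) : 0 < X -> (forall n, `|p n| <= C * X^-1 ^+ n) ->
 (forall n, `|r n| <= C * X^-1 ^+ n) -> 0 <= s -> T `^ s < X -> 0 < m -> 0 < T ->
 itg (fun t => pp m T t * oscs p r s w t).
move=> X0 hp hr s0 TX m0 T0.
have y0 : 0 <= T `^ s / X by rewrite divr_ge0 ?powR_ge0 ?(ltW X0).
have y1 : T `^ s / X < 1 by rewrite ltr_pdivrMr// mul1r.
pose f n t := pp m T t * (t `^ (n%:R * s) * osc p r w n (ln t)).
have fb n t : `|f n t| <= pp m T t * (2 * C) * (T `^ s / X) ^+ n.
 rewrite /f /pp; case: ifPn => [/andP[t0 tT]|_]; last by rewrite !mul0r normr0.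
 rewrite normrM (ger0_norm (powR_ge0 _ _)) -mulrA; apply: ler_wpM2l; first exact: powR_ge0.
 by apply: oscs_term => //; exact: ltW.
have fg t : geo (f ^~ t) by exists (pp m T t * (2 * C)), (T `^ s / X); split => // n; exact: fb.
have fE t : pp m T t * oscs p r s w t = ssum (f ^~ t).
 rewrite /f; have [->|t0] := eqVneq (pp m T t) 0.
  rewrite mul0r (_ : (fun _ => _) = fun=> 0); last by apply/funext => n; rewrite mul0r.
  rewrite (@ssum_lim _ (fun=> 0) 0)//.
  by rewrite (_ : series _ = fun=> 0); [exact: cvg_cst|apply/funext => n; rewrite /series /= big1].
 rewrite ssumZ//; exists (2 * C), (T `^ s / X); split => // n.
 move: t0; rewrite /pp; case: ifPn => [/andP[t0 tT]|_]; last by rewrite eqxx.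
 by move=> _; by apply: oscs_term => //; exact: ltW.
apply: (@itg_dom _ _ (fun t => 2 * C / (1 - T `^ s / X) * pp m T t)).
- rewrite (_ : (fun _ => _) = fun t => ssum (f ^~ t)); last by apply/funext => t; exact: fE.
 apply: mfs_ssum fg => n; apply: mfsM; first exact: mfs_pp.
 apply: mfsM; first exact: measurable_powR.
 apply: mfsD; apply: mfsM => //.
  apply: (mfsT (f := sin)); first exact: continuous_measurable_fun (@continuous_sin R).
  by apply: mfsM => //; exact: measurable_ln.
 apply: (mfsT (f := cos)); first exact: continuous_measurable_fun (@continuous_cos R).
 by apply: mfsM => //; exact: measurable_ln.
- move=> t; rewrite fE; apply: le_trans (ssum_bound y0 y1 (fb ^~ t)) _.
 by rewrite le_eqVlt; apply/orP; left; apply/eqP; ring.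
- exact: itgZ (pp_int m0 T0).1.
Qed.

Lemma ssum_delta (x : nat -> R) : (forall n, (0 < n)%N -> x n = 0) -> ssum x = x 0%N.
move=> h; apply: ssum_lim; apply: cvg_near_cst; exists 1%N => // n /= n1.
rewrite /series /= -(subnKC n1) big_nat_recl// big1_seq ?addr0// => i _.
by rewrite h.
Qed.

Lemma osc0 (p r : nat -> R) (w : R) n : (forall l, osc p r w n l = 0) -> r n = 0 /\ (n%:R * w != 0 -> p n = 0).
move=> h; have r0 : r n = 0 by have := h 0; rewrite /osc !mulr0 sin0 cos0 mulr0 add0r mulr1.
split => // nw; have := h (pi / 2 / (n%:R * w)).
by rewrite /osc r0 mul0r addr0 mulrCA mulfV// mulr1 sin_pihalf mulr1.
Qed.

(** Every [osc n] vanishes: for [Re b > 0] by comparing orders in [osc_lead], for [Re b = 0] by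
    Fourier uniqueness in the logarithm. So all [c n] are real, and for [Im b != 0] only [c 0]
    survives; either way a real fractional power series remains. *)
Lemma real_kernel c rho (b : R[i]) (T d : R) : analytic_on_disc c rho -> 0 < T -> 0 <= Re b -> b != 0 ->
 T `^ Re b < rho -> 0 < d -> c 0%N != 0 ->
 {ae mu, forall t, 0 < t -> t < d -> Im (power_sum c (cpow t b)) = 0} ->
 exists e L bt C, [/\ 0 < bt, T < L, coefbd e L bt C, e 0%N != 0 &
  forall t, 0 < t -> t <= T -> Re (power_sum c (cpow t b)) = ssum (fun n => e n * t `^ (n%:R * bt))].
move=> hc T0 s0 b0 Tr d0 c0 hI; have [C [X [X0 TX hp hr]]] := coef_bd hc T0 Tr.
have hr' n : `|- Im (c n)| <= C * X^-1 ^+ n by rewrite normrN.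
have tr t : 0 < t -> t <= T -> t `^ Re b < rho.
 by move=> t0 tT; apply: le_lt_trans Tr; apply: ge0_ler_powR => //; rewrite nnegrE ltW.
pose D := Num.min d T.
have D0 : 0 < D by rewrite lt_min d0.
have DT : D <= T by rewrite ge_min lexx orbT.
have z : forall t, 0 < t -> t < D -> oscs (fun n => Re (c n)) (fun n => Im (c n)) (Re b) (Im b) t = 0.
 apply: (oscs_zero X0 hp hr s0 D0 DT TX); apply: (aeS hI) => t ht t0 tD.
 have td : t < d by apply: lt_le_trans tD _; rewrite ge_min lexx.
 rewrite -(power_sum_oscs hc t0 (tr t t0 (le_trans (ltW tD) DT))).1; exact: ht.
have C0 : 0 <= C by have := hp 0%N; rewrite expr0 mulr1; exact: le_trans.
have key : (forall n, Im (c n) = 0) /\ (Im b != 0 -> forall n, (0 < n)%N -> Re (c n) = 0).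
 have [s1|s1] := ltP 0 (Re b).
  have o := osc_lead X0 hp hr s1 D0 DT TX z.
  split=> [n|w0 n n0]; first exact: (osc0 (o n)).1.
  by apply: (osc0 (o n)).2; rewrite mulf_neq0// pnatr_eq0 -lt0n.
 have sE : Re b = 0 by apply/eqP; rewrite eq_le s1.
 have w0 : Im b != 0 by apply: contra b0 => /eqP w0; rewrite eq_complex sE w0 /= eqxx.
 have X1 : 1 < X by move: TX; rewrite sE powRr0.
 have v0 := @fourier_unique R (fun n => Re (c n)) (fun n => Im (c n)) C X X1 hp hr.
 have o n l : osc (fun n => Re (c n)) (fun n => Im (c n)) (Im b) n l = 0.
  rewrite /osc -mulrA; apply: v0 => u.
  have w1 : 0 < `|Im b| by rewrite normr_gt0.
  have p2 : 0 < 2 * pi :> R by rewrite mulr_gt0// pi_gt0.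
  (* The series is periodic in [ln t]; subtracting [j] periods moves an arbitrary [u] into the range
     [ln t < ln D] where the series is known to vanish. *)
  pose j := (Num.truncn (`|u / Im b - ln D| / (2 * pi / `|Im b|))).+1.
  have jl : `|u / Im b - ln D| < j%:R * (2 * pi / `|Im b|).
   by rewrite -ltr_pdivrMr ?divr_gt0//; exact: truncnS_gt.
  pose x := u / Im b - j%:R * (2 * pi / `|Im b|).
  have xD : x < ln D by move: jl; rewrite ltr_norml /x => /andP[_]; lra.
  have tD : expR x < D by rewrite -[D]lnK ?posrE// ltr_expR.
  have := z _ (expR_gt0 x) tD; rewrite /oscs => h0; rewrite -[RHS]h0.
  congr ssum; apply/funext => n0; rewrite sE mulr0 powRr0 mul1r expRK /osc.
  have [s2 c2] := sin2pi_n R (n0 * j)%N.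
  have -> : n0%:R * Im b * x = n0%:R * u - Num.sg (Im b) * (2 * pi * (n0 * j)%:R).
   have sg : Im b / `|Im b| = Num.sg (Im b) by rewrite [X in X / _]numEsg mulfK// gt_eqF.
   by rewrite /x natrM -sg; field; rewrite w0 gt_eqF.
  have [p0|p0] := ltP 0 (Im b).
   by rewrite gtr0_sg// mul1r sinB cosB s2 c2 !mulr1 !mulr0 subr0 addr0.
  rewrite ltr0_sg; last by rewrite lt_neqAle w0.
  by rewrite mulN1r opprK sinD cosD s2 c2 !mulr1 !mulr0 addr0 subr0.
 split=> [n|_ n n0]; first exact: (osc0 (o n)).1.
 by apply: (osc0 (o n)).2; rewrite mulf_neq0// pnatr_eq0 -lt0n.
have {key}[i0 k0] := key.
have c00 : Re (c 0%N) != 0 by apply: contra c0 => /eqP r0; rewrite eq_complex r0 i0 /= eqxx.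
have E t : 0 < t -> t <= T -> Re (power_sum c (cpow t b)) =
  ssum (fun n => Re (c n) * (t `^ (n%:R * Re b) * cos (n%:R * Im b * ln t))).
 move=> t0 tT; rewrite (power_sum_oscs hc t0 (tr t t0 tT)).2; congr ssum; apply/funext => n.
 by rewrite /osc i0 oppr0 mul0r add0r mulrCA.
have [w0|w0] := eqVneq (Im b) 0.
 have s1 : 0 < Re b by rewrite lt_neqAle s0 andbT eq_sym; apply: contra b0 => /eqP r0; rewrite eq_complex r0 w0 /= eqxx.
 (* [L] is the radius in [t] that corresponds to the radius [X] in [t^(Re b)]. *)
 exists (fun n => Re (c n)), (X `^ (Re b)^-1), (Re b), C; split => //.
 - have -> : T = (T `^ Re b) `^ (Re b)^-1 by rewrite -powRrM mulfV ?gt_eqF// powRr1// ltW.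
  by apply: gt0_ltr_powR; rewrite ?invr_gt0// nnegrE ?powR_ge0// ltW.
 - move=> n; rewrite -powRrM mulrCA mulVf ?gt_eqF// mulr1 powR_mulrn ?(ltW X0)//.
  by rewrite -ler_pdivlMr ?exprn_gt0// -exprVn.
 - move=> t t0 tT; rewrite E//; congr ssum; apply/funext => n.
  by rewrite w0 mulr0 mul0r cos0 mulr1.
(* A constant kernel: any exponent and any radius above [T] will do. *)
exists (fun n => if n is 0%N then Re (c 0%N) else 0), (T + 1), 1, `|Re (c 0%N)|; split => //.
- by lra.
- by case=> [|n]; rewrite ?mul0r ?powRr0 ?mulr1// normr0 mul0r.
- move=> t t0 tT; rewrite E// !ssum_delta ?mul0r ?powRr0 ?mul0r ?cos0 ?mulr1//.
  by case=> // n _; rewrite mul0r.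
 by move=> n n0; rewrite k0// mul0r.
Qed.
End complex_series.

#[local] Opaque powR itg ker cv rcv.

(** * Derivatives of functions known almost everywhere *)

Section ae_derivative.
Variable R : realType.
Notation mu := (@lebesgue_measure R).
Implicit Types (F G f g h phi z : R -> R) (t : R).

Lemma derive_lin (c : R) F G t : derivable F t 1 -> derivable G t 1 ->
 derivable (c *: F + G) t 1 /\ 'D_1 (c *: F + G) t = c * 'D_1 F t + 'D_1 G t.
move=> d1 d2; have d3 := derivableZ (k := c) d1; split; first exact: derivableD.
by rewrite (deriveD d3 d2) (deriveZ _ d1).
Qed.

Lemma is_derive_subl (c s : R) : is_derive s (1 : R) (fun s => c - s) (-1).
have -> : (fun s => c - s) = cst c - id by apply/funext.
by apply: is_derive_eq; rewrite sub0r.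
Qed.

Lemma derive0_ae (D : R -> R) t (d : R) : 0 < d -> {ae mu, forall s, `|s - t| < d -> D s = 0} -> D t = 0 ->
 derivable D t 1 -> 'D_1 D t = 0.
move=> d0 h Dt hd; apply/eqP/negPn/negP => n0.
have := hd; rewrite /derivable => /cvgrPdist_lt; rewrite -/('D_1 D t) => /(_ _ _)/=.
have n1 : 0 < `|'D_1 D t| by rewrite normr_gt0.
move=> /(_ _ n1) [e /= e0 he].
have de : 0 < Num.min d e by rewrite lt_min d0.
have [s [s0 s1 /= Ps]] := ae_dense (x := t) (y := t + Num.min d e) h ltac:(by rewrite ltrDl).
have sd : `|s - t| < Num.min d e by rewrite gtr0_norm ?subr_gt0// ltrBlDl.
have := he (s - t); rewrite /ball /= sub0r normrN (lt_le_trans sd) ?ge_min ?lexx ?orbT// => /(_ isT).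
rewrite subr_eq0 gt_eqF// => /(_ isT).
rewrite /GRing.scale /= mulr1 subrK Dt Ps; last by rewrite (lt_le_trans sd)// ge_min lexx.
by rewrite subrr mulr0 subr0 ltxx.
Qed.

(** A Caputo derivative is that of one given function, which is identified with a primitive almost
    everywhere only. At a point of agreement where both are derivable, the difference vanishes on a
    dense set around it, so [derive0_ae] makes the derivatives equal. *)
Lemma ae_derive F G (G' : R -> R) (T : R) : {ae mu, forall t, 0 < t -> t < T -> F t = G t} ->
 {ae mu, forall t, derivable G t 1 /\ 'D_1 G t = G' t} ->
 {ae mu, forall t, 0 < t -> t < T -> derivable F t 1 -> 'D_1 F t = G' t}.
move=> hFG hG; apply: (aeS (ae_and hFG hG)) => t ok t0 tT dF; have e := ok.1 t0 tT; have [dG <-] := ok.2.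
apply/eqP; rewrite -subr_eq0 -deriveB//; apply/eqP.
have m0 : 0 < Num.min t (T - t) by rewrite lt_min t0 subr_gt0.
apply: (derive0_ae m0); [|by rewrite !fctE e subrr|exact: derivableB].
apply: (aeS hFG) => s hs; rewrite lt_min !ltr_norml => /andP[/andP[a1 a2] /andP[a3 a4]].
by rewrite /= !fctE hs ?subrr//; lra.
Qed.
End ae_derivative.

(** * Caputo derivatives in terms of the density *)

Section reduction.
Variable R : realType.
Notation mu := (@lebesgue_measure R).
Implicit Types (F G f g h phi z : R -> R) (t s : R).
Variables (e : nat -> R) (L bt C al T T' : R).
Hypotheses (he : coefbd e L bt C) (L0 : 0 < L) (b0 : 0 < bt)
 (T0 : 0 < T) (TL : T < L) (al0 : 0 < al) (al1 : al < 1)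
 (T'0 : 0 < T') (T'T : T' < T).
Let k := ker e bt al T.
Let kap := ker e bt (1 - al) T.
Let g := gcoef e e (1 - al) al bt.
(** Coefficients of the derivative of the series with terms [g_n t^(n bt)], read as a kernel of
    order [bt]. *)
Definition dcoef n := g n.+1 * (n.+1%:R * bt).
Let q := ker dcoef bt bt T.
Let al1' : 0 < 1 - al. Proof. by rewrite subr_gt0. Qed.

Lemma gcoef0_neq0 : e 0%N != 0 -> g 0%N != 0.
move=> e0; rewrite /g /gcoef big_ord_recl big_ord0 addr0 /= subn0 !mul0r !addr0.
by rewrite !mulf_neq0// gt_eqF// Bt_gt0.
Qed.

Lemma coefbd_le (e1 : nat -> R) L1 L2 C1 C2 : 0 < L2 -> L2 <= L1 -> C1 <= C2 -> coefbd e1 L1 bt C1 -> coefbd e1 L2 bt C2.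
move=> L20 L21 C12 h n; apply: le_trans C12; apply: le_trans (h n); apply: ler_wpM2l => //.
by apply: ge0_ler_powR => //; rewrite ?mulr_ge0 ?ler0n ?(ltW b0)// nnegrE ltW// (lt_le_trans L20).
Qed.

(** Two successive losses of radius, one for the convolution and one for the factor [n + 1] of the
    derivative; the constants are then made common. *)
Lemma dcoef_bd : exists L' C', [/\ T < L', coefbd e L' bt C', coefbd g L' bt C' & coefbd dcoef L' bt C'].
have mid x y : x < y -> exists2 z : R, x < z & z < y by move=> xy; exists ((x + y) / 2); lra.
have [L1 TL1 L1L] := mid _ _ TL; have [L2 TL2 L2L1] := mid _ _ TL1.
have L10 := lt_trans T0 TL1; have L20 := lt_trans T0 TL2.
have [C1 h1] := gcoef_bd L0 b0 al1' al0 he he L10 L1L.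
pose w := (L2 / L1) `^ bt.
have w0 : 0 < w by rewrite powR_gt0// divr_gt0.
have w1 : w < 1.
 have -> : 1 = 1 `^ bt by rewrite powR1.
 apply: gt0_ltr_powR => //; rewrite ?nnegrE ?ler01 ?divr_ge0 ?ltW//.
 by rewrite ltr_pdivrMr// mul1r.
have [D [w' [ww' w'1 D0 hD]]] := natS_expr_le w0 w1.
have C10 : 0 <= C1 by have := h1 0%N; apply: le_trans; rewrite mulr_ge0 ?powR_ge0.
have C2h : coefbd dcoef L2 bt (C1 * L1 `^ (- bt) * D * bt).
 move=> n; rewrite /dcoef normrM (ger0_norm (x := _ * bt)) ?mulr_ge0 ?(ltW b0)//.
 have p1 : L2 `^ (n%:R * bt) = w ^+ n * L1 `^ (n.+1%:R * bt) * L1 `^ (- bt).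
  rewrite /w -powR_mulrn ?powR_ge0// -powRrM (mulrC bt) -mulrA -powRD; last by rewrite (gt_eqF L10) implybT.
  rewrite (_ : n.+1%:R * bt - bt = n%:R * bt); last by rewrite -[n.+1%:R]natr1; ring.
  by rewrite -powRM ?divr_ge0 ?(ltW L10) ?(ltW L20)// divfK ?gt_eqF.
 have nd : n.+1%:R * w ^+ n <= D.
  apply: le_trans (hD n) _; rewrite ler_piMr// exprn_ile1// ?(ltW w'1)//; apply: ltW; exact: lt_trans ww'.
 have -> : `|g n.+1| * (n.+1%:R * bt) * L2 `^ (n%:R * bt) =
   (`|g n.+1| * L1 `^ (n.+1%:R * bt)) * (L1 `^ (- bt)) * (n.+1%:R * w ^+ n) * bt by rewrite p1; ring.
 apply: ler_wpM2r; first exact: ltW.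
 apply: ler_pM => //; rewrite ?mulr_ge0 ?powR_ge0 ?exprn_ge0 ?(ltW w0)//.
 by apply: ler_wpM2r; [exact: powR_ge0|exact: h1].
exists L2, (Num.max C (Num.max C1 (C1 * L1 `^ (- bt) * D * bt))); split => //.
- by apply: coefbd_le he => //; [exact: ltW (lt_trans L2L1 L1L)|rewrite le_max lexx].
- by apply: coefbd_le h1 => //; [exact: ltW|rewrite !le_max lexx orbT].
- by apply: coefbd_le C2h => //; rewrite !le_max lexx !orbT.
Qed.

Let ik : itg k. Proof. exact: (itg_ker he L0 b0 T0 al0 TL). Qed.
Let ikap : itg kap. Proof. exact: (itg_ker he L0 b0 T0 al1' TL). Qed.
Let iq : itg q.
have [L' [C' [TL' _ _ h]]] := dcoef_bd.
exact: (itg_ker h (lt_trans T0 TL') b0 T0 b0 TL').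
Qed.

Lemma kerE0 (e1 : nat -> R) m s : s <= 0 -> ker e1 bt m T s = 0.
Transparent ker.
move=> s0; rewrite /ker /kx (@ssum_lim _ _ 0)//.
Opaque ker.
rewrite (_ : series _ = fun=> 0); first exact: cvg_cst.
apply/funext => n; rewrite /series /= big1// => i _.
by rewrite /kt /pp ltNge s0 /= mulr0 mul0r.
Qed.

Lemma kerE_ssum (e1 : nat -> R) m s : ker e1 bt m T s = ssum (fun n => kt e1 m bt T n s).
Transparent ker.
by rewrite /ker /kx; congr ssum; apply/funext => n; rewrite mulr1.
Opaque ker.
Qed.

(* [kap * k] is absolutely continuous on [0,T] with value [g 0] at [0+] and derivative [q]. *)
Lemma cv_kap_k t : 0 < t -> t < T -> cv kap k t = g 0%N + cv (pp 1 T) q t.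
move=> t0 tT; have [L' [C' [TL' he' hg' hd']]] := dcoef_bd; have L'0 := lt_trans T0 TL'.
rewrite /kap /k (ker_conv L'0 b0 T0 TL' al1' al0 he' he' t0 tT) subrK -/g.
pose dl n : R := (n == 0%N)%:R.
have C'0 : 0 <= C' by have := hg' 0%N; apply: le_trans; rewrite mulr_ge0 ?powR_ge0.
have dbd : coefbd dl L' bt (Num.max C' 1).
 move=> [|n]; first by rewrite normr1 mul0r powRr0 mul1r le_max lexx orbT.
 by rewrite normr0 mul0r le_max C'0.
have hd2 : coefbd dcoef L' bt (Num.max C' 1) by apply: coefbd_le hd' => //; rewrite le_max lexx.
(* The unit step is itself a kernel, with the coefficients [dl], so [ker_conv] integrates [q] term
   by term. *)
have pE : pp 1 T = ker dl bt 1 T.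
 apply/funext => s; rewrite kerE_ssum (@ssum_lim _ _ (pp 1 T s))//.
 apply: cvg_near_cst; exists 1%N => // n /= n1.
 rewrite /series /= -(subnKC n1) big_nat_recl// big1_seq ?addr0 /kt /dl ?mul0r ?addr0 ?mul1r// => i _.
 by rewrite mul0r.
rewrite {1}pE /q (ker_conv L'0 b0 T0 TL' ltr01 b0 dbd hd2 t0 tT) !kerE_ssum.
have gg : geo (fun n => kt g 1 bt T n t).
 have TL1 : 1 * T < L' by rewrite mul1r.
 have := kx_geo hg' L'0 b0 T0 t ltr01 TL1 (one_bd bt 1).
 by under eq_fun do rewrite mulr1.
rewrite (ssum_recl gg); congr (_ + ssum _).
 by rewrite /kt mul0r addr0 /pp t0 tT /= subrr powRr0 mulr1.
apply/funext => n; rewrite /kt; congr (_ * pp _ _ _); last first.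
 by rewrite -[n.+1%:R]natr1; ring.
rewrite /gcoef big_ord_recl big1 ?addr0 => [|i _]; last by rewrite /dl /= !mul0r.
rewrite /dl /= mul1r subn0 mul0r addr0 Bt1r; last by rewrite ltr_wpDr// mulr_ge0 ?(ltW b0).
rewrite /dcoef (_ : bt + n%:R * bt = n.+1%:R * bt); last by rewrite -[n.+1%:R]natr1; ring.
by rewrite mulfK// mulf_neq0 ?gt_eqF.
Qed.

Transparent cv rcv.
Lemma cv0 f phi t : (forall s, s <= 0 -> f s = 0) -> (forall s, s <= 0 -> phi s = 0) -> t <= 0 -> cv f phi t = 0.
move=> f0 p0 t0; rewrite /cv (eqRint (g := fun=> 0)) => [|s]; first by rewrite /Rintegral integral0.
have [s0|s0] := leP s 0; first by rewrite p0// mulr0.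
by rewrite f0 ?mul0r//; lra.
Qed.

Lemma cv_prim phi t : (forall s, s <= 0 -> phi s = 0) -> t < T -> cv (pp 1 T) phi t = prim phi t.
move=> p0 tT; rewrite /cv /prim; apply: eqRint => s; rewrite /pp.
have [s0|s0] := leP s 0; first by rewrite p0// mulr0 mul0r.
rewrite subr_gt0 (_ : (t - s < T) = true); last by lra.
by rewrite andbT subrr powRr0; case: ifP => _; rewrite ?mul1r ?mulr1 ?mul0r ?mulr0.
Qed.

Lemma supp_le0 phi : supp T' phi -> forall s, s <= 0 -> phi s = 0.
Proof. by move=> h s s0; apply: h; rewrite ltNge s0. Qed.

(** Associativity replaces [kap] applied to [z] by the convolution of [cv kap k] with [phi]; by
    [cv_kap_k] this kernel is a multiple of the unit step plus the primitive of [q], and convolution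
    with the unit step is a primitive. *)
Lemma cv_kap phi z : itg phi -> supp T' phi -> itg z -> supp T' z ->
 {ae mu, forall t, 0 < t -> t < T' -> cv k phi t = z t} ->
 {ae mu, forall t, 0 < t -> t < T' -> cv kap z t = g 0%N * prim phi t + prim (cv q phi) t}.
move=> ip sp iz sz hz; have P := pp_int ltr01 T0.
have p0 := supp_le0 sp; have z0 := supp_le0 sz.
have k0 m (e1 : nat -> R) s : s <= 0 -> ker e1 bt m T s = 0 by exact: kerE0.
have pp0 s : s <= 0 -> pp 1 T s = 0 by move=> s0; rewrite /pp ltNge s0.
have ok1 := cvok_ae (itg_norm ikap) (cv_itg (itg_norm ik) (itg_norm ip)).
have ok2 := cvok_ae (itg_norm P.1) (cv_itg (itg_norm iq) (itg_norm ip)).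
have ok3 := cvok_ae P.1 ip; have ok4 := cvok_ae (cv_itg P.1 iq) ip.
apply: (aeS (ae_and (ae_and ok1 ok2) (ae_and ok3 ok4))) => t ok t0 tT'.
have o1 := ok.1.1; have o2 := ok.1.2; have o3 := ok.2.1; have o4 := ok.2.2.
have tT := lt_trans tT' T'T.
transitivity (cv kap (cv k phi) t).
 rewrite /cv; apply: int_ae_eq.
 - by apply: mfsM; [exact: mfs_subl (imeas ikap)|exact: imeas].
 - by apply: mfsM; [exact: mfs_subl (imeas ikap)|exact: imeas (cv_itg ik ip)].
 apply: (aeS hz) => s hs; have [s0|s0] := leP s 0.
  by rewrite z0// -/(cv k phi s) (cv0 (k0 _ _) p0 s0).
 have [st|st] := leP t s.
  have -> : kap (t - s) = 0 by apply: k0; rewrite subr_le0.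
  by rewrite !mul0r.
 by rewrite -hs//; exact: lt_trans tT'.
rewrite (cvA_at ikap ik ip o1).
transitivity (cv (fun v => g 0%N * pp 1 T v + cv (pp 1 T) q v) phi t).
 rewrite {1 3}/cv; apply: eqRint => s; have [ts|ts] := leP (t - s) 0.
  by rewrite (cv0 (k0 _ _) (k0 _ _) ts) (cv0 pp0 (k0 _ _) ts) pp0// mulr0 addr0.
 have [s0|s0] := leP s 0; first by rewrite p0// !mulr0.
 rewrite cv_kap_k//; last by lra.
 by rewrite {2}/pp ts (_ : t - s < T) ?subrr ?powRr0 ?mulr1//; lra.
transitivity (g 0%N * cv (pp 1 T) phi t + cv (cv (pp 1 T) q) phi t).
 rewrite {1 2 4}/cv -(intZ _ o3) -(intD (itgZ _ o3) o4); apply: eqRint => s.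
 by rewrite mulrDl mulrA.
by rewrite -(cvA_at P.1 iq ip o2) !cv_prim// => s s0; exact: cv0 (k0 _ _) p0 s0.
Qed.
Opaque cv rcv.

Lemma derive_left phi z F : itg phi -> supp T' phi -> itg z -> supp T' z ->
 {ae mu, forall t, 0 < t -> t < T' -> cv k phi t = z t} ->
 {ae mu, forall t, 0 < t -> t < T' -> F t = cv kap z t} ->
 {ae mu, forall t, 0 < t -> t < T' -> derivable F t 1 -> 'D_1 F t = g 0%N * phi t + cv q phi t}.
move=> ip sp iz sz hz hF.
pose G := (g 0%N *: prim phi + prim (cv q phi) : R -> R).
apply: (@ae_derive _ F G).
 apply: (aeS (ae_and hF (cv_kap ip sp iz sz hz))) => t ok t0 tT.
 by rewrite (ok.1 t0 tT) (ok.2 t0 tT).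
apply: (aeS (ae_and (prim_derive ip) (prim_derive (cv_itg iq ip)))) => t ok.
by rewrite -ok.1.2 -ok.2.2; exact: derive_lin ok.1.1 ok.2.1.
Qed.

(** Reflection of []0, T'[] exchanges left and right convolutions, and accounts for the sign in the
    right derivative. *)
Let rfl (f : R -> R) s := f (T' - s).

Lemma rfl_itg f : itg f -> itg (rfl f). Proof. exact: itg_refl. Qed.

Lemma rfl_supp f : supp T' f -> supp T' (rfl f).
Proof. by move=> h t ht; apply: h; apply: contra ht; lra. Qed.

Transparent cv rcv.
Lemma cv_rfl f h t : itg (fun s => f (s - (T' - t)) * h s) -> cv f (rfl h) t = rcv f h (T' - t).
move=> ok; rewrite /rcv -(int_refl T' ok) /cv; apply: eqRint => s.
by rewrite /rfl; congr (f _ * _); ring.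
Qed.
Opaque cv rcv.

Lemma derive_right phi z F : itg phi -> supp T' phi -> itg z -> supp T' z ->
 {ae mu, forall t, 0 < t -> t < T' -> rcv k phi t = z t} ->
 {ae mu, forall t, 0 < t -> t < T' -> F t = rcv kap z t} ->
 {ae mu, forall t, 0 < t -> t < T' -> derivable F t 1 -> - 'D_1 F t = g 0%N * phi t + rcv q phi t}.
move=> ip sp iz sz hz hF.
have rT t : 0 < t -> t < T' -> 0 < T' - t /\ T' - t < T' by lra.
have h1 : {ae mu, forall t, 0 < t -> t < T' -> cv k (rfl phi) t = (rfl z) t}.
 apply: (aeS (ae_and (ae_refl T' hz) (ae_refl T' (rcv_ok_ae ik ip)))) => t ok t0 tT.
 by have [a1 a2] := rT t t0 tT; rewrite cv_rfl; [exact: ok.1|exact: ok.2].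
have h2 : {ae mu, forall t, 0 < t -> t < T' -> (rfl F) t = cv kap (rfl z) t}.
 apply: (aeS (ae_and (ae_refl T' hF) (ae_refl T' (rcv_ok_ae ikap iz)))) => t ok t0 tT.
 by have [a1 a2] := rT t t0 tT; rewrite cv_rfl; [exact: ok.1|exact: ok.2].
have h := derive_left (rfl_itg ip) (rfl_supp sp) (rfl_itg iz) (rfl_supp sz) h1 h2.
apply: (aeS (ae_and (ae_refl T' h) (rcv_ok_ae iq ip))) => t ok t0 tT dF.
have [a1 a2] := rT t t0 tT; have TT : T' - (T' - t) = t by ring.
have dr : is_derive (T' - t) (1 : R) (rfl F) (- 'D_1 F t).
 have d1 := is_derive_subl T' (T' - t).
 have d2 : is_derive ((fun s => T' - s) (T' - t)) (1 : R) F ('D_1 F t) by rewrite TT; exact: DeriveDef.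
 by have := @is_derive1_comp _ F (fun s => T' - s) (T' - t) _ _ d2 d1; rewrite mulrN1.
have := ok.1 a1 a2 (@ex_derive _ _ _ _ _ _ _ dr); rewrite (@derive_val _ _ _ _ _ _ _ dr) => ->.
by rewrite /rfl TT cv_rfl TT//; exact: ok.2.
Qed.
End reduction.

#[local] Opaque powR itg ker cv rcv.

(** * From the local to the global Lipschitz bound *)

Section lipschitz.
Variable R : realType.
Implicit Types (F : R -> R).

(** The local bound limits the derivative by [K] at each point, and the mean value theorem makes it
    global. *)
Lemma lip_global F (dF : R -> R) (K : R) : (forall x : R, is_derive x (1 : R) F (dF x)) ->
 (forall x, \forall y \near x, `|F y - F x| <= K * `|y - x|) -> forall x y, `|F x - F y| <= K * `|x - y|.
move=> hd hl; have bd x : `|dF x| <= K.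
 rewrite leNgt; apply/negP => Kx.
 have e0 : 0 < `|dF x| - K by rewrite subr_gt0.
 have := @ex_derive _ _ _ _ _ _ _ (hd x); rewrite /derivable => /cvgrPdist_lt; rewrite -/('D_1 F x) => /(_ _ e0).
 rewrite (@derive_val _ _ _ _ _ _ _ (hd x)) => h1.
 have h2 : \forall h \near (0 : R)^', `|F (h + x) - F x| <= K * `|h|.
  have /nbhs_ballP[e /= e1 he] := hl x; rewrite near_withinE; apply/nbhs_ballP; exists e => //= h.
  rewrite /ball /= sub0r normrN => hh _; have := he (h + x).
  by rewrite /ball /= opprD addrCA subrr addr0 normrN addrK; apply.
 have h3 : \forall h \near (0 : R)^', h != 0 by exact: nbhs_dnbhs_neq.
 have [h [g1 [g2 g3]]] := filter_ex (filterI h1 (filterI h2 h3)).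
 move: g1; rewrite /= /GRing.scale /= mulr1 => g1.
 have g4 : `|h^-1 * (F (h + x) - F x)| <= K.
  by rewrite normrM normfV ler_pdivrMl ?normr_gt0// mulrC.
 have := ler_distD (h^-1 * (F (h + x) - F x)) (dF x) 0; rewrite !subr0; lra.
move=> x y; wlog xy : x y / x < y.
 move=> H; case: (ltgtP x y) => [h|h|->]; [exact: H| |by rewrite !subrr normr0 mulr0].
 by rewrite distrC [X in _ * X]distrC; exact: H.
have [|c _ E] := @MVT R F dF x y xy (fun z _ => hd z).
 by apply: derivable_within_continuous => z _; exact: (@ex_derive _ _ _ _ _ _ _ (hd z)).
by rewrite distrC E normrM [X in _ * X]distrC ler_wpM2r.
Qed.

(** One variable at a time through the intermediate point [(y, u)]; [|K|] keeps the constant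
    manifestly nonnegative. *)
Lemma Lipschitz_global (a b K : R) (f : R -> R -> R -> R) : C1_on_slab a b f -> locally_Lipschitz a b f K ->
 forall t, t \in `[a, b] -> forall x u y v, `|f t x u - f t y v| <= `|K| * (`|x - y| + `|u - v|).
move=> [g1 [g2 [g3 [hd _]]]] hK t tab x u y v.
have h1 : `|f t x u - f t y u| <= `|K| * `|x - y|.
 apply: (@lip_global (fun x => f t x u) (fun x => g2 t x u)) => [z|z].
  by have [_ h _] := hd t z u tab.
 have [U hU lU] := hK t z u tab.
 have [[V1 V2] /= [hV1 hV2] V12] := hU; apply: filterS hV1 => w V1w.
 have Uw : U (w, u) by apply: V12; split => //=; exact: nbhs_singleton hV2.
 have := lU w u z u Uw (nbhs_singleton hU); rewrite subrr normr0 addr0 => h.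
 by apply: le_trans h _; rewrite ler_wpM2r// ler_norm.
have h2 : `|f t y u - f t y v| <= `|K| * `|u - v|.
 apply: (@lip_global (fun u => f t y u) (fun u => g3 t y u)) => [z|z].
  by have [_ _ h] := hd t y z tab.
 have [U hU lU] := hK t y z tab.
 have [[V1 V2] /= [hV1 hV2] V12] := hU; apply: filterS hV2 => w V2w.
 have Uw : U (y, w) by apply: V12; split => //=; exact: nbhs_singleton hV1.
 have := lU y w y z Uw (nbhs_singleton hU); rewrite subrr normr0 add0r => h.
 by apply: le_trans h _; rewrite ler_wpM2r// ler_norm.
by have := ler_distD (f t y u) (f t x u) (f t y v); rewrite mulrDr; lra.
Qed.
End lipschitz.

(** * Transport to an interval starting at 0 *)

Section cut.
Variable R : realType.
Notation mu := (@lebesgue_measure R).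
Implicit Types (x f g k phi W : R -> R) (t s : R).
Variables (a b : R).
Hypothesis ab : a < b.
Let T' := b - a.

Definition cut x s := if (0 < s) && (s < b - a) then x (a + s) else 0.

(** Measurability of [f] is not read off from almost everywhere equality: [f] is [g] plus multiples
    of the indicators of the two points. *)
Lemma int_off f g (p r : R) : itg g -> (forall s, s != p -> s != r -> f s = g s) ->
 itg f /\ \int[mu]_s f s = \int[mu]_s g s.
move=> ig h; pose D : R -> R := fun s => f s - g s.
have mf : mfs f.
 have -> : f = fun s => g s + ((f p - g p) * \1_[set p] s + (if r == p then 0 else f r - g r) * \1_[set r] s).
  apply/funext => s; have I c : \1_[set c] s = (s == c)%:R :> R.
   by rewrite indicE (_ : (s \in [set c]) = (s == c))//; apply/idP/eqP; rewrite inE.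
  rewrite !I; have [->|sp] := eqVneq s p.
   by rewrite mulr1 (eq_sym p r); case: (r == p); rewrite ?mul0r ?mulr0; ring.
  have [sr|sr] := eqVneq s r; first by rewrite -sr (negbTE sp) mulr1 mulr0 add0r addrC subrK.
  by rewrite h// !mulr0 !addr0.
 apply: mfsD; first exact: imeas.
 by apply: mfsD; apply: mfsM => //; exact: measurable_indic.
have E : {ae mu, forall s, f s = g s} by apply: (aeS2 (ae_neq p) (ae_neq r)) => s; exact: h.
split; last by apply: int_ae_eq => //; exact: imeas.
apply: (itg_ae_dom mf (itg_norm ig)).
by apply: (aeS E) => s ->.
Qed.

Lemma itg_cut x : L1 a b x -> itg (cut x).
rewrite /L1 => /itg_restrict hx.
have ix := itg_shift (- a) (hx (measurable_itv _)).
rewrite (_ : cut x = fun s => (x \_ `[a, b]) (s - - a) * (pp 1 (b - a) s)); last first.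
 apply/funext => s; rewrite /cut /pp opprK patchE; case: ifPn => [/andP[s0 s1]|_]; last by rewrite mulr0.
 rewrite subrr powRr0 mulr1 addrC ifT// inE /= in_itv /=; apply/andP; split; lra.
apply: (itg_dom _ _ (itg_norm ix)).
 by apply: mfsM; [exact: imeas|exact: mfs_pp].
move=> s; rewrite normrM; apply: ler_piMr => //.
by rewrite /pp; case: ifP => _; rewrite ?subrr ?powRr0 ?normr1 ?normr0.
Qed.

Lemma left_cv W k x t : (forall v, 0 < v -> v < b - a -> k v = W v) -> (forall v, v <= 0 -> k v = 0) ->
 0 < t -> t < b - a -> cvok k (cut x) t ->
 \int[mu]_(s in `[a, a + t]) (W (a + t - s) * x s) = cv k (cut x) t.
Transparent cv.
move=> kW k0 t0 tT ok; rewrite Rintegral_mkcond /cv -(int_shift a ok).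
apply: (int_off (p := a) (r := a + t) (itg_shift a ok) _).2 => s sa st; rewrite patchE mem_setE in_itv /=.
Opaque cv.
rewrite /cut; have -> : t - (s - a) = a + t - s by ring.
have -> : a + (s - a) = s by ring.
have [as_|as_] := ltP a s; last first.
 have -> : (a <= s) = false by apply/negbTE; rewrite -ltNge lt_neqAle sa.
 by rewrite subr_gt0 ltNge as_ /= mulr0.
rewrite (ltW as_) subr_gt0 as_ /=.
have [h|h] := leP s (a + t); last by rewrite k0 ?mul0r//; lra.
have {}h : s < a + t by rewrite lt_neqAle st.
rewrite kW ?ifT//; lra.
Qed.

Lemma right_cv W k x t : (forall v, 0 < v -> v < b - a -> k v = W v) -> (forall v, v <= 0 -> k v = 0) ->
 0 < t -> t < b - a -> itg (fun s => k (s - t) * cut x s) ->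
 \int[mu]_(s in `[a + t, b]) (W (s - (a + t)) * x s) = rcv k (cut x) t.
Transparent rcv.
move=> kW k0 t0 tT ok; rewrite Rintegral_mkcond /rcv -(int_shift a ok).
apply: (int_off (p := a + t) (r := b) (itg_shift a ok) _).2 => s sa sb; rewrite patchE mem_setE in_itv /=.
Opaque rcv.
rewrite /cut; have -> : s - a - t = s - (a + t) by ring.
have -> : a + (s - a) = s by ring.
have [h|h] := leP s b; last first.
 rewrite andbF (_ : s - a < b - a = false) ?andbF ?mulr0//.
 by apply/negbTE; rewrite -leNgt; lra.
have {}h : s < b by rewrite lt_neqAle sb.
rewrite andbT; have [g|g] := leP (a + t) s; last by rewrite k0 ?mul0r//; lra.
have {}g : a + t < s by rewrite lt_neqAle eq_sym sa.
rewrite kW ?ifT//; lra.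
Qed.
End cut.

(** * Representation of trajectories and of their differences *)

Section trajectories.
Variable R : realType.
Notation mu := (@lebesgue_measure R).
Notation Re := complex.Re.
Notation Im := complex.Im.
Implicit Types (x y f g k phi W : R -> R) (t s v : R).
Variables (a b : R).
Hypothesis ab : a < b.

Lemma abs_cont_dist x t0 (e : R) : abs_continuous a b x -> t0 \in `[a, b] -> 0 < e ->
 exists2 d, 0 < d & forall t, t \in `[a, b] -> `|t - t0| < d -> `|x t - x t0| < e.
move=> hx t0ab e0; have [d d0 hd] := hx e e0; exists d => // t tab.
wlog tt : t t0 t0ab tab / t0 < t.
 move=> H; case: (ltgtP t t0) => [h|h|->]; last by move=> _; rewrite subrr normr0.
  by rewrite distrC [`|x _ - _|]distrC; exact: H.
 exact: H.
move=> td; have := hd 1%N (fun=> t0) (fun=> t).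
rewrite !big_ord1; apply; last by move: td; rewrite gtr0_norm// subr_gt0.
 move=> _; split => //; first by move: t0ab; rewrite in_itv /= => /andP[].
 by move: tab; rewrite in_itv /= => /andP[].
by move=> i j; rewrite !ord1 eqxx.
Qed.

Lemma abs_cont_L1 x : abs_continuous a b x -> L1 a b x.
move=> hx; apply: continuous_compact_integrable; first exact: segment_compact.
have ain : a \in `[a, b] by rewrite in_itv /= lexx ltW.
have bin : b \in `[a, b] by rewrite in_itv /= lexx ltW.
apply/continuous_within_itvP => //; split.
- move=> t tab; have tab' : t \in `[a, b] by move: tab; rewrite !in_itv /= => /andP[h1 h2]; rewrite !ltW.
 apply/cvgrPdist_lt => e e0; have [d d0 hd] := abs_cont_dist hx tab' e0.
 move: tab; rewrite in_itv /= => /andP[h1 h2].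
 near=> s; rewrite distrC; apply: hd; last by rewrite distrC; near: s; exact: cvgr_dist_lt.
 rewrite in_itv /=; apply/andP; split; apply: ltW; near: s; first exact: lt_nbhsr.
 exact: lt_nbhsl.
- apply/cvgrPdist_lt => e e0; have [d d0 hd] := abs_cont_dist hx ain e0.
 near=> s; rewrite distrC; apply: hd; last first.
  by rewrite distrC; near: s; apply: cvgr_dist_lt => //; exact: cvg_at_right_filter.
 rewrite in_itv /=; apply/andP; split; apply: ltW; near: s; first exact: nbhs_right_gt.
 exact: nbhs_right_lt.
- apply/cvgrPdist_lt => e e0; have [d d0 hd] := abs_cont_dist hx bin e0.
 near=> s; rewrite distrC; apply: hd; last first.
  by rewrite distrC; near: s; apply: cvgr_dist_lt => //; exact: cvg_at_left_filter.
 rewrite in_itv /=; apply/andP; split; apply: ltW; near: s; first exact: nbhs_left_gt.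
 exact: nbhs_left_lt.
Unshelve. all: by end_near. Qed.

Variables (B : nat -> R[i]) (beta : R[i]).
Definition WR nu v := v `^ (nu - 1) * Re (power_sum B (cpow v beta)).
Definition WI nu v := v `^ (nu - 1) * Im (power_sum B (cpow v beta)).

Lemma Re_scale (r c : R) (z : R[i]) : Re (r%:C%C * z * c%:C%C) = r * Re z * c.
Proof. by rewrite !ReM /= !mul0r mulr0 !subr0. Qed.

Lemma Im_scale (r c : R) (z : R[i]) : Im (r%:C%C * z * c%:C%C) = r * Im z * c.
Proof. by rewrite !ImM !ReM /= !mul0r mulr0 add0r addr0. Qed.

Lemma Re_frac_left nu x t : Re (frac_int_left B nu beta a x t) = \int[mu]_(s in `[a, t]) (WR nu (t - s) * x s).
Proof. by apply: eq_Rintegral => s _; rewrite Re_scale. Qed.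

Lemma Im_frac_left nu x t : Im (frac_int_left B nu beta a x t) = \int[mu]_(s in `[a, t]) (WI nu (t - s) * x s).
Proof. by apply: eq_Rintegral => s _; rewrite Im_scale. Qed.

Lemma Re_frac_right nu x t : Re (frac_int_right B nu beta b x t) = \int[mu]_(s in `[t, b]) (WR nu (s - t) * x s).
Proof. by apply: eq_Rintegral => s _; rewrite Re_scale. Qed.

Lemma ReD (z1 z2 : R[i]) : Re (z1 + z2) = Re z1 + Re z2. Proof. by case: z1 z2 => [? ?] [? ?]. Qed.
Lemma ImD (z1 z2 : R[i]) : Im (z1 + z2) = Im z1 + Im z2. Proof. by case: z1 z2 => [? ?] [? ?]. Qed.

Lemma cut_supp x : supp (b - a) (cut a b x).
Proof. by move=> t /negbTE h; rewrite /cut h. Qed.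

Definition agree k W := forall v, 0 < v -> v < b - a -> k v = W v.

Lemma ae_shift_itv (P : R -> Prop) : {ae mu, forall t, t \in `[a, b] -> P t} ->
 {ae mu, forall t, 0 < t -> t < b - a -> P (a + t)}.
move=> h; apply: (aeS (ae_translate a h)) => t ht t0 tT; rewrite addrC; apply: ht.
by rewrite in_itv /=; apply/andP; split; lra.
Qed.

(** [k] is any integrable kernel that agrees with the real or the imaginary part of the weighted
    series on []0, b - a[]. The trajectory being real, the imaginary part of its representation is a
    vanishing convolution. *)
Lemma AC_repr (al : R) x : AC_space B al beta a b x -> exists phi, [/\ itg phi, supp (b - a) phi &
 forall k, itg k -> (forall v, v <= 0 -> k v = 0) ->
 [/\ agree k (WR al) -> {ae mu, forall t, 0 < t -> t < b - a -> x (a + t) - x a = cv k phi t},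
   agree k (WR al) -> {ae mu, forall t, 0 < t -> t < b - a -> x (a + t) - x b = rcv k phi t} &
   agree k (WI al) -> {ae mu, forall t, 0 < t -> t < b - a -> cv k phi t = 0}]].
move=> [hx [phi [[hphi _ _] hl hr]]]; have ip := itg_cut hphi.
exists (cut a b phi); split; [exact: ip|exact: cut_supp|] => k ik k0.
have o1 := cvok_ae ik ip; have o2 := rcv_ok_ae ik ip.
split=> hk.
- apply: (aeS (ae_and o1 (ae_shift_itv hl))) => t ok t0 tT.
 have := congr1 (@complex.Re R) (ok.2 t0 tT); rewrite ReD Re_frac_left /= (left_cv hk k0 t0 tT ok.1) => ->.
 by rewrite addrAC subrr add0r.
- apply: (aeS (ae_and o2 (ae_shift_itv hr))) => t ok t0 tT.
 have := congr1 (@complex.Re R) (ok.2 t0 tT); rewrite ReD Re_frac_right /= (right_cv hk k0 t0 tT ok.1) => ->.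
 by rewrite addrAC subrr add0r.
- apply: (aeS (ae_and o1 (ae_shift_itv hl))) => t ok t0 tT.
 have := congr1 (@complex.Im R) (ok.2 t0 tT); rewrite ImD Im_frac_left /= (left_cv hk k0 t0 tT ok.1) add0r => <-.
 by [].
Qed.

Transparent cv rcv.
Lemma cvB k f g t : cvok k f t -> cvok k g t -> cv k (fun s => f s - g s) t = cv k f t - cv k g t.
Proof. by move=> h1 h2; rewrite /cv -(intB h1 h2); apply: eqRint => s; rewrite mulrBr. Qed.

Lemma rcvB k f g t : itg (fun s => k (s - t) * f s) -> itg (fun s => k (s - t) * g s) ->
 rcv k (fun s => f s - g s) t = rcv k f t - rcv k g t.
Proof. by move=> h1 h2; rewrite /rcv -(intB h1 h2); apply: eqRint => s; rewrite mulrBr. Qed.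
Opaque cv rcv.

(** [phi] is the difference of the two densities. Equal initial values remove the constant on the
    left; on the right the difference at [b] remains, and subtracting the two gives (E1). *)
Lemma AC_diff (al : R) x y : AC_space B al beta a b x -> AC_space B al beta a b y -> x a = y a ->
 exists phi, [/\ itg phi, supp (b - a) phi &
 forall k, itg k -> (forall v, v <= 0 -> k v = 0) ->
 [/\ agree k (WR al) -> {ae mu, forall t, 0 < t -> t < b - a -> cv k phi t = x (a + t) - y (a + t)},
   agree k (WR al) -> {ae mu, forall t, 0 < t -> t < b - a -> rcv k phi t = x (a + t) - y (a + t) - (x b - y b)} &
   agree k (WI al) -> {ae mu, forall t, 0 < t -> t < b - a -> cv k phi t = 0}]].
move=> /AC_repr[f [jf sf hf]] /AC_repr[g [jg sg hg]] xya.
exists (fun s => f s - g s); split.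
- exact: itgB.
- by move=> t h; rewrite sf// sg// subrr.
move=> k ik k0; have o1 := ae_and (cvok_ae ik jf) (cvok_ae ik jg).
have o2 := ae_and (rcv_ok_ae ik jf) (rcv_ok_ae ik jg).
have [f1 f2 f3] := hf k ik k0; have [g1 g2 g3] := hg k ik k0.
split=> hk.
- apply: (aeS (ae_and o1 (ae_and (f1 hk) (g1 hk)))) => t ok t0 tT.
 rewrite (cvB ok.1.1 ok.1.2) -(ok.2.1 t0 tT) -(ok.2.2 t0 tT) xya; ring.
- apply: (aeS (ae_and o2 (ae_and (f2 hk) (g2 hk)))) => t ok t0 tT.
 rewrite (rcvB ok.1.1 ok.1.2) -(ok.2.1 t0 tT) -(ok.2.2 t0 tT); ring.
- apply: (aeS (ae_and o1 (ae_and (f3 hk) (g3 hk)))) => t ok t0 tT.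
 by rewrite (cvB ok.1.1 ok.1.2) (ok.2.1 t0 tT) (ok.2.2 t0 tT) subrr.
Qed.

(** Convolution bounds hold almost everywhere; continuity of the trajectories carries them to the
    given point. *)
Lemma cont_ae_bound x y t0 (r M : R) : abs_continuous a b x -> abs_continuous a b y -> 0 < t0 -> t0 < b - a -> 0 < r ->
 {ae mu, forall t, `|t - t0| < r -> `|x (a + t) - y (a + t)| <= M} -> `|x (a + t0) - y (a + t0)| <= M.
move=> hx hy t00 t0T r0 h; rewrite leNgt; apply/negP => lt.
pose e := (`|x (a + t0) - y (a + t0)| - M) / 2.
have e0 : 0 < e by rewrite divr_gt0// subr_gt0.
have t0ab : a + t0 \in `[a, b] by rewrite in_itv /=; apply/andP; split; lra.
have [d d0 hd] := abs_cont_dist hx t0ab e0; have [d' d'0 hd'] := abs_cont_dist hy t0ab e0.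
pose m := Num.min (Num.min d d') (Num.min r (b - a - t0)).
have m0 : 0 < m by rewrite !lt_min d0 d'0 r0 subr_gt0.
have [t [t1 t2 ht]] := ae_dense (x := t0) (y := t0 + m) h ltac:(by rewrite ltrDl).
have tm : t - t0 < m by rewrite ltrBlDl.
move: tm; rewrite !lt_min => /andP[/andP[k1 k2] /andP[k3 k4]].
have tp : `|t - t0| = t - t0 by rewrite gtr0_norm// subr_gt0.
have tab : a + t \in `[a, b] by rewrite in_itv /=; apply/andP; split; lra.
have E : a + t - (a + t0) = t - t0 by ring.
have := hd _ tab; rewrite E tp => /(_ k1) g1; have := hd' _ tab; rewrite E tp => /(_ k2) g2.
have := ht; rewrite tp => /(_ k3) g3.
have := ler_distD (x (a + t)) (x (a + t0)) (y (a + t0)).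
have := ler_distD (y (a + t)) (x (a + t)) (y (a + t0)).
rewrite (distrC (x (a + t0)) (x (a + t))); move: g1 g2 g3 e0; rewrite /e; lra.
Qed.
End trajectories.

#[local] Opaque powR itg ker cv rcv.

(** * The perturbation estimate for a real kernel *)

Section state_difference.
Variable R : realType.
Notation mu := (@lebesgue_measure R).
Notation Re := complex.Re.
Notation Im := complex.Im.
Implicit Types (x y f g h k phi W : R -> R) (t s v : R).

Lemma derive_shift g (a t : R) : derivable g (a + t) 1 ->
 derivable (fun s => g (a + s)) t 1 /\ 'D_1 (fun s => g (a + s)) t = 'D_1 g (a + t).
move=> dg; have d1 : is_derive t (1 : R) (fun s => a + s) 1.
 have -> : (fun s => a + s) = cst a + id by apply/funext.
 by apply: is_derive_eq; rewrite add0r.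
have d2 : is_derive (a + t) (1 : R) g ('D_1 g (a + t)) by exact: DeriveDef.
have d := @is_derive1_comp _ g (fun s => a + s) t _ _ d2 d1; rewrite mulr1 in d.
by split; [exact: (@ex_derive _ _ _ _ _ _ _ d)|exact: (@derive_val _ _ _ _ _ _ _ d)].
Qed.

Lemma derive_shiftB g h (a t : R) : derivable g (a + t) 1 -> derivable h (a + t) 1 ->
 derivable (fun s => g (a + s) - h (a + s)) t 1 /\
 'D_1 (fun s => g (a + s) - h (a + s)) t = 'D_1 g (a + t) - 'D_1 h (a + t).
move=> /derive_shift[d1 <-] /derive_shift[d2 <-]; split; first exact: derivableB.
by rewrite -deriveB.
Qed.

Lemma abs_contB (a b c : R) x : abs_continuous a b x -> abs_continuous a b (fun s => x s - c).
move=> h e e0; have [d d0 hd] := h e e0; exists d => // n l r h1 h2 h3.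
have := hd n l r h1 h2 h3; congr (_ < _); apply: eq_bigr => i _; congr `|_|; ring.
Qed.

(** From [|z| <= 1 + z^2] on an interval of finite length. *)
Lemma L2_L1 (a b : R) h : L2 a b h -> L1 a b h.
rewrite /L2 => hh; apply/itg_restrict; first exact: measurable_itv.
have mh : mfs (h \_ `[a, b]) by move: hh; rewrite inE => /andP[]; rewrite inE.
have i2 : itg (fun t => (h \_ `[a, b]) t ^+ 2) by exact: Lfun2_integrable_sqr hh.
have i1 : itg (\1_`[a, b] : R -> R).
 have := (@itg_restrict R `[a, b]%classic (fun=> 1 : R) (measurable_itv _)).2.
 have -> : (fun=> 1 : R) \_ `[a, b] = \1_`[a, b] :> (R -> R).
  by apply/funext => s; rewrite patchE indicE; case: ifP.
 apply; apply: continuous_compact_integrable; first exact: segment_compact.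
 by apply: continuous_subspaceT => ?; exact: cvg_cst.
apply: (itg_dom mh _ (itgD i1 i2)) => t; rewrite patchE indicE; case: ifP => _; last by rewrite normr0 expr0n addr0.
rewrite -real_normK ?num_real//; set z := `|h t|; have : 0 <= (z - 1) ^+ 2 by exact: sqr_ge0.
have z0 : 0 <= z by exact: normr_ge0.
by rewrite sqrrB expr1n mulr1 mulr2n /=; nra.
Qed.

Lemma add_itv (a b t : R) : 0 < t -> t < b - a -> a + t \in `[a, b].
Proof. by move=> t0 tT; rewrite in_itv /=; apply/andP; split; lra. Qed.

Lemma combine_sides (ga dxl dyl dxr dyr p ql qr c d : R) : dxl - dyl = p + ql -> - (dxr - dyr) = p + qr ->
 ga * dxl - (1 - ga) * dxr = c -> ga * dyl - (1 - ga) * dyr = d ->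
 p + ga * ql + (1 - ga) * qr = c - d.
move=> h1 h2 <- <-; transitivity (ga * (p + ql) + (1 - ga) * (p + qr)); first by ring.
by rewrite -h1 -h2; ring.
Qed.

Lemma Re_combined_caputo B al beta ga a b x t : Re (combined_caputo B al beta ga a b x t) =
  ga * 'D_1 (fun s => Re (pre_caputo_left B al beta a x s)) t -
  (1 - ga) * 'D_1 (fun s => Re (pre_caputo_right B al beta b x s)) t.
Proof. by rewrite /combined_caputo ReD !ReM /= !mul0r !subr0 mulrN. Qed.

Variables (a b : R).
Hypothesis ab : a < b.
Variables (B : nat -> R[i]) (beta : R[i]).
Variables (e : nat -> R) (L bt C al T : R).
Hypotheses (he : coefbd e L bt C) (L0 : 0 < L) (b0 : 0 < bt)
 (T0 : 0 < T) (TL : T < L) (al0 : 0 < al) (al1 : al < 1) (T'T : b - a < T) (e0 : e 0%N != 0).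
Hypothesis hS : forall t, 0 < t -> t <= b - a -> Re (power_sum B (cpow t beta)) = ssum (fun n => e n * t `^ (n%:R * bt)).
Let k := ker e bt al T.
Let kap := ker e bt (1 - al) T.
Let g0 := gcoef e e (1 - al) al bt 0%N.
Let q := ker (dcoef e bt al) bt bt T.
Let T'0 : 0 < b - a. Proof. by rewrite subr_gt0. Qed.
Let al1' : 0 < 1 - al. Proof. by rewrite subr_gt0. Qed.
Let ik : itg k. Proof. exact: (itg_ker he L0 b0 T0 al0 TL). Qed.
Let ikap : itg kap. Proof. exact: (itg_ker he L0 b0 T0 al1' TL). Qed.

Lemma ker_agree m : agree a b (ker e bt m T) (WR B beta m).
move=> v v0 vT; have vT1 := lt_trans vT T'T; rewrite kerE_ssum /WR hS//; last exact: ltW.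
have g : geo (fun n => e n * v `^ (n%:R * bt)).
 have TL1 : 1 * T < L by rewrite mul1r.
 have := kx_geo he L0 b0 T0 v ltr01 TL1 (one_bd bt 1).
 under eq_fun do rewrite mulr1 /kt /pp v0 vT1 /= addrAC subrr add0r.
 by [].
rewrite -ssumZ//; congr ssum; apply/funext => n; rewrite /kt /pp v0 vT1 /= mulrCA -powRD; last first.
 by rewrite (gt_eqF v0) implybT.
by congr (_ * _ `^ _); ring.
Qed.

(** This is (E2). By [derive_left] and [derive_right] both Caputo derivatives of the difference are
    [g0 phi] plus a convolution with [q], with the same [g0], so their combination with weights
    summing to 1 keeps [g0 phi]; the state equations turn it into a difference of values of [f]. *)
Lemma state_diff (ga K xa : R) (f : R -> R -> R -> R) u w x y phi : 0 <= K ->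
 state_trajectory B al beta ga a b f xa u x -> state_trajectory B al beta ga a b f xa w y ->
 (forall t, t \in `[a, b] -> `|f t (x t) (u t) - f t (y t) (w t)| <= K * (`|x t - y t| + `|u t - w t|)) ->
 itg phi -> supp (b - a) phi ->
 {ae mu, forall t, 0 < t -> t < b - a -> cv k phi t = x (a + t) - y (a + t)} ->
 {ae mu, forall t, 0 < t -> t < b - a -> rcv k phi t = x (a + t) - y (a + t) - (x b - y b)} ->
 {ae mu, forall t, 0 < t -> t < b - a ->
   `|g0 * phi t + ga * cv q phi t + (1 - ga) * rcv q phi t| <= K * (`|cv k phi t| + `|u (a + t) - w (a + t)|)}.
move=> K0 [[acx _] sx xax] [[acy _] sy yay] hf ip sp h1 h2.
have k0 m v : v <= 0 -> ker e bt m T v = 0 by exact: kerE0.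
have icut (z : R -> R) c : abs_continuous a b z -> itg (cut a b (fun s => z s - c)).
 by move=> hz; apply: itg_cut; apply: abs_cont_L1 => //; exact: abs_contB.
have ixa := icut x (x a) acx; have iya := icut y (y a) acy.
have ixb := icut x (x b) acx; have iyb := icut y (y b) acy.
pose zl s := cut a b (fun s => x s - x a) s - cut a b (fun s => y s - y a) s.
pose zr s := cut a b (fun s => x s - x b) s - cut a b (fun s => y s - y b) s.
have szl : supp (b - a) zl by move=> t ht; rewrite /zl !cut_supp// subrr.
have szr : supp (b - a) zr by move=> t ht; rewrite /zr !cut_supp// subrr.
have zlE : {ae mu, forall t, 0 < t -> t < b - a -> cv k phi t = zl t}.
 by apply: (aeS h1) => t ht t0 tT; rewrite ht// /zl /cut t0 tT /= xax yay; ring.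
have zrE : {ae mu, forall t, 0 < t -> t < b - a -> rcv k phi t = zr t}.
 by apply: (aeS h2) => t ht t0 tT; rewrite ht// /zr /cut t0 tT /=; ring.
pose px s := Re (pre_caputo_left B al beta a x s); pose py s := Re (pre_caputo_left B al beta a y s).
pose rx s := Re (pre_caputo_right B al beta b x s); pose ry s := Re (pre_caputo_right B al beta b y s).
pose F s := px (a + s) - py (a + s); pose G s := rx (a + s) - ry (a + s).
have FE : {ae mu, forall t, 0 < t -> t < b - a -> F t = cv kap zl t}.
 apply: (aeS (ae_and (cvok_ae ikap ixa) (cvok_ae ikap iya))) => t ok t0 tT.
 rewrite /F /px /py /pre_caputo_left !Re_frac_left (left_cv (@ker_agree (1 - al)) (k0 _) t0 tT ok.1).
 by rewrite (left_cv (@ker_agree (1 - al)) (k0 _) t0 tT ok.2) /zl (cvB ok.1 ok.2).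
have GE : {ae mu, forall t, 0 < t -> t < b - a -> G t = rcv kap zr t}.
 apply: (aeS (ae_and (rcv_ok_ae ikap ixb) (rcv_ok_ae ikap iyb))) => t ok t0 tT.
 rewrite /G /rx /ry /pre_caputo_right !Re_frac_right (right_cv (@ker_agree (1 - al)) (k0 _) t0 tT ok.1).
 by rewrite (right_cv (@ker_agree (1 - al)) (k0 _) t0 tT ok.2) /zr (rcvB ok.1 ok.2).
have dl := derive_left he L0 b0 T0 TL al0 al1 T'T ip sp (itgB ixa iya) szl zlE FE.
have dr := derive_right he L0 b0 T0 TL al0 al1 T'T ip sp (itgB ixb iyb) szr zrE GE.
apply: (aeS (ae_and (ae_and h1 (ae_and dl dr)) (ae_and (ae_shift_itv sx) (ae_shift_itv sy)))) => t ok t0 tT.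
have [[dx1 _] [dx2 _] ex] := ok.2.1 t0 tT; have [[dy1 _] [dy2 _] ey] := ok.2.2 t0 tT.
have [d1 e1] := derive_shiftB dx1 dy1; have [d2 e2] := derive_shiftB dx2 dy2.
have E1 := ok.1.2.1 t0 tT d1; have E2 := ok.1.2.2 t0 tT d2.
rewrite (ok.1.1 t0 tT).
rewrite (combine_sides (etrans (esym e1) E1) (etrans (esym (congr1 -%R e2)) E2)
 (etrans (esym (Re_combined_caputo _ _ _ _ _ _ _ _)) (congr1 (@complex.Re R) ex))
 (etrans (esym (Re_combined_caputo _ _ _ _ _ _ _ _)) (congr1 (@complex.Re R) ey))).
exact: hf (add_itv t0 tT).
Qed.

(** At [a] the states agree, at [b] their difference is the constant of (E1), and in between it is a
    convolution bounded by [core_int], with a constant depending on [t]. *)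
Lemma perturbation_bound (ga K xa : R) (f : R -> R -> R -> R) u h xs (xe : R -> R -> R) : 0 <= K -> L2 a b h ->
 (forall t, t \in `[a, b] -> forall x u y v : R, `|f t x u - f t y v| <= K * (`|x - y| + `|u - v|)) ->
 (forall eps, state_trajectory B al beta ga a b f xa (fun t => u t + eps * h t) (xe eps)) ->
 state_trajectory B al beta ga a b f xa u xs ->
 forall t, t \in `[a, b] -> exists N, forall eps, `|xe eps t - xs t| <= N * `|eps|.
move=> K0 /L2_L1 /itg_cut ih hf hxe hxs.
have [L' [C' [TL' he' _ hd']]] := dcoef_bd he L0 b0 T0 TL al0 al1.
have L'0 := lt_trans T0 TL'.
have g0n : g0 != 0 by exact: gcoef0_neq0.
have k0 v : v <= 0 -> k v = 0 by exact: kerE0.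
have [N N0 hN] := core_norm he' hd' L'0 b0 T0 TL' al0 al1 b0 T'0 T'T e0 ga (1 - ga) g0n K0
 (itg_norm ih) (fun t => normr_ge0 _).
have D eps : exists2 phi, [/\ itg phi, supp (b - a) phi & norm1 phi <= N * `|eps|] &
  {ae mu, forall t, 0 < t -> t < b - a -> cv k phi t = xe eps (a + t) - xs (a + t)} /\
  {ae mu, forall t, 0 < t -> t < b - a -> cv k phi t - rcv k phi t = xe eps b - xs b}.
 have [ace sse xea] := hxe eps; have [acs sss xsa] := hxs.
 have [phi [ip sp /(_ k ik k0)[/(_ (@ker_agree al)) h1 /(_ (@ker_agree al)) h2 _]]] := AC_diff ace acs (etrans xea (esym xsa)).
 have h3 : {ae mu, forall t, 0 < t -> t < b - a -> cv k phi t - rcv k phi t = xe eps b - xs b}.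
  by apply: (aeS (ae_and h1 h2)) => t ok t0 tT; rewrite (ok.1 t0 tT) (ok.2 t0 tT); ring.
 exists phi; last by split.
 split => //; apply: (hN phi _ _ ip sp (normr_ge0 eps) h3).
 have := state_diff (w := u) K0 (hxe eps) hxs _ ip sp h1 h2.
 move=> /(_ (fun t tab => hf t tab _ _ _ _)) => H; apply: (aeS H) => t ht t0 tT.
 have := ht t0 tT; rewrite (addrAC (u (a + t))) subrr add0r normrM /cut t0 tT; exact.
move=> t; rewrite in_itv /= => /andP[].
rewrite le_eqVlt => /predU1P[<- _|at_].
 by exists 0 => eps; have [_ _ ->] := hxe eps; have [_ _ ->] := hxs; rewrite subrr normr0 mul0r.
rewrite le_eqVlt => /predU1P[->|tb].
 exists (norm1 (oddf k) * N / (b - a)) => eps; have [phi [ip sp np] [h1 h3]] := D eps.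
 have := core_const he' L'0 b0 T0 TL' al0 T'0 ip h3; rewrite -ler_pdivlMr// => H; apply: le_trans H _.
 rewrite [leRHS]mulrAC; apply: ler_wpM2r; first by rewrite invr_ge0 (ltW T'0).
 by rewrite -mulrA; apply: ler_wpM2l => //; exact: norm1_ge0.
have s0 : 0 < t - a by rewrite subr_gt0.
have s1 : t - a < b - a by rewrite ltrD2r.
have [r r0 [M M0 hM]] := core_int he' L'0 b0 T0 TL' al0 al1 T'0 T'T e0 s0 s1.
exists (M * N) => eps; have [phi [ip sp np] [h1 h3]] := D eps.
have [[ace _] _ _] := hxe eps; have [[acs _] _ _] := hxs.
(* The radius also keeps the window inside the interval, where the representation of the difference
   holds. *)
have r1 : 0 < Num.min r (Num.min (t - a) (b - t)) by rewrite !lt_min r0 s0 subr_gt0.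
have := @cont_ae_bound _ a b (xe eps) xs (t - a) (Num.min r (Num.min (t - a) (b - t))) (M * N * `|eps|) ace acs s0 s1 r1.
rewrite (_ : a + (t - a) = t); last by ring.
apply; apply: (aeS (ae_and h1 (hM phi _ ip sp h3))) => s ok.
rewrite !lt_min => /andP[sr /andP[sl su]].
move: (ok.2 sr); rewrite ok.1; first last.
- move: su; rewrite ltr_norml => /andP[_]; lra.
- move: sl; rewrite ltr_norml => /andP[]; lra.
by move=> H; apply: le_trans H _; rewrite -mulrA; apply: ler_wpM2l.
Qed.
End state_difference.

(** * The two cases of the kernel and the conclusion *)

Section main.
Variable R : realType.
Notation mu := (@lebesgue_measure R).
Notation Re := complex.Re.
Notation Im := complex.Im.

(** The constant term of the reciprocity is a product containing [Gamma alpha] and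
    [Gamma (1 - alpha)]; [Gamma] takes the value 0 at its pole, so neither argument can be 0, and no
    factor vanishes as the product is 1. *)
Lemma conjugate_kernel0 (A Abar : nat -> R[i]) (alpha : R) (beta : R[i]) : 0 <= alpha <= 1 ->
 conjugate_kernel A Abar alpha beta -> [/\ 0 < alpha, alpha < 1 & Abar 0%N != 0].
move=> /andP[a0 a1] /(_ 0%N); rewrite big_ord_recl big_ord0 addr0 /Gamma_coef /= subn0 !mulr0 !add0r => h.
have G0 : @Gamma R (0 : R)%:C%C = 0 by rewrite /Gamma /= ltxx invr0 mulr0.
have n1 : (1 : R[i]) != 0 := oner_neq0 _.
split.
- rewrite lt_neqAle a0 andbT eq_sym; apply: contraNneq n1 => z; move: h.
 by rewrite z G0 mulr0 mul0r => /esym/eqP.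
- rewrite lt_neqAle a1 andbT; apply: contraNneq n1 => z; move: h.
 by rewrite z subrr G0 !mulr0 => /esym/eqP.
- by apply: contraNneq n1 => z; move: h; rewrite z mul0r mulr0 => /esym/eqP.
Qed.

Transparent cv rcv.
Lemma cv_ae0 (k f : R -> R) t : mfs k -> mfs f -> {ae mu, forall s, f s = 0} ->
 cv k f t = 0 /\ rcv k f t = 0.
move=> mk mf h; have z : \int[mu]_s (0 : R) = 0 by rewrite /Rintegral integral0.
split; rewrite -z; apply: int_ae_eq => //; try by apply: (aeS h) => s ->; rewrite mulr0.
 by apply: mfsM => //; exact: mfs_subl.
by apply: mfsM => //; apply: mfsT => //; exact: mfsB.
Qed.
Opaque cv rcv.

(** Titchmarsh: [phi] convolved with the imaginary kernel is 0 before [b - a], and that kernel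
    vanishes near 0 on no interval, so [phi = 0] and the trajectories coincide inside. At [b] the
    equality comes from the right-sided representation. *)
Lemma complex_case (a b al rho : R) (beta : R[i]) (B : nat -> R[i]) x y : a < b -> 0 < al ->
 0 <= Re beta -> (b - a) `^ Re beta < rho -> analytic_on_disc B rho ->
 (forall d, 0 < d -> ~ {ae mu, forall t, 0 < t -> t < d -> Im (power_sum B (cpow t beta)) = 0}) ->
 AC_space B al beta a b x -> AC_space B al beta a b y -> x a = y a ->
 forall t, t \in `[a, b] -> x t = y t.
move=> ab al0 s0 Tr hB hI acx acy xya; have T'0 : 0 < b - a by rewrite subr_gt0.
have [C [X [X0 TX hp hr]]] := coef_bd hB T'0 Tr.
have hr' n : `|- Im (B n)| <= C * X^-1 ^+ n by rewrite normrN.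
pose kI v := pp al (b - a) v * oscs (fun n => Re (B n)) (fun n => Im (B n)) (Re beta) (Im beta) v.
pose kR v := pp al (b - a) v * oscs (fun n => - Im (B n)) (fun n => Re (B n)) (Re beta) (Im beta) v.
have ikI : itg kI := oscs_kernel _ X0 hp hr s0 TX al0 T'0.
have ikR : itg kR := oscs_kernel _ X0 hr' hp s0 TX al0 T'0.
have kI0 v : v <= 0 -> kI v = 0 by move=> v0; rewrite /kI /pp ltNge v0 mul0r.
have kR0 v : v <= 0 -> kR v = 0 by move=> v0; rewrite /kR /pp ltNge v0 mul0r.
have tr v : 0 < v -> v < b - a -> v `^ Re beta < rho.
 by move=> v0 vT; apply: le_lt_trans Tr; apply: ge0_ler_powR => //; rewrite ?nnegrE ltW.
have aI : agree a b kI (WI B beta al).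
 by move=> v v0 vT; rewrite /kI /WI /pp v0 vT /= (power_sum_oscs hB v0 (tr v v0 vT)).1.
have aR : agree a b kR (WR B beta al).
 by move=> v v0 vT; rewrite /kR /WR /pp v0 vT /= (power_sum_oscs hB v0 (tr v v0 vT)).2.
have [phi [ip sp hk]] := AC_diff acx acy xya.
have [_ _ /(_ aI) hI0] := hk kI ikI kI0; have [/(_ aR) h1 /(_ aR) h2 _] := hk kR ikR kR0.
have p0 v : v <= 0 -> phi v = 0 by move=> v0; apply: sp; rewrite ltNge v0.
have vphi : van phi (b - a).
 apply: (titchmarsh T'0 ip _ ikI); first 3 last.
 - move=> c c0 vc; apply: (hI (Num.min c (b - a))); first by rewrite lt_min c0.
  apply: (aeS vc) => t ht t0; rewrite lt_min => /andP[tc tT].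
  have := ht tc; rewrite aI// /WI => /eqP; rewrite mulf_eq0 => /orP[/eqP P|/eqP//].
  by have := powR_gt0 (al - 1) t0; rewrite P ltxx.
 - by move=> v [v0|v1]; apply: sp; rewrite negb_and -!leNgt; [rewrite (ltW v0)|rewrite (ltW v1) orbT].
 - by move=> v [v0|v1]; rewrite /kI /pp; [rewrite ltNge (ltW v0)|rewrite [v < _]ltNge (ltW v1) andbF]; rewrite mul0r.
 apply: (aeS (ae_and hI0 (cvok_ae ip ikI))) => t ok tT.
 have [t0|t0] := leP t 0; first exact: cv0.
 by rewrite (cvC ok.2) ok.1.
have aephi : {ae mu, forall s, phi s = 0}.
 apply: (aeS vphi) => s hs; have [st|st] := ltP s (b - a); first exact: hs.
 by apply: sp; rewrite negb_and -!leNgt st orbT.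
have c0 t := (cv_ae0 t (imeas ikR) (imeas ip) aephi).1.
have r0 t := (cv_ae0 t (imeas ikR) (imeas ip) aephi).2.
have E s : 0 < s -> s < b - a -> x (a + s) = y (a + s).
 move=> s0' s1; have := @cont_ae_bound _ a b x y s (Num.min s (b - a - s)) 0 acx.1 acy.1 s0' s1.
 rewrite lt_min s0' subr_gt0 s1 => /(_ isT) H; apply/eqP; rewrite -subr_eq0 -normr_le0; apply: H.
 apply: (aeS h1) => t ht; rewrite lt_min !ltr_norml => /andP[/andP[u1 u2] /andP[u3 u4]].
 by rewrite -ht ?c0 ?normr0//; lra.
move=> t; rewrite in_itv /= => /andP[].
rewrite le_eqVlt => /predU1P[<- //|at_]; rewrite le_eqVlt => /predU1P[->|tb].
 have [s [s0' s1 hs]] := ae_dense h2 T'0.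
 by have := hs s0' s1; rewrite r0 E// subrr sub0r => /esym/eqP; rewrite oppr_eq0 subr_eq0 => /eqP.
by have := E (t - a); rewrite subr_gt0 ltrD2r (_ : a + (t - a) = t); [exact|ring].
Qed.

Theorem lemma8_core (a b alpha gamma rho : R) (beta : R[i]) (A Abar : nat -> R[i])
  (f : R -> R -> R -> R) (xa K : R) (ustar xstar h : R -> R) (xeps : R -> R -> R) : a < b ->
 0 <= alpha <= 1 -> 0 <= Re beta -> 1 <= normc (alpha%:C%C + beta) ->
 (b - a) `^ Re beta < rho -> analytic_on_disc Abar rho -> conjugate_kernel A Abar alpha beta ->
 C1_on_slab a b f -> locally_Lipschitz a b f K ->
 state_trajectory Abar alpha beta gamma a b f xa ustar xstar -> L2 a b h ->
 (forall eps : R, state_trajectory Abar alpha beta gamma a b f xa (fun t => ustar t + eps * h t) (xeps eps)) ->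
 forall t : R, t \in `[a, b] -> exists N, forall eps, `|xeps eps t - xstar t| <= N * `|eps|.
move=> ab ha hb hab Tr hB hAB hf hfK hxs hh hxe.
have [al0 al1 B0] := conjugate_kernel0 ha hAB.
have T'0 : 0 < b - a by rewrite subr_gt0.
(* Here [|alpha + beta| >= 1] enters: with [alpha < 1] it excludes [beta = 0]. *)
have bn0 : beta != 0.
 apply: contraTneq hab => ->; rewrite -ltNge addr0 /= expr0n addr0 sqrtr_sqr ger0_norm//; exact: ltW.
have [[d [d0 hd]]|hI] := pselect (exists d, 0 < d /\
  {ae mu, forall t, 0 < t -> t < d -> Im (power_sum Abar (cpow t beta)) = 0}).
 have [e [L [bt [C [b0 TL he e0 hS]]]]] := real_kernel hB T'0 hb bn0 Tr d0 B0 hd.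
 have [T T1 T2] : exists2 T, b - a < T & T < L by exists ((b - a + L) / 2); lra.
 have T0 := lt_trans T'0 T1.
 apply: (perturbation_bound ab he (lt_trans T0 T2) b0 T0 T2 al0 al1 T1 e0 hS (normr_ge0 K) hh _ hxe hxs).
 exact: Lipschitz_global hf hfK.
move=> t tab; exists 0 => eps; rewrite mul0r normr_le0 subr_eq0; apply/eqP.
have [ace _ xea] := hxe eps; have [acs _ xsa] := hxs.
apply: (complex_case ab al0 hb Tr hB _ ace acs (etrans xea (esym xsa)) tab).
by move=> d d0 hd; apply: hI; exists d.
Qed.

Lemma cvg_lin_dnbhs (F : R -> R) (l N : R) : (forall eps, `|F eps - l| <= N * `|eps|) -> F eps @[eps --> 0^'] --> l.
move=> h; apply/cvgrPdist_le => r r0; have N1 : 0 < `|N| + 1 by rewrite ltr_wpDl.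
rewrite near_withinE; apply/nbhs_ballP; exists (r / (`|N| + 1)) => /=; first exact: divr_gt0.
move=> z; rewrite /ball /= sub0r normrN ltr_pdivlMr// => zr _; rewrite distrC.
apply: le_trans (h z) _; apply: le_trans (ltW zr); rewrite mulrC; apply: ler_wpM2l => //.
by rewrite (le_trans (ler_norm _))// lerDl.
Qed.

End main.
Local Open Scope complex_scope.

Theorem lemma8 (R : realType) (a b alpha gamma rho : R) (beta : R[i])
  (A Abar : nat -> R[i])
  (L f : R -> R -> R -> R) (xa K M : R) (Omega : R -> set (R -> R))
  (ustar xstar h : R -> R) (xeps : R -> R -> R)
  (hab : a < b)
  (halpha : 0 <= alpha <= 1)
  (hbeta : 0 <= complex.Re beta)
  (halphabeta : 1 <= normc (alpha%:C + beta))
  (hgamma : 0 <= gamma <= 1)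
  (hrho : (b - a) `^ complex.Re beta < rho)
  (hA : analytic_on_disc A rho)
  (hAbar : analytic_on_disc Abar rho)
  (hAAbar : conjugate_kernel A Abar alpha beta)
  (hOmega : forall t, t \in `[a, b] -> closed_convex_L2 a b (Omega t))
  (hL : C1_on_slab a b L)
  (hf : C1_on_slab a b f)
  (hfK : locally_Lipschitz a b f K)
  (hopt : optimal Abar alpha beta gamma a b L f xa Omega ustar xstar)
  (hh : L2 a b h)
  (hxeps : forall eps : R,
    state_trajectory Abar alpha beta gamma a b f xa
     (fun t => ustar t + eps * h t) (xeps eps))
  (hM : supremums (kernel_values A rho ((b - a) `^ alpha)) M)
  (hK : K < 1 / ((b - a) `^ (alpha - 1) * M)) :
 forall t : R, t \in `[a, b] -> xeps eps t @[eps --> 0^'] --> xstar t.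
move=> t tab; have [[hxs _] _ _] := hopt.
have [N hN] := lemma8_core hab halpha hbeta halphabeta hrho hAbar hAAbar hf hfK hxs hh hxeps tab.
exact: cvg_lin_dnbhs hN.
Qed.
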